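(* Let $(M,h)$ be a $Z^{(x,y)}$ manifold of dimension at least $2$ such that all unit-speed geodesics starting at $x$ reach $y$ in uniformly bounded time, i.e. there is some $T>0$ such that for every unit-speed geodesic $\alpha$ with $\alpha(0)=x$ there is some $t\in(0,T]$ with $\alpha(t)=y$. Then $M$ is compact with finite fundamental group.
   Context: All Riemannian manifolds are smooth, connected and without boundary; geodesics are maximal. For a complete Riemannian manifold $(M,h)$ and $x,y\in M$ (possibly $x=y$), $(M,h)$ is a $Z^{(x,y)}$ manifold if for every (nonconstant) geodesic $\alpha$ with $\alpha(0)=x$ there is some $t>0$ with $\alpha(t)=y$. *)

(* Defs.v *)
(* MathComp-Analysis; the real numbers are an arbitrary [R : realType]. *)
From HB Require Import structures.
From mathcomp Require Import all_boot all_order all_algebra.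
From mathcomp Require Import all_classical all_reals all_analysis.
Set Implicit Arguments.
Unset Strict Implicit.
Unset Printing Implicit Defensive.
Import Order.TTheory GRing.Theory Num.Theory.
Import numFieldNormedType.Exports.
Local Open Scope classical_set_scope.
Local Open Scope ring_scope.

Section Smooth.
Context {R : realType} {n : nat}.

Definition partial (f : 'rV[R]_n -> R) (a : 'I_n) : 'rV[R]_n -> R :=
  fun u => 'D_(delta_mx 0 a) f u.

Definition iter_partial (f : 'rV[R]_n -> R) (s : seq 'I_n) : 'rV[R]_n -> R :=
  foldl partial f s.

(* C^oo on an open set [U]: all iterated partial derivatives exist and are
   continuous at the points of [U].  As [U] is open, the values of [f] outside
   [U] are irrelevant. *)
Definition smooth_on (U : set 'rV[R]_n) (f : 'rV[R]_n -> R) : Prop :=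
  forall (s : seq 'I_n) (u : 'rV[R]_n), U u ->
    {for u, continuous (iter_partial f s)} /\
    forall a : 'I_n, derivable (iter_partial f s) u (delta_mx 0 a).

End Smooth.

(* A second countable Hausdorff space with a smooth atlas.  The chart of index
   [i] is the homeomorphism [chart i] from the open set [chart_dom i] onto the
   open set [chart i @` chart_dom i] of R^n, with inverse [chart_inv i]; both
   maps are total, with irrelevant values outside these sets. *)
Record smooth_manifold (R : realType) (n : nat) := SmoothManifold {
  carrier :> topologicalType;
  carrier_hausdorff : hausdorff_space carrier;
  carrier_second_countable : @second_countable carrier;
  chart_index : Type;
  chart_dom : chart_index -> set carrier;
  chart : chart_index -> carrier -> 'rV[R]_n;
  chart_inv : chart_index -> 'rV[R]_n -> carrier;
  chart_dom_cover : forall p : carrier, exists i, chart_dom i p;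
  chart_dom_open : forall i, open (chart_dom i);
  chart_image_open : forall i, open (chart i @` chart_dom i);
  chartK : forall i p, chart_dom i p -> chart_inv i (chart i p) = p;
  chart_continuous : forall i, {within chart_dom i, continuous (chart i)};
  chart_inv_continuous : forall i,
      {within chart i @` chart_dom i, continuous (chart_inv i)};
  transition_smooth : forall (i j : chart_index) (k : 'I_n),
      smooth_on (chart i @` (chart_dom i `&` chart_dom j))
        (fun u => chart j (chart_inv i u) 0 k)
}.

Section Transition.
Context {R : realType} {n : nat} (M : smooth_manifold R n).

Definition transition (i j : chart_index M) (u : 'rV[R]_n) : 'rV[R]_n :=
  chart j (chart_inv i u).

End Transition.

(* [metric_mx i u] is the matrix of the metric in the coordinates of the chart
   [i], at the point with coordinates [u].  Tangent vectors are row vectors and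
   the derivative of [f] at [u] is [fun v => v *m 'J f u], so the last axiom is
   the transformation law of a (0,2)-tensor. *)
Record riemannian_metric (R : realType) (n : nat) (M : smooth_manifold R n) :=
  RiemannianMetric {
  metric_mx : chart_index M -> 'rV[R]_n -> 'M[R]_n;
  metric_smooth : forall i (a b : 'I_n),
      smooth_on (chart i @` chart_dom i) (fun u => metric_mx i u a b);
  metric_sym : forall i p, chart_dom i p ->
      (metric_mx i (chart i p))^T = metric_mx i (chart i p);
  metric_posdef : forall i p, chart_dom i p -> forall v : 'rV[R]_n, v != 0 ->
      0 < (v *m metric_mx i (chart i p) *m v^T) 0 0;
  metric_transition : forall i j p, chart_dom i p -> chart_dom j p ->
      metric_mx i (chart i p) =
        'J (transition i j) (chart i p)
          *m metric_mx j (chart j p)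
          *m ('J (transition i j) (chart i p))^T
}.

Section Geodesics.
Context {R : realType} {n : nat} {M : smooth_manifold R n}.
Variable h : riemannian_metric M.

(* Gamma^k_{ab} = 1/2 g^{kl} (d_a g_{lb} + d_b g_{la} - d_l g_{ab}) *)
Definition christoffel (i : chart_index M) (k a b : 'I_n) (u : 'rV[R]_n) : R :=
  2^-1 * \sum_(l < n) invmx (metric_mx h i u) k l *
    (partial (fun w => metric_mx h i w l b) a u
     + partial (fun w => metric_mx h i w l a) b u
     - partial (fun w => metric_mx h i w a b) l u).

(* Only the values of [gam] on the open interval [J] matter. *)
Definition smooth_curve (J : set R) (gam : R -> M) : Prop :=
  forall t, J t -> {for t, continuous gam} /\
    forall i, chart_dom i (gam t) ->
      forall m : nat, derivable (derive1n m (chart i \o gam)) t 1.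

Definition geodesic_equation (J : set R) (gam : R -> M) : Prop :=
  forall t i, J t -> chart_dom i (gam t) ->
    let u := chart i \o gam in
    forall k : 'I_n,
      derive1n 2 u t 0 k +
      \sum_(a < n) \sum_(b < n)
        christoffel i k a b (u t) * derive1 u t 0 a * derive1 u t 0 b = 0.

Definition geodesic (J : set R) (gam : R -> M) : Prop :=
  [/\ open J, is_interval J & J !=set0] /\
  smooth_curve J gam /\ geodesic_equation J gam.

Definition maximal_geodesic (J : set R) (gam : R -> M) : Prop :=
  geodesic J gam /\
  forall (J' : set R) (gam' : R -> M), geodesic J' gam' -> J `<=` J' ->
    (forall t, J t -> gam' t = gam t) -> J' = J.

Definition nonconstant (J : set R) (gam : R -> M) : Prop :=
  exists s t, [/\ J s, J t & gam s <> gam t].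

Definition unit_speed (J : set R) (gam : R -> M) : Prop :=
  forall t i, J t -> chart_dom i (gam t) ->
    let v := derive1 (chart i \o gam) t in
    Num.sqrt ((v *m metric_mx h i (chart i (gam t)) *m v^T) 0 0) = 1.

(* Geodesic completeness, which is equivalent to metric completeness by the
   Hopf-Rinow theorem. *)
Definition complete_metric : Prop :=
  forall (J : set R) (gam : R -> M), maximal_geodesic J gam -> J = setT.

Definition Z_manifold (x y : M) : Prop :=
  complete_metric /\
  forall (J : set R) (alpha : R -> M),
    maximal_geodesic J alpha -> nonconstant J alpha ->
    J 0 -> alpha 0 = x ->
    exists t, [/\ J t, 0 < t & alpha t = y].

End Geodesics.

Section FundamentalGroup.
Context {R : realType} {T : topologicalType}.

(* Loops are functions on [R] of which only the restriction to [0, 1]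
   matters. *)
Definition loop (p : T) (f : R -> T) : Prop :=
  [/\ {within `[0, 1], continuous f}, f 0 = p & f 1 = p].

Definition loop_homotopic (p : T) (f g : R -> T) : Prop :=
  exists H : R * R -> T,
    [/\ {within `[0, 1] `*` `[0, 1], continuous H},
        forall t, t \in `[0, 1] -> H (0, t) = f t,
        forall t, t \in `[0, 1] -> H (1, t) = g t &
        forall s, s \in `[0, 1] -> H (s, 0) = p /\ H (s, 1) = p].

(* The underlying set of the fundamental group based at [p]: the set of all
   homotopy classes of loops. *)
Definition fundamental_group (p : T) : set (set (R -> T)) :=
  [set C | exists2 f, loop p f &
           C = [set g | loop p g /\ loop_homotopic p f g]].

End FundamentalGroup.
Arguments fundamental_group R {T} p.

(* Main.v *)
(** Hopf-Rinow inside a homotopy class.  Every path from [x] is homotopic, with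
    fixed ends, to a geodesic ray from [x] that is shortest in the class: extend
    a minimizing ray through one normal ball after another; the continuation has
    no corner, because cutting a corner shortens the curve.

    Such a ray is never longer than [T].  If one were, then so would be the
    minimal rays in the nearby classes obtained by moving the end point.  All of
    them pass through [y] before time [T].  By compactness the arcs from [x] to
    [y] of length at most [T] form finitely many homotopy classes, and two
    minimal rays whose arcs are homotopic coincide, since exchanging the arcs
    would create a corner.  Hence finitely many rays, that is, finitely many
    Lipschitz curves, would fill a ball of dimension at least 2.

    So the exponential map at [x] is onto from the compact product of the unit
    sphere and [0, T], and every loop at [p], composed with a path from [x] to
    [p], falls into one of finitely many classes.

    Length is not defined by an integral: a curve of length at most [L] is
    replaced by a curve on [0, L] whose speed is everywhere at most 1. *)

Require Import Defs.
From HB Require Import structures.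
From mathcomp Require Import all_boot all_order all_algebra.
From mathcomp Require Import all_classical all_reals all_analysis.
From mathcomp Require Import lra ring.
Import Order.TTheory GRing.Theory Num.Theory.
Import numFieldNormedType.Exports.
Local Open Scope classical_set_scope.
Local Open Scope ring_scope.
Set Implicit Arguments.
Unset Strict Implicit.
Unset Printing Implicit Defensive.

(** Only Lipschitz dependence of geodesics on their initial velocity is proved, so the exponential
    map is not known to be a diffeomorphism near 0. Normal coordinates come from a contraction
    argument instead, and the Gauss lemma takes the form of an estimate with a quadratic error. One
    inequality is enough: all that is used of a normal ball is that a curve of speed at most 1
    leaving the centre cannot reach a geodesic sphere before a radial geodesic of unit speed does.
    Every other comparison is cutting and pasting inside a coordinate ball, where straight-line
    homotopies exist.

    The infimum of the durations in a homotopy class is not attained a priori. Minimality is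
    therefore phrased with competitors exceeding the infimum by an arbitrary [eta], and the initial
    direction is found by compactness of the unit sphere. Cutting a corner saves an amount fixed in
    advance, which beats a small [eta].

    That a supposed ray is strictly longer than [T] is used twice: [y] is then an interior point of
    the arc, with room on both sides for cutting, and nearby minimal rays are still longer than
    [T]. *)

(** Continuation principle, by taking the supremum of the initial stretches on which [P] holds.
    Trapping, uniqueness of geodesics, continuity of the flow and the continuation of minimizing
    rays are all instances of it. *)
Lemma real_induction (R : realType) (P : R -> Prop) (a b : R) :
  P a ->
  (forall t, a <= t < b -> (forall s, a <= s <= t -> P s) ->
     exists2 d : R, 0 < d & forall s, t < s < t + d -> P s) ->
  (forall t, a < t <= b -> (forall s, a <= s < t -> P s) -> P t) ->
  forall t, a <= t <= b -> P t.
Proof.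
move=> Pa Pr Pl t /andP[at_ tb].
pose S := [set s | a <= s <= b /\ forall r, a <= r <= s -> P r].
have ab : a <= b by apply: le_trans tb.
have Sa : S a.
  by split; [rewrite lexx|move=> r /andP[ar ra]; have -> : r = a by apply/le_anti; rewrite ra].
have hS : has_sup S.
  by split; [exists a|exists b => s [/andP[]]].
have Sub : forall s, S s -> s <= sup S by move=> s Ss; apply: ub_le_sup => //; case: hS.
have aS : a <= sup S by exact: Sub.
have Sb : sup S <= b by apply: ge_sup; [exists a|move=> s [/andP[]]].
have low : forall s, a <= s < sup S -> P s.
  move=> s /andP[as_ ss]; have sS0 : 0 < sup S - s by lra.
  have [r [Sr1 Sr2] sr] := sup_adherent sS0 hS.
  apply: Sr2; rewrite as_ /=; apply: ltW; apply: le_lt_trans sr; lra.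
have SS : S (sup S).
  split; first by rewrite aS.
  move=> r /andP[ar]; rewrite le_eqVlt => /orP[/eqP ->|rs]; last by apply: low; rewrite ar.
  move: aS; rewrite le_eqVlt => /orP[/eqP <- //|aS].
  by apply: Pl => //; rewrite aS.
have [sb|sb] := ltP (sup S) b; last first.
  by apply: SS.2; rewrite at_ (le_trans tb).
have [|d d0 Pd] := Pr (sup S) _ SS.2; first by rewrite aS.
have : S (Num.min b (sup S + d / 2)).
  split; first by rewrite le_min ab ge_min lexx /= andbT; lra.
  move=> r /andP[ar]; rewrite le_min => /andP[rb rd].
  have [rs|rs] := leP r (sup S); first by apply: SS.2; rewrite ar.
  by apply: Pd; rewrite rs /=; lra.
move=> /Sub; rewrite ge_min => /orP[|]; lra.
Qed.

Lemma nearN (R : realType) (V : normedModType R) (x : V) (P : V -> Prop) :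
  (\forall u \near x, P u) <-> exists2 d : R, 0 < d & forall u, `|u - x| < d -> P u.
Proof.
split=> [/nbhs_normP[d d0 H]|[d d0 H]].
  by exists d => // u ux; apply: H; rewrite /= /ball_/= distrC.
by apply/nbhs_normP; exists d => // u /=; rewrite distrC; exact: H.
Qed.

Lemma continuousN (R : realType) (V W : normedModType R) (f : V -> W) (x : V) :
  {for x, continuous f} <-> forall e : R, 0 < e ->
    exists2 d : R, 0 < d & forall u, `|u - x| < d -> `|f u - f x| < e.
Proof.
split=> [/cvgrPdist_lt H e e0|H].
  have [d d0 Hd] := (nearN x (fun t => `|f x - f t| < e)).1 (H e e0).
  by exists d => // u ux; rewrite distrC Hd.
apply/cvgrPdist_lt => e e0; apply/nearN; have [d d0 Hd] := H e e0.
by exists d => // u ux; rewrite distrC Hd.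
Qed.

(** * Calculus on coordinate spaces *)

Section RowNorm.
Context {R : realType} {n : nat}.
Implicit Types u v w : 'rV[R]_n.

Lemma rV_normP v (c : R) : 0 <= c -> `|v| <= c <-> forall i, `|v 0 i| <= c.
Proof.
move=> c0; rewrite [`|v|]mx_normrE; split=> [/bigmax_leP[_ H] i|H].
  exact: (H (0, i)).
by apply/bigmax_leP; split=> // -[i j] _ /=; rewrite (ord1 i).
Qed.

Lemma coord_norm v i : `|v 0 i| <= `|v|.
Proof. exact: ((rV_normP v (normr_ge0 v)).1 (lexx _)). Qed.

Lemma norm_delta (i : 'I_n) : `|delta_mx 0 i : 'rV[R]_n| <= 1.
Proof.
by apply/rV_normP => // j; rewrite mxE eqxx /=; case: eqP; rewrite ?normr1 ?normr0.
Qed.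

Lemma rV_sum_delta v : v = \sum_(a < n) v 0 a *: delta_mx 0 a.
Proof. by rewrite [LHS]row_sum_delta. Qed.

End RowNorm.

Section Directional.
Context {R : realType}.

Lemma is_derive_line (V W : normedModType R) (f : V -> W) (x v : V) (s : R) :
  derivable f (x + s *: v) v ->
  is_derive s 1 (fun t : R => f (x + t *: v)) ('D_v f (x + s *: v)).
Proof.
move=> df.
have E : (fun h : R => h^-1 *: (((fun t : R => f (x + t *: v)) \o shift s) (h *: (1:R)) - f (x + s *: v)))
   = (fun h => h^-1 *: ((f \o shift (x + s *: v)) (h *: v) - f (x + s *: v))).
  apply/funext => h /=; congr (_ *: (f _ - _)).
  by rewrite scalerDl addrCA [h *: 1](mulr1).
by split; rewrite /derivable /derive E.
Qed.

Lemma MVT_bound (f df : R -> R) (a b C : R) : a <= b ->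
  (forall t, a <= t <= b -> is_derive t 1 f (df t)) ->
  (forall t, a <= t <= b -> `|df t| <= C) ->
  `|f b - f a| <= C * (b - a).
Proof.
move=> ab H HC.
have [||c /itvP cab ->] := @MVT_segment _ f df a b ab.
- by move=> x /itvP xab; apply: H; rewrite !xab.
- apply: derivable_within_continuous => x /itvP xab; apply: ex_derive.
  by apply: H; rewrite !xab.
rewrite normrM [`|b - a|]ger0_norm ?subr_ge0//; apply: ler_wpM2r; first by rewrite subr_ge0.
by apply: HC; rewrite !cab.
Qed.

(** The two conditions on [s] together say that [s] lies between 0 and [c], whatever the sign of
    [c]; coordinate paths run in both directions. *)
Lemma MVT_dir (V : normedModType R) (f : V -> R) (x v : V) (c : R) :
  (forall s, `|s| <= `|c| -> 0 <= s * c -> derivable f (x + s *: v) v) ->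
  exists s, [/\ `|s| <= `|c|, 0 <= s * c & f (x + c *: v) - f x = c * 'D_v f (x + s *: v)].
Proof.
move=> H; pose g t := f (x + t *: v); pose dg t := 'D_v f (x + t *: v).
have E0 : g 0 = f x by rewrite /g scale0r addr0.
have [c0|c0] := leP 0 c.
  have Hs s : 0 <= s <= c -> is_derive s 1 g (dg s).
    move=> /andP[s0 sc]; apply: is_derive_line; apply: H; last by rewrite mulr_ge0.
    by rewrite !ger0_norm.
  have [||s /itvP sc] := @MVT_segment _ g dg 0 c c0.
  - by move=> s /itvP sc; apply: Hs; rewrite !sc.
  - apply: derivable_within_continuous => s /itvP sc; apply: ex_derive.
    by apply: Hs; rewrite !sc.
  rewrite E0 subr0 mulrC => E; exists s; split=> //; last by rewrite mulr_ge0 ?sc.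
  by rewrite !ger0_norm ?sc.
have Hs s : c <= s <= 0 -> is_derive s 1 g (dg s).
  move=> /andP[s0 sc]; apply: is_derive_line; apply: H; last by rewrite mulr_le0// ltW.
  by rewrite !ler0_norm ?lerN2// ltW.
have [||s /itvP sc] := @MVT_segment _ g dg c 0 (ltW c0).
- by move=> s /itvP sc; apply: Hs; rewrite !sc.
- apply: derivable_within_continuous => s /itvP sc; apply: ex_derive.
  by apply: Hs; rewrite !sc.
rewrite E0 sub0r => E; exists s; split.
- by rewrite !ler0_norm ?lerN2 ?sc// ltW.
- by rewrite mulr_le0 ?sc// ltW.
by apply: oppr_inj; rewrite opprB E mulrC mulNr.
Qed.

End Directional.

Section IncrementFormula.
Context {R : realType} {n : nat}.
Implicit Types u v w : 'rV[R]_n.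

Let mix u w (k : nat) : 'rV[R]_n := \row_j (if (j < k)%N then w 0 j else u 0 j).

(* The segment from [u] to [w] is replaced by a path along the coordinate
   axes, on each edge of which the mean value theorem applies. *)
Lemma increment_formula (f : 'rV[R]_n -> R) u w :
  (forall v (a : 'I_n), (forall j, `|v 0 j - u 0 j| <= `|w 0 j - u 0 j| /\
      0 <= (v 0 j - u 0 j) * (w 0 j - u 0 j)) -> derivable f v (delta_mx 0 a)) ->
  exists xi : 'I_n -> 'rV[R]_n,
    (forall a j, `|xi a 0 j - u 0 j| <= `|w 0 j - u 0 j| /\
      0 <= (xi a 0 j - u 0 j) * (w 0 j - u 0 j)) /\
    f w - f u = \sum_(a < n) (w 0 a - u 0 a) * partial f a (xi a).
Proof.
move=> H.
have step (a : 'I_n) : exists x : 'rV[R]_n,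
    (forall j, `|x 0 j - u 0 j| <= `|w 0 j - u 0 j| /\
      0 <= (x 0 j - u 0 j) * (w 0 j - u 0 j)) /\
    f (mix u w a.+1) - f (mix u w a) = (w 0 a - u 0 a) * partial f a x.
  set c := w 0 a - u 0 a.
  have bnd s : `|s| <= `|c| -> 0 <= s * c ->
      forall j, `|(mix u w a + s *: delta_mx 0 a) 0 j - u 0 j| <= `|w 0 j - u 0 j| /\
       0 <= ((mix u w a + s *: delta_mx 0 a) 0 j - u 0 j) * (w 0 j - u 0 j).
    move=> sc sc0 j; rewrite !mxE eqxx /=.
    have [->|ja] := eqVneq j a.
      by rewrite ltnn /= mulr1 addrC addKr.
    rewrite mulr0 addr0; case: ifP => _; first by rewrite -expr2 sqr_ge0.
    by rewrite subrr normr0 mul0r.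
  have [s sc sc0|s [sc sc0]] := @MVT_dir _ _ f (mix u w a) (delta_mx 0 a) c.
    by apply: H; apply: bnd.
  have -> : mix u w a + c *: delta_mx 0 a = mix u w a.+1.
    apply/rowP => j; rewrite !mxE eqxx /=.
    have -> : (j < a.+1)%N = (j == a) || (j < a)%N by rewrite ltnS leq_eqVlt.
    have [->|ja] := eqVneq j a; first by rewrite ltnn mulr1 addrC subrK.
    by rewrite /= mulr0 addr0.
  by move=> E; exists (mix u w a + s *: delta_mx 0 a); split; first exact: bnd.
exists (fun a => sval (cid (step a))); split.
  by move=> a; case: (cid (step a)) => x [].
have -> : f w - f u = \sum_(a < n) (f (mix u w a.+1) - f (mix u w a)).
  rewrite -(big_mkord xpredT (fun a => f (mix u w a.+1) - f (mix u w a))) telescope_sumr//.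
  by congr (f _ - f _); apply/rowP => j; rewrite !mxE ?ltn_ord.
by apply: eq_bigr => a _; case: (cid (step a)) => x [].
Qed.

(** In each coordinate the intermediate points of [increment_formula] lie between [u] and [w], which
    is what its two conditions say. Such a box is contained in every sup-norm ball that contains
    both of its corners. *)
Lemma increment_ball (f : 'rV[R]_n -> R) u0 (r : R) u w :
  (forall v (a : 'I_n), `|v - u0| <= r -> derivable f v (delta_mx 0 a)) ->
  `|u - u0| <= r -> `|w - u0| <= r ->
  exists xi : 'I_n -> 'rV[R]_n,
    (forall a, `|xi a - u| <= `|w - u| /\ `|xi a - u0| <= r) /\
    f w - f u = \sum_(a < n) (w 0 a - u 0 a) * partial f a (xi a).
Proof.
move=> H ur wr; have r0 : 0 <= r by apply: le_trans ur.
have box v : (forall j, `|v 0 j - u 0 j| <= `|w 0 j - u 0 j| /\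
      0 <= (v 0 j - u 0 j) * (w 0 j - u 0 j)) -> `|v - u| <= `|w - u| /\ `|v - u0| <= r.
  move=> Hv; split.
    apply/rV_normP => // j; rewrite !mxE; apply: le_trans (Hv j).1 _.
    by have := coord_norm (w - u) j; rewrite !mxE.
  apply/rV_normP => // j; rewrite !mxE.
  have := (rV_normP _ r0).1 ur j; have := (rV_normP _ r0).1 wr j; rewrite !mxE.
  have [] := Hv j; set a := v 0 j; set b := u 0 j; set c := w 0 j; set d := u0 0 j.
  move=> h1 h2; rewrite !ler_norml => /andP[h3 h4] /andP[h5 h6].
  have [bc|cb] := leP b c.
    move: h1; rewrite [`|c - b|]ger0_norm ?subr_ge0// ler_norml => /andP[h7 h8].
    have [e|ne] := eqVneq c b; first by apply/andP; split; lra.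
    have : 0 <= a - b by rewrite -(pmulr_lge0 _ (_ : 0 < c - b))// subr_gt0 lt_neqAle eq_sym ne.
    by move=> ?; apply/andP; split; lra.
  move: h1; rewrite [`|c - b|]ltr0_norm ?subr_lt0// ler_norml => /andP[h7 h8].
  have : a - b <= 0 by rewrite -(nmulr_lge0 _ (_ : c - b < 0))// subr_lt0.
  by move=> ?; apply/andP; split; lra.
have [v a Hv|xi [h1 h2]] := @increment_formula f u w.
  by apply: H; apply: (box v Hv).2.
by exists xi; split=> // a; exact: box.
Qed.

Lemma norm_sum_le (k : nat) (F : 'I_k -> R) (C : R) :
  (forall a, `|F a| <= C) -> `|\sum_(a < k) F a| <= k%:R * C.
Proof.
move=> H; apply: le_trans (ler_norm_sum _ _ _) _.
by apply: le_trans (ler_sum _ (fun a _ => H a)) _; rewrite sumr_const card_ord mulr_natl.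
Qed.

Lemma lipschitz_ball (f : 'rV[R]_n -> R) u0 (r C : R) u w :
  (forall v (a : 'I_n), `|v - u0| <= r -> derivable f v (delta_mx 0 a)) ->
  (forall v (a : 'I_n), `|v - u0| <= r -> `|partial f a v| <= C) ->
  `|u - u0| <= r -> `|w - u0| <= r -> `|f w - f u| <= n%:R * C * `|w - u|.
Proof.
move=> H HC ur wr; have [xi [h1 ->]] := increment_ball H ur wr.
rewrite -mulrA; apply: norm_sum_le => a; rewrite normrM mulrC.
apply: ler_pM => //; first by apply: HC; apply: (h1 a).2.
by have := coord_norm (w - u) a; rewrite !mxE.
Qed.

Lemma taylor_ball (f : 'rV[R]_n -> R) u0 (r K : R) u w :
  (forall v (a : 'I_n), `|v - u0| <= r -> derivable f v (delta_mx 0 a)) ->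
  (forall v v' (a : 'I_n), `|v - u0| <= r -> `|v' - u0| <= r ->
     `|partial f a v' - partial f a v| <= K * `|v' - v|) -> 0 <= K ->
  `|u - u0| <= r -> `|w - u0| <= r ->
  `|f w - f u - \sum_(a < n) (w 0 a - u 0 a) * partial f a u| <= n%:R * (K * `|w - u| ^+ 2).
Proof.
move=> H HK K0 ur wr; have [xi [h1 ->]] := increment_ball H ur wr.
rewrite -sumrB; apply: norm_sum_le => a; rewrite -mulrBr normrM expr2 mulrA mulrC.
have [h2 h3] := h1 a.
apply: ler_pM => //; last by have := coord_norm (w - u) a; rewrite !mxE.
by apply: le_trans (HK _ _ _ _ _) _ => //; rewrite ler_wpM2l.
Qed.

End IncrementFormula.

(** * Smooth functions of several variables *)

Section SmoothFunctions.
Context {R : realType} {n : nat}.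
Implicit Types (U : set 'rV[R]_n) (f g : 'rV[R]_n -> R) (u v w : 'rV[R]_n).

(** Smoothness of finite order, by recursion. Closure under products and inverses needs an induction
    on the order, since the derivative of a product contains the undifferentiated factors; the
    quantification over lists in [smooth_on] does not lend itself to that. *)
Fixpoint ksmooth (k : nat) U f : Prop :=
  (forall u, U u -> {for u, continuous f}) /\
  if k is k'.+1 then forall a, (forall u, U u -> derivable f u (delta_mx 0 a)) /\
    ksmooth k' U (partial f a)
  else True.

Lemma smooth_on_partial U f a : smooth_on U f -> smooth_on U (partial f a).
Proof. by move=> sf s u Uu; exact: (sf (a :: s) u Uu). Qed.

Lemma smooth_onP U f : smooth_on U f <-> forall k, ksmooth k U f.
Proof.
split=> [sf k|sf s].
  elim: k f sf => [|k IH] f sf /=; split=> //.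
  - by move=> u /(sf [::])[].
  - by move=> u /(sf [::])[].
  move=> a; split; first by move=> u /(sf [::])[].
  by apply: IH; exact: smooth_on_partial.
elim: s f sf => [|a s IH] f sf /= u Uu.
  split; first by have [H _] := sf 0%N; exact: H.
  by move=> a; have [_ H] := sf 1%N; exact: (H a).1.
by apply: IH => // k; have [_ H] := sf k.+1; exact: (H a).2.
Qed.

Lemma ksmoothW k U f : ksmooth k.+1 U f -> ksmooth k U f.
Proof.
elim: k f => [|k IH] f; first by case.
move=> [H1 H2]; split=> // a; have [H3 H4] := H2 a; split=> //.
exact: IH.
Qed.

Lemma open_near_eq (V : normedModType R) (W : Type) (A : set V) (f g : V -> W) (x : V) :
  open A -> (forall y, A y -> f y = g y) -> A x -> \forall y \near x, f y = g y.
Proof. by move=> oA H Ax; near=> y; apply: H; near: y; exact: open_nbhs_nbhs. Unshelve. all: by end_near. Qed.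

Lemma near_eq_continuous (V : topologicalType) (W : topologicalType) (f g : V -> W) x :
  (\forall y \near x, f y = g y) -> {for x, continuous f} -> {for x, continuous g}.
Proof.
move=> H cf; rewrite /prop_for /continuous_at -(nbhs_singleton H).
exact: cvg_trans (near_eq_cvg H) cf.
Qed.

Lemma eq_ksmooth k U f g : open U -> (forall u, U u -> f u = g u) ->
  ksmooth k U f -> ksmooth k U g.
Proof.
move=> oU; elim: k f g => [|k IH] f g fg [H1 H2].
  by split=> // u Uu; apply: near_eq_continuous (H1 u Uu); exact: open_near_eq Uu.
split=> [u Uu|a].
  by apply: near_eq_continuous (H1 u Uu); exact: open_near_eq Uu.
have [H3 H4] := H2 a; split=> [u Uu|].
  by apply: near_eq_derivable (H3 u Uu); exact: open_near_eq Uu.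
by apply: IH H4 => u Uu; apply: near_eq_derive; exact: open_near_eq Uu.
Qed.

Lemma ksmooth_cst k U (c : R) : open U -> ksmooth k U (cst c).
Proof.
move=> oU; elim: k c => [|k IH] c; split=> //.
- by move=> u _; exact: cst_continuous.
- by move=> u _; exact: cst_continuous.
move=> a; split=> [u Uu|]; first exact: derivable_cst.
apply: (@eq_ksmooth k U (cst 0)) => // u Uu; by rewrite /partial derive_cst.
Qed.

Lemma ksmoothD k U f g : open U -> ksmooth k U f -> ksmooth k U g ->
  ksmooth k U (fun u => f u + g u).
Proof.
move=> oU; elim: k f g => [|k IH] f g [f1 f2] [g1 g2].
  by split=> // u Uu; apply: continuousD; [exact: f1|exact: g1].
split=> [u Uu|a]; first by apply: continuousD; [exact: f1|exact: g1].
have [f3 f4] := f2 a; have [g3 g4] := g2 a.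
split=> [u Uu|]; first by apply: derivableD; [exact: f3|exact: g3].
apply: (@eq_ksmooth k U (fun u => partial f a u + partial g a u)) => // [u Uu|].
  by rewrite /partial -deriveD; [|exact: f3|exact: g3].
exact: IH.
Qed.

Lemma ksmoothM k U f g : open U -> ksmooth k U f -> ksmooth k U g ->
  ksmooth k U (fun u => f u * g u).
Proof.
move=> oU; elim: k f g => [|k IH] f g sf sg.
  by split=> // u Uu; apply: continuousM; [exact: sf.1|exact: sg.1].
have [f1 f2] := sf; have [g1 g2] := sg.
split=> [u Uu|a]; first by apply: continuousM; [exact: f1|exact: g1].
have [f3 f4] := f2 a; have [g3 g4] := g2 a.
split=> [u Uu|]; first by apply: derivableM; [exact: f3|exact: g3].
apply: (@eq_ksmooth k U (fun u => f u * partial g a u + g u * partial f a u)) => // [u Uu|].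
  by rewrite /partial [RHS](deriveM (f3 u Uu) (g3 u Uu)).
by apply: ksmoothD => //; apply: IH => //; exact: ksmoothW.
Qed.

Lemma ksmoothV k U f : open U -> (forall u, U u -> f u != 0) -> ksmooth k U f ->
  ksmooth k U (fun u => (f u)^-1).
Proof.
move=> oU f0; elim: k => [|k IH] sf.
  by split=> // u Uu; apply: continuousV; [exact: f0|exact: sf.1].
have [f1 f2] := sf.
split=> [u Uu|a]; first by apply: continuousV; [exact: f0|exact: f1].
have [f3 f4] := f2 a.
split=> [u Uu|]; first by apply: derivableV; [exact: f0|exact: f3].
have sV := IH (ksmoothW sf).
apply: (@eq_ksmooth k U (fun u => -1 * ((f u)^-1 * (f u)^-1 * partial f a u))) => // [u Uu|].
  rewrite /partial [RHS](deriveV (f0 u Uu) (f3 u Uu)).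
  by rewrite mulN1r scaleNr -exprVn expr2.
by apply: ksmoothM => //; [exact: ksmooth_cst|apply: ksmoothM => //; exact: ksmoothM].
Qed.

Lemma smooth_cst U (c : R) : open U -> smooth_on U (fun _ => c).
Proof. by move=> oU; apply/smooth_onP => k; exact: ksmooth_cst. Qed.

Lemma eq_smooth U f g : open U -> (forall u, U u -> f u = g u) ->
  smooth_on U f -> smooth_on U g.
Proof. by move=> oU fg /smooth_onP sf; apply/smooth_onP => k; exact: eq_ksmooth (sf k). Qed.

Lemma smoothD U f g : open U -> smooth_on U f -> smooth_on U g ->
  smooth_on U (fun u => f u + g u).
Proof. by move=> oU /smooth_onP sf /smooth_onP sg; apply/smooth_onP => k; exact: ksmoothD. Qed.

Lemma smoothM U f g : open U -> smooth_on U f -> smooth_on U g ->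
  smooth_on U (fun u => f u * g u).
Proof. by move=> oU /smooth_onP sf /smooth_onP sg; apply/smooth_onP => k; exact: ksmoothM. Qed.

Lemma smoothV U f : open U -> (forall u, U u -> f u != 0) -> smooth_on U f ->
  smooth_on U (fun u => (f u)^-1).
Proof. by move=> oU f0 /smooth_onP sf; apply/smooth_onP => k; exact: ksmoothV. Qed.

Lemma smoothB U f g : open U -> smooth_on U f -> smooth_on U g ->
  smooth_on U (fun u => f u - g u).
Proof.
move=> oU sf sg; apply: (@eq_smooth U (fun u => f u + -1 * g u) _ oU) => [u _|].
  by rewrite mulN1r.
exact: (smoothD oU sf (smoothM oU (smooth_cst (-1) oU) sg)).
Qed.

Lemma smooth_sum (I : Type) (r : seq I) U (F : I -> 'rV[R]_n -> R) : open U ->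
  (forall i, smooth_on U (F i)) -> smooth_on U (fun u => \sum_(i <- r) F i u).
Proof.
move=> oU sF; elim: r => [|i r IH].
  apply: (@eq_smooth U (fun=> 0) _ oU) => [u _|]; [by rewrite big_nil|exact: smooth_cst].
apply: (@eq_smooth U (fun u => F i u + \sum_(i <- r) F i u) _ oU) => [u _|]; first by rewrite big_cons.
exact: (smoothD oU (sF i) IH).
Qed.

Lemma smooth_prod (I : Type) (r : seq I) U (F : I -> 'rV[R]_n -> R) : open U ->
  (forall i, smooth_on U (F i)) -> smooth_on U (fun u => \prod_(i <- r) F i u).
Proof.
move=> oU sF; elim: r => [|i r IH].
  apply: (@eq_smooth U (fun=> 1) _ oU) => [u _|]; [by rewrite big_nil|exact: smooth_cst].
apply: (@eq_smooth U (fun u => F i u * \prod_(i <- r) F i u) _ oU) => [u _|]; first by rewrite big_cons.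
exact: (smoothM oU (sF i) IH).
Qed.

Lemma smooth_det (m : nat) U (A : 'rV[R]_n -> 'M[R]_m) : open U ->
  (forall i j, smooth_on U (fun u => A u i j)) -> smooth_on U (fun u => \det (A u)).
Proof.
move=> oU sA; apply: smooth_sum => // s.
have sp : smooth_on U (fun u => \prod_i A u i (perm.fun_of_perm s i)).
  exact: (@smooth_prod _ _ U (fun i u => A u i (perm.fun_of_perm s i))).
exact: (smoothM oU (smooth_cst _ oU) sp).
Qed.

(** By Cramer's rule an entry of the inverse is a signed minor divided by the determinant. The
    Christoffel symbols and the lower bound for the metric norm depend on this. *)
Lemma smooth_invmx (m : nat) U (A : 'rV[R]_n -> 'M[R]_m) : open U ->
  (forall u, U u -> A u \in unitmx) ->
  (forall i j, smooth_on U (fun u => A u i j)) ->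
  forall i j, smooth_on U (fun u => invmx (A u) i j).
Proof.
move=> oU Au sA i j.
apply: (@eq_smooth U (fun u => (\det (A u))^-1 * ((-1) ^+ (j + i) *
   \det (row' j (col' i (A u)))))) => // [u Uu|].
  by rewrite /invmx Au// !mxE.
have s1 : smooth_on U (fun u => (\det (A u))^-1).
  apply: (smoothV oU) (smooth_det oU sA) => u Uu; by rewrite -unitfE -unitmxE Au.
have s2 : smooth_on U (fun u => \det (row' j (col' i (A u)))).
  apply: (smooth_det oU) => k l.
  apply: (eq_smooth oU) (sA (lift j k) (lift i l)) => u _; by rewrite !mxE.
exact: (smoothM oU s1 (smoothM oU (smooth_cst _ oU) s2)).
Qed.

Lemma open_ball_sub U u : open U -> U u -> exists2 r : R, 0 < r & forall v, `|v - u| <= r -> U v.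
Proof.
move=> oU Uu; have /nearN[d d0 H] := open_nbhs_nbhs (conj oU Uu).
by exists (d / 2); [rewrite divr_gt0|move=> v vu; apply: H; apply: le_lt_trans vu _; rewrite ltr_pdivrMr// ltr_pMr// ltr1n].
Qed.

(** Finitely many local estimates, such as one for each entry of the metric, get a common radius and
    a common constant, because each survives shrinking the radius and enlarging the constant. *)
Lemma fin_uniform (I : finType) (P : I -> R -> R -> Prop) :
  (forall i (r r' C C' : R), 0 < r' -> r' <= r -> C <= C' -> P i r C -> P i r' C') ->
  (forall i, exists r C : R, [/\ 0 < r, 0 < C & P i r C]) ->
  exists r C : R, [/\ 0 < r, 0 < C & forall i, P i r C].
Proof.
move=> mono H.
have [r [C [r0 C0 HP]]] : exists r C : R, [/\ 0 < r, 0 < C & forall i, i \in enum I -> P i r C].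
  elim: (enum I) => [|i s [r [C [r0 C0 HP]]]].
    by exists 1, 1; split.
  have [r' [C' [r'0 C'0 HP']]] := H i.
  exists (Num.min r r'), (Num.max C C'); split.
  - by rewrite lt_min r0.
  - by rewrite lt_max C0.
  move=> j; rewrite inE => /orP[/eqP ->|js].
    by apply: mono HP'; rewrite ?lt_min ?r0 ?ge_min ?le_max ?lexx ?orbT.
  by apply: mono (HP j js); rewrite ?lt_min ?r0 ?ge_min ?le_max ?lexx ?orbT.
by exists r, C; split=> // i; apply: HP; rewrite mem_enum.
Qed.

Lemma finI_uniform (I : finType) (P : I -> R -> Prop) :
  (forall i r r', 0 < r' -> r' <= r -> P i r -> P i r') ->
  (forall i, exists2 r : R, 0 < r & P i r) ->
  exists2 r : R, 0 < r & forall i, P i r.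
Proof.
move=> mono H; have [|i|r [C [r0 _ HP]]] := @fin_uniform I (fun i r _ => P i r).
- by move=> i r r' _ _ r0 rr _; exact: mono.
- by have [r r0 Pr] := H i; exists r, 1.
- by exists r.
Qed.

Definition lip_bounded f u0 (r C : R) :=
  (forall v, `|v - u0| <= r -> `|f v| <= C) /\
  (forall v w, `|v - u0| <= r -> `|w - u0| <= r -> `|f w - f v| <= C * `|w - v|).

Lemma lip_boundedW f u0 r r' C C' : r' <= r -> C <= C' ->
  lip_bounded f u0 r C -> lip_bounded f u0 r' C'.
Proof.
move=> rr CC [H1 H2]; split=> [v vr|v w vr wr].
  by apply: le_trans CC; apply: H1; exact: le_trans rr.
apply: le_trans (H2 v w _ _) _; [exact: le_trans rr|exact: le_trans rr|].
exact: ler_wpM2r.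
Qed.

Lemma continuous_bounded f u0 : {for u0, continuous f} ->
  exists r C : R, [/\ 0 < r, 0 < C & forall v, `|v - u0| <= r -> `|f v| <= C].
Proof.
move=> /continuousN/(_ 1 ltr01)[d d0 H]; exists (d / 2), (`|f u0| + 1); split.
- by rewrite divr_gt0.
- by rewrite ltr_wpDl.
move=> v vd; rewrite -(subrK (f u0) (f v)) addrC; apply: le_trans (ler_normD _ _) _.
by rewrite lerD2l ltW// H//; apply: le_lt_trans vd _; rewrite ltr_pdivrMr// ltr_pMr// ltr1n.
Qed.

Lemma smooth_lip_bounded U f u0 : open U -> U u0 -> smooth_on U f ->
  exists r C : R, [/\ 0 < r, 0 < C & lip_bounded f u0 r C].
Proof.
move=> oU Uu sf.
have [r1 r10 HU] := open_ball_sub oU Uu.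
have [r2 [C2 [r20 C20 H2]]] := continuous_bounded (sf [::] u0 Uu).1.
have [|a|r3 [C3 [r30 C30 H3]]] := @fin_uniform _ (fun (a : 'I_n) r C =>
    forall v, `|v - u0| <= r -> `|partial f a v| <= C).
- move=> a r r' C C' _ rr CC H v vr; apply: le_trans CC; apply: H; exact: le_trans rr.
- by apply: continuous_bounded; exact: (sf [:: a] u0 Uu).1.
exists (Num.min r1 (Num.min r2 r3)), (Num.max C2 (n%:R * C3)); split.
- by rewrite !lt_min r10 r20.
- by rewrite lt_max C20.
split=> [v|v w]; rewrite !le_min.
  by move=> /and3P[_ v2 _]; rewrite le_max H2.
move=> /and3P[v1 _ v3] /and3P[w1 _ w3].
apply: le_trans (_ : n%:R * C3 * `|w - v| <= _); last first.
  by rewrite ler_wpM2r// le_max lexx orbT.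
have H4 := @lipschitz_ball _ _ f u0 (Num.min r1 r3) C3 v w.
apply: H4; rewrite ?le_min ?v1 ?w1 ?v3 ?w3// => x a; rewrite le_min => /andP[x1 x3].
  by apply: (sf [::] x _).2; exact: HU.
exact: H3.
Qed.

Let linform (c : 'I_n -> R) (h : 'rV[R]_n) : R := \sum_(a < n) h 0 a * c a.

Let linform_linear c : linear (linform c).
Proof.
move=> k x y; rewrite /linform scaler_sumr -big_split /=; apply: eq_bigr => a _.
by rewrite !mxE mulrDl -mulrA.
Qed.

(** [smooth_on] speaks of partial derivatives only; their continuity together with the increment
    formula gives the Fréchet differential, on which the chain rule rests. *)
Lemma smooth_differentiable U f u : open U -> U u -> smooth_on U f ->
  differentiable f u /\ forall h, 'd f u h = \sum_(a < n) h 0 a * partial f a u.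
Proof.
move=> oU Uu sf.
pose L : {linear 'rV[R]_n -> R} := HB.pack (linform (fun a => partial f a u))
  (GRing.isLinear.Build R 'rV[R]_n R *:%R _ (linform_linear (fun a => partial f a u))).
have Lb h : `|L h| <= n%:R * ((\sum_(a < n) `|partial f a u|) * `|h|).
  apply: norm_sum_le => a; rewrite normrM mulrC; apply: ler_pM => //; last exact: coord_norm.
  by rewrite (bigD1 a)//= lerDl sumr_ge0.
have cL : continuous L.
  apply/linear_bounded_continuous.
  apply/linear_boundedP; exists (n%:R * (\sum_(a < n) `|partial f a u|)); split=> [|M cM x]; first exact: num_real.
  by apply: le_trans (Lb x) _; rewrite mulrA ler_wpM2r// ltW.
have key e : 0 < e -> \forall h \near (0 : 'rV[R]_n), `|f (h + u) - (f u + L h)| <= e * `|h|.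
  move=> e0.
  have [r1 r10 HU] := open_ball_sub oU Uu.
  have [|a|r2 r20 H2] := @finI_uniform _ (fun (a : 'I_n) r =>
    forall v, `|v - u| < r -> `|partial f a v - partial f a u| <= e / n%:R).
  - by move=> a r r' _ rr H v vr; apply: H; exact: lt_le_trans rr.
  - have n0 : 0 < n%:R :> R by rewrite ltr0n; case: (n) a => [[]|].
    have /continuousN H := (sf [:: a] u Uu).1; have [d d0 Hd] := H _ (divr_gt0 e0 n0).
    by exists d => // v vd; apply/ltW/Hd.
  (* The error is distributed as [e / n%:R] over the coordinates, so dimension 0, where the only
     increment is 0, is settled apart. *)
  have [n0|n0] := posnP n.
    near=> h; rewrite [h](_ : _ = 0); last by apply/rowP => i; move: (ltn_ord i); rewrite {2}n0.
    by rewrite add0r linear0 addr0 subrr !normr0 mulr0.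
  apply/nearN; exists (Num.min r1 r2); first by rewrite lt_min r10.
  move=> h; rewrite subr0 lt_min => /andP[h1 h2].
  have [|||xi [H3 H4]] := @increment_ball _ _ f u r1 u (h + u).
  - by move=> v a vr; apply: (sf [::] v _).2; exact: HU.
  - by rewrite subrr normr0 ltW.
  - by rewrite addrK ltW.
  have nR : 0 < n%:R :> R by rewrite ltr0n.
  have E : f (h + u) - (f u + L h) = \sum_(a < n) h 0 a * (partial f a (xi a) - partial f a u).
    rewrite opprD addrA H4 -sumrB; apply: eq_bigr => a _.
    by rewrite !mxE addrK mulrBr.
  rewrite E.
  apply: le_trans (_ : n%:R * (`|h| * (e / n%:R)) <= _); last first.
    by rewrite mulrCA [n%:R * _]mulrC divfK ?gt_eqF// mulrC.
  apply: norm_sum_le => a; rewrite normrM; apply: ler_pM => //; first exact: coord_norm.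
  by apply: H2; apply: le_lt_trans (H3 a).1 _; rewrite addrK.
have dE : 'd f u = L :> (_ -> _).
  apply: diff_unique => //; apply/eqaddoP => e e0; exact: key.
split; last by move=> h; rewrite dE.
by apply/diff_locallyP; rewrite dE; split=> //; apply/eqaddoP => e e0; exact: key.
Unshelve. all: by end_near. Qed.

Lemma is_derive_shift_arg (V W : normedModType R) (f : V -> W) (x c v : V) :
  derivable f (x + c) v ->
  is_derive x v (fun y => f (y + c)) ('D_v f (x + c)).
Proof.
move=> df.
have E : (fun h : R => h^-1 *: (((fun y => f (y + c)) \o shift x) (h *: v) - f (x + c)))
   = (fun h => h^-1 *: ((f \o shift (x + c)) (h *: v) - f (x + c))).
  by apply/funext => h /=; rewrite addrA.
by split; rewrite /derivable /derive E.
Qed.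

(** The mean value theorem is applied to the increment [F] in the direction [a], then to
    [partial f a] in the direction [b]. The left-hand side is symmetric in [a] and [b], which is the
    source of [schwarz_partial]. *)
Let second_difference U f u a b (h r : R) : smooth_on U f -> (forall v, `|v - u| <= r -> U v) ->
  0 <= h -> h + h <= r ->
  exists v, `|v - u| <= h + h /\
    f (u + h *: delta_mx 0 a + h *: delta_mx 0 b) - f (u + h *: delta_mx 0 a)
      - (f (u + h *: delta_mx 0 b) - f u) = h * (h * partial (partial f a) b v).
Proof.
move=> sf HU h0 hr.
have nd s (i : 'I_n) : `|s| <= h -> `|s *: delta_mx 0 i : 'rV[R]_n| <= h.
  by move=> sh; rewrite normrZ -[h]mulr1; apply: ler_pM => //; exact: norm_delta.
have nd2 s t : `|s| <= h -> `|t| <= h ->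
   `|u + s *: delta_mx 0 a + t *: delta_mx 0 b - u| <= h + h.
  move=> sh th; rewrite addrC !addrA addNr add0r.
  by apply: le_trans (ler_normD _ _) _; apply: lerD; exact: nd.
have h00 : `|0 : R| <= h by rewrite normr0.
have U2 s t : `|s| <= h -> `|t| <= h -> U (u + s *: delta_mx 0 a + t *: delta_mx 0 b).
  by move=> sh th; apply: HU; apply: le_trans (nd2 _ _ sh th) hr.
have d0 s t : `|s| <= h -> `|t| <= h ->
  derivable f (u + s *: delta_mx 0 a + t *: delta_mx 0 b) (delta_mx 0 a).
  by move=> sh th; apply: (sf [::] _ (U2 s t sh th)).2.
pose F v := f (v + h *: delta_mx 0 b) - f v.
have hh : `|h| <= h by rewrite ger0_norm.
have dF s : `|s| <= h -> is_derive (u + s *: delta_mx 0 a) (delta_mx 0 a) F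
   (partial f a (u + s *: delta_mx 0 a + h *: delta_mx 0 b) - partial f a (u + s *: delta_mx 0 a)).
  move=> sh; apply: is_deriveB; first by apply: is_derive_shift_arg; exact: d0.
  by apply: derivableP; have := d0 s 0 sh h00; rewrite scale0r addr0.
have [s|s [sh _]] := @MVT_dir _ _ F u (delta_mx 0 a) h.
  by rewrite [`|h|]ger0_norm// => sh _; case: (dF s sh).
rewrite [`|h|]ger0_norm// in sh.
rewrite (@derive_val _ _ _ _ _ _ _ (dF s sh)).
have [t|t [th _]] := @MVT_dir _ _ (partial f a) (u + s *: delta_mx 0 a) (delta_mx 0 b) h.
  by rewrite [`|h|]ger0_norm// => th _; apply: (sf [:: a] _ (U2 s t sh th)).2.
rewrite [`|h|]ger0_norm// in th.
move=> -> E; exists (u + s *: delta_mx 0 a + t *: delta_mx 0 b); split; first exact: nd2.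
by rewrite -E.
Qed.

Let sub4 (p q r s : R) : p - q - (r - s) = p - r - (q - s).
Proof. by ring. Qed.

Let tri (p q r e : R) : `|p - q| < e / 2 -> `|p - r| < e / 2 -> `|q - r| <= e.
Proof.
rewrite distrC => h1 h2; apply: le_trans (ler_distD p _ _) _.
by rewrite (splitr e); apply: ltW; exact: ltrD.
Qed.

(** Both orders of differentiation are compared with the same second difference, over a square so
    small that continuity makes either error less than [e / 2]. *)
Lemma schwarz_partial U f u a b : open U -> U u -> smooth_on U f ->
  partial (partial f a) b u = partial (partial f b) a u.
Proof.
move=> oU Uu sf; apply/eqP; rewrite -subr_eq0 -normr_le0; apply/ler_addgt0Pr => e e0.
rewrite add0r.
have [r r0 HU] := open_ball_sub oU Uu.
have e2 : 0 < e / 2 by rewrite divr_gt0.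
have /continuousN/(_ _ e2)[d1 d10 H1] := (sf [:: a; b] u Uu).1.
have /continuousN/(_ _ e2)[d2 d20 H2] := (sf [:: b; a] u Uu).1.
have m0 : 0 < Num.min r (Num.min d1 d2) by rewrite !lt_min r0 d10.
have [h h0] : exists2 h : R, 0 < h & h + h < Num.min r (Num.min d1 d2).
  by exists (Num.min r (Num.min d1 d2) / 3); lra.
rewrite !lt_min => /and3P[hr hd1 hd2].
have [v [v1 E1]] := second_difference a b sf HU (ltW h0) (ltW hr).
have [w [w1 E2]] := second_difference b a sf HU (ltW h0) (ltW hr).
have hn0 : h != 0 by rewrite lt0r_neq0.
have E : partial (partial f a) b v = partial (partial f b) a w.
  have : h * (h * partial (partial f a) b v) = h * (h * partial (partial f b) a w).
    by apply: (etrans (esym E1)); apply: (etrans _ E2); rewrite sub4 (addrAC u).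
  by move=> /(mulfI hn0)/(mulfI hn0).
have H3 : `|partial (partial f a) b v - partial (partial f a) b u| < e / 2.
  exact: H1 v (le_lt_trans v1 hd1).
have H4 : `|partial (partial f b) a w - partial (partial f b) a u| < e / 2.
  exact: H2 w (le_lt_trans w1 hd2).
by rewrite E in H3; exact: tri H3 H4.
Qed.

End SmoothFunctions.

Section ChainRule.
Context {R : realType} {n : nat}.

Lemma is_derive_comp_smooth (U : set 'rV[R]_n) f (u : R -> 'rV[R]_n) (t : R) du :
  open U -> smooth_on U f -> U (u t) -> (forall a, is_derive t 1 (fun s => u s 0 a) (du a)) ->
  is_derive t 1 (fun s => f (u s)) (\sum_(a < n) du a * partial f a (u t)).
Proof.
move=> oU sf Uut Hu.
have du1 : derivable u t 1 by apply/derivable_mxP => i j; rewrite (ord1 i); case: (Hu j).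
have [df dE] := smooth_differentiable oU Uut sf.
have du2 : differentiable u t by apply/derivable1_diffP.
have dfu : differentiable (f \o u) t by exact: differentiable_comp.
split; first by apply/derivable1_diffP.
rewrite -/(f \o u) deriveE// diff_comp//= dE; apply: eq_bigr => a _.
by rewrite -deriveE// derive_mx// mxE (@derive_val _ _ _ _ _ _ _ (Hu a)).
Qed.

Lemma smooth_map_jacobian (m : nat) (U : set 'rV[R]_n) (F : 'rV[R]_n -> 'rV[R]_m) u :
  open U -> U u -> (forall k, smooth_on U (fun v => F v 0 k)) ->
  differentiable F u /\ forall a k, 'J F u a k = partial (fun v => F v 0 k) a u.
Proof.
move=> oU Uu sF.
have dF : differentiable F u.
  have -> : F = \sum_(k < m) (fun v => F v 0 k *: delta_mx 0 k).
    apply/funext => v; rewrite fct_sumE; exact: rV_sum_delta.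
  apply: differentiable_sum => k; apply: differentiableZl.
  exact: (smooth_differentiable oU Uu (sF k)).1.
split=> // a k.
have := deriveEjacobian (delta_mx 0 a) dF; rewrite derive_mx; last exact: diff_derivable.
by move=> /rowP/(_ k); rewrite -rowE !mxE.
Qed.

End ChainRule.

(** * Ordinary differential equations *)

Section LocalODE.
Context {R : realType}.

(** Integration starts at -1, so that 0 and all [t] with [|t| < 1] are interior points with a
    two-sided derivative; subtracting the value at 0 normalises the primitive. *)
Lemma primitive_exists (G : R -> R) : continuous G ->
  exists P : R -> R, P 0 = 0 /\ forall t : R, `|t| < 1 -> is_derive t 1 P (G t).
Proof.
move=> cG.
pose F x := \int[lebesgue_measure]_(t in [set` Interval (BLeft (-1 : R)) (BRight x)]) G t.
have HF (t : R) : `|t| < 1 -> is_derive t 1 (F : R -> R) (G t).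
  rewrite ltr_norml => /andP[t1 t2].
  have [||||dF FE] := @continuous_FTC1 R G (BLeft (-1)) t 2.
  - lra.
  - apply: continuous_compact_integrable; first exact: segment_compact.
    exact: continuous_subspaceT.
  - first [exact: (ltW t1)|exact: t1|by rewrite /Order.lt /= t1].
  - exact: cG.
  move: dF FE; rewrite -/F => dF FE.
  by apply: DeriveDef; [exact: dF|rewrite -FE derive1E].
exists (fun x => F x - F 0); split; first by rewrite subrr.
by move=> t t1; rewrite -[G t]subr0; apply: is_deriveB; exact: HF.
Qed.

(** The retraction of the line onto [[-r, r]]. Being 1-Lipschitz, it turns functions and vector
    fields that are controlled only near a point into globally controlled ones. *)
Definition clamp (r x : R) := Num.max (- r) (Num.min x r).

Lemma clamp_bound r x : 0 <= r -> `|clamp r x| <= r.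
Proof.
move=> r0; rewrite ler_norml /clamp le_max lexx /= ge_max ge_min lexx orbT andbT.
by lra.
Qed.

Lemma clamp_id r x : `|x| <= r -> clamp r x = x.
Proof.
by rewrite ler_norml /clamp => /andP[h1 h2]; rewrite (min_idPl h2); apply/max_idPr.
Qed.

Lemma clamp_lip r x y : 0 <= r -> `|clamp r x - clamp r y| <= `|x - y|.
Proof.
move=> r0; rewrite /clamp /Num.max /Num.min.
have := ler_norm (x - y); have := ler_norm (y - x); rewrite (distrC y) => ? ?.
by rewrite ler_norml; case: (ltP x r) => ?; case: (ltP y r) => ?; case: ltP => ?; case: ltP => ?;
  apply/andP; split; lra.
Qed.

Lemma clamp_continuous r : 0 <= r -> continuous (clamp r).
Proof.
move=> r0 x; apply/continuousN => e e0; exists e => // u ux.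
exact: le_lt_trans (clamp_lip _ _ r0) ux.
Qed.

Lemma geometric_le0 (x C : R) : (forall k, x <= C * 2^-1 ^+ k) -> x <= 0.
Proof.
move=> H; rewrite leNgt; apply/negP => x0.
have C0 : 0 < C by have := lt_le_trans x0 (H 0%N); rewrite expr0 mulr1.
have [k hk] : exists k : nat, C / x < k%:R.
  by exists (Num.Def.archi_bound (C / x)); apply: archi_boundP; rewrite divr_ge0 ?ltW.
have := H k; rewrite exprVn leNgt => /negP; apply.
rewrite ltr_pdivrMr ?exprn_gt0//; move: hk; rewrite ltr_pdivrMr// => hk.
apply: lt_trans hk _; rewrite mulrC ltr_pM2l//.
by rewrite -natrX ltr_nat ltn_expl.
Qed.

Lemma row_continuousP n (z : R -> 'rV[R]_n) t :
  {for t, continuous z} <-> forall i, {for t, continuous (fun s => z s 0 i)}.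
Proof.
split=> [/continuousN H i|H].
  apply/continuousN => e e0; have [d d0 Hd] := H e e0; exists d => // u ut.
  by apply: le_lt_trans (Hd u ut); have := coord_norm (z u - z t) i; rewrite !mxE.
apply/continuousN => e e0; have e2 : 0 < e / 2 by rewrite divr_gt0.
have [|i|d d0 Hd] := @finI_uniform _ _ (fun i r => forall u, `|u - t| < r -> `|z u 0 i - z t 0 i| < e / 2).
- by move=> i r r' _ rr Hi u ut; apply: Hi; exact: lt_le_trans rr.
- by have /continuousN/(_ _ e2)[d d0 Hd] := H i; exists d.
exists d => // u ut; apply: (@le_lt_trans _ _ (e / 2)); last by lra.
by apply/rV_normP; [rewrite ltW|move=> i; rewrite !mxE ltW ?Hd].
Qed.

Section Picard.
Variables (N : nat) (F : 'rV[R]_N -> 'rV[R]_N) (K h : R) (z0 : 'rV[R]_N).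
Hypothesis FK : forall z w, `|F z - F w| <= K * `|z - w|.
Hypotheses (K0 : 0 < K) (h0 : 0 < h) (hK : K * h <= 2^-1) (h1 : h + h < 1).

(** Picard's operator as a relation, because the primitive is known only to exist. Continuity is
    global while the derivative is prescribed on [[-h, h]] only; precomposing the primitive with a
    clamp at radius [h + h] achieves both. *)
Let picard_rel (z y : R -> 'rV[R]_N) :=
  [/\ continuous y, y 0 = z0 & forall (t : R) i, `|t| <= h -> is_derive t 1 (fun s => y s 0 i) (F (z t) 0 i)].

Let F_continuous (z : R -> 'rV[R]_N) : continuous z -> continuous (fun t : R => F (z t)).
Proof.
move=> cz t; apply/continuousN => e e0.
have /continuousN/(_ (e / K) (divr_gt0 e0 K0))[d d0 Hd] := cz t.
exists d => // u ut; apply: le_lt_trans (FK _ _) _.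
by rewrite mulrC -ltr_pdivlMr// Hd.
Qed.

Let picard_step z : continuous z -> exists y, picard_rel z y.
Proof.
have h0_ := h0; have h1_ := h1.
move=> cz; have Fz i : continuous (fun t => F (z t) 0 i).
  move=> t; have H := F_continuous cz.
  have H2 := (row_continuousP (fun t : R => F (z t)) t).1 (H t).
  exact: H2.
have [P HP0] : exists P : 'I_N -> R -> R, forall i, P i 0 = 0 /\
    forall t : R, `|t| < 1 -> is_derive t 1 (P i) (F (z t) 0 i).
  by exists (fun i => sval (cid (primitive_exists (Fz i)))) => i; exact: (svalP (cid (primitive_exists (Fz i)))).
have P0 i := (HP0 i).1; have HP i := (HP0 i).2.
have hh : 0 <= h + h by lra.
exists (fun t => \row_i (z0 0 i + P i (clamp (h + h) t))); split.
- move=> t; apply/row_continuousP => i.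
  rewrite (_ : (fun _ => _) = fun s => z0 0 i + P i (clamp (h + h) s)); last by apply/funext => s; rewrite mxE.
  apply: continuousD; first exact: cst_continuous.
  apply: (@continuous_comp _ _ _ (clamp (h + h)) (P i)); first exact: clamp_continuous.
  apply/differentiable_continuous/derivable1_diffP.
  by case: (HP i (clamp (h + h) t)) => //; apply: le_lt_trans (clamp_bound _ hh) _.
- by apply/rowP => i; rewrite mxE clamp_id ?normr0// P0 addr0.
move=> t i th.
apply: (@near_eq_is_derive _ _ _ (fun s => z0 0 i + P i s)).
  apply/nearN; exists h => // s st; rewrite mxE clamp_id//.
  rewrite -(subrK t s); apply: le_trans (ler_normD _ _) _; lra.
rewrite -[F _ _ _]add0r; apply: is_deriveD; apply: HP; lra.
Qed.

Let picard_contract z w y x D : picard_rel z y -> picard_rel w x ->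
  (forall t, `|t| <= h -> `|z t - w t| <= D) -> forall t, `|t| <= h -> `|y t - x t| <= D / 2.
Proof.
have h0_ := h0; have h1_ := h1.
move=> [cy y0 dy] [cx x0 dx] zw t th.
have D0 : 0 <= D by apply: le_trans (zw 0 _); rewrite ?normr0// ltW.
have KD : 0 <= K * D by rewrite mulr_ge0// ltW.
apply/rV_normP => [|i]; first by rewrite divr_ge0.
rewrite !mxE.
pose f s := y s 0 i - x s 0 i; pose df s := F (z s) 0 i - F (w s) 0 i.
have Hf (s : R) : `|s| <= h -> is_derive s 1 f (df s) by move=> sh; apply: is_deriveB; [exact: dy|exact: dx].
have Hdf s : `|s| <= h -> `|df s| <= K * D.
  move=> sh; have := coord_norm (F (z s) - F (w s)) i; rewrite !mxE => H.
  apply: le_trans H _; apply: le_trans (FK _ _) _.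
  by rewrite ler_pM2l// zw.
have f0 : f 0 = 0 by rewrite /f y0 x0 subrr.
have KDh : K * D * h <= D / 2.
  rewrite mulrAC [D / 2]mulrC; exact: ler_wpM2r.
move: th; rewrite ler_norml => /andP[t1 t2].
have [tp|tn] := leP 0 t.
  have := @MVT_bound _ f df 0 t (K * D) tp.
  rewrite f0 !subr0 => H; apply: le_trans (H _ _) _.
  - by move=> s /andP[s1 s2]; apply: Hf; rewrite ler_norml; lra.
  - by move=> s /andP[s1 s2]; apply: Hdf; rewrite ler_norml; lra.
  by apply: le_trans KDh; exact: ler_wpM2l.
have := @MVT_bound _ f df t 0 (K * D) (ltW tn).
rewrite f0 !sub0r normrN => H; apply: le_trans (H _ _) _.
- by move=> s /andP[s1 s2]; apply: Hf; rewrite ler_norml; lra.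
- by move=> s /andP[s1 s2]; apply: Hdf; rewrite ler_norml; lra.
by apply: le_trans KDh; apply: ler_wpM2l => //; lra.
Qed.

Let picard_next (z : {z : R -> 'rV[R]_N | continuous z}) : {z : R -> 'rV[R]_N | continuous z} :=
  let y := cid (picard_step (proj2_sig z)) in
  exist _ (sval y) (let: And3 c _ _ := proj2_sig y in c).

Let seqz k := iter k picard_next (exist _ (cst z0) (@cst_continuous _ _ z0)).
Let zz k := sval (seqz k).

Let zzS k : picard_rel (zz k) (zz k.+1).
Proof. by rewrite /zz /seqz iterS /picard_next /=; case: cid. Qed.

Let D := `|F z0| + 1.

Let zz_dist k t : `|t| <= h -> `|zz k.+1 t - zz k t| <= D * 2^-1 ^+ k.
Proof.
have h0_ := h0; have h1_ := h1.
elim: k t => [|k IH] t th.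
  rewrite expr0 mulr1; have [cy y0 dy] := zzS 0.
  apply/rV_normP => [|i]; first by rewrite addr_ge0.
  have Fb : `|F z0 0 i| <= D by apply: le_trans (coord_norm _ _) _; rewrite lerDl.
  have D0 : 0 <= D by rewrite addr_ge0.
  have h_1 : h <= 1 by move: h0 h1; lra.
  have Dh : D * h <= D by rewrite -[leRHS]mulr1 ler_wpM2l.
  move: th; rewrite !mxE ler_norml => /andP[t1 t2].
  have [tp|tn] := leP 0 t.
    have := @MVT_bound _ (fun s => zz 1 s 0 i) (fun s => F (zz 0 s) 0 i) 0 t D tp.
    rewrite y0 subr0 => H; apply: le_trans (H _ _) _ => //.
    - by move=> s /andP[s1 s2]; apply: dy; rewrite ler_norml; lra.
    by apply: le_trans Dh; apply: ler_wpM2l => //; rewrite addr_ge0.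
  have := @MVT_bound _ (fun s => zz 1 s 0 i) (fun s => F (zz 0 s) 0 i) t 0 D (ltW tn).
  rewrite y0 sub0r distrC => H; apply: le_trans (H _ _) _ => //.
  - by move=> s /andP[s1 s2]; apply: dy; rewrite ler_norml; lra.
  by apply: le_trans Dh; apply: ler_wpM2l => //; lra.
rewrite exprSr mulrA; apply: (picard_contract (zzS k.+1) (zzS k)) => //.
Qed.

Let zz_dist2 k m t : `|t| <= h -> `|zz (k + m) t - zz k t| <= D * 2 * 2^-1 ^+ k.
Proof.
have h0_ := h0; have h1_ := h1.
move=> th; suff : `|zz (k + m) t - zz k t| <= D * 2 * 2^-1 ^+ k - D * 2 * 2^-1 ^+ (k + m).
  move=> H; apply: le_trans H _; rewrite lerBlDr lerDl.
  by rewrite !mulr_ge0// ?addr_ge0// exprn_ge0.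
elim: m => [|m IH]; first by rewrite addn0 !subrr normr0.
rewrite addnS -(subrKA (zz (k + m) t)); apply: le_trans (ler_normD _ _) _.
have := zz_dist (k + m) th; rewrite exprS; move: IH; set p := 2^-1 ^+ _; set q := 2^-1 ^+ _.
set X := `|_|; set Y := `|_|; move: D => d; lra.
Qed.

Let zz_cvg t : `|t| <= h -> exists l, forall k, `|l - zz k t| <= D * 2 * 2^-1 ^+ k.
Proof.
have h0_ := h0; have h1_ := h1.
move=> th.
have D0 : 0 <= D by rewrite addr_ge0.
have [l Hl] : exists l : 'I_N -> R, forall i, (fun k => zz k t 0 i) @ \oo --> l i.
  suff H i : cvg ((fun k => zz k t 0 i) @ \oo).
    by exists (fun i => lim ((fun k => zz k t 0 i) @ \oo)) => i; exact: H.
  apply/cauchy_cvgP/cauchyP => e e0.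
  have [k hk] : exists k, D * 2 * 2^-1 ^+ k < e.
    apply: contrapT => H; have : e <= 0; last by rewrite leNgt e0.
    apply: (@geometric_le0 _ (D * 2)) => k; rewrite leNgt; apply/negP => hk; apply: H; by exists k.
  exists (zz k t 0 i); exists k => // m /= km; rewrite /ball /= distrC.
  apply: le_lt_trans hk; rewrite -(subnKC km).
  by apply: le_trans (zz_dist2 k (m - k) th); have := coord_norm (zz (k + (m - k)) t - zz k t) i; rewrite !mxE.
exists (\row_i l i) => k; apply/rV_normP => [|i]; first by rewrite !mulr_ge0// exprn_ge0.
rewrite !mxE.
have cv : (fun m => `|zz m t 0 i - zz k t 0 i|) @ \oo --> `|l i - zz k t 0 i|.
  by apply: cvg_norm; apply: cvgB => //; exact: cvg_cst.
apply: (cvgr_to_le cv); exists k => // m /= km; rewrite -(subnKC km).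
by apply: le_trans (zz_dist2 k (m - k) th); have := coord_norm (zz (k + (m - k)) t - zz k t) i; rewrite !mxE.
Qed.

(** The iterates contract by the factor 1/2, since [K * h <= 2^-1], and converge uniformly on
    [[-h, h]]. One further Picard step [y] applied to the limit [z] agrees with [z] on that
    interval, so [z] inherits the derivative of [y]. *)
Lemma picard : exists z : R -> 'rV[R]_N, [/\ continuous z, z 0 = z0 &
  forall (t : R) i, `|t| < h -> is_derive t 1 (fun s => z s 0 i) (F (z t) 0 i)].
Proof.
have h0_ := h0; have h1_ := h1.
have hh : 0 <= h by exact: ltW.
have cl t : `|clamp h t| <= h by exact: clamp_bound.
pose z t := sval (cid (zz_cvg (cl t))).
have zE t k : `|z t - zz k (clamp h t)| <= D * 2 * 2^-1 ^+ k.
  by rewrite /z; case: cid => l /=; exact.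
have zE' t k : `|t| <= h -> `|z t - zz k t| <= D * 2 * 2^-1 ^+ k.
  by move=> th; have := zE t k; rewrite clamp_id.
have cz : continuous z.
  move=> t; apply/continuousN => e e0; have e3 : 0 < e / 3 by lra.
  have [k hk] : exists k, D * 2 * 2^-1 ^+ k < e / 3.
    apply: contrapT => H; have : e / 3 <= 0; last by rewrite leNgt e3.
    apply: (@geometric_le0 _ (D * 2)) => k; rewrite leNgt; apply/negP => hk; apply: H; by exists k.
  have ck : continuous (fun s => zz k (clamp h s)).
    move=> s; apply: continuous_comp; [exact: clamp_continuous|exact: (proj2_sig (seqz k))].
  have /continuousN/(_ _ e3)[d d0 Hd] := ck t.
  exists d => // u /Hd ut.
  have := zE t k; have := zE u k => a1 a2; rewrite distrC in a2.
  rewrite -(subrKA (zz k (clamp h u))) -[X in _ + X](subrKA (zz k (clamp h t))).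
  apply: le_lt_trans (ler_normD _ _) _.
  have := ler_normD (zz k (clamp h u) - zz k (clamp h t)) (zz k (clamp h t) - z t); lra.
have [y yP] := picard_step cz.
have yz t : `|t| <= h -> y t = z t.
  move=> th; apply/eqP; rewrite -subr_eq0 -normr_le0.
  apply: (@geometric_le0 _ (D * 2)) => k.
  rewrite -(subrKA (zz k.+1 t)); apply: le_trans (ler_normD _ _) _.
  have := picard_contract yP (zzS k) (fun s sh => zE' s k sh) th.
  by have := zE' t k.+1 th; rewrite distrC exprS; set p := 2^-1 ^+ k; move: D => d; lra.
exists z; split=> //.
  by case: yP => _ <- _; rewrite yz// normr0.
move=> t i th; have [_ _ dy] := yP.
apply: near_eq_is_derive (dy t i (ltW th)).
apply/nearN; exists (h - `|t|); first by rewrite subr_gt0.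
move=> s st; rewrite yz//; rewrite -(subrK t s); apply: le_trans (ler_normD _ _) _; lra.
Qed.

End Picard.

(** Composition with the projection [rho] onto the cube of radius [r] makes [F] globally Lipschitz.
    By continuity the solution stays in the cube for a short time, and there [rho] is the identity.
    The two bounds in the minimum [h] yield [h + h < 1] and [K * h <= 2^-1]. *)
Lemma local_ode (N : nat) (F : 'rV[R]_N -> 'rV[R]_N) (z0 : 'rV[R]_N) (r K : R) : 0 < r -> 0 < K ->
  (forall z w, `|z - z0| <= r -> `|w - z0| <= r -> `|F z - F w| <= K * `|z - w|) ->
  exists h (z : R -> 'rV[R]_N), [/\ 0 < h, z 0 = z0 & forall t : R, `|t| < h -> `|z t - z0| <= r /\
    forall i, is_derive t 1 (fun s => z s 0 i) (F (z t) 0 i)].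
Proof.
move=> r0 K0 FK; have r0' := ltW r0.
pose rho (z : 'rV[R]_N) : 'rV[R]_N := \row_i (z0 0 i + clamp r (z 0 i - z0 0 i)).
have rho1 z : `|rho z - z0| <= r.
  by apply/rV_normP => // i; rewrite !mxE addrC addKr clamp_bound.
have rho2 z w : `|rho z - rho w| <= `|z - w|.
  apply/rV_normP => // i; rewrite !mxE opprD addrACA subrr add0r.
  apply: le_trans (clamp_lip _ _ r0') _; rewrite opprB addrA subrK.
  by have := coord_norm (z - w) i; rewrite !mxE.
have rho3 z : `|z - z0| <= r -> rho z = z.
  move=> zr; apply/rowP => i; rewrite !mxE clamp_id ?subrKC//.
  by have := (rV_normP _ r0').1 zr i; rewrite !mxE.
have FK' z w : `|F (rho z) - F (rho w)| <= K * `|z - w|.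
  by apply: le_trans (FK _ _ (rho1 z) (rho1 w)) _; apply: ler_wpM2l; [exact: ltW|exact: rho2].
pose h := Num.min 4^-1 ((2 * K)^-1).
have h0 : 0 < h.
  by rewrite lt_min; apply/andP; split; rewrite invr_gt0 ?mulr_gt0 ?ltr0n.
have h4 : h <= 4^-1 by rewrite ge_min lexx.
have hK : K * h <= 2^-1.
  have : h <= (2 * K)^-1 by rewrite ge_min lexx orbT.
  move=> H; apply: le_trans (ler_wpM2l (ltW K0) H) _.
  by rewrite invfM mulrCA divff ?gt_eqF// mulr1.
have [|z [cz zz0 dz]] := @picard N (F \o rho) K h z0 FK' K0 h0 hK; first lra.
have /continuousN/(_ r r0)[d d0 Hd] := cz 0.
exists (Num.min h d), z; split=> //; first by rewrite lt_min h0.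
move=> t; rewrite lt_min => /andP[th td].
have zt : `|z t - z0| <= r by rewrite -zz0 ltW// Hd// subr0.
by split=> // i; have := dz t i th; rewrite /= rho3.
Qed.

End LocalODE.

(** * Smooth functions of one variable *)

Section SmoothCurves.
Context {R : realType}.
Implicit Types (J : set R) (f g : R -> R).

(** The one-variable analogue of [ksmooth], stratified by order for the regularity bootstrap of
    solutions of the geodesic equation. *)
Fixpoint kcurve (k : nat) J f : Prop :=
  (forall t, J t -> {for t, continuous f}) /\
  if k is k'.+1 then (forall t, J t -> derivable f t 1) /\ kcurve k' J (derive1 f)
  else True.

Lemma kcurve_continuous k J f t : kcurve k J f -> J t -> {for t, continuous f}.
Proof. by case: k => [|k] [H _]; exact: H. Qed.

Lemma kcurveW k J f : kcurve k.+1 J f -> kcurve k J f.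
Proof.
elim: k f => [|k IH] f; first by case.
by move=> [H1 [H2 H3]]; split=> //; split=> //; exact: IH.
Qed.

Lemma eq_kcurve k J f g : open J -> (forall t, J t -> f t = g t) ->
  kcurve k J f -> kcurve k J g.
Proof.
move=> oJ; elim: k f g => [|k IH] f g fg [H1 H2].
  by split=> // t Jt; apply: near_eq_continuous (H1 t Jt); exact: open_near_eq Jt.
split=> [t Jt|]; first by apply: near_eq_continuous (H1 t Jt); exact: open_near_eq Jt.
have [H3 H4] := H2; split=> [t Jt|].
  by apply: near_eq_derivable (H3 t Jt); exact: open_near_eq Jt.
apply: IH H4 => t Jt; rewrite !derive1E; apply: near_eq_derive; exact: open_near_eq Jt.
Qed.

Lemma kcurveS k J f df : open J -> (forall t, J t -> is_derive t 1 f (df t)) ->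
  kcurve k J df -> kcurve k.+1 J f.
Proof.
move=> oJ H kd; split=> [t Jt|].
  by apply/differentiable_continuous/derivable1_diffP; case: (H t Jt).
split=> [t Jt|]; first by case: (H t Jt).
by apply: eq_kcurve kd => // t Jt; rewrite derive1E; case: (H t Jt).
Qed.

Lemma kcurve_is_derive k J f t : kcurve k.+1 J f -> J t -> is_derive t 1 f (derive1 f t).
Proof. by move=> [_ [H _]] Jt; rewrite derive1E; apply: derivableP; exact: H. Qed.

Lemma kcurve_cst k J (c : R) : open J -> kcurve k J (fun=> c).
Proof.
move=> oJ; elim: k c => [|k IH] c; first by split=> // t _; exact: cst_continuous.
by apply: (@kcurveS _ _ _ (fun=> 0)) => // t _; exact: is_derive_cst.
Qed.

Lemma kcurveD k J f g : open J -> kcurve k J f -> kcurve k J g -> kcurve k J (fun t => f t + g t).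
Proof.
move=> oJ; elim: k f g => [|k IH] f g sf sg.
  by split=> // t Jt; apply: continuousD; [exact: sf.1|exact: sg.1].
apply: (@kcurveS _ _ _ (fun t => derive1 f t + derive1 g t)) => //.
  by move=> t Jt; apply: is_deriveD; [exact: (kcurve_is_derive sf Jt)|exact: (kcurve_is_derive sg Jt)].
by apply: IH; [case: sf => _ []|case: sg => _ []].
Qed.

Lemma kcurveM k J f g : open J -> kcurve k J f -> kcurve k J g -> kcurve k J (fun t => f t * g t).
Proof.
move=> oJ; elim: k f g => [|k IH] f g sf sg.
  by split=> // t Jt; apply: continuousM; [exact: sf.1|exact: sg.1].
apply: (@kcurveS _ _ _ (fun t => f t * derive1 g t + g t * derive1 f t)) => //.
  by move=> t Jt; apply: is_deriveM; [exact: (kcurve_is_derive sf Jt)|exact: (kcurve_is_derive sg Jt)].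
apply: kcurveD => //; apply: IH.
- exact: kcurveW.
- by case: sg => _ [].
- exact: kcurveW.
- by case: sf => _ [].
Qed.

Lemma kcurve_sum k J (I : Type) (r : seq I) (F : I -> R -> R) : open J ->
  (forall i, kcurve k J (F i)) -> kcurve k J (fun t => \sum_(i <- r) F i t).
Proof.
move=> oJ sF; elim: r => [|i r IH].
  by apply: (eq_kcurve oJ) (kcurve_cst k 0 oJ) => t _; rewrite big_nil.
by apply: (eq_kcurve oJ) (kcurveD oJ (sF i) IH) => t _; rewrite big_cons.
Qed.

Lemma kcurve_comp n k J (U : set 'rV[R]_n) (f : 'rV[R]_n -> R) (u : R -> 'rV[R]_n) : open J -> open U ->
  (forall t, J t -> U (u t)) -> smooth_on U f ->
  (forall a, kcurve k J (fun t => u t 0 a)) -> kcurve k J (fun t => f (u t)).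
Proof.
move=> oJ oU JU; elim: k f => [|k IH] f sf ku.
  split=> // t Jt; apply: (@continuous_comp _ _ _ u f).
    by apply/row_continuousP => i; exact: (ku i).1.
  exact: (sf [::] _ (JU t Jt)).1.
apply: (@kcurveS _ _ _ (fun t => \sum_(a < n) derive1 (fun s => u s 0 a) t * partial f a (u t))) => //.
  move=> t Jt; apply: (is_derive_comp_smooth oU sf (JU t Jt)) => a.
  exact: (kcurve_is_derive (ku a) Jt).
apply: kcurve_sum => // a; apply: kcurveM => //; first by case: (ku a) => _ [].
apply: IH; first exact: smooth_on_partial.
by move=> b; exact: kcurveW.
Qed.

Lemma derive1n_coord n (u : R -> 'rV[R]_n) J m : open J ->
  (forall k a, kcurve k J (fun t => u t 0 a)) ->
  forall t, J t -> (forall a, derive1n m u t 0 a = derive1n m (fun s => u s 0 a) t) /\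
    derivable (derive1n m u) t 1.
Proof.
move=> oJ ku.
have kd k : forall f, kcurve (m + k) J f -> kcurve k J (derive1n m f).
  elim: {ku} m k => [|m IH] k f // H.
  rewrite derive1nS; have := IH k.+1 f; rewrite addnS -addSn => /(_ H).
  by case=> _ [].
have dd t a : J t -> derivable (derive1n m (fun s => u s 0 a)) t 1.
  by move=> Jt; have [_ [H _]] := kd 1%N _ (ku _ a); exact: H.
suff E t : J t -> forall a, derive1n m u t 0 a = derive1n m (fun s => u s 0 a) t.
  move=> t Jt; split; first exact: E.
  apply/derivable_mxP => i a; rewrite (ord1 i).
  apply: near_eq_derivable (dd t a Jt).
  by apply: (@open_near_eq _ _ _ J) => // s Js; rewrite E.
elim: {kd dd} m t => [|m IH] t Jt a //.
have kd k : forall f, kcurve (m + k) J f -> kcurve k J (derive1n m f).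
  elim: {IH} m k => [|m IH] k f // H.
  rewrite derive1nS; have := IH k.+1 f; rewrite addnS -addSn => /(_ H).
  by case=> _ [].
have nE b : \forall s \near t, derive1n m (fun s => u s 0 b) s = derive1n m u s 0 b.
  by apply: (@open_near_eq _ _ _ J) => // s Js; rewrite IH.
rewrite !derive1nS !derive1E derive_mx.
  rewrite mxE; apply: near_eq_derive; near=> s; symmetry; near: s; exact: nE.
apply/derivable_mxP => i b; rewrite (ord1 i); apply: near_eq_derivable (nE b) _.
by have [_ [H _]] := kd 1%N _ (ku _ b); exact: H.
Unshelve. all: by end_near. Qed.

End SmoothCurves.

(** * Geodesics as solutions of the Euler-Lagrange equations *)

Section EulerLagrange.
Context {R : realType} {n : nat}.
Implicit Types (g : 'rV[R]_n -> 'M[R]_n) (u v x y : 'rV[R]_n).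

Lemma is_derive_sumf (k : nat) (F : 'I_k -> R -> R) (dF : 'I_k -> R) (t : R) :
  (forall i, is_derive t 1 (F i) (dF i)) ->
  is_derive t 1 (fun s => \sum_(i < k) F i s) (\sum_(i < k) dF i).
Proof.
move=> H; have -> : (fun s => \sum_(i < k) F i s) = \sum_(i < k) F i.
  by apply/funext => s; rewrite fct_sumE.
exact: is_derive_sum.
Qed.

Lemma is_derive_ext (f : R -> R) (t a b : R) : is_derive t 1 f a -> a = b -> is_derive t 1 f b.
Proof. by move=> + <-. Qed.

Lemma is_derive_unique (f : R -> R) (t a b : R) : is_derive t 1 f a -> is_derive t 1 f b -> a = b.
Proof. by move=> [_ <-] [_ <-]. Qed.

Lemma is_deriveM_ (f g : R -> R) (t a b : R) : is_derive t 1 f a -> is_derive t 1 g b ->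
  is_derive t 1 (fun s => f s * g s) (a * g t + f t * b).
Proof.
move=> df dg; apply: is_derive_ext (is_deriveM df dg) _.
by rewrite addrC [g t *: a]mulrC.
Qed.

Lemma is_derive_affine (c k t : R) : is_derive t 1 (fun s => c + s * k) k.
Proof.
have D1 : is_derive t 1 (fun=> c) 0 by exact: is_derive_cst.
have D2 : is_derive t 1 (fun=> k) 0 by exact: is_derive_cst.
have D3 : is_derive t 1 (fun s : R => s) 1 by exact: is_derive_id.
apply: is_derive_ext (is_deriveD D1 (is_deriveM_ D3 D2)) _.
by rewrite mul1r mulr0 addr0 add0r.
Qed.

Lemma is_derive_mull (f : R -> R) (t a k : R) : is_derive t 1 f a -> is_derive t 1 (fun s => k * f s) (k * a).
Proof.
move=> df; have D : is_derive t 1 (fun=> k) 0 by exact: is_derive_cst.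
by apply: is_derive_ext (is_deriveM_ D df) _; rewrite mul0r add0r.
Qed.

Lemma is_derive_mulr (f : R -> R) (t a k : R) : is_derive t 1 f a -> is_derive t 1 (fun s => f s * k) (a * k).
Proof.
move=> df; have D : is_derive t 1 (fun=> k) 0 by exact: is_derive_cst.
by apply: is_derive_ext (is_deriveM_ df D) _; rewrite mulr0 addr0.
Qed.

Definition quad_form g u v (w : 'rV[R]_n) : R := \sum_(a < n) \sum_(b < n) g u a b * v 0 a * w 0 b.

Lemma quad_formE g u v w : quad_form g u v w = (v *m g u *m w^T) 0 0.
Proof.
rewrite mxE /quad_form exchange_big /=; apply: eq_bigr => b _.
by rewrite !mxE mulr_suml; apply: eq_bigr => a _; rewrite [_ * v 0 a]mulrC.
Qed.

(** With [momentum], the derivatives of the kinetic energy, half of [quad_form g u v v], in position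
    and in velocity. The Euler-Lagrange form of the geodesic equation passes through a change of
    chart without a transformation law for Christoffel symbols. *)
Definition energy_grad g u v (a : 'I_n) : R :=
  2^-1 * \sum_(b < n) \sum_(c < n) partial (fun y => g y b c) a u * v 0 b * v 0 c.

Definition momentum g u v (a : 'I_n) : R := \sum_(b < n) g u a b * v 0 b.

Definition euler_lagrange g (u v : R -> 'rV[R]_n) (t : R) : Prop :=
  forall a, is_derive t 1 (fun s => momentum g (u s) (v s) a) (energy_grad g (u t) (v t) a).

Section ChangeOfChart.
Variables (U V : set 'rV[R]_n) (sigma : 'rV[R]_n -> 'rV[R]_n) (g g' : 'rV[R]_n -> 'M[R]_n).
Let Jac x : 'M[R]_n := \matrix_(a, c) partial (fun y => sigma y 0 c) a x.
Hypotheses (oU : open U) (oV : open V) (UV : forall x, U x -> V (sigma x)).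
Hypothesis smooth_sigma : forall c, smooth_on U (fun y => sigma y 0 c).
Hypothesis smooth_g : forall a b, smooth_on V (fun y => g y a b).
Hypothesis smooth_g' : forall a b, smooth_on U (fun y => g' y a b).
Hypothesis sym_g : forall y, V y -> (g y)^T = g y.
Hypothesis pullback : forall x, U x -> g' x = Jac x *m g (sigma x) *m (Jac x)^T.

(** The quadratic form of [g'] on the fixed vector [v] is differentiated along the line [l] in the
    direction [c] in two ways: directly, and through the pullback formula, where both the metric at
    [sigma] and the Jacobian vary. The symmetry of [g] merges the two Jacobian terms. *)
Let energy_grad_pullback x v (c : 'I_n) : U x ->
  energy_grad g' x v c = \sum_(a < n) Jac x c a * energy_grad g (sigma x) (v *m Jac x) a
   + \sum_(a < n) (\sum_(d < n) v 0 d * partial (partial (fun y => sigma y 0 a) d) c x)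
        * momentum g (sigma x) (v *m Jac x) a.
Proof.
move=> Ux.
pose l (s : R) : 'rV[R]_n := x + s *: delta_mx 0 c.
have l0 : l 0 = x by rewrite /l scale0r addr0.
have dl a : is_derive (0:R) 1 (fun s => l s 0 a) ((a == c)%:R).
  rewrite (_ : (fun s => l s 0 a) = (fun s : R => x 0 a + s * (a == c)%:R)); last first.
    by apply/funext => s; rewrite !mxE eqxx.
  exact: is_derive_affine.
have Ul : U (l 0) by rewrite l0.
have dpart (W : set 'rV[R]_n) (f : 'rV[R]_n -> R) : open W -> smooth_on W f -> W x ->
    is_derive (0:R) 1 (fun s => f (l s)) (partial f c x).
  move=> oW sf Wx; apply: is_derive_ext (is_derive_comp_smooth oW sf _ dl) _; first by rewrite l0.
  by rewrite l0 (bigD1 c)//= eqxx mul1r big1 ?addr0// => a /negbTE ->; rewrite mul0r.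
pose Vv a s := \sum_(d < n) v 0 d * partial (fun y => sigma y 0 a) d (l s).
pose dVv a := \sum_(d < n) v 0 d * partial (partial (fun y => sigma y 0 a) d) c x.
have dV a : is_derive (0:R) 1 (Vv a) (dVv a).
  apply: is_derive_sumf => d.
  exact: is_derive_mull (dpart U _ oU (smooth_on_partial d (smooth_sigma a)) Ux).
pose G a b s := g (sigma (l s)) a b.
pose dG a b := \sum_(e < n) Jac x c e * partial (fun y => g y a b) e (sigma x).
have ds e : is_derive (0:R) 1 (fun s => sigma (l s) 0 e) (Jac x c e).
  by rewrite mxE; exact: (dpart U (fun y => sigma y 0 e) oU (smooth_sigma e) Ux).
have dGp a b : is_derive (0:R) 1 (G a b) (dG a b).
  have := @is_derive_comp_smooth R n V (fun y => g y a b) (fun s => sigma (l s)) 0 (fun e => Jac x c e) oV (smooth_g a b).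
  by rewrite l0; apply => //; exact: UV.
have nearU : \forall s \near (0:R), U (l s).
  have cl : {for (0:R), continuous l}.
    by apply/row_continuousP => a; apply/differentiable_continuous/derivable1_diffP; case: (dl a).
  apply: (cl U); exact: open_nbhs_nbhs.
have VE s a : Vv a s = (v *m Jac (l s)) 0 a.
  by rewrite mxE; apply: eq_bigr => d _; rewrite mxE.
have E1 : is_derive (0:R) 1 (fun s => quad_form g' (l s) v v)
   (\sum_(a < n) \sum_(b < n) partial (fun y => g' y a b) c x * v 0 a * v 0 b).
  apply: is_derive_sumf => a; apply: is_derive_sumf => b.
  by do 2 apply: is_derive_mulr; exact: (dpart U _ oU (smooth_g' a b) Ux).
have E2 : is_derive (0:R) 1 (fun s => quad_form g' (l s) v v)
   (\sum_(a < n) \sum_(b < n) ((dG a b * Vv a 0 + G a b 0 * dVv a) * Vv b 0 + G a b 0 * Vv a 0 * dVv b)).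
  apply: (@near_eq_is_derive _ _ _ (fun s => \sum_(a < n) \sum_(b < n) G a b s * Vv a s * Vv b s)).
    near=> s; have Us : U (l s) by near: s.
    rewrite quad_formE (pullback Us) !mulmxA -mulmxA -trmx_mul -quad_formE.
    by apply: eq_bigr => a _; apply: eq_bigr => b _; rewrite !VE.
  apply: is_derive_sumf => a; apply: is_derive_sumf => b.
  exact: (is_deriveM_ (is_deriveM_ (dGp a b) (dV a)) (dV b)).
have := is_derive_unique E1 E2; rewrite /energy_grad => ->.
have V0 a : Vv a 0 = (v *m Jac x) 0 a by rewrite VE l0.
have gs a b : G a b 0 = G b a 0.
  by rewrite /G l0; have /matrixP/(_ b a) := sym_g (UV Ux); rewrite mxE.
have G0 a b : G a b 0 = g (sigma x) a b by rewrite /G l0.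
set w := v *m Jac x.
transitivity (2^-1 * (\sum_(a < n) \sum_(b < n) dG a b * w 0 a * w 0 b) +
   2^-1 * (2 * \sum_(a < n) dVv a * momentum g (sigma x) w a)).
  rewrite -mulrDr; congr (_ * _).
  have S : \sum_(a < n) dVv a * momentum g (sigma x) w a = \sum_(a < n) \sum_(b < n) dVv a * (G a b 0 * w 0 b).
    by apply: eq_bigr => a _; rewrite mulr_sumr; apply: eq_bigr => b _; rewrite G0.
  rewrite mulr_natl mulr2n {1}S S [X in _ + (_ + X)]exchange_big /= -!big_split /=.
  apply: eq_bigr => a _; rewrite -!big_split /=; apply: eq_bigr => b _.
  rewrite !V0 -/w (gs b a).
  move: (dG a b) (w 0 a) (w 0 b) (G a b 0) (dVv a) (dVv b) => p1 p2 p3 p4 p5 p6; ring.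
congr (_ + _); last by rewrite mulrA mulVf ?mul1r.
rewrite /dG.
under [RHS]eq_bigr do rewrite mulrCA.
rewrite -mulr_sumr; congr (_ * _).
under [RHS]eq_bigr do rewrite mulr_sumr.
rewrite [RHS]exchange_big /=; apply: eq_bigr => a _.
under [RHS]eq_bigr do rewrite mulr_sumr.
rewrite [RHS]exchange_big /=; apply: eq_bigr => b _.
by rewrite !mulr_suml; apply: eq_bigr => e _; rewrite !mulrA.
Unshelve. all: by end_near. Qed.

(* Symmetry of the second derivatives of [sigma] identifies the derivative of
   the Jacobian along the curve with the second term of [energy_grad_pullback]. *)
Lemma euler_lagrange_pullback (x v : R -> 'rV[R]_n) (t : R) :
  (\forall s \near t, U (x s)) ->
  (forall a, is_derive t 1 (fun s => x s 0 a) (v t 0 a)) ->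
  euler_lagrange g (fun s => sigma (x s)) (fun s => v s *m Jac (x s)) t ->
  euler_lagrange g' x v t.
Proof.
move=> nU dx EL c; have Ux : U (x t) by exact: nbhs_singleton nU.
rewrite energy_grad_pullback//.
apply: (@near_eq_is_derive _ _ _ (fun s => \sum_(a < n) Jac (x s) c a * momentum g (sigma (x s)) (v s *m Jac (x s)) a)).
  near=> s; have Us : U (x s) by near: s.
  have mE (g0 : 'rV[R]_n -> 'M[R]_n) y w a : momentum g0 y w a = (g0 y *m w^T) a 0.
    by rewrite mxE; apply: eq_bigr => b _; rewrite mxE.
  rewrite [RHS]mE (pullback Us) -!mulmxA -trmx_mul mxE.
  by apply: eq_bigr => a _; rewrite mE.
have dJ a : is_derive t 1 (fun s => Jac (x s) c a)
    (\sum_(d < n) v t 0 d * partial (partial (fun y => sigma y 0 a) d) c (x t)).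
  rewrite (_ : (fun s => Jac (x s) c a) = fun s => partial (fun y => sigma y 0 a) c (x s)); last first.
    by apply/funext => s; rewrite mxE.
  apply: is_derive_ext (is_derive_comp_smooth oU (smooth_on_partial c (smooth_sigma a)) Ux dx) _.
  by apply: eq_bigr => d _; rewrite (schwarz_partial _ _ oU Ux (smooth_sigma a)).
apply: is_derive_ext (is_derive_sumf (fun a => is_deriveM_ (dJ a) (EL a))) _.
by rewrite -big_split /=; apply: eq_bigr => a _; rewrite addrC.
Unshelve. all: by end_near. Qed.

End ChangeOfChart.

Section ChristoffelForm.
Variables (V : set 'rV[R]_n) (g : 'rV[R]_n -> 'M[R]_n) (oV : open V).
Hypothesis smooth_g : forall a b, smooth_on V (fun y => g y a b).

Definition christoffel_of g (k a b : 'I_n) (u : 'rV[R]_n) : R :=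
  2^-1 * \sum_(l < n) invmx (g u) k l *
    (partial (fun w => g w l b) a u + partial (fun w => g w l a) b u
     - partial (fun w => g w a b) l u).

Lemma momentum_derive (u v : R -> 'rV[R]_n) (w : 'rV[R]_n) (t : R) a : V (u t) ->
  (forall a, is_derive t 1 (fun s => u s 0 a) (v t 0 a)) ->
  (forall a, is_derive t 1 (fun s => v s 0 a) (w 0 a)) ->
  is_derive t 1 (fun s => momentum g (u s) (v s) a)
    (\sum_(b < n) \sum_(c < n) v t 0 c * partial (fun y => g y a b) c (u t) * v t 0 b +
     \sum_(b < n) g (u t) a b * w 0 b).
Proof.
move=> Vu du dv.
apply: is_derive_ext (is_derive_sumf (fun b => is_deriveM_ (is_derive_comp_smooth oV (smooth_g a b) Vu du) (dv b))) _.
by rewrite -big_split /=; apply: eq_bigr => b _; rewrite mulr_suml.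
Qed.

Lemma christoffel_momentum (u v w : 'rV[R]_n) : g u \in unitmx ->
  (forall k, w 0 k + \sum_(a < n) \sum_(b < n) christoffel_of g k a b u * v 0 a * v 0 b = 0) <->
  (forall a, \sum_(b < n) \sum_(c < n) v 0 c * partial (fun y => g y a b) c u * v 0 b +
     \sum_(b < n) g u a b * w 0 b = energy_grad g u v a).
Proof.
move=> gu.
pose S : 'cV[R]_n := \col_l (2 * \sum_(b < n) \sum_(c < n) v 0 c * partial (fun y => g y l b) c u * v 0 b
   - \sum_(b < n) \sum_(c < n) partial (fun y => g y b c) l u * v 0 b * v 0 c).
have SE l : \sum_(a < n) \sum_(b < n) (partial (fun w => g w l b) a u + partial (fun w => g w l a) b u
     - partial (fun w => g w a b) l u) * v 0 a * v 0 b = S l 0.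
  rewrite mxE mulr_natl mulr2n [X in _ = X + _ - _]exchange_big /= -!big_split -sumrB /=.
  apply: eq_bigr => a _; rewrite -big_split -sumrB /=; apply: eq_bigr => b _; ring.
have CE k : \sum_(a < n) \sum_(b < n) christoffel_of g k a b u * v 0 a * v 0 b = (2^-1 *: (invmx (g u) *m S)) k 0.
  rewrite !mxE /christoffel_of mulr_sumr.
  under [RHS]eq_bigr do rewrite -SE mulr_sumr mulr_sumr.
  rewrite [RHS]exchange_big /=; apply: eq_bigr => a _.
  under [RHS]eq_bigr do rewrite mulr_sumr mulr_sumr.
  rewrite [RHS]exchange_big /=; apply: eq_bigr => b _.
  by rewrite mulr_sumr !mulr_suml; apply: eq_bigr => l _; rewrite !mulrA.
have WE a : \sum_(b < n) g u a b * w 0 b = (g u *m w^T) a 0.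
  by rewrite mxE; apply: eq_bigr => b _; rewrite mxE.
have h1 : (forall k, w 0 k + \sum_(a < n) \sum_(b < n) christoffel_of g k a b u * v 0 a * v 0 b = 0) <->
    w^T = - (2^-1 *: (invmx (g u) *m S)).
  split=> [H|H k].
    by apply/colP => k; rewrite [LHS]mxE [RHS]mxE -CE; apply/eqP; rewrite -addr_eq0 H.
  by rewrite CE; have /colP/(_ k) := H; rewrite [LHS]mxE [RHS]mxE => ->; rewrite addNr.
have h2 : (forall a, \sum_(b < n) \sum_(c < n) v 0 c * partial (fun y => g y a b) c u * v 0 b +
     \sum_(b < n) g u a b * w 0 b = energy_grad g u v a) <-> g u *m w^T = - (2^-1 *: S).
  have key a : energy_grad g u v a - \sum_(b < n) \sum_(c < n) v 0 c * partial (fun y => g y a b) c u * v 0 b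
      = (- (2^-1 *: S)) a 0.
    rewrite /energy_grad !mxE; set X := \sum_b _; set Y := \sum_b _; lra.
  split=> [H|H a].
    by apply/colP => a; rewrite -key -WE -H addrC addKr.
  by rewrite WE H -key addrC subrK.
rewrite h1 h2; split=> [->|H].
  by rewrite mulmxN -scalemxAr mulKVmx.
by rewrite -[LHS](mulKmx gu) H mulmxN -scalemxAr.
Qed.

End ChristoffelForm.

End EulerLagrange.

(** * Charts, and solutions of the geodesic equation in one chart *)

Section ChartsAndGeodesics.
Context {R : realType} {n : nat} {M : smooth_manifold R n}.
Variable h : riemannian_metric M.
Implicit Types (i j : chart_index M) (p q : M) (u v w : 'rV[R]_n) (J : set R) (gam : R -> M).

Definition chart_image i : set 'rV[R]_n := chart i @` chart_dom i.
Definition overlap i j : set 'rV[R]_n := chart i @` (chart_dom i `&` chart_dom j).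

Lemma chart_image_chart i p : chart_dom i p -> chart_image i (chart i p).
Proof. by move=> dp; exists p. Qed.

Lemma chart_invP i u : chart_image i u ->
  chart_dom i (chart_inv i u) /\ chart i (chart_inv i u) = u.
Proof. by move=> [p dp <-]; rewrite chartK. Qed.

Lemma chart_continuous_at i p : chart_dom i p -> {for p, continuous (chart i)}.
Proof.
move=> dp; have := @chart_continuous _ _ M i.
by rewrite continuous_open_subspace; [apply; exact: mem_set|exact: chart_dom_open].
Qed.

Lemma chart_inv_continuous_at i u : chart_image i u -> {for u, continuous (chart_inv i)}.
Proof.
move=> iu; have := @chart_inv_continuous _ _ M i.
by rewrite continuous_open_subspace; [apply; exact: mem_set|exact: chart_image_open].
Qed.

Lemma overlapP i j u : overlap i j u <-> chart_image i u /\ chart_dom j (chart_inv i u).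
Proof.
split=> [[p [di dj] <-]|[iu dj]]; first by rewrite chartK//; split=> //; exists p.
have [di E] := chart_invP iu; by exists (chart_inv i u).
Qed.

Lemma open_overlap i j : open (overlap i j).
Proof.
rewrite openE => u /overlapP[iu dj]; rewrite /interior.
have := chart_inv_continuous_at iu (open_nbhs_nbhs (conj (@chart_dom_open _ _ M j) dj)).
rewrite nbhs_filterE /= => H.
have H2 : nbhs u (chart_image i) by apply: open_nbhs_nbhs; split=> //; exact: chart_image_open.
by apply: filterS2 H H2 => w /= dw iw; apply/overlapP.
Qed.

Lemma transition_mem i j u : overlap i j u ->
  overlap j i (transition i j u) /\ transition j i (transition i j u) = u.
Proof.
move=> /overlapP[iu dj]; have [di E] := chart_invP iu.
rewrite /transition chartK// E; split=> //; by exists (chart_inv i u).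
Qed.

Lemma near_chart_dom i gam t : {for t, continuous gam} -> chart_dom i (gam t) ->
  \forall s \near t, chart_dom i (gam s).
Proof.
by move=> cg di; apply: (cg (chart_dom i)); apply: open_nbhs_nbhs; split=> //; exact: chart_dom_open.
Qed.

Lemma metric_sym_at i u : chart_image i u -> (metric_mx h i u)^T = metric_mx h i u.
Proof. by move=> [p dp <-]; exact: (Defs.metric_sym h dp). Qed.

Lemma metric_unit i u : chart_image i u -> metric_mx h i u \in unitmx.
Proof.
move=> [p dp <-]; rewrite -row_free_unit -kermx_eq0; apply/rowV0P => v /sub_kermxP vg.
apply/eqP; apply: contraT => v0; have := metric_posdef h dp v0.
by rewrite vg mul0mx mxE ltxx.
Qed.

Lemma metric_smooth_at i a b : smooth_on (chart_image i) (fun u => metric_mx h i u a b).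
Proof. exact: metric_smooth. Qed.

Lemma transition_jacobian i j u : overlap i j u ->
  'J (transition i j) u = \matrix_(a, c) partial (fun y => transition i j y 0 c) a u.
Proof.
move=> ou; apply/matrixP => a c; rewrite [RHS]mxE.
exact: (smooth_map_jacobian (@open_overlap i j) ou (@transition_smooth _ _ M i j)).2.
Qed.

Lemma metric_pullback i j u : overlap i j u ->
  metric_mx h i u = (\matrix_(a, c) partial (fun y => transition i j y 0 c) a u)
    *m metric_mx h j (transition i j u)
    *m (\matrix_(a, c) partial (fun y => transition i j y 0 c) a u)^T.
Proof.
move=> ou; rewrite -transition_jacobian//; move: ou => [p [di dj] <-].
by rewrite (metric_transition h di dj) /transition chartK.
Qed.

Lemma christoffel_smooth i k a b : smooth_on (chart_image i) (christoffel h i k a b).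
Proof.
have oU := @chart_image_open _ _ M i; have sg := @metric_smooth_at i.
apply: (smoothM oU (smooth_cst _ oU)); apply: smooth_sum => // l.
apply: (smoothM oU).
  by apply: smooth_invmx => // u; exact: metric_unit.
apply: (smoothB oU); last exact: smooth_on_partial (sg _ _).
by apply: (smoothD oU); exact: smooth_on_partial (sg _ _).
Qed.

Definition acceleration i u v : 'rV[R]_n :=
  \row_k - \sum_(a < n) \sum_(b < n) christoffel h i k a b u * v 0 a * v 0 b.

Lemma euler_lagrangeP i (u v : R -> 'rV[R]_n) w (t : R) : chart_image i (u t) ->
  (forall a, is_derive t 1 (fun s => u s 0 a) (v t 0 a)) ->
  (forall a, is_derive t 1 (fun s => v s 0 a) (w 0 a)) ->
  euler_lagrange (metric_mx h i) u v t <->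
  (forall k, w 0 k + \sum_(a < n) \sum_(b < n) christoffel h i k a b (u t) * v t 0 a * v t 0 b = 0).
Proof.
move=> iu du dv.
have md a := momentum_derive (@chart_image_open _ _ M i) (@metric_smooth_at i) a iu du dv.
have := christoffel_momentum (v t) w (metric_unit iu).
rewrite /christoffel => ->; split=> [EL a|H a]; first exact: is_derive_unique (md a) (EL a).
by rewrite -H; exact: md.
Qed.

Lemma geodesic_ode J gam t i : geodesic h J gam -> J t -> chart_dom i (gam t) ->
  (forall a, is_derive t 1 (fun s => chart i (gam s) 0 a) (derive1 (chart i \o gam) t 0 a)) /\
  (forall a, is_derive t 1 (fun s => derive1 (chart i \o gam) s 0 a)
     (acceleration i (chart i (gam t)) (derive1 (chart i \o gam) t) 0 a)).
Proof.
move=> [_ [sg eq]] Jt di; have [_ /(_ i di) sm] := sg t Jt.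
have D0 := sm 0%N; have D1 := sm 1%N; rewrite /= in D0 D1.
split=> a.
  have Da := (derivable_mxP _ _ _).1 D0 0 a.
  split; first exact: Da.
  by rewrite derive1E (derive_mx D0) mxE.
have Da := (derivable_mxP _ _ _).1 D1 0 a.
split; first exact: Da.
have := eq t i Jt di a; rewrite /= derive1E (derive_mx D1) mxE => /eqP; rewrite addr_eq0 => /eqP E.
by rewrite [RHS]mxE -E.
Qed.

Lemma eq_euler_lagrange (g : 'rV[R]_n -> 'M[R]_n) (u v u' v' : R -> 'rV[R]_n) (t : R) :
  (\forall s \near t, u s = u' s) -> (\forall s \near t, v s = v' s) ->
  euler_lagrange g u v t -> euler_lagrange g u' v' t.
Proof.
move=> nu nv EL a; rewrite -(nbhs_singleton nu) -(nbhs_singleton nv).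
apply: near_eq_is_derive (EL a); near=> s.
by rewrite (_ : u s = u' s) 1?(_ : v s = v' s)//; near: s.
Unshelve. all: by end_near. Qed.

Section LocalSolution.
Variables (i : chart_index M) (J : set R) (u v : R -> 'rV[R]_n).
Hypotheses (oJ : open J) (iJ : is_interval J) (J0 : J !=set0).
Hypothesis ui : forall t, J t -> chart_image i (u t).
Hypothesis du : forall (t : R) a, J t -> is_derive t 1 (fun s => u s 0 a) (v t 0 a).
Hypothesis dv : forall (t : R) a, J t -> is_derive t 1 (fun s => v s 0 a) (acceleration i (u t) (v t) 0 a).

(** Bootstrap: if [u] and [v] have order [k], so has the acceleration, which is the derivative of
    [v]; hence both gain one order. *)
Let kcurve_uv k : (forall a, kcurve k J (fun s => u s 0 a)) /\ (forall a, kcurve k J (fun s => v s 0 a)).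
Proof.
elim: k => [|k [IHu IHv]].
  split=> a; split=> // t Jt; apply/differentiable_continuous/derivable1_diffP.
    by case: (du a Jt).
  by case: (dv a Jt).
split=> a; first by apply: (kcurveS oJ) (IHv a) => t Jt; exact: du.
apply: (kcurveS oJ (fun t Jt => dv a Jt)).
apply: (@eq_kcurve _ _ _ (fun t => (-1) * \sum_(b < n) \sum_(c < n) christoffel h i a b c (u t) * v t 0 b * v t 0 c)) => //.
  by move=> t Jt; rewrite mulN1r mxE.
apply: kcurveM => //; first exact: kcurve_cst.
apply: kcurve_sum => // b; apply: kcurve_sum => // c.
apply: (kcurveM oJ) (IHv c); apply: (kcurveM oJ) (IHv b).
by apply: (kcurve_comp oJ (@chart_image_open _ _ M i) ui) IHu; exact: christoffel_smooth.
Qed.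

Let u_continuous t : J t -> {for t, continuous u}.
Proof. by move=> Jt; apply/row_continuousP => a; exact: (kcurve_continuous ((kcurve_uv 0).1 a)). Qed.

Let gam t := chart_inv i (u t).

Let gam_continuous t : J t -> {for t, continuous gam}.
Proof.
move=> Jt; apply: (@continuous_comp _ _ _ u (chart_inv i)); first exact: u_continuous.
by apply: chart_inv_continuous_at; exact: ui.
Qed.

Let Jj j := [set t | J t /\ overlap i j (u t)].

Let open_Jj j : open (Jj j).
Proof.
rewrite openE => t [Jt ot]; rewrite /interior.
have H1 : nbhs t J by exact: open_nbhs_nbhs.
have H2 : \forall s \near t, overlap i j (u s).
  by apply: (u_continuous Jt); apply: open_nbhs_nbhs; split=> //; exact: open_overlap.
exact: filterS2 H1 H2.
Qed.

Let gam_Jj j t : J t -> chart_dom j (gam t) -> Jj j t.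
Proof. by move=> Jt dj; split=> //; apply/overlapP; split=> //; exact: ui. Qed.

Let kcurve_other j k c : kcurve k (Jj j) (fun s => chart j (gam s) 0 c).
Proof.
apply: (@kcurve_comp _ n k (Jj j) (overlap i j) (fun y => transition i j y 0 c) u) => //.
- exact: open_overlap.
- by move=> t [].
- exact: transition_smooth.
move=> a; have := (kcurve_uv k).1 a.
have sub : forall m f, kcurve m J f -> kcurve m (Jj j) f.
  elim=> [|m IH] f [H1 H2]; split=> //; try by move=> t [Jt _]; exact: H1.
  by case: H2 => H2 H3; split=> [t [Jt _]|]; [exact: H2|exact: IH].
exact: sub.
Qed.

(** A geodesic has to satisfy its equation in every chart, not only in the chart [i] in which the
    system is solved. In another chart [j], smoothness comes from composing with the transition map,
    and the equation is carried over in Euler-Lagrange form by [euler_lagrange_pullback] and then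
    translated back. *)
Lemma local_geodesic : geodesic h J gam.
Proof.
split=> //; split.
  move=> t Jt; split; first exact: gam_continuous.
  move=> j dj m.
  by have [] := derive1n_coord m (open_Jj (j := j)) (fun k c => kcurve_other j k c) (gam_Jj Jt dj).
move=> t j Jt dj /= k.
have Jjt := gam_Jj Jt dj.
pose ut s := chart j (gam s); pose vt := derive1 ut.
have D m := derive1n_coord m (open_Jj (j := j)) (fun k c => kcurve_other j k c).
have dut s a : Jj j s -> is_derive s 1 (fun r => ut r 0 a) (vt s 0 a).
  move=> Js; have [_ D0] := D 0%N s Js; split; first exact: (derivable_mxP _ _ _).1 D0 0 a.
  by rewrite /vt derive1E (derive_mx D0) mxE.
have dvt a : is_derive t 1 (fun r => vt r 0 a) (derive1n 2 ut t 0 a).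
  have [_ D1] := D 1%N t Jjt; split; first exact: (derivable_mxP _ _ _).1 D1 0 a.
  have -> : derive1n 2 ut t = 'D_1 vt t by rewrite derive1nS derive1E.
  by rewrite (derive_mx D1) mxE.
have nJ : \forall s \near t, Jj j s by apply: open_nbhs_nbhs; split=> //; exact: open_Jj.
have ELi s : J s -> euler_lagrange (metric_mx h i) u v s.
  move=> Js; apply/(euler_lagrangeP (ui Js) (fun a => du a Js) (fun a => dv a Js)) => c.
  by rewrite mxE addNr.
have oji s : Jj j s -> overlap j i (ut s) /\ transition j i (ut s) = u s.
  by move=> [Js os]; exact: transition_mem.
have ELj : euler_lagrange (metric_mx h j) ut vt t.
  apply: (@euler_lagrange_pullback _ _ (overlap j i) (chart_image i) (transition j i)
     (metric_mx h i) (metric_mx h j)).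
  - exact: open_overlap.
  - exact: chart_image_open.
  - by move=> y /transition_mem[/overlapP[]].
  - exact: transition_smooth.
  - exact: metric_smooth_at.
  - move=> a b s y oy; apply: (metric_smooth_at a b s); by case/overlapP: oy.
  - exact: metric_sym_at.
  - exact: metric_pullback.
  - by near=> s; have [] : overlap j i (ut s) /\ transition j i (ut s) = u s by apply: oji; near: s.
  - by move=> a; exact: dut.
  apply: eq_euler_lagrange (ELi t Jt).
    by near=> s; have [] : overlap j i (ut s) /\ transition j i (ut s) = u s by apply: oji; near: s.
  near=> s; have Jjs : Jj j s by near: s.
  have [os Es] := oji s Jjs.
  apply/rowP => a.
  have D1 := du a Jjs.1.
  have D2 : is_derive s 1 (fun r => u r 0 a) (\sum_(c < n) vt s 0 c * partial (fun y => transition j i y 0 a) c (ut s)).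
    apply: (@near_eq_is_derive _ _ _ (fun r => transition j i (ut r) 0 a)).
      by apply: (open_near_eq (open_Jj (j := j))) Jjs => r Jr; rewrite (oji r Jr).2.
    exact: (is_derive_comp_smooth (open_overlap (i := j) (j := i)) (transition_smooth (s := M) a) os (fun c => dut s c Jjs)).
  rewrite (is_derive_unique D1 D2) mxE; by apply: eq_bigr => c _; rewrite mxE.
have := (euler_lagrangeP (chart_image_chart dj) (fun a => dut t a Jjt) dvt).1 ELj k.
by [].
Unshelve. all: by end_near. Qed.

End LocalSolution.

End ChartsAndGeodesics.

Section RowPairs.
Context {R : realType} {n : nat}.
Implicit Types u v w : 'rV[R]_n.

Lemma norm_row_mx_le u v (c : R) : `|row_mx u v| <= c <-> `|u| <= c /\ `|v| <= c.
Proof.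
split=> [H|[Hu Hv]].
  have c0 : 0 <= c by apply: le_trans H.
  split; apply/rV_normP => // a; apply: le_trans H.
    by have := coord_norm (row_mx u v) (lshift n a); rewrite row_mxEl.
  by have := coord_norm (row_mx u v) (rshift n a); rewrite row_mxEr.
have c0 : 0 <= c by apply: le_trans Hu.
apply/rV_normP => // a; case: (split_ordP a) => b ->; rewrite ?row_mxEl ?row_mxEr.
  exact: le_trans (coord_norm _ _) Hu.
exact: le_trans (coord_norm _ _) Hv.
Qed.

Lemma sub_row_mx u v u' v' : row_mx u v - row_mx u' v' = row_mx (u - u') (v - v').
Proof. by rewrite opp_row_mx add_row_mx. Qed.

Lemma is_derive_row_mx (u v : R -> 'rV[R]_n) (du dv : 'rV[R]_n) (t : R) :
  (forall a, is_derive t 1 (fun s => u s 0 a) (du 0 a)) ->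
  (forall a, is_derive t 1 (fun s => v s 0 a) (dv 0 a)) ->
  forall a, is_derive t 1 (fun s => row_mx (u s) (v s) 0 a) (row_mx du dv 0 a).
Proof.
move=> Hu Hv a; case: (split_ordP a) => b ->.
  by rewrite row_mxEl; under eq_fun do rewrite row_mxEl.
by rewrite row_mxEr; under eq_fun do rewrite row_mxEr.
Qed.

Lemma derive1_row (u : R -> 'rV[R]_n) w (t : R) :
  (forall a, is_derive t 1 (fun s => u s 0 a) (w 0 a)) -> derive1 u t = w.
Proof.
move=> H; have D : derivable u t 1.
  by apply/derivable_mxP => i a; rewrite (ord1 i); case: (H a).
rewrite derive1E (derive_mx D); apply/rowP => a; rewrite mxE.
exact: derive_val.
Qed.

Lemma is_derive_row_continuous (u : R -> 'rV[R]_n) (w : 'I_n -> R) (t : R) :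
  (forall a, is_derive t 1 (fun s => u s 0 a) (w a)) -> {for t, continuous u}.
Proof.
move=> H; apply/row_continuousP => a; apply/differentiable_continuous/derivable1_diffP.
by case: (H a).
Qed.

Lemma closed_le_norm (V : normedModType R) (c : V) (r : R) : closed [set v | `|v - c| <= r].
Proof.
have -> : [set v : V | `|v - c| <= r] = (fun v : V => `|v - c|) @^-1` [set x | x <= r] by [].
apply: closed_comp => [v _|]; last exact: closed_le.
apply: (@continuous_comp _ _ _ (fun v : V => v - c)); last exact: norm_continuous.
by apply: continuousB; [exact: cvg_id|exact: cst_continuous].
Qed.

Lemma closed_left_limit (T : topologicalType) (A : set T) (f : R -> T) (s t : R) :
  closed A -> s < t -> {for t, continuous f} -> (forall r, s <= r < t -> A (f r)) -> A (f t).
Proof.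
move=> cA st cf H; apply: cA => B /cf /nearN[d d0 Hd].
pose r := Num.max s (t - d / 2).
have rt : r < t by rewrite gt_max st; lra.
have sr : s <= r by rewrite le_max lexx.
have tr : t - d / 2 <= r by rewrite le_max lexx orbT.
exists (f r); split; first by apply: H; rewrite sr.
by apply: Hd; rewrite ler0_norm; lra.
Qed.

End RowPairs.

(** * The geodesic flow *)

Section Trapping.
Context {R : realType}.

(** A speed bound [K] that is valid only while [X] is within [r] of its start is self-sustaining up
    to time [T], because [K * T <= r]. The predicate [D], in applications membership in a chart
    domain, is what gives [X] its meaning and is propagated along with the bound. *)
Lemma trapped (N : nat) (X dX : R -> 'rV[R]_N) (s T K r : R) (D : R -> Prop) :
  0 < K -> 0 < r -> K * T <= r ->
  (forall t, s <= t <= s + T -> D t -> `|X t - X s| <= r ->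
     (forall a, is_derive t 1 (fun x => X x 0 a) (dX t 0 a)) /\ `|dX t| <= K) ->
  D s ->
  (forall t, s <= t < s + T -> D t -> `|X t - X s| < r ->
     exists2 d : R, 0 < d & forall t', t < t' < t + d -> D t') ->
  (forall t, s < t <= s + T -> (forall t', s <= t' < t -> D t' /\ `|X t' - X s| <= r) ->
     D t /\ {for t, continuous X}) ->
  forall t, s <= t <= s + T -> D t /\ `|X t - X s| <= K * (t - s).
Proof.
move=> K0 r0 KT H Ds Dr Dl.
have step t : s <= t <= s + T -> (forall t', s <= t' <= t -> D t' /\ `|X t' - X s| <= r) ->
    `|X t - X s| <= K * (t - s).
  move=> /andP[st tT] Hr; apply/rV_normP => [|a]; first by rewrite mulr_ge0 ?subr_ge0// ltW.
  have HH x : s <= x <= t -> (forall a, is_derive x 1 (fun x => X x 0 a) (dX x 0 a)) /\ `|dX x| <= K.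
    move=> sxt; have [Dx Xx] := Hr x sxt; apply: H => //; lra.
  rewrite !mxE.
  apply: (@MVT_bound _ (fun x => X x 0 a) (fun x => dX x 0 a)) => // x sxt; first exact: (HH x sxt).1.
  exact: le_trans (coord_norm _ _) (HH x sxt).2.
have KTr t : s <= t <= s + T -> K * (t - s) <= r.
  by move=> /andP[st tT]; apply: le_trans KT; apply: ler_wpM2l; [exact: ltW|lra].
apply: real_induction => [|t /andP[st tT] Pt|t /andP[st tT] Pt].
- by split=> //; rewrite !subrr normr0 mulr0.
- have [Dt0 Xt0] : D t /\ `|X t - X s| <= K * (t - s) by apply: Pt; rewrite st lexx.
  have Xr : `|X t - X s| < r.
    by apply: le_lt_trans Xt0 _; apply: lt_le_trans KT; rewrite ltr_pM2l//; lra.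
  have [d d0 Hd] := Dr t (introT andP (conj st tT)) Dt0 Xr.
  have [dX1 _] : (forall a, is_derive t 1 (fun x => X x 0 a) (dX t 0 a)) /\ `|dX t| <= K.
    by apply: H => //; rewrite ?st ltW.
  have /continuousN/(_ (r - `|X t - X s|)) := is_derive_row_continuous dX1.
  rewrite subr_gt0 => /(_ Xr)[e e0 He].
  exists (Num.min (Num.min d e) (s + T - t)); first by rewrite !lt_min d0 e0 subr_gt0.
  move=> t' /andP[tt']; rewrite -ltrBlDl !lt_min => /andP[/andP[td te] tT'].
  have near x : t < x <= t' -> D x /\ `|X x - X s| <= r.
    move=> /andP[tx xt]; split; first by apply: Hd; rewrite tx /=; lra.
    have HX : `|X x - X t| < r - `|X t - X s| by apply: He; rewrite ger0_norm; lra.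
    by rewrite -(subrKA (X t)); apply: le_trans (ler_normD _ _) _; lra.
  have all x : s <= x <= t' -> D x /\ `|X x - X s| <= r.
    move=> /andP[sx xt]; have [xt'|xt'] := leP x t; last by apply: near; rewrite xt'.
    have [Dx Xx] : D x /\ `|X x - X s| <= K * (x - s) by apply: Pt; rewrite sx.
    by split=> //; apply: le_trans Xx _; apply: KTr; rewrite sx /=; lra.
  split; first by apply: (near t' _).1; rewrite tt' lexx.
  by apply: step => //; apply/andP; split; lra.
have Pr x : s <= x < t -> D x /\ `|X x - X s| <= r.
  move=> /andP[sx xt]; have [Dx Xx] : D x /\ `|X x - X s| <= K * (x - s) by apply: Pt; rewrite sx.
  by split=> //; apply: le_trans Xx _; apply: KTr; rewrite sx /=; lra.
have [Dt cX] := Dl t (introT andP (conj st tT)) Pr.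
have Xt : `|X t - X s| <= r.
  exact: (closed_left_limit (closed_le_norm (c := X s) (r := r)) st cX (fun x sx => (Pr x sx).2)).
split=> //; apply: step; first by rewrite tT ltW.
move=> x /andP[sx]; rewrite le_eqVlt => /orP[/eqP -> //|xt].
by apply: Pr; rewrite sx.
Qed.

End Trapping.

Section GeodesicFlow.
Context {R : realType} {n : nat} {M : smooth_manifold R n}.
Variable h : riemannian_metric M.
Implicit Types (i j : chart_index M) (p q : M) (u v w : 'rV[R]_n) (J : set R) (gam : R -> M).

Lemma eq_derive1n (V : normedModType R) (A : set R) (f g : R -> V) m : open A ->
  (forall s, A s -> f s = g s) -> forall s, A s -> derive1n m f s = derive1n m g s.
Proof.
move=> oA fg; elim: m => [|m IH] s As; first exact: fg.
by rewrite !derive1nS !derive1E; apply: near_eq_derive; exact: (open_near_eq oA IH).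
Qed.

Lemma geodesic_gluing J gam : open J -> is_interval J -> J !=set0 ->
  (forall t, J t -> exists J' gam', [/\ geodesic h J' gam', J' t & forall s, J' s -> gam s = gam' s]) ->
  geodesic h J gam.
Proof.
move=> oJ iJ J0 H; split=> //; split.
  move=> t Jt; have [J' [gam' [[[oJ' _ _] [sg eg]] J't E]]] := H t Jt.
  have [c1 d1] := sg t J't; split.
    by apply: near_eq_continuous c1; apply: (open_near_eq oJ') J't => s Js; rewrite E.
  move=> i; rewrite E// => di m.
  apply: near_eq_derivable (d1 i di m).
  apply: (open_near_eq oJ' _ J't); apply: eq_derive1n => // s Js /=; by rewrite E.
move=> t i Jt; have [J' [gam' [[[oJ' _ _] [sg eg]] J't E]]] := H t Jt.
rewrite E// => di /= k; have := eg t i J't di k; rewrite /=.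
have e2 m : derive1n m (chart i \o gam) t = derive1n m (chart i \o gam') t.
  by apply: (eq_derive1n m oJ') => // s Js /=; rewrite E.
by have /= -> := e2 2; have /= -> := e2 1%N; rewrite E.
Qed.

(** The acceleration is quadratic in the velocity, so it is bounded and Lipschitz only for
    velocities below a bound [B] fixed beforehand. *)
Lemma acceleration_lipschitz i u0 (B : R) : chart_image i u0 -> 0 < B ->
  exists r C : R, [/\ 0 < r, 0 < C, forall u, `|u - u0| <= r -> chart_image i u,
   forall u v, `|u - u0| <= r -> `|v| <= B -> `|acceleration h i u v| <= C &
   forall u v u' v', `|u - u0| <= r -> `|u' - u0| <= r -> `|v| <= B -> `|v'| <= B ->
     `|acceleration h i u v - acceleration h i u' v'| <= C * Num.max `|u - u'| `|v - v'|].
Proof.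
move=> iu B0; have oU := @chart_image_open _ _ M i.
have [r1 r10 Hr1] := open_ball_sub oU iu.
have [||r2 [C [r20 C0 HC]]] := @fin_uniform R ('I_n * 'I_n * 'I_n)%type (fun kab r C =>
    lip_bounded (christoffel h i kab.1.1 kab.1.2 kab.2) u0 r C).
- by move=> kab r r' C C' _ rr CC; exact: lip_boundedW.
- by move=> [[k a] b]; exact: (smooth_lip_bounded oU iu (@christoffel_smooth _ _ _ h i k a b)).
pose r := Num.min r1 r2.
have r0 : 0 < r by rewrite lt_min r10.
(* The first summand is the Lipschitz constant, with one term for each factor varied in [split3];
   the second bounds the acceleration itself; the third keeps [D] positive even for [n = 0]. *)
pose D := n%:R * (n%:R * (C * B * B + C * B + C * B)) + n%:R * (n%:R * (C * B * B)) + 1.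
have CB : 0 < C * B by rewrite mulr_gt0.
have CBB : 0 < C * B * B by rewrite mulr_gt0.
have n0 : 0 <= n%:R :> R by rewrite ler0n.
have X0 : 0 <= n%:R * (n%:R * (C * B * B + C * B + C * B)) by rewrite !mulr_ge0//; lra.
have Y0 : 0 <= n%:R * (n%:R * (C * B * B)) by rewrite !mulr_ge0//; lra.
have D0 : 0 < D by rewrite /D; lra.
have co v (a : 'I_n) (c : R) : `|v| <= c -> `|v 0 a| <= c by move=> H; exact: le_trans (coord_norm _ _) H.
have mul3 (x y z X Y Z : R) : `|x| <= X -> `|y| <= Y -> `|z| <= Z -> `|x * y * z| <= X * Y * Z.
  by move=> xX yY zZ; rewrite !normrM; apply: ler_pM; rewrite ?mulr_ge0//; exact: ler_pM.
exists r, D; split=> //.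
- by move=> u ur; apply: Hr1; apply: le_trans ur _; rewrite ge_min lexx.
- move=> u v; rewrite le_min => /andP[ur1 ur2] vB; apply/rV_normP => [|k]; first exact: ltW.
  rewrite mxE normrN; apply: (@le_trans _ _ (n%:R * (n%:R * (C * B * B)))); last by rewrite /D; lra.
  apply: norm_sum_le => a; apply: norm_sum_le => b.
  by apply: mul3; [exact: ((HC (k, a, b)).1 u ur2)|exact: co|exact: co].
move=> u v u' v'; rewrite !le_min => /andP[ur1 ur2] /andP[ur1' ur2'] vB vB'.
set m := Num.max _ _.
have mu : `|u - u'| <= m by rewrite le_max lexx.
have mv : `|v - v'| <= m by rewrite le_max lexx orbT.
have m0 : 0 <= m by apply: le_trans mu.
apply/rV_normP => [|k]; first by rewrite mulr_ge0// ltW.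
rewrite !mxE -opprD normrN -sumrB.
apply: (@le_trans _ _ (n%:R * (n%:R * ((C * B * B + C * B + C * B) * m)))); last first.
  by rewrite 2!mulrA -[n%:R * n%:R * _]mulrA; apply: ler_wpM2r => //; rewrite /D; lra.
apply: norm_sum_le => a; rewrite -sumrB; apply: norm_sum_le => b.
have G1 := (HC (k, a, b)).1 u' ur2'; have G2 := (HC (k, a, b)).2 u' u ur2' ur2; rewrite /= in G1 G2.
have va := co v a _ vB; have vb := co v b _ vB; have va' := co v' a _ vB'; have vb' := co v' b _ vB'.
have da : `|v 0 a - v' 0 a| <= m.
  by apply: le_trans mv; have := coord_norm (v - v') a; rewrite !mxE.
have db : `|v 0 b - v' 0 b| <= m.
  by apply: le_trans mv; have := coord_norm (v - v') b; rewrite !mxE.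
set G := christoffel _ _ _ _ _ _; set G' := christoffel _ _ _ _ _ u' in G1 G2 *.
have split3 (x y z x' y' z' : R) : x * y * z - x' * y' * z' =
   (x - x') * y * z + x' * (y - y') * z + x' * y' * (z - z') by ring.
rewrite split3.
have {}G2 : `|G - G'| <= C * m by apply: le_trans G2 _; rewrite ler_pM2l.
have -> : (C * B * B + C * B + C * B) * m = C * m * B * B + C * m * B + C * B * m by ring.
apply: le_trans (ler_normD _ _) _; apply: lerD; last exact: mul3.
by apply: le_trans (ler_normD _ _) _; apply: lerD; exact: mul3.
Qed.

Lemma ball_interval (c d : R) : 0 < d ->
  let J := [set t : R | `|t - c| < d] in [/\ open J, is_interval J & J !=set0].
Proof.
move=> d0; split.
- rewrite openE => t /= td; suff : \forall s \near t, `|s - c| < d by [].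
  apply/nearN; exists (d - `|t - c|); first by rewrite subr_gt0.
  move=> s st; rewrite -(subrKA t); apply: le_lt_trans (ler_normD _ _) _; lra.
- by move=> x y /=; rewrite !ltr_norml => /andP[? ?] /andP[? ?] z /andP[? ?] /=; rewrite ltr_norml; apply/andP; split; lra.
- by exists c; rewrite /= subrr normr0.
Qed.

Lemma geodesic_local_existence i u0 v0 : chart_image i u0 ->
  exists J gam, [/\ geodesic h J gam, J 0, gam 0 = chart_inv i u0 & derive1 (chart i \o gam) 0 = v0].
Proof.
move=> iu; have B0 : 0 < `|v0| + 1 by rewrite ltr_wpDl.
have [r [C [r0 C0 Hr Hb HC]]] := acceleration_lipschitz iu B0.
pose F (z : 'rV[R]_(n + n)) := row_mx (rsubmx z) (acceleration h i (lsubmx z) (rsubmx z)).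
(* A radius of at most 1 keeps the velocity component below [|v0| + 1], the bound for which the
   Lipschitz estimate was requested. *)
pose z0 := row_mx u0 v0; pose r' := Num.min r 1.
have r'0 : 0 < r' by rewrite lt_min r0 ltr01.
have sub z (c : R) : `|z - z0| <= c -> `|lsubmx z - u0| <= c /\ `|rsubmx z - v0| <= c.
  by rewrite -{1}(hsubmxK z) sub_row_mx norm_row_mx_le.
have inB z : `|z - z0| <= r' -> `|lsubmx z - u0| <= r /\ `|rsubmx z| <= `|v0| + 1.
  move=> /sub[]; rewrite !le_min => /andP[h1 _] /andP[_ h2]; split=> //.
  by rewrite -(subrK v0 (rsubmx z)); apply: le_trans (ler_normD _ _) _; lra.
have [|z w /inB[z1 z2] /inB[w1 w2]|d [z [d0 z00 Hz]]] := @local_ode R (n + n) F z0 r' (C + 1) r'0.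
- lra.
- have E : `|z - w| = Num.max `|lsubmx z - lsubmx w| `|rsubmx z - rsubmx w|.
    rewrite -{1}(hsubmxK z) -{1}(hsubmxK w) sub_row_mx; apply/le_anti/andP; split.
      by apply/norm_row_mx_le; rewrite !le_max !lexx ?orbT.
    by rewrite ge_max; apply/andP/norm_row_mx_le.
  rewrite /F sub_row_mx norm_row_mx_le E; split.
    apply: (@le_trans _ _ (1 * Num.max `|lsubmx z - lsubmx w| `|rsubmx z - rsubmx w|)).
      by rewrite mul1r le_max lexx orbT.
    by apply: ler_wpM2r; [rewrite le_max normr_ge0|lra].
  apply: le_trans (HC _ _ _ _ z1 w1 z2 w2) _; apply: ler_wpM2r; last lra.
  by rewrite le_max normr_ge0.
pose u t := lsubmx (z t); pose v t := rsubmx (z t); pose J := [set t : R | `|t - 0| < d].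
have [oJ iJ J0] := ball_interval 0 d0.
have Ju t : J t -> chart_image i (u t).
  by rewrite /J /= subr0 => td; apply: Hr; apply: (inB (z t) _).1; exact: (Hz t td).1.
have du (t : R) a : J t -> is_derive t 1 (fun s => u s 0 a) (v t 0 a).
  rewrite /J /= subr0 => td; have := (Hz t td).2 (lshift n a); rewrite /F row_mxEl.
  by have -> : (fun s => u s 0 a) = (fun s => z s 0 (lshift n a)) by apply/funext => s; rewrite /u mxE.
have dv (t : R) a : J t -> is_derive t 1 (fun s => v s 0 a) (acceleration h i (u t) (v t) 0 a).
  rewrite /J /= subr0 => td; have := (Hz t td).2 (rshift n a); rewrite /F row_mxEr.
  by have -> : (fun s => v s 0 a) = (fun s => z s 0 (rshift n a)) by apply/funext => s; rewrite /v mxE.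
have J00 : J 0 by rewrite /J /= subrr normr0.
exists J, (fun t => chart_inv i (u t)); split=> //.
- exact: (local_geodesic oJ iJ J0 Ju du dv).
- by rewrite /u z00 row_mxKl.
rewrite (_ : v0 = v 0); last by rewrite /v z00 row_mxKr.
apply: derive1_row => a; apply: near_eq_is_derive (du 0 a J00).
by apply: (open_near_eq oJ _ J00) => s Js /=; rewrite (chart_invP (Ju s Js)).2.
Qed.

End GeodesicFlow.

Lemma normB_le (R : realType) (V : normedModType R) (a b c : V) (x y : R) :
  `|a - b| <= x -> `|b - c| <= y -> `|a - c| <= x + y.
Proof. by move=> h1 h2; rewrite -(subrKA b); apply: le_trans (ler_normD _ _) _; exact: lerD. Qed.

Lemma normB_add (R : realType) (V : normedModType R) (a b : V) (x y : R) :
  `|a - b| <= x -> `|b| <= y -> `|a| <= x + y.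
Proof. by move=> h1 h2; rewrite -(subrK b a); apply: le_trans (ler_normD _ _) _; exact: lerD. Qed.

Lemma normB_eq (R : realType) (V : normedModType R) (a b c : V) (x : R) :
  b = c -> `|a - b| <= x -> `|a - c| <= x.
Proof. by move=> ->. Qed.

Lemma sub_row_coord (R : realType) m (u v : 'rV[R]_m) (a : 'I_m) : (u - v) 0 a = u 0 a - v 0 a.
Proof. by rewrite !mxE. Qed.

(** * Extension, flow boxes and uniqueness of geodesics *)

Section GlobalGeodesics.
Context {R : realType} {n : nat} {M : smooth_manifold R n}.
Variable h : riemannian_metric M.
Implicit Types (i j : chart_index M) (p q : M) (u v w : 'rV[R]_n) (J : set R) (gam : R -> M).

(** Completeness is a statement about maximal geodesics, so a local geodesic is first extended to a
    maximal one by Zorn's lemma. The union of a chain of extensions is a geodesic because being one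
    is a local property, [geodesic_gluing]. *)
Lemma geodesic_extend J0 (gam0 : R -> M) : complete_metric h -> geodesic h J0 gam0 ->
  exists gam, geodesic h setT gam /\ forall t, J0 t -> gam t = gam0 t.
Proof.
move=> hc g0; pose q := gam0 0.
(* Outside [J] a curve is normalised to [q], which makes the extension order antisymmetric. *)
pose P (c : set R * (R -> M)) := [/\ geodesic h c.1 c.2, forall t, ~ c.1 t -> c.2 t = q,
  J0 `<=` c.1 & forall t, J0 t -> c.2 t = gam0 t].
pose T := {c | P c}.
pose ext (s t : T) : bool := `[< (sval s).1 `<=` (sval t).1 /\
   forall x, (sval s).1 x -> (sval t).2 x = (sval s).2 x >].
pose norm J (gam : R -> M) t := if pselect (J t) then gam t else q.
have normE J gam t : J t -> norm J gam t = gam t by rewrite /norm; case: pselect.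
have normN J gam t : ~ J t -> norm J gam t = q by rewrite /norm; case: pselect.
have geo_norm J gam : geodesic h J gam -> geodesic h J (norm J gam).
  move=> g; have [[oJ iJ ne] _] := g; apply: geodesic_gluing => // t Jt.
  by exists J, gam; split=> // s; exact: normE.
have P0 : P (J0, norm J0 gam0).
  by split=> //=; [exact: geo_norm|exact: normN|exact: normE].
have [||||[[J gam] HJ] maxJ] := @Zorn T ext.
- by move=> s; apply/asboolP; split=> //; exact: subset_refl.
- move=> r s t /asboolP[h1 h2] /asboolP[h3 h4]; apply/asboolP; split; first exact: subset_trans h3.
  by move=> x rx; rewrite h4 ?h2//; exact: h1.
- move=> [[J1 g1] H1] [[J2 g2] H2] /asboolP[/= h1 h2] /asboolP[/= h3 h4].
  have EJ : J1 = J2 by apply/seteqP.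
  have Eg : g1 = g2.
    apply/funext => x; have [J1x|J1x] := pselect (J1 x); first by rewrite h2.
    case: H1 => _ /= -> // _ _; case: H2 => _ /= -> //; by rewrite -EJ.
  move: H1 H2; rewrite EJ Eg => H1 H2; congr exist; exact: Prop_irrelevance.
- move=> A totA; have [A0|/set0P[s0 As0]] := eqVneq A set0.
    by exists (exist _ _ P0) => s; rewrite A0.
  pose JU := [set x | exists2 s, A s & (sval s).1 x].
  have pick x : JU x -> exists s, A s /\ (sval s).1 x by move=> [s]; exists s.
  pose gU x := if pselect (JU x) is left H then (sval (projT1 (cid (pick x H)))).2 x else q.
  have agree s x : A s -> (sval s).1 x -> gU x = (sval s).2 x.
    move=> As sx; rewrite /gU; case: pselect => [H|[]]; last by exists s.
    case: cid => r [Ar rx] /=; have [/asboolP[_ E]|/asboolP[_ E]] := totA s r As Ar.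
      exact: E.
    by rewrite E.
  have PU : P (JU, gU).
    have [[[_ _ n0] _] _ sub0 eq0] := svalP s0.
    split => /=.
    + apply: geodesic_gluing.
      * rewrite openE => x [s As sx]; have [[[os _ _] _] _ _ _] := svalP s.
        by apply: filterS (open_nbhs_nbhs (conj os sx)) => y sy; exists s.
      * move=> x y [s As sx] [r Ar ry] z xyz.
        have [[[_ is_ _] _] _ _ _] := svalP s; have [[[_ ir _] _] _ _ _] := svalP r.
        have [/asboolP[E _]|/asboolP[E _]] := totA s r As Ar.
          by exists r => //; apply: ir xyz => //; exact: E.
        by exists s => //; apply: is_ xyz => //; exact: E.
      * by case: n0 => x s0x; exists x; exists s0.
      move=> x [s As sx]; exists (sval s).1, (sval s).2; split=> //; first by case: (svalP s).
      by move=> y sy; exact: agree.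
    + by move=> x nx; rewrite /gU; case: pselect.
    + by move=> x J0x; exists s0 => //; exact: sub0.
    + by move=> x J0x; rewrite (agree s0)//; [exact: eq0|exact: sub0].
  exists (exist _ _ PU) => s As; apply/asboolP; split=> /= [x sx|x sx]; first by exists s.
  exact: agree.
have [gJ nJ subJ eqJ] := HJ; rewrite /= in gJ nJ subJ eqJ.
have maxi : maximal_geodesic h J gam.
  split=> // J' gam' g' JJ' E.
  have P' : P (J', norm J' gam').
    split=> //=; [exact: geo_norm|exact: normN|exact: subset_trans JJ'|].
    by move=> t J0t; rewrite normE ?E ?eqJ//; [exact: subJ|apply: JJ'; exact: subJ].
  have := maxJ (exist _ _ P'); case/(_ _)/Wrap; last by case=> -> _.
  by apply/asboolP; split=> //= x Jx; rewrite normE ?E//; exact: JJ'.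
by exists gam; rewrite -(hc _ _ maxi).
Qed.

Definition velocity i gam t : 'rV[R]_n := derive1 (chart i \o gam) t.
Definition state i gam t : 'rV[R]_(n + n) := row_mx (chart i (gam t)) (velocity i gam t).

Lemma geodesicT_ode gam t i : geodesic h setT gam -> chart_dom i (gam t) ->
  (forall a, is_derive t 1 (fun s => chart i (gam s) 0 a) (velocity i gam t 0 a)) /\
  (forall a, is_derive t 1 (fun s => velocity i gam s 0 a)
     (acceleration h i (chart i (gam t)) (velocity i gam t) 0 a)).
Proof. by move=> g di; exact: (geodesic_ode g (I : setT t) di). Qed.

Lemma geodesicT_continuous gam : geodesic h setT gam -> continuous gam.
Proof. by move=> [_ [sg _]] t; have [] := sg t I. Qed.

Lemma state_derive gam t i : geodesic h setT gam -> chart_dom i (gam t) ->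
  forall a, is_derive t 1 (fun s => state i gam s 0 a)
    (row_mx (velocity i gam t) (acceleration h i (chart i (gam t)) (velocity i gam t)) 0 a).
Proof. by move=> g di; have [d1 d2] := geodesicT_ode g di; exact: is_derive_row_mx. Qed.

Lemma geodesic_exists i q v : complete_metric h -> chart_dom i q ->
  exists gam, [/\ geodesic h setT gam, gam 0 = q & velocity i gam 0 = v].
Proof.
move=> hc di; have [J [g0 [gg J0 g00 dg]]] := geodesic_local_existence h v (chart_image_chart di).
have [gam [ggam E]] := geodesic_extend hc gg.
exists gam; split; [exact: ggam|by rewrite (E _ J0) g00 (chartK di)|].
rewrite -dg /velocity !derive1E; apply: near_eq_derive.
have [[oJ _ _] _] := gg; apply: (open_near_eq oJ) J0 => s Js /=; by rewrite E.
Qed.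

(** The set is compact, and [M] is Hausdorff. Hence a curve whose coordinates stay in a closed ball
    cannot converge to a point outside the chart. *)
Lemma closed_chart_ball i u0 (r : R) : (forall u, `|u - u0| <= r -> chart_image i u) ->
  closed (chart_inv i @` [set u | `|u - u0| <= r]).
Proof.
move=> Hr; apply: compact_closed; first exact: carrier_hausdorff.
apply: continuous_compact.
  apply: continuous_in_subspaceT => u; rewrite inE => /= ur.
  by apply: chart_inv_continuous_at; exact: Hr.
apply: bounded_closed_compact; last exact: closed_le_norm.
exists (`|u0| + r); split; first exact: num_real.
move=> x xr u /= ur; rewrite -(subrK u0 u); apply: le_trans (ler_normD _ _) _; lra.
Qed.

(** Two applications of [trapped]: to the state of one geodesic, and to the difference of two
    states, whose derivative is at most [K * D] as long as the difference is at most [D + D]. Room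
    for the motion is left by taking for [r] half of the radius on which the acceleration is
    controlled, and by controlling it for velocities up to [B + B]. The constants are the same for
    all geodesics entering the box. *)
Lemma flow_box i u0 (B : R) : chart_image i u0 -> 0 < B ->
  exists r T K : R, [/\ 0 < r, 0 < T, 0 < K, K * T <= Num.min r (Num.min B 1) &
   (forall u, `|u - u0| <= r + r -> chart_image i u) /\
   (forall gam s, geodesic h setT gam -> chart_dom i (gam s) -> `|chart i (gam s) - u0| <= r ->
      `|velocity i gam s| <= B -> forall t, s <= t <= s + T ->
      chart_dom i (gam t) /\ `|state i gam t - state i gam s| <= K * (t - s)) /\
   (forall gam gam' (s D : R), geodesic h setT gam -> chart_dom i (gam s) -> `|chart i (gam s) - u0| <= r ->
      `|velocity i gam s| <= B ->
      geodesic h setT gam' -> chart_dom i (gam' s) -> `|chart i (gam' s) - u0| <= r ->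
      `|velocity i gam' s| <= B -> 0 < D -> `|state i gam s - state i gam' s| <= D ->
      forall t, s <= t <= s + T ->
      `|(state i gam t - state i gam' t) - (state i gam s - state i gam' s)| <= K * D * (t - s))].
Proof.
move=> iu B0; have B20 : 0 < B + B by rewrite addr_gt0.
have [r2 [C [r20 C0 Hr Hb HC]]] := acceleration_lipschitz h iu B20.
pose r := r2 / 2; have r0 : 0 < r by rewrite divr_gt0.
have rr : r + r = r2 by rewrite -splitr.
(* [B + B] and [C] bound velocity and acceleration; the term 2 and the second [C] serve the
   differences of velocities and of accelerations when the states are [D + D] apart. *)
pose K := B + B + C + C + 2; have K0 : 0 < K by rewrite /K; lra.
have KB : B + B <= K by rewrite /K; lra.
have KC : C <= K by rewrite /K; lra.
have KD1 D : 0 < D -> D + D <= K * D.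
  by move=> D0; rewrite -mulr2n -mulr_natl ler_pM2r// /K; lra.
have KD2 D : 0 < D -> C * (D + D) <= K * D.
  by move=> D0; rewrite -mulr2n -mulr_natl mulrA ler_pM2r// /K; lra.
pose m := Num.min r (Num.min B 1); have m0 : 0 < m by rewrite !lt_min r0 B0 ltr01.
have [mr mB m1] : [/\ m <= r, m <= B & m <= 1].
  by rewrite /m; split; rewrite !ge_min lexx ?orbT.
pose T := m / K; have T0 : 0 < T by rewrite divr_gt0.
have KT : K * T = m by rewrite mulrCA divff ?gt_eqF// mulr1.
pose S := chart_inv i @` [set u | `|u - u0| <= r2].
have SP p : S p -> chart_dom i p /\ `|chart i p - u0| <= r2.
  by move=> [u /= ur <-]; have [d ->] := chart_invP (Hr u ur).
have SP' p : chart_dom i p -> `|chart i p - u0| <= r2 -> S p.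
  by move=> d pr; exists (chart i p) => //; rewrite chartK.
have inb gam s t : `|chart i (gam s) - u0| <= r -> `|velocity i gam s| <= B ->
    `|state i gam t - state i gam s| <= m -> `|chart i (gam t) - u0| <= r2 /\ `|velocity i gam t| <= B + B.
  move=> s1 s2; rewrite /state sub_row_mx norm_row_mx_le => -[t1 t2]; split.
    by rewrite -rr; apply: (normB_le (le_trans t1 mr)).
  by apply: (normB_add _ s2); exact: le_trans t2 mB.
have stay gam s : geodesic h setT gam -> chart_dom i (gam s) -> `|chart i (gam s) - u0| <= r ->
      `|velocity i gam s| <= B -> forall t, s <= t <= s + T ->
      S (gam t) /\ `|state i gam t - state i gam s| <= K * (t - s).
  move=> g ds s1 s2; have cg := geodesicT_continuous g.
  apply: (@trapped R (n + n) (state i gam) (fun t => row_mx (velocity i gam t)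
     (acceleration h i (chart i (gam t)) (velocity i gam t))) s T K m (fun t => S (gam t))) => //.
  - by rewrite KT.
  - move=> t _ /SP[dt _] tm; have [h1 h2] := inb _ _ _ s1 s2 tm.
    split; first exact: state_derive.
    by apply/norm_row_mx_le; split; [exact: le_trans h2 KB|exact: le_trans (Hb _ _ h1 h2) KC].
  - by apply: SP' => //; rewrite -rr; apply: le_trans s1 _; rewrite lerDl ltW.
  - move=> t _ /SP[dt _] tm.
    have c1 : `|chart i (gam t) - u0| < r2.
      rewrite /state sub_row_mx in tm; have [t1 _] := (norm_row_mx_le _ _ _).1 (lexx `|row_mx
        (chart i (gam t) - chart i (gam s)) (velocity i gam t - velocity i gam s)|).
      have {}t1 := le_lt_trans t1 tm.
      rewrite -(subrKA (chart i (gam s))); apply: le_lt_trans (ler_normD _ _) _; rewrite -rr.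
      exact: ltr_leD (lt_le_trans t1 mr) s1.
    have /nearN[d1 d10 H1] := near_chart_dom (cg t) dt.
    have /continuousN/(_ (r2 - `|chart i (gam t) - u0|)) := is_derive_row_continuous (geodesicT_ode g dt).1.
    rewrite subr_gt0 => /(_ c1)[d2 d20 H2].
    exists (Num.min d1 d2); first by rewrite lt_min d10.
    move=> t' /andP[tt']; rewrite -ltrBlDl lt_min => /andP[td1 td2].
    apply: SP'; first by apply: H1; rewrite ger0_norm ?subr_ge0// ltW.
    have := H2 t'; rewrite ger0_norm ?subr_ge0 ?(ltW tt')// => /(_ td2) HX.
    by apply: le_trans (normB_le (ltW HX) (lexx `|chart i (gam t) - u0|)) _; rewrite subrK.
  move=> t /andP[st tT] H.
  have St : S (gam t).
    by apply: (closed_left_limit (closed_chart_ball Hr) st (cg t)) => x sx; exact: (H x sx).1.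
  split; [exact: St|exact: is_derive_row_continuous (state_derive g (SP _ St).1)].
exists r, T, K; split=> //; first by rewrite KT.
split; first by rewrite rr.
split.
  move=> gam s g ds s1 s2 t st; have [St tK] := stay gam s g ds s1 s2 t st.
  by split=> //; exact: (SP _ St).1.
move=> gam gam' s D g ds s1 s2 g' ds' s1' s2' D0 sD.
have KTm (gam0 : R -> M) t : s <= t <= s + T -> `|state i gam0 t - state i gam0 s| <= K * (t - s) ->
    `|state i gam0 t - state i gam0 s| <= m.
  by move=> /andP[st tT] H; apply: le_trans H _; rewrite -KT (ler_pM2l K0) lerBlDl.
have KD0 : 0 < K * D by rewrite mulr_gt0.
suff H : forall t, s <= t <= s + T -> True /\
    `|(state i gam t - state i gam' t) - (state i gam s - state i gam' s)| <= K * D * (t - s).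
  by move=> t st; have [] := H t st.
have dD t a : s <= t <= s + T ->
    is_derive t 1 (fun x => (state i gam x - state i gam' x) 0 a)
     ((row_mx (velocity i gam t) (acceleration h i (chart i (gam t)) (velocity i gam t)) -
       row_mx (velocity i gam' t) (acceleration h i (chart i (gam' t)) (velocity i gam' t))) 0 a).
  move=> st; have [St _] := stay gam s g ds s1 s2 t st; have [St' _] := stay gam' s g' ds' s1' s2' t st.
  have -> : (fun x => (state i gam x - state i gam' x) 0 a) =
     (fun x => state i gam x 0 a - state i gam' x 0 a) by apply/funext => x; exact: sub_row_coord.
  have d1 := state_derive g (SP _ St).1 a; have d2 := state_derive g' (SP _ St').1 a.
  by apply: is_derive_ext (is_deriveB d1 d2) _; rewrite [RHS]mxE [X in _ = _ + X]mxE.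
apply: (@trapped R (n + n) (fun t => state i gam t - state i gam' t)
  (fun t => row_mx (velocity i gam t) (acceleration h i (chart i (gam t)) (velocity i gam t)) -
       row_mx (velocity i gam' t) (acceleration h i (chart i (gam' t)) (velocity i gam' t)))
   s T (K * D) D (fun=> True) KD0 D0 _ _ I _ _).
- by rewrite mulrAC KT ler_piMl// ltW.
- move=> t st _ tD; split; first by move=> a; exact: dD.
  have [_ /(KTm gam t st)/(inb _ _ _ s1 s2)[a1 a2]] := stay gam s g ds s1 s2 t st.
  have [_ /(KTm gam' t st)/(inb _ _ _ s1' s2')[a1' a2']] := stay gam' s g' ds' s1' s2' t st.
  have : `|state i gam t - state i gam' t| <= D + D.
    rewrite -(subrK (state i gam s - state i gam' s) (state i gam t - state i gam' t)).
    by apply: le_trans (ler_normD _ _) _; exact: lerD.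
  rewrite /state sub_row_mx norm_row_mx_le => -[b1 b2].
  rewrite sub_row_mx norm_row_mx_le; split.
    exact: le_trans b2 (KD1 D D0).
  apply: le_trans (HC _ _ _ _ a1 a1' a2 a2') _.
  apply: le_trans (KD2 D D0); by rewrite ler_pM2l// ge_max b1 b2.
- by move=> t _ _ _; exists 1.
move=> t /andP[st tT] _; split; first exact: I.
apply: (@is_derive_row_continuous _ _ _ (fun a => (row_mx (velocity i gam t) (acceleration h i (chart i (gam t)) (velocity i gam t)) -
       row_mx (velocity i gam' t) (acceleration h i (chart i (gam' t)) (velocity i gam' t))) 0 a)) => a.
by apply: dD; rewrite tT ltW.
Qed.

Lemma is_derive_comp_affine (f : R -> R) (a c d t : R) : is_derive (c * t + d) 1 f a ->
  is_derive t 1 (fun s => f (c * s + d)) (c * a).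
Proof.
move=> H.
have D1 : is_derive t 1 (fun s : R => c * s + d) c.
  by have := is_derive_affine d c t; under eq_fun do rewrite addrC mulrC.
apply: is_derive_ext (@is_derive1_comp _ f (fun s : R => c * s + d) t a c H D1) _.
by rewrite mulrC.
Qed.

Lemma geodesic_affine gam (c d : R) : geodesic h setT gam ->
  geodesic h setT (fun t => gam (c * t + d)).
Proof.
move=> g; have cg := geodesicT_continuous g.
apply: geodesic_gluing; [exact: openT|by []|by exists 0|move=> t _].
have [i di] := chart_dom_cover (gam (c * t + d)).
have ca : {for t, continuous (fun s : R => gam (c * s + d))}.
  apply: (@continuous_comp _ _ _ (fun s : R => c * s + d) gam); last exact: cg.
  apply: continuousD; last exact: cst_continuous.
  by apply: continuousM; [exact: cst_continuous|exact: cvg_id].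
have /nearN[e e0 He] := near_chart_dom ca di.
pose J := [set s : R | `|s - t| < e]; have [oJ iJ J0] := ball_interval t e0.
exists J, (fun s => chart_inv i (chart i (gam (c * s + d)))).
split; last by move=> s Js; rewrite chartK//; exact: He.
  apply: (@local_geodesic _ _ _ h i J (fun s => chart i (gam (c * s + d)))
    (fun s => c *: velocity i gam (c * s + d))) => //.
  - by move=> s Js; apply: chart_image_chart; exact: He.
  - move=> s a Js; rewrite mxE.
    apply: (@is_derive_comp_affine (fun x => chart i (gam x) 0 a)).
    exact: (geodesicT_ode g (He s Js)).1.
  move=> s a Js.
  have -> : (fun x => (c *: velocity i gam (c * x + d)) 0 a) = fun x => c * velocity i gam (c * x + d) 0 a.
    by apply/funext => x; rewrite mxE.
  have := is_derive_mull c (@is_derive_comp_affine (fun x => velocity i gam x 0 a) _ c d s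
     ((geodesicT_ode g (He s Js)).2 a)).
  move=> H; apply: is_derive_ext H _; rewrite !mxE !mulrN; congr (- _).
  rewrite !mulr_sumr; apply: eq_bigr => b _; rewrite !mulr_sumr; apply: eq_bigr => k _.
  by rewrite !mxE; ring.
by rewrite /J /= subrr normr0.
Qed.

Lemma velocity_affine gam (c d : R) i t : geodesic h setT gam -> chart_dom i (gam (c * t + d)) ->
  velocity i (fun t => gam (c * t + d)) t = c *: velocity i gam (c * t + d).
Proof.
move=> g di; apply: derive1_row => a; rewrite mxE.
apply: (@is_derive_comp_affine (fun x => chart i (gam x) 0 a)).
exact: (geodesicT_ode g di).1.
Qed.

Lemma velocity_transition gam i j t : geodesic h setT gam -> chart_dom i (gam t) -> chart_dom j (gam t) ->
  velocity j gam t = velocity i gam t *m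
    (\matrix_(a, c) partial (fun y => transition i j y 0 c) a (chart i (gam t))).
Proof.
move=> g di dj; apply: derive1_row => a /=.
have ov : overlap i j (chart i (gam t)) by exists (gam t).
apply: (@near_eq_is_derive _ _ _ (fun s => transition i j (chart i (gam s)) 0 a)).
  near=> s; rewrite /transition chartK//; near: s.
  by apply: near_chart_dom di; exact: geodesicT_continuous.
apply: is_derive_ext (is_derive_comp_smooth (open_overlap (i := i) (j := j)) (transition_smooth (s := M) a) ov (geodesicT_ode g di).1) _.
by rewrite [RHS]mxE; apply: eq_bigr => c _; rewrite mxE.
Unshelve. all: by end_near. Qed.

(** The property continued in time is equality of points and of velocities in every chart around the
    point; by [velocity_transition] one chart suffices to establish it. It spreads to the right by
    the Lipschitz dependence in a flow box, and passes to left limits because [M] is Hausdorff and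
    velocities are continuous. *)
Lemma geodesic_unique_forward gam gam' i s : geodesic h setT gam -> geodesic h setT gam' ->
  chart_dom i (gam s) -> gam s = gam' s -> velocity i gam s = velocity i gam' s ->
  forall t, s <= t -> gam t = gam' t.
Proof.
move=> g g' di E Ev t st.
have cg := geodesicT_continuous g; have cg' := geodesicT_continuous g'.
pose P t := gam t = gam' t /\ forall j, chart_dom j (gam t) -> velocity j gam t = velocity j gam' t.
suff : P t by case.
have one j x : chart_dom j (gam x) -> gam x = gam' x -> velocity j gam x = velocity j gam' x -> P x.
  move=> dj Ex Evx; split; [exact: Ex|move=> k dk].
  have dj' : chart_dom j (gam' x) by rewrite -Ex.
  have dk' : chart_dom k (gam' x) by rewrite -Ex.
  by rewrite (velocity_transition g dj dk) (velocity_transition g' dj' dk') -Ex Evx.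
apply: (@real_induction _ P s t); last by rewrite st lexx.
- exact: one di E Ev.
- move=> x /andP[sx xt] HP; have [Ex Vx] : P x by apply: HP; rewrite sx lexx.
  have [j dj] := chart_dom_cover (gam x).
  have B0 : 0 < `|velocity j gam x| + 1 by rewrite ltr_wpDl.
  have [r [T [K [r0 T0 K0 KT [_ [Hs Hl]]]]]] := flow_box (chart_image_chart dj) B0.
  have dj' : chart_dom j (gam' x) by rewrite -Ex.
  have a1 : `|chart j (gam x) - chart j (gam x)| <= r by rewrite subrr normr0 ltW.
  have a1' : `|chart j (gam' x) - chart j (gam x)| <= r by rewrite -Ex.
  have a2 : `|velocity j gam x| <= `|velocity j gam x| + 1 by rewrite lerDl.
  have a2' : `|velocity j gam' x| <= `|velocity j gam x| + 1 by rewrite -Vx.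
  exists T; [exact: T0|move=> y /andP[xy yT]].
  have xyT : x <= y <= x + T by rewrite !ltW.
  have S0 : state j gam x - state j gam' x = 0 by rewrite /state Ex Vx// subrr.
  have S1 e : 0 < e -> `|state j gam x - state j gam' x| <= e by rewrite S0 normr0; exact: ltW.
  have Sy : state j gam y = state j gam' y.
    apply/eqP; rewrite -subr_eq0 -normr_le0; apply/ler_addgt0Pr => e e0; rewrite add0r.
    (* [flow_box] asks for a positive bound on the initial difference, which is 0 here; with this
       choice the resulting bound is at most [e]. *)
    have D0 : 0 < e / (K * T + 1) by exact: divr_gt0 e0 (addr_gt0 (mulr_gt0 K0 T0) ltr01).
    have H := normB_eq S0 (Hl gam gam' x _ g dj a1 a2 g' dj' a1' a2' D0 (S1 _ D0) y xyT); rewrite subr0 in H.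
    apply: le_trans H _; rewrite mulrAC mulrCA ger_pMr//.
    rewrite (ler_pdivrMr _ _ (addr_gt0 (mulr_gt0 K0 T0) ltr01)) mul1r.
    apply: (@le_trans _ _ (K * T)); last by rewrite lerDl.
    by rewrite (ler_pM2l K0) lerBlDl ltW.
  have [dy _] := Hs gam x g dj a1 a2 y xyT; have [dy' _] := Hs gam' x g' dj' a1' a2' y xyT.
  have /eq_row_mx[E1 E2] := Sy.
  by apply: (one j y dy _ E2); rewrite -(chartK dy) E1 (chartK dy').
move=> x /andP[sx xt] HP.
have Ex : gam x = gam' x.
  apply: (@carrier_hausdorff _ _ M) => A B nA nB.
  have /nearN[d1 d10 H1] := cg x A nA; have /nearN[d2 d20 H2] := cg' x B nB.
  pose y := Num.max s (x - Num.min d1 d2 / 2).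
  have m0 : 0 < Num.min d1 d2 by rewrite lt_min d10.
  have [m1 m2] : Num.min d1 d2 <= d1 /\ Num.min d1 d2 <= d2 by rewrite !ge_min !lexx orbT.
  have yx : y < x by rewrite gt_max sx; lra.
  have sy : s <= y by rewrite le_max lexx.
  have xy : x - Num.min d1 d2 / 2 <= y by rewrite le_max lexx orbT.
  have [Ey _] : P y by apply: HP; rewrite sy.
  exists (gam y); split; first by apply: H1; rewrite ler0_norm; lra.
  by rewrite Ey; apply: H2; rewrite ler0_norm; lra.
have [j dj] := chart_dom_cover (gam x).
apply: (one j x dj Ex).
have /nearN[d d0 Hd] := near_chart_dom (cg x) dj.
pose s' := Num.max s (x - d / 2).
have s'x : s' < x by rewrite gt_max sx; lra.
have ss' : s <= s' by rewrite le_max lexx.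
have xs' : x - d / 2 <= s' by rewrite le_max lexx orbT.
have cv : {for x, continuous (fun y => velocity j gam y - velocity j gam' y)}.
  have dj' : chart_dom j (gam' x) by rewrite -Ex.
  apply: continuousB; first exact: is_derive_row_continuous (geodesicT_ode g dj).2.
  exact: is_derive_row_continuous (geodesicT_ode g' dj').2.
have H : `|velocity j gam x - velocity j gam' x - 0| <= 0.
  apply: (closed_left_limit (closed_le_norm (c := 0 : 'rV[R]_n) (r := 0)) s'x cv) => y /andP[sy yx] /=.
  rewrite subr0; have [_ ->] : P y by apply: HP; rewrite yx (le_trans ss').
    by rewrite subrr normr0.
  by apply: Hd; rewrite ler0_norm; lra.
by apply/eqP; rewrite -subr_eq0 -normr_le0 -[X in `|X|]subr0.
Qed.

(** Reversing time by [geodesic_affine] with factor -1 reduces the past to the future. *)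
Lemma geodesic_unique gam gam' i s : geodesic h setT gam -> geodesic h setT gam' ->
  chart_dom i (gam s) -> gam s = gam' s -> velocity i gam s = velocity i gam' s -> gam = gam'.
Proof.
move=> g g' di E Ev; apply/funext => t.
have [st|ts] := leP s t; first exact: (geodesic_unique_forward g g' di E Ev st).
have r0 gam0 x : gam0 x = (fun y : R => gam0 (-1 * y + 0)) (- x) :> M.
  by congr gam0; rewrite mulN1r opprK addr0.
have rs : -1 * - s + 0 = s by rewrite mulN1r opprK addr0.
rewrite (r0 gam) (r0 gam').
have ga := geodesic_affine (-1) 0 g; have ga' := geodesic_affine (-1) 0 g'.
have d1 : chart_dom i (gam (-1 * - s + 0)) by rewrite rs.
have d1' : chart_dom i (gam' (-1 * - s + 0)) by rewrite rs -E.
have E1 : gam (-1 * - s + 0) = gam' (-1 * - s + 0) by rewrite rs.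
have Ev1 : velocity i (fun y : R => gam (-1 * y + 0)) (- s) = velocity i (fun y : R => gam' (-1 * y + 0)) (- s).
  by rewrite (velocity_affine g d1) (velocity_affine g' d1') rs Ev.
have ts1 : - s <= - t by rewrite lerN2 ltW.
exact: (geodesic_unique_forward ga ga' d1 E1 Ev1 ts1).
Qed.

End GlobalGeodesics.

Lemma nbhs_lt (R : realType) (V : normedModType R) (x : V) (d : R) : 0 < d ->
  nbhs x [set y | `|y - x| < d].
Proof. by move=> d0; apply: (nearN x (fun y => `|y - x| < d)).2; exists d. Qed.

Lemma max0_lip (R : realType) (a b : R) : `|Num.max 0 a - Num.max 0 b| <= `|a - b|.
Proof.
by rewrite /Num.max; case: ltP => h1; case: ltP => h2; rewrite ?subrr ?normr0//;
  rewrite ?sub0r ?subr0 ?normrN; rewrite ler_norml; have := ler_norm (a - b);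
  have := ler_norm (b - a); rewrite (distrC b) => ? ?; apply/andP; split; lra.
Qed.

(** * Continuity of the flow in the initial velocity and in time *)

Section FlowContinuity.
Context {R : realType} {n : nat} {M : smooth_manifold R n}.
Variables (h : riemannian_metric M) (G : 'rV[R]_n -> R -> M) (x : M) (i0 : chart_index M).
Hypothesis G_geodesic : forall v, geodesic h setT (G v).
Hypothesis G_start : forall v, G v 0 = x.
Hypothesis chart_x : chart_dom i0 x.
Hypothesis G_velocity : forall v, velocity i0 (G v) 0 = v.
Implicit Types (i j : chart_index M) (v : 'rV[R]_n).

Lemma rV_continuous (T : topologicalType) (m : nat) (z : T -> 'rV[R]_m) (t : T) :
  (forall a, {for t, continuous (fun s => z s 0 a)}) -> {for t, continuous z}.
Proof.
move=> H; apply/cvgrPdist_le => e e0; near=> s.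
apply/rV_normP => [|a]; first exact: ltW.
rewrite !mxE; move: a; near: s; apply: filter_forall => a.
by have /cvgrPdist_le/(_ e e0) := H a.
Unshelve. all: by end_near. Qed.

Lemma continuous_sumf (T : topologicalType) (m : nat) (F : 'I_m -> T -> R) (t : T) :
  (forall a, {for t, continuous (F a)}) -> {for t, continuous (fun s => \sum_(a < m) F a s)}.
Proof.
move=> H; rewrite (_ : (fun s => _) = \sum_(a < m) F a); last by apply/funext => s; rewrite fct_sumE.
apply: (big_ind (fun f : T -> R => {for t, continuous f})) => [|f g cf cg|a _].
- exact: cst_continuous.
- exact: continuousD cf cg.
exact: H.
Qed.

Let coord_cts (m : nat) (a : 'I_m) (z : 'rV[R]_m) : {for z, continuous (fun w : 'rV[R]_m => w 0 a)}.
Proof. exact: coord_continuous. Qed.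

(** Continuity at [v0] of the position and the velocity reached at time [t]. Velocities exist only
    in coordinates, so a chart is named; [good_change] allows it to be exchanged. *)
Let good i v0 (t : R) := [/\ chart_dom i (G v0 t), \forall v \near v0, chart_dom i (G v t) &
  {for v0, continuous (fun v => state i (G v) t)}].

Let good_change i j v0 (t : R) : good i v0 t -> chart_dom j (G v0 t) -> good j v0 t.
Proof.
move=> [di ni ci] dj.
pose Phi (z : 'rV[R]_(n + n)) : 'rV[R]_(n + n) := row_mx (transition i j (lsubmx z))
  (rsubmx z *m (\matrix_(a, c) partial (fun y => transition i j y 0 c) a (lsubmx z))).
have ov : overlap i j (chart i (G v0 t)) by exists (G v0 t).
have cl (z : 'rV[R]_(n + n)) : {for z, continuous (fun w : 'rV[R]_(n + n) => lsubmx w)}.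
  apply: rV_continuous => a; rewrite (_ : (fun s => _) = fun w : 'rV[R]_(n + n) => w 0 (lshift n a)).
    exact: coord_cts.
  by apply/funext => w; rewrite mxE.
have cc : {for v0, continuous (fun v => chart i (G v t))}.
  rewrite (_ : (fun v => _) = fun v => lsubmx (state i (G v) t)); last first.
    by apply/funext => v; rewrite row_mxKl.
  by apply: (@continuous_comp _ _ _ (fun v => state i (G v) t) lsubmx v0 ci); exact: cl.
have nov : \forall v \near v0, overlap i j (chart i (G v t)).
  by apply: (cc (overlap i j)); apply: open_nbhs_nbhs; split=> //; exact: open_overlap.
have nj : \forall v \near v0, chart_dom i (G v t) /\ chart_dom j (G v t).
  near=> v; have di' : chart_dom i (G v t) by near: v.
  split; first exact: di'.
  have : overlap i j (chart i (G v t)) by near: v.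
  by move=> /overlapP[_]; rewrite chartK.
split; [exact: dj|by near=> v; apply: (proj2 (_ : chart_dom i (G v t) /\ _)); near: v|].
apply: (@near_eq_continuous _ _ (fun v => Phi (state i (G v) t))).
  near=> v; have [di' dj'] : chart_dom i (G v t) /\ chart_dom j (G v t) by near: v.
  rewrite /Phi row_mxKl row_mxKr /state (velocity_transition (G_geodesic v) di' dj').
  by rewrite /transition chartK.
apply: (@continuous_comp _ _ _ (fun v => state i (G v) t) Phi v0 ci).
have l0 : lsubmx (state i (G v0) t) = chart i (G v0 t) by rewrite row_mxKl.
have csm f : smooth_on (overlap i j) f ->
    {for state i (G v0) t, continuous (fun w : 'rV[R]_(n + n) => f (lsubmx w))}.
  move=> sf; apply: (@continuous_comp _ _ _ (fun w : 'rV[R]_(n + n) => lsubmx w) f); first exact: cl.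
  by rewrite l0; exact: (sf [::] _ ov).1.
apply: rV_continuous => a; case: (split_ordP a) => b ->.
  rewrite (_ : (fun s => _) = fun w : 'rV[R]_(n + n) => transition i j (lsubmx w) 0 b); last first.
    by apply/funext => w; rewrite row_mxEl.
  by apply: (csm (fun y => transition i j y 0 b)); exact: transition_smooth.
rewrite (_ : (fun s => _) = fun w : 'rV[R]_(n + n) => \sum_(c < n) w 0 (rshift n c) *
    partial (fun y => transition i j y 0 b) c (lsubmx w)); last first.
  by apply/funext => w; rewrite row_mxEr mxE; apply: eq_bigr => c _; rewrite !mxE.
apply: continuous_sumf => c; apply: continuousM; first exact: coord_cts.
by apply: csm; apply: smooth_on_partial; exact: transition_smooth.
Unshelve. all: by end_near. Qed.

(** Continuity at [v0] uniformly over the times in [[y, y + T]]. The uniformity is what later yields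
    joint continuity in velocity and time. *)
Let flow_window k v0 (y T : R) := forall e : R, 0 < e -> exists2 d : R, 0 < d &
  forall v, `|v - v0| < d -> forall t, y <= t <= y + T ->
    chart_dom k (G v t) /\ `|state k (G v) t - state k (G v0) t| <= e.

Let window_good k v0 (y T t : R) : flow_window k v0 y T -> y <= t <= y + T -> good k v0 t.
Proof.
move=> W yt; have [d d0 H] := W 1 ltr01; split.
- by apply: (H v0 _ t yt).1; rewrite subrr normr0.
- by apply/nearN; exists d => // v vd; exact: (H v vd t yt).1.
apply/continuousN => e e0; have e20 : 0 < e / 2 by rewrite divr_gt0.
have [d' d'0 H'] := W _ e20; exists d' => // v vd.
apply: le_lt_trans (H' v vd t yt).2 _; by rewrite ltr_pdivrMr// ltr_pMr// ltr1n.
Qed.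

(* Around every parameter [t] there is a flow box, entered at an earlier time
   [y] as soon as the flow is known to be continuous at times before [t]. *)
Let window_exists v0 (t : R) (P : R -> Prop) : 0 <= t -> (forall s, P s -> exists i, good i v0 s) ->
  (forall s, 0 <= s < t -> P s) -> (t = 0 -> P 0) ->
  exists k y T, [/\ 0 < T, 0 <= y <= t, t < y + T, t = 0 \/ y < t & flow_window k v0 y T].
Proof.
move=> t0 HP Ps P0; have [k dk] := chart_dom_cover (G v0 t).
have B0 : 0 < `|velocity k (G v0) t| + 1 by rewrite ltr_wpDl.
have [r [T [K [r0 T0 K0 KT [_ [Hs Hl]]]]]] := flow_box h (chart_image_chart dk) B0.
have cG : {for t, continuous (G v0)} by exact: (geodesicT_continuous (G_geodesic v0)).
have nk := near_chart_dom cG dk.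
have [c1 c2] := geodesicT_ode (G_geodesic v0) dk.
have /continuousN/(_ r r0)[d1 d10 H1] := is_derive_row_continuous c1.
have /continuousN/(_ 1 ltr01)[d2 d20 H2] := is_derive_row_continuous c2.
have /nearN[d3 d30 H3] := nk.
have [y [yt Py Ty ty]] : exists y, [/\ 0 <= y <= t, P y, t - y < Num.min T (Num.min d1 (Num.min d2 d3)) & t = 0 \/ y < t].
  set m := Num.min _ _; have m0 : 0 < m by rewrite !lt_min T0 d10 d20.
  move: t0; rewrite le_eqVlt => /orP[/eqP E|t0].
    by exists 0; rewrite -E lexx subrr; split=> //; [exact: P0|left].
  exists (Num.max 0 (t - m / 2)).
  have [y1 y2] : 0 <= Num.max 0 (t - m / 2) /\ t - m / 2 <= Num.max 0 (t - m / 2) by rewrite !le_max !lexx orbT.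
  have y3 : Num.max 0 (t - m / 2) < t by rewrite gt_max t0; lra.
  by split; [rewrite y1 ltW|apply: Ps; rewrite y1|lra|right].
have /andP[y0 yt'] := yt.
move: Ty; rewrite !lt_min => /and4P[TT Td1 Td2 Td3].
have ny d : t - y < d -> `|y - t| < d by rewrite distrC ger0_norm// subr_ge0.
have gk : good k v0 y.
  by have [i gi] := HP y Py; apply: good_change gi _; exact: H3 (ny _ Td3).
have [dky nky cky] := gk.
have a1 : `|chart k (G v0 y) - chart k (G v0 t)| < r by exact: H1 (ny _ Td1).
have a2 : `|velocity k (G v0) y| < `|velocity k (G v0) t| + 1.
  rewrite -(subrK (velocity k (G v0) t) (velocity k (G v0) y)) addrC.
  apply: le_lt_trans (ler_normD _ _) _; rewrite addrC [ltRHS]addrC ltrD2r; exact: H2 (ny _ Td2).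
exists k, y, T; split=> //; first by rewrite -ltrBlDl.
move=> e e0.
pose D := Num.min (e / 2) (Num.min (r - `|chart k (G v0 y) - chart k (G v0 t)|)
   (`|velocity k (G v0) t| + 1 - `|velocity k (G v0) y|)).
have D0 : 0 < D by rewrite !lt_min divr_gt0//= !subr_gt0 a1 a2.
have [De Dr Dv] : [/\ D <= e / 2, D <= r - `|chart k (G v0 y) - chart k (G v0 t)| &
   D <= `|velocity k (G v0) t| + 1 - `|velocity k (G v0) y|] by rewrite /D; split; rewrite !ge_min lexx ?orbT.
have /continuousN/(_ D D0)[d4 d40 H4] := cky.
have /nearN[d5 d50 H5] := nky.
exists (Num.min d4 d5); first by rewrite lt_min d40.
move=> v; rewrite lt_min => /andP[v4 v5] s ys.
have dkv := H5 v v5; have sD := ltW (H4 v v4).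
have [b1 b2] : `|chart k (G v y) - chart k (G v0 y)| <= D /\ `|velocity k (G v) y - velocity k (G v0) y| <= D.
  by apply/norm_row_mx_le; rewrite -sub_row_mx.
have c3 : `|chart k (G v y) - chart k (G v0 t)| <= r.
  by apply: le_trans (normB_le b1 (lexx _)) _; rewrite -lerBrDr.
have c4 : `|velocity k (G v) y| <= `|velocity k (G v0) t| + 1.
  by apply: le_trans (normB_add b2 (lexx _)) _; rewrite -lerBrDr.
split; first exact: (Hs _ _ (G_geodesic v) dkv c3 c4 s ys).1.
have := Hl _ _ _ _ (G_geodesic v) dkv c3 c4 (G_geodesic v0) dky (ltW a1) (ltW a2) D0 sD s ys => H.
apply: le_trans (normB_add H sD) _.
rewrite (splitr e); apply: lerD => //; apply: le_trans De.
have KT1 : K * T <= 1 by apply: le_trans KT _; rewrite !ge_min lexx !orbT.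
rewrite mulrAC -[leRHS]mul1r ler_pM2r//; apply: le_trans KT1.
by rewrite ler_pM2l// lerBlDl; case/andP: ys.
Qed.

Let good_all v0 (t : R) : 0 <= t -> exists i, good i v0 t.
Proof.
move=> t0; pose P s := exists i, good i v0 s.
have P0 : P 0.
  exists i0; split; [by rewrite G_start|by near=> v; rewrite G_start|].
  rewrite (_ : (fun v => _) = fun v => row_mx (chart i0 x) v); last first.
    by apply/funext => v; rewrite /state G_start G_velocity.
  apply/continuousN => e e0; exists (e / 2); first by rewrite divr_gt0.
  move=> v ve; apply: (@le_lt_trans _ _ (e / 2)); last by rewrite ltr_pdivrMr// ltr_pMr// ltr1n.
  by rewrite sub_row_mx subrr; apply/norm_row_mx_le; rewrite normr0 !ltW// divr_gt0.
apply: (@real_induction _ P 0 t); last by rewrite t0 lexx.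
- exact: P0.
- move=> s /andP[s0 st] HP.
  have [r Hr|E|k [y [T [T0 /andP[y0 ys] sT _ W]]]] := @window_exists v0 s P s0 (fun s => id).
  + by apply: HP; case/andP: Hr => r0 rs; rewrite r0 ltW.
  + exact: P0.
  exists (y + T - s); first by rewrite subr_gt0.
  move=> r /andP[sr rT]; exists k; apply: (window_good W).
  by rewrite (le_trans ys (ltW sr)) /= ltW//; move: rT; rewrite addrC subrK.
move=> s /andP[s0 st] HP.
have [r Hr|E|k [y [T [T0 /andP[y0 ys] sT _ W]]]] := @window_exists v0 s P (ltW s0) (fun s => id).
- exact: HP.
- exact: P0.
by exists k; apply: (window_good W); rewrite ys ltW.
Unshelve. all: by end_near. Qed.

(** Over a window, closeness in [v] uniform in time is combined with continuity of the single
    geodesic [G v0]. The maximum with 0 makes the map total; for [t0 = 0] it moves nearby negative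
    times into the window, which then starts at 0. *)
Lemma flow_continuous v0 (t0 : R) : 0 <= t0 ->
  {for (v0, t0), continuous (fun p : 'rV[R]_n * R => G p.1 (Num.max 0 p.2))}.
Proof.
move=> t0_ge0.
have [k [y [T [T0 /andP[y0 yt] tT ty W]]]] := @window_exists v0 t0 (fun s => 0 <= s) t0_ge0
  (fun s s0 => good_all v0 s0) (fun s H => proj1 (andP H)) (fun _ => lexx 0).
have [dk nk ck] := window_good W (introT andP (conj yt (ltW tT))).
have max0 : Num.max 0 t0 = t0 by apply/max_idPr.
pose f (p : 'rV[R]_n * R) := chart k (G p.1 (Num.max 0 p.2)).
have ct : {for t0, continuous (fun t => chart k (G v0 t))}.
  exact: is_derive_row_continuous (geodesicT_ode (G_geodesic v0) dk).1.
have tb : \forall p \near (v0, t0), y <= Num.max 0 p.2 <= y + T.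
  have [d d0 Hd] : exists2 d : R, 0 < d & forall t, `|t - t0| < d -> y <= Num.max 0 t <= y + T.
    case: ty => [E|ty].
      exists T => // t; rewrite E subr0 => tT'.
      have y00 : y = 0 by apply/le_anti; rewrite y0 -E yt.
      rewrite y00 le_max lexx add0r /= ge_max (ltW T0) /=; apply: le_trans (ler_norm _) (ltW tT').
    exists (Num.min (t0 - y) (y + T - t0)); first by rewrite lt_min !subr_gt0 ty.
    move=> t; rewrite lt_min ltr_norml => /andP[/andP[h1 _]]; rewrite ltr_norml => /andP[_ h2].
    rewrite le_max ge_max; apply/andP; split; first by apply/orP; right; lra.
    by apply/andP; split; lra.
  exists ([set: 'rV[R]_n], [set t | `|t - t0| < d]).
    by split; [exact: filterT|exact: nbhs_lt].
  by move=> [v t] [_ /=]; exact: Hd.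
have nW e : 0 < e -> \forall p \near (v0, t0), chart_dom k (G p.1 (Num.max 0 p.2)) /\
    `|f p - chart k (G v0 (Num.max 0 p.2))| <= e.
  move=> e0; have [d d0 H] := W e e0.
  have nv : \forall p \near (v0, t0), `|p.1 - v0| < d.
    exists ([set v | `|v - v0| < d], setT); first by split; [exact: nbhs_lt|exact: filterT].
    by move=> [v t] [].
  near=> p; have pn : `|p.1 - v0| < d by near: p.
  have pt : y <= Num.max 0 p.2 <= y + T by near: p.
  have [h1 h2] := H p.1 pn _ pt.
  split; [exact: h1|apply: le_trans h2].
  have [h3 _] := (norm_row_mx_le _ _ _).1 (lexx `|row_mx (f p - chart k (G v0 (Num.max 0 p.2)))
    (velocity k (G p.1) (Num.max 0 p.2) - velocity k (G v0) (Num.max 0 p.2))|).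
  by rewrite /state sub_row_mx.
have cf : {for (v0, t0), continuous f}.
  apply/cvgrPdist_le => e e0; have e2 : 0 < e / 2 by rewrite divr_gt0.
  have /continuousN/(_ _ e2)[d d0 Hd] := ct.
  have nt : \forall p \near (v0, t0), `|p.2 - t0| < d.
    exists (setT, [set t | `|t - t0| < d]); first by split; [exact: filterT|exact: nbhs_lt].
    by move=> [v t] [].
  near=> p; rewrite distrC [e]splitr; apply: (@normB_le _ _ _ (chart k (G v0 (Num.max 0 p.2)))).
    by apply: (proj2 (_ : chart_dom k (G p.1 (Num.max 0 p.2)) /\ _)); near: p; exact: nW.
  rewrite /f /= max0; apply/ltW/Hd.
  have pd : `|p.2 - t0| < d by near: p.
  apply: le_lt_trans pd; rewrite -{1}max0.
  exact: max0_lip.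
apply: (@near_eq_continuous _ _ (fun p => chart_inv k (f p))).
  near=> p; rewrite /f chartK//.
  by apply: (proj1 (_ : _ /\ `|f p - chart k (G v0 (Num.max 0 p.2))| <= 1)); near: p; exact: nW.
apply: (@continuous_comp _ _ _ f (chart_inv k) (v0, t0) cf).
by apply: chart_inv_continuous_at; rewrite /f /= max0; exact: chart_image_chart.
Unshelve. all: by end_near. Qed.

End FlowContinuity.

(** * Metric norm, Gauss lemma and normal balls *)

Section MetricNorm.
Context {R : realType} {n : nat} {M : smooth_manifold R n}.
Variable h : riemannian_metric M.
Implicit Types (i j : chart_index M) (u v w : 'rV[R]_n).

Definition gdot i u v w : R := quad_form (metric_mx h i) u v w.
Definition gnorm i u v : R := Num.sqrt (gdot i u v v).

Lemma gdotE i u v w : gdot i u v w = (v *m metric_mx h i u *m w^T) 0 0.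
Proof. exact: quad_formE. Qed.

Lemma gdotC i u v w : chart_image i u -> gdot i u v w = gdot i u w v.
Proof.
move=> iu; rewrite !gdotE.
have -> : v *m metric_mx h i u *m w^T = (w *m metric_mx h i u *m v^T)^T.
  by rewrite !trmx_mul trmxK (metric_sym_at h iu) mulmxA.
by rewrite mxE.
Qed.

Lemma gdotDl i u v v' w : gdot i u (v + v') w = gdot i u v w + gdot i u v' w.
Proof. by rewrite !gdotE !mulmxDl mxE. Qed.

Lemma gdotDr i u v w w' : gdot i u v (w + w') = gdot i u v w + gdot i u v w'.
Proof. by rewrite !gdotE linearD mulmxDr mxE. Qed.

Lemma gdotZl i u (c : R) v w : gdot i u (c *: v) w = c * gdot i u v w.
Proof. by rewrite !gdotE -!scalemxAl mxE. Qed.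

Lemma gdotZr i u (c : R) v w : gdot i u v (c *: w) = c * gdot i u v w.
Proof. by rewrite !gdotE linearZ -scalemxAr mxE. Qed.

Lemma gdot_gt0 i u v : chart_image i u -> v != 0 -> 0 < gdot i u v v.
Proof. by move=> [p dp <-] v0; rewrite gdotE; exact: metric_posdef. Qed.

Lemma gdot_ge0 i u v : chart_image i u -> 0 <= gdot i u v v.
Proof.
move=> iu; have [->|v0] := eqVneq v 0; last exact/ltW/gdot_gt0.
by rewrite gdotE mul0mx mul0mx mxE.
Qed.

Lemma gnorm_sq i u v : chart_image i u -> gnorm i u v ^+ 2 = gdot i u v v.
Proof. by move=> iu; rewrite sqr_sqrtr// gdot_ge0. Qed.

Lemma gnorm_ge0 i u v : 0 <= gnorm i u v.
Proof. exact: sqrtr_ge0. Qed.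

Lemma gnormZ i u (c : R) v : gnorm i u (c *: v) = `|c| * gnorm i u v.
Proof. by rewrite /gnorm gdotZl gdotZr mulrA -expr2 sqrtrM ?sqr_ge0// sqrtr_sqr. Qed.

Lemma gnorm0 i u : gnorm i u 0 = 0.
Proof. by rewrite -(scale0r (0 : 'rV[R]_n)) gnormZ normr0 mul0r. Qed.

Lemma gnorm_gt0 i u v : chart_image i u -> v != 0 -> 0 < gnorm i u v.
Proof. by move=> iu v0; rewrite sqrtr_gt0 gdot_gt0. Qed.

Lemma gdot_sqr_le i u v w : chart_image i u -> gdot i u v w ^+ 2 <= gdot i u v v * gdot i u w w.
Proof.
move=> iu; have [->|w0] := eqVneq w 0.
  by rewrite !gdotE trmx0 !mulmx0 mxE expr0n mulr0.
have W := gdot_gt0 iu w0; set c := gdot i u v w.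
(* The component of [v] orthogonal to [w], multiplied by [gdot i u w w] to avoid a division. *)
have := gdot_ge0 (gdot i u w w *: v + (- c) *: w) iu.
rewrite gdotDl !gdotDr !gdotZl !gdotZr (gdotC w v iu) -/c => H.
by nra.
Qed.

Lemma gdot_le i u v w : chart_image i u -> gdot i u v w <= gnorm i u v * gnorm i u w.
Proof.
move=> iu; apply: le_trans (ler_norm _) _.
rewrite -(@ler_pXn2r _ 2)// ?nnegrE ?mulr_ge0 ?gnorm_ge0//.
by rewrite exprMn !gnorm_sq// real_normK ?num_real// gdot_sqr_le.
Qed.

Lemma gnormD i u v w : chart_image i u -> gnorm i u (v + w) <= gnorm i u v + gnorm i u w.
Proof.
move=> iu; rewrite -(@ler_pXn2r _ 2)// ?nnegrE ?addr_ge0 ?gnorm_ge0//.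
rewrite gnorm_sq// gdotDl !gdotDr sqrrD !gnorm_sq// (gdotC w v iu).
by have := gdot_le v w iu; lra.
Qed.

Lemma gnorm_parallelogram i u v w : chart_image i u ->
  gnorm i u (v + w) ^+ 2 + gnorm i u (v - w) ^+ 2 = 2 * gnorm i u v ^+ 2 + 2 * gnorm i u w ^+ 2.
Proof.
move=> iu; rewrite !gnorm_sq// -[- w]scaleN1r !gdotDl !gdotDr !gdotZl !gdotZr (gdotC w v iu); ring.
Qed.

Lemma gdot_transition i j u v w : overlap i j u ->
  gdot i u v w = gdot j (transition i j u)
     (v *m (\matrix_(a, c) partial (fun y => transition i j y 0 c) a u))
     (w *m (\matrix_(a, c) partial (fun y => transition i j y 0 c) a u)).
Proof. by move=> ov; rewrite !gdotE (metric_pullback h ov) trmx_mul !mulmxA. Qed.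

Lemma gdot_velocity gam i j t : geodesic h setT gam -> chart_dom i (gam t) -> chart_dom j (gam t) ->
  gdot i (chart i (gam t)) (velocity i gam t) (velocity i gam t) =
  gdot j (chart j (gam t)) (velocity j gam t) (velocity j gam t).
Proof.
move=> g di dj; have ov : overlap i j (chart i (gam t)) by exists (gam t).
by rewrite (gdot_transition _ _ ov) (velocity_transition g di dj) /transition chartK.
Qed.

Lemma momentum_gdot i u v w : chart_image i u ->
  \sum_(a < n) momentum (metric_mx h i) u v a * w 0 a = gdot i u v w.
Proof.
move=> iu; rewrite (gdotC v w iu) /gdot /quad_form; apply: eq_bigr => a _; rewrite mulr_suml.
by apply: eq_bigr => b _; rewrite mulrAC.
Qed.

Lemma geodesic_euler_lagrange gam i t : geodesic h setT gam -> chart_dom i (gam t) ->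
  euler_lagrange (metric_mx h i) (fun s => chart i (gam s)) (velocity i gam) t.
Proof.
move=> g di; have [d1 d2] := geodesicT_ode g di.
apply: (@euler_lagrangeP _ _ _ h i (fun s => chart i (gam s)) (velocity i gam) _ t (chart_image_chart di) d1 d2).2 => k.
by rewrite mxE addNr.
Qed.

(** The energy is differentiated in two ways. Written as momentum paired with velocity it has
    derivative [A + B] by Euler-Lagrange; the product rule on the metric entries gives
    [2 * A + 2 * B]. Hence [A + B] is 0. *)
Lemma energy_derive0 gam i t : geodesic h setT gam -> chart_dom i (gam t) ->
  is_derive t 1 (fun s => gdot i (chart i (gam s)) (velocity i gam s) (velocity i gam s)) 0.
Proof.
move=> g di; have iu := chart_image_chart di; have [d1 d2] := geodesicT_ode g di.
have EL := geodesic_euler_lagrange g di.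
set u := chart i (gam t); set v := velocity i gam t; set w := acceleration h i u v in d2.
pose A := \sum_(a < n) energy_grad (metric_mx h i) u v a * v 0 a.
pose B := \sum_(a < n) momentum (metric_mx h i) u v a * w 0 a.
have D1 : is_derive t 1 (fun s => gdot i (chart i (gam s)) (velocity i gam s) (velocity i gam s)) (A + B).
  apply: (@near_eq_is_derive _ _ _ (fun s => \sum_(a < n) momentum (metric_mx h i) (chart i (gam s)) (velocity i gam s) a * velocity i gam s 0 a)).
    have cg : {for t, continuous gam} by exact: (geodesicT_continuous g).
    near=> s; rewrite momentum_gdot//; apply: chart_image_chart; near: s; exact: near_chart_dom di.
  apply: is_derive_ext (is_derive_sumf (fun a => is_deriveM_ (EL a) (d2 a))) _.
  by rewrite big_split.
have D2 : is_derive t 1 (fun s => gdot i (chart i (gam s)) (velocity i gam s) (velocity i gam s)) (2 * A + 2 * B).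
  have dg a b := is_derive_comp_smooth (@chart_image_open _ _ M i) (@metric_smooth_at _ _ _ h i a b) iu d1.
  apply: is_derive_ext (is_derive_sumf (fun a => is_derive_sumf (fun b =>
    is_deriveM_ (is_deriveM_ (dg a b) (d2 a)) (d2 b)))) _.
  have -> : 2 * B = \sum_(a < n) \sum_(b < n) metric_mx h i u a b * w 0 a * v 0 b +
     \sum_(a < n) \sum_(b < n) metric_mx h i u a b * v 0 a * w 0 b.
    rewrite /B momentum_gdot// -/(quad_form (metric_mx h i) u w v) -/(quad_form (metric_mx h i) u v w).
    by rewrite -!/(gdot _ _ _ _) (gdotC w v iu); ring.
  have -> : 2 * A = \sum_(a < n) \sum_(b < n) (\sum_(c < n) v 0 c * partial (fun y => metric_mx h i y a b) c u) * v 0 a * v 0 b.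
    rewrite /A mulr_sumr /energy_grad.
    under eq_bigr do rewrite -mulrA mulVKf ?pnatr_eq0// mulr_suml.
    rewrite exchange_big /=; apply: eq_bigr => a _.
    under eq_bigr do rewrite mulr_suml.
    rewrite exchange_big /=; apply: eq_bigr => b _.
    rewrite !mulr_suml; apply: eq_bigr => c _; ring.
  rewrite -!big_split /=; apply: eq_bigr => a _; rewrite -!big_split /=; apply: eq_bigr => b _.
  by rewrite -/u -/v; ring.
have := is_derive_unique D1 D2 => E.
by apply: is_derive_ext D1 _; lra.
Unshelve. all: by end_near. Qed.

Lemma speed_constant gam i j s t : geodesic h setT gam -> chart_dom i (gam s) -> chart_dom j (gam t) ->
  gdot i (chart i (gam s)) (velocity i gam s) (velocity i gam s) =
  gdot j (chart j (gam t)) (velocity j gam t) (velocity j gam t).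
Proof.
move=> g di dj.
(* A chart is picked for each time separately; by [gdot_velocity] the value of [F] does not depend
   on the pick, so near each time [F] may be differentiated in one fixed chart. *)
pose ch r := projT1 (cid (chart_dom_cover (gam r))).
have chP r : chart_dom (ch r) (gam r) by rewrite /ch; case: cid.
pose F r := gdot (ch r) (chart (ch r) (gam r)) (velocity (ch r) gam r) (velocity (ch r) gam r).
have FE r k : chart_dom k (gam r) -> gdot k (chart k (gam r)) (velocity k gam r) (velocity k gam r) = F r.
  by move=> dk; rewrite /F; exact: gdot_velocity.
have dF (r : R) : is_derive r 1 F 0.
  apply: near_eq_is_derive (energy_derive0 g (chP r)).
  have cg : {for r, continuous gam} by exact: (geodesicT_continuous g).
  near=> y; apply: FE; near: y; exact: near_chart_dom (chP r).
have cst a b : a <= b -> F a = F b.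
  move=> ab; apply/eqP; rewrite eq_sym -subr_eq0 -normr_le0.
  have := @MVT_bound _ F (fun=> 0) a b 0 ab (fun r _ => dF r).
  by rewrite mul0r; apply => r _; rewrite normr0.
rewrite (FE s i di) (FE t j dj); have [st|ts] := leP s t; [exact: (cst s t st)|symmetry; exact: (cst t s (ltW ts))].
Unshelve. all: by end_near. Qed.

Lemma speed_gnorm gam i j s t : geodesic h setT gam -> chart_dom i (gam s) -> chart_dom j (gam t) ->
  gnorm i (chart i (gam s)) (velocity i gam s) = gnorm j (chart j (gam t)) (velocity j gam t).
Proof. by move=> g di dj; rewrite /gnorm (speed_constant g di dj). Qed.

(** Comparison of the metric norm with the coordinate norm, and of metric norms at neighbouring
    points. All constants come from bounds on the entries of the metric and of its inverse; the
    factor [1 + C * |u - u'|] tends to 1, which is what the cutting of corners requires. *)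
Lemma metric_bounds i u0 : chart_image i u0 -> exists r C : R, [/\ 0 < r, 1 <= C,
  forall u, `|u - u0| <= r -> chart_image i u,
  forall u v, `|u - u0| <= r -> gnorm i u v <= C * `|v| /\ `|v| <= C * gnorm i u v &
  forall u u' v, `|u - u0| <= r -> `|u' - u0| <= r -> gnorm i u v <= (1 + C * `|u - u'|) * gnorm i u' v].
Proof.
move=> iu; have oU := @chart_image_open _ _ M i.
have [r1 r10 Hr1] := open_ball_sub oU iu.
have [||r2 [C2 [r20 C20 H2]]] := @fin_uniform R ('I_n * 'I_n)%type (fun ab r C =>
    lip_bounded (fun u => metric_mx h i u ab.1 ab.2) u0 r C).
- by move=> ab r r' C C' _ rr CC; exact: lip_boundedW.
- by move=> [a b]; apply: (smooth_lip_bounded oU iu); exact: metric_smooth_at.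
have [||r3 [C3 [r30 C30 H3]]] := @fin_uniform R ('I_n * 'I_n)%type (fun ab r C =>
    lip_bounded (fun u => invmx (metric_mx h i u) ab.1 ab.2) u0 r C).
- by move=> ab r r' C C' _ rr CC; exact: lip_boundedW.
- move=> [a b]; apply: (smooth_lip_bounded oU iu); apply: smooth_invmx => //.
    by move=> u; exact: metric_unit.
  by move=> c d; exact: metric_smooth_at.
pose r := Num.min r1 (Num.min r2 r3).
have n0 : 0 <= n%:R :> R by rewrite ler0n.
pose A := n%:R * (n%:R * C2) : R; have A0 : 0 <= A by rewrite !mulr_ge0// ltW.
pose D := C3 + 1 : R.
pose C := (A + 1) * (D * D) + A + D + 1.
have D1 : 1 <= D by rewrite /D; lra.
have DD : 1 <= D * D by nra.
have C1 : 1 <= C by rewrite /C; nra.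
have AC : A + 1 <= C by rewrite /C; nra.
have DC : D <= C by rewrite /C; nra.
have ADC : A * (D * D) <= C by rewrite /C; nra.
exists r, C.
have sub u : `|u - u0| <= r -> [/\ chart_image i u, `|u - u0| <= r2 & `|u - u0| <= r3].
  by rewrite !le_min => /and3P[a b c]; split=> //; exact: Hr1.
have up u v : `|u - u0| <= r -> gdot i u v v <= A * `|v| ^+ 2.
  move=> /sub[_ u2 _]; apply: le_trans (ler_norm _) _.
  rewrite /A -!mulrA; apply: norm_sum_le => a; apply: norm_sum_le => b; rewrite !normrM expr2 -mulrA.
  apply: ler_pM; rewrite ?mulr_ge0//; first exact: ((H2 (a, b)).1 u u2).
  by apply: ler_pM => //; exact: coord_norm.
have low u v : `|u - u0| <= r -> `|v| <= D * gnorm i u v.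
  move=> ur; have [iu' _ u3] := sub u ur.
  apply/rV_normP => [|a]; first by rewrite mulr_ge0 ?gnorm_ge0//; lra.
  (* [w] represents the [a]-th coordinate functional with respect to the metric, so Cauchy-Schwarz
     bounds that coordinate of [v] by its metric norm and a diagonal entry of the inverse matrix. *)
  pose w := delta_mx 0 a *m invmx (metric_mx h i u) : 'rV[R]_n.
  have gu := metric_unit h iu'; have gs := metric_sym_at h iu'.
  have gw : metric_mx h i u *m w^T = (delta_mx 0 a : 'rV[R]_n)^T.
    by rewrite -{1}gs -trmx_mul /w mulmxKV.
  have E1 : gdot i u v w = v 0 a by rewrite gdotE -mulmxA gw trmx_delta -colE mxE.
  have E2 : gdot i u w w = invmx (metric_mx h i u) a a.
    by rewrite gdotE -mulmxA gw trmx_delta -colE mxE /w -rowE mxE.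
  have := gdot_sqr_le v w iu'; rewrite E1 E2 -gnorm_sq// => H.
  have b3 : invmx (metric_mx h i u) a a <= C3 by apply: le_trans (ler_norm _) _; exact: ((H3 (a, a)).1 u u3).
  rewrite -(@ler_pXn2r _ 2)// ?nnegrE ?mulr_ge0 ?gnorm_ge0//; last by lra.
  rewrite real_normK ?num_real// exprMn; apply: le_trans H _.
  rewrite mulrC; apply: ler_wpM2r; first exact: sqr_ge0.
  by apply: le_trans b3 _; rewrite expr2 /D; nra.
split=> //.
- by rewrite !lt_min r10 r20.
- by move=> u /sub[].
- move=> u v ur; split; last first.
    by apply: le_trans (low u v ur) _; apply: ler_wpM2r; rewrite ?gnorm_ge0.
  have [iu' _ _] := sub u ur.
  rewrite -(@ler_pXn2r _ 2)// ?nnegrE ?mulr_ge0 ?gnorm_ge0//; last by lra.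
  rewrite gnorm_sq// exprMn; apply: le_trans (up u v ur) _.
  by apply: ler_wpM2r; rewrite ?sqr_ge0// expr2; nra.
move=> u u' v ur ur'; have [iu1 u2 _] := sub u ur; have [iu1' u2' _] := sub u' ur'.
have cc : 0 <= C * `|u - u'| by rewrite mulr_ge0//; lra.
rewrite -(@ler_pXn2r _ 2)// ?nnegrE ?mulr_ge0 ?gnorm_ge0//; last by lra.
have dif : gdot i u v v - gdot i u' v v <= A * (`|u - u'| * `|v| ^+ 2).
  apply: le_trans (ler_norm _) _; rewrite -sumrB /A -2!mulrA; apply: norm_sum_le => a.
  rewrite -sumrB; apply: norm_sum_le => b; rewrite -!mulrBl !normrM expr2.
  have -> : C2 * (`|u - u'| * (`|v| * `|v|)) = C2 * `|u - u'| * `|v| * `|v| by ring.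
  apply: ler_pM; rewrite ?mulr_ge0//; last exact: coord_norm.
  by apply: ler_pM => //; [exact: ((H2 (a, b)).2 u' u u2' u2)|exact: coord_norm].
have lw := low u' v ur'.
have lw2 : `|v| ^+ 2 <= D * D * gnorm i u' v ^+ 2.
  by rewrite -expr2 -exprMn ler_pXn2r// nnegrE// mulr_ge0 ?gnorm_ge0//; lra.
rewrite gnorm_sq// exprMn gnorm_sq//.
have -> : gdot i u v v = gdot i u' v v + (gdot i u v v - gdot i u' v v) by ring.
apply: (@le_trans _ _ (gdot i u' v v + C * `|u - u'| * gdot i u' v v)).
  rewrite lerD2l; apply: le_trans dif _; rewrite -gnorm_sq//.
  apply: (@le_trans _ _ (A * (`|u - u'| * (D * D * gnorm i u' v ^+ 2)))).
    by apply: ler_wpM2l => //; apply: ler_wpM2l.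
  have -> : A * (`|u - u'| * (D * D * gnorm i u' v ^+ 2)) = A * (D * D) * (`|u - u'| * gnorm i u' v ^+ 2) by ring.
  by rewrite -[leRHS]mulrA; apply: ler_wpM2r; [rewrite mulr_ge0// sqr_ge0|exact: ADC].
have g0 := gdot_ge0 v iu1'.
rewrite -{1}[gdot i u' v v]mul1r -mulrDl; apply: ler_wpM2r => //.
by rewrite expr2 ler_peMr ?lerDl// addr_ge0.
Qed.

End MetricNorm.

(** * Taylor expansion of the energy and the Gauss estimate *)

Section GaussEstimate.
Context {R : realType} {n : nat} {M : smooth_manifold R n}.
Variable h : riemannian_metric M.

(** The linear part is twice the differential of the kinetic energy in position and velocity. Along
    a geodesic, Euler-Lagrange makes this same expression twice the derivative of the pairing of its
    momentum with the displacement to another geodesic. The remainder is uniform for velocities up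
    to [B]. *)
Lemma energy_taylor i u0 (B : R) : chart_image i u0 -> 0 < B -> exists r C : R, [/\ 0 < r, 0 < C,
  forall u, `|u - u0| <= r -> chart_image i u &
  forall u u' v v' m, `|u - u0| <= r -> `|u' - u0| <= r -> `|v| <= B -> `|v'| <= B ->
    `|u' - u| <= m -> `|v' - v| <= m ->
    `|gdot h i u' v' v' - gdot h i u v v - 2 * \sum_(a < n)
       (energy_grad (metric_mx h i) u v a * (u' - u) 0 a + momentum (metric_mx h i) u v a * (v' - v) 0 a)|
    <= C * m ^+ 2].
Proof.
move=> iu B0; have oU := @chart_image_open _ _ M i.
have [r1 r10 Hr1] := open_ball_sub oU iu.
have [||r2 [C2 [r20 C20 H2]]] := @fin_uniform R ('I_n * 'I_n)%type (fun ab r C =>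
    lip_bounded (fun u => metric_mx h i u ab.1 ab.2) u0 r C).
- by move=> ab r r' C C' _ rr CC; exact: lip_boundedW.
- by move=> [a b]; apply: (smooth_lip_bounded oU iu); exact: metric_smooth_at.
have [||r3 [C3 [r30 C30 H3]]] := @fin_uniform R ('I_n * 'I_n * 'I_n)%type (fun abc r C =>
    lip_bounded (partial (fun u => metric_mx h i u abc.1.1 abc.1.2) abc.2) u0 r C).
- by move=> ab r r' C C' _ rr CC; exact: lip_boundedW.
- move=> [[a b] c]; apply: (smooth_lip_bounded oU iu); apply: smooth_on_partial; exact: metric_smooth_at.
pose r := Num.min r1 (Num.min r2 r3).
pose c := n%:R * C3 * B * B + n%:R * C3 * (B + B) + C2 : R.
have n0 : 0 <= n%:R :> R by rewrite ler0n.
have nC : 0 <= n%:R * C3 by rewrite mulr_ge0// ltW.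
have c0 : 0 < c.
  rewrite /c ltr_wpDl// addr_ge0// ?mulr_ge0//; lra.
exists r, (n%:R * (n%:R * c) + 1).
have sub u : `|u - u0| <= r -> [/\ chart_image i u, `|u - u0| <= r1, `|u - u0| <= r2 & `|u - u0| <= r3].
  by rewrite !le_min => /and3P[a b d]; split=> //; exact: Hr1.
split.
- by rewrite !lt_min r10 r20.
- by rewrite ltr_wpDl// !mulr_ge0// ltW.
- by move=> u /sub[].
move=> u u' v v' m ur ur' vB vB' um vm; have [iu1 _ u2 u3] := sub u ur.
have m0 : 0 <= m by apply: le_trans um.
set g := metric_mx h i; set d := v' - v.
pose L a b := \sum_(k < n) (u' 0 k - u 0 k) * partial (fun y => g y a b) k u.
pose T a b := g u' a b * v' 0 a * v' 0 b - g u a b * v 0 a * v 0 b -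
   (L a b * v 0 a * v 0 b + (g u a b * v 0 a * d 0 b + g u a b * d 0 a * v 0 b)).
have Tb a b : `|T a b| <= c * m ^+ 2.
  pose rho := g u' a b - g u a b - L a b.
  have -> : T a b = rho * (v' 0 a * v' 0 b) + L a b * (v' 0 a * d 0 b + d 0 a * v 0 b) + g u a b * (d 0 a * d 0 b).
    by rewrite /T /rho /d !mxE; ring.
  have cb (w : 'rV[R]_n) k : `|w| <= B -> `|w 0 k| <= B by apply: le_trans; exact: coord_norm.
  have db k : `|d 0 k| <= m by apply: le_trans (coord_norm _ _) vm.
  have rb : `|rho| <= n%:R * (C3 * m ^+ 2).
    apply: (@le_trans _ _ (n%:R * (C3 * `|u' - u| ^+ 2))); last first.
      apply: ler_wpM2l => //; apply: ler_wpM2l; first exact: ltW.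
      by rewrite !expr2; apply: ler_pM.
    apply: (@taylor_ball _ _ (fun y => g y a b) u0 r C3) => //.
    - move=> w k wr; have := @metric_smooth_at _ _ _ h i a b; move=> /smooth_onP/(_ 1%N)[_ /(_ k)[+ _]]; apply.
      by have [] := sub w wr.
    - move=> w w' k wr wr'; have [_ _ _ w3] := sub w wr; have [_ _ _ w3'] := sub w' wr'.
      exact: ((H3 (a, b, k)).2 w w' w3 w3').
    - exact: ltW.
  have Lb : `|L a b| <= n%:R * (m * C3).
    apply: norm_sum_le => k; rewrite normrM; apply: ler_pM => //; last exact: ((H3 (a, b, k)).1 u u3).
    by apply: le_trans um; have := coord_norm (u' - u) k; rewrite !mxE.
  have gb : `|g u a b| <= C2 by exact: ((H2 (a, b)).1 u u2).
  have e1 : `|rho * (v' 0 a * v' 0 b)| <= n%:R * (C3 * m ^+ 2) * (B * B).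
    by rewrite !normrM; apply: ler_pM; rewrite ?mulr_ge0// ler_pM// cb.
  have e2 : `|L a b * (v' 0 a * d 0 b + d 0 a * v 0 b)| <= n%:R * (m * C3) * (B * m + m * B).
    rewrite normrM; apply: ler_pM => //; apply: le_trans (ler_normD _ _) _.
    by rewrite !normrM lerD// ler_pM// cb.
  have e3 : `|g u a b * (d 0 a * d 0 b)| <= C2 * (m * m).
    by rewrite !normrM; apply: ler_pM; rewrite ?mulr_ge0// ler_pM.
  apply: le_trans (ler_normD _ _) _.
  apply: (@le_trans _ _ (n%:R * (C3 * m ^+ 2) * (B * B) + n%:R * (m * C3) * (B * m + m * B) + C2 * (m * m))).
    apply: lerD e3; apply: le_trans (ler_normD _ _) _; exact: lerD.
  by rewrite le_eqVlt; apply/orP; left; apply/eqP; rewrite /c; ring.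
have -> : gdot h i u' v' v' - gdot h i u v v - 2 * \sum_(a < n)
       (energy_grad g u v a * (u' - u) 0 a + momentum g u v a * (v' - v) 0 a) = \sum_(a < n) \sum_(b < n) T a b.
  rewrite big_split /= momentum_gdot// -/d.
  have -> : \sum_(a < n) energy_grad g u v a * (u' - u) 0 a = 2^-1 * \sum_(a < n) \sum_(b < n) L a b * v 0 a * v 0 b.
    rewrite /energy_grad; under eq_bigr do rewrite -mulrA mulr_suml.
    rewrite -mulr_sumr; congr (_ * _); rewrite exchange_big /=; apply: eq_bigr => a _.
    under eq_bigr do rewrite mulr_suml.
    rewrite exchange_big /=; apply: eq_bigr => b _; rewrite /L !mulr_suml.
    by apply: eq_bigr => k _; rewrite !mxE; ring.
  rewrite mulrDr mulVKf ?pnatr_eq0//.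
  have -> : 2 * gdot h i u v d = gdot h i u v d + gdot h i u d v by rewrite (gdotC h v d iu1); ring.
  rewrite /gdot /quad_form -!big_split /= -!sumrB; apply: eq_bigr => a _.
  by rewrite -!big_split /= -!sumrB; apply: eq_bigr => b _; rewrite /T -/g.
apply: (@le_trans _ _ (n%:R * (n%:R * (c * m ^+ 2)))).
  by apply: norm_sum_le => a; apply: norm_sum_le => b.
by rewrite [leRHS]mulrDl mul1r -!mulrA lerDl sqr_ge0.
Qed.

(* The derivative of [sum_a p_a D_a], with [p] the momentum of [gam] and [D]
   the difference of positions, is the first variation of the energy, which is
   the (constant) difference of the energies up to second order. *)
Lemma gauss_estimate i u0 (B : R) : chart_image i u0 -> 0 < B -> exists r C : R, [/\ 0 < r, 0 < C &
  forall gam gam' (T m : R), geodesic h setT gam -> geodesic h setT gam' -> gam 0 = gam' 0 -> 0 <= T ->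
   (forall t : R, 0 <= t <= T -> [/\ chart_dom i (gam t), `|chart i (gam t) - u0| <= r & `|velocity i gam t| <= B]) ->
   (forall t : R, 0 <= t <= T -> [/\ chart_dom i (gam' t), `|chart i (gam' t) - u0| <= r & `|velocity i gam' t| <= B]) ->
   (forall t : R, 0 <= t <= T -> `|chart i (gam' t) - chart i (gam t)| <= m /\
      `|velocity i gam' t - velocity i gam t| <= m) ->
   `|2 * gdot h i (chart i (gam T)) (velocity i gam T) (chart i (gam' T) - chart i (gam T)) -
     T * (gdot h i (chart i (gam 0)) (velocity i gam' 0) (velocity i gam' 0) -
          gdot h i (chart i (gam 0)) (velocity i gam 0) (velocity i gam 0))| <= C * m ^+ 2 * T].
Proof.
move=> iu B0; have [r [C [r0 C0 ri Ht]]] := energy_taylor iu B0.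
exists r, C; split=> // gam gam' T m g g' e0 T0 b b' bm.
have T00 : 0 <= (0 : R) <= T by rewrite lexx.
have TT : 0 <= T <= T by rewrite lexx T0.
have [d0 _ _] := b 0 T00; have [d0' _ _] := b' 0 T00.
set E := gdot h i _ (velocity i gam' 0) _ - _.
pose G := metric_mx h i.
pose F (t : R) := 2 * \sum_(a < n) momentum G (chart i (gam t)) (velocity i gam t) a *
   (chart i (gam' t) 0 a - chart i (gam t) 0 a) - t * E.
pose dF (t : R) := 2 * \sum_(a < n) (energy_grad G (chart i (gam t)) (velocity i gam t) a * (chart i (gam' t) - chart i (gam t)) 0 a +
   momentum G (chart i (gam t)) (velocity i gam t) a * (velocity i gam' t - velocity i gam t) 0 a) - E.
have dFP (t : R) : 0 <= t <= T -> is_derive t 1 F (dF t).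
  move=> tT; have [di _ _] := b t tT; have [di' _ _] := b' t tT.
  have EL := geodesic_euler_lagrange g di; have [x1 _] := geodesicT_ode g di; have [x1' _] := geodesicT_ode g' di'.
  have db a : is_derive t 1 (fun s => chart i (gam' s) 0 a - chart i (gam s) 0 a) (velocity i gam' t 0 a - velocity i gam t 0 a).
    by have := x1 a; have := x1' a => h1 h2; exact: is_deriveB.
  have D1 := is_derive_mull 2 (is_derive_sumf (fun a => is_deriveM_ (EL a) (db a))).
  have D2 := is_derive_mulr E (is_derive_id t 1).
  apply: is_derive_ext (is_deriveB D1 D2) _.
  rewrite /dF mul1r; congr (_ * _ - _); apply: eq_bigr => a _.
  by rewrite !mxE.
have dFb (t : R) : 0 <= t <= T -> `|dF t| <= C * m ^+ 2.
  move=> tT; have [di tr tB] := b t tT; have [di' tr' tB'] := b' t tT; have [m1 m2] := bm t tT.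
  have := Ht _ _ _ _ m tr tr' tB tB' m1 m2.
  (* Constancy of speed replaces the energies at time [t] by those at time 0, so the comparison term
     is the constant [E]. *)
  rewrite (speed_constant g di d0) (speed_constant g' di' d0') -e0 -/E.
  by rewrite distrC.
have := MVT_bound T0 dFP dFb; rewrite subr0.
have -> : F 0 = 0.
  rewrite /F mul0r subr0 -e0 big1 ?mulr0// => a _; by rewrite subrr mulr0.
rewrite subr0 /F -(momentum_gdot h _ _ (chart_image_chart (let: And3 d _ _ := b T TT in d))).
by have -> : \sum_(a < n) momentum G (chart i (gam T)) (velocity i gam T) a * (chart i (gam' T) 0 a - chart i (gam T) 0 a) =
  \sum_(a < n) momentum G (chart i (gam T)) (velocity i gam T) a * (chart i (gam' T) - chart i (gam T)) 0 a
  by apply: eq_bigr => a _; rewrite !mxE.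
Qed.

End GaussEstimate.

Lemma shooting_arith {R : realType} (x z : R) : x <= z / 4 + z -> z <= z / 4 + x -> x <= 2 * z /\ z <= 2 * x.
Proof. by move=> h1 h2; split; lra. Qed.

(** In the application [l * a] and [l * b] are the values of [F] at two points, [N] and [y] the
    metric and coordinate norms of their difference, and [gd] its product with the final velocity of
    the first geodesic. The hypothesis with [C3] is the Gauss estimate. The conclusion rests on
    [2 * p * (q - p) <= q ^+ 2 - p ^+ 2]. *)
Lemma eikonal_arith {R : realType} (l a b N y C C3 m gd : R) : 0 <= l -> 0 <= C -> 0 <= C3 -> 0 <= m ->
  l * m <= 4 * y -> - (C3 * m ^+ 2 * l) <= 2 * gd - l * (b ^+ 2 - a ^+ 2) -> gd <= a * N ->
  l * a * (l * b - l * a) <= l * a * N + (2 * C + 32 * C3) * y ^+ 2.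
Proof.
move=> l0 C0 C30 m0 lm H cs.
have lm2 : l ^+ 2 * m ^+ 2 <= 16 * y ^+ 2.
  by have := ler_pM (mulr_ge0 l0 m0) (mulr_ge0 l0 m0) lm lm; lra.
have E1 : l * (b ^+ 2 - a ^+ 2) <= 2 * (a * N) + C3 * m ^+ 2 * l by lra.
have E2 : l * l * (b ^+ 2 - a ^+ 2) <= 2 * (l * a * N) + C3 * (16 * y ^+ 2).
  apply: le_trans (_ : l * (2 * (a * N) + C3 * m ^+ 2 * l) <= _).
    by rewrite -mulrA; apply: ler_wpM2l.
  by have := ler_wpM2l C30 lm2; rewrite mulrDr => E3; lra.
have E3 : 0 <= (l * b - l * a) ^+ 2 by exact: sqr_ge0.
have E4 : 0 <= C * y ^+ 2 by rewrite mulr_ge0 ?sqr_ge0.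
have E5 : 0 <= C3 * y ^+ 2 by rewrite mulr_ge0 ?sqr_ge0.
by lra.
Qed.

(** * Normal balls *)

Section NormalBall.
Context {R : realType} {n : nat} {M : smooth_manifold R n}.
Variable h : riemannian_metric M.
Variables (i : chart_index M) (q : M) (G : 'rV[R]_n -> R -> M).
Hypothesis chart_q : chart_dom i q.
Hypothesis G_geodesic : forall v, geodesic h setT (G v).
Hypothesis G_start : forall v, G v 0 = q.
Hypothesis G_velocity : forall v, velocity i (G v) 0 = v.
Let u0 := chart i q.
Let iu0 : chart_image i u0 := chart_image_chart chart_q.

Lemma exponential_zero t : G 0 t = q.
Proof.
have g0 := geodesic_affine 0 0 (G_geodesic 0).
have d0 : chart_dom i (G 0 (0 * 0 + 0)) by rewrite mul0r addr0 G_start.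
have dG : chart_dom i (G 0 0) by rewrite G_start.
have E := geodesic_unique (G_geodesic 0) g0 dG.
rewrite E; first by rewrite mul0r addr0 G_start.
  by rewrite mul0r addr0.
by rewrite (velocity_affine (G_geodesic 0) d0) scale0r G_velocity.
Qed.

(** A quantitative form of the fact that the exponential map has the identity as derivative at 0: in
    coordinates the endpoint at time [t] is [t *: w] up to an error with Lipschitz constant [t / 4].
    The error is found by integrating the difference of velocities given by [flow_box], for times
    with [K * t <= 4^-1]. *)
Lemma shooting (B e : R) : 0 < B -> 0 < e -> exists2 h0 : R, 0 < h0 & forall t : R, 0 <= t <= h0 ->
  (forall w, `|w| <= B -> [/\ chart_dom i (G w t), `|chart i (G w t) - u0| <= e & `|velocity i (G w) t| <= B + B]) /\
  (forall w w', `|w| <= B -> `|w'| <= B ->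
     `|(chart i (G w t) - chart i (G w' t)) - t *: (w - w')| <= t * `|w - w'| / 4 /\
     `|velocity i (G w) t - velocity i (G w') t| <= 2 * `|w - w'|).
Proof.
move=> B0 e0; have [r [T [K [r0 T0 K0 KT [ri [fb1 fb2]]]]]] := flow_box h iu0 B0.
pose h0 := Num.min T (Num.min (4^-1 / K) (Num.min (e / K) (B / K))).
have h00 : 0 < h0 by rewrite !lt_min T0 !divr_gt0.
have hK (t : R) : 0 <= t <= h0 -> [/\ t <= T, K * t <= 4^-1, K * t <= e & K * t <= B].
  by rewrite !le_min !ler_pdivlMr// ![t * K]mulrC => /and5P[].
have sb w (t : R) : `|w| <= B -> 0 <= t <= h0 -> chart_dom i (G w t) /\ `|state i (G w) t - state i (G w) 0| <= K * t.
  move=> wB t0; have [tT _ _ _] := hK t t0.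
  have := fb1 (G w) 0 (G_geodesic w); rewrite G_start subrr normr0 G_velocity => /(_ chart_q (ltW r0) wB t).
  by rewrite subr0 add0r tT andbT; apply; case/andP: t0.
have vb w w' (t : R) : `|w| <= B -> `|w'| <= B -> 0 <= t <= h0 ->
   `|velocity i (G w) t - velocity i (G w') t - (w - w')| <= K * `|w - w'| * t.
  move=> wB wB' t0; have [tT _ _ _] := hK t t0.
  have [->|ww] := eqVneq w w'; first by rewrite !subrr normr0 mulr0 mul0r.
  have D0 : 0 < `|w - w'| by rewrite normr_gt0 subr_eq0.
  have := fb2 (G w) (G w') 0 `|w - w'| (G_geodesic w).
  rewrite !G_start subrr normr0 !G_velocity => /(_ chart_q (ltW r0) wB (G_geodesic w') chart_q (ltW r0) wB' D0).
  have E0 : state i (G w) 0 - state i (G w') 0 = row_mx 0 (w - w').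
    by rewrite /state sub_row_mx !G_start subrr !G_velocity.
  have E : `|state i (G w) 0 - state i (G w') 0| <= `|w - w'| by rewrite E0; apply/norm_row_mx_le; rewrite normr0.
  have tI : 0 <= t <= 0 + T by rewrite add0r tT andbT; case/andP: t0.
  move=> /(_ E t tI)/(normB_eq E0); rewrite subr0.
  by rewrite /state 2!sub_row_mx => /norm_row_mx_le[].
exists h0 => // t t0; have [tT K4 Ke KB] := hK t t0; split.
  move=> w wB; have [d s] := sb w t wB t0; split=> //.
    by move: s; rewrite /state sub_row_mx => /norm_row_mx_le[+ _]; rewrite G_start => /le_trans; apply.
  move: s; rewrite /state sub_row_mx G_velocity => /norm_row_mx_le[_ s].
  by rewrite -[velocity i (G w) t](subrK w); apply: le_trans (ler_normD _ _) _; apply: lerD => //; exact: le_trans s KB.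
move=> w w' wB wB'; set D := `|w - w'|; have D0 : 0 <= D by exact: normr_ge0.
have t1 : 0 <= t by case/andP: t0.
split.
  apply/rV_normP => [|a]; first by rewrite !mulr_ge0.
  rewrite !mxE.
  pose f (s : R) := chart i (G w s) 0 a - chart i (G w' s) 0 a - s * (w 0 a - w' 0 a).
  pose df (s : R) := velocity i (G w) s 0 a - velocity i (G w') s 0 a - (w 0 a - w' 0 a).
  have st (s : R) : 0 <= s <= t -> 0 <= s <= h0.
    by case/andP => -> /= st; apply: le_trans st _; case/andP: t0.
  have dfP (s : R) : 0 <= s <= t -> is_derive s 1 f (df s).
    move=> /st s0; have [d1 _] := sb w s wB s0; have [d2 _] := sb w' s wB' s0.
    have [x1 _] := geodesicT_ode (G_geodesic w) d1; have [x2 _] := geodesicT_ode (G_geodesic w') d2.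
    apply: is_derive_ext (is_deriveB (is_deriveB (x1 a) (x2 a)) (is_derive_mulr (w 0 a - w' 0 a) (is_derive_id s 1))) _.
    by rewrite mul1r.
  have dfb (s : R) : 0 <= s <= t -> `|df s| <= K * D * t.
    move=> s0; apply: (@le_trans _ _ (K * D * s)); last first.
      by apply: ler_wpM2l; [exact: mulr_ge0 (ltW K0) D0|case/andP: s0].
    by apply: le_trans (vb w w' s wB wB' (st s s0)); have := coord_norm (velocity i (G w) s - velocity i (G w') s - (w - w')) a; rewrite !mxE.
  have := MVT_bound t1 dfP dfb.
  rewrite /f mul0r !subr0 !G_start subrr subr0 => H; apply: le_trans H _.
  have -> : K * D * t * t = t * D * (K * t) by ring.
  by apply: ler_wpM2l => //; rewrite mulr_ge0.
rewrite -[X in `|X|](subrK (w - w')); apply: le_trans (ler_normD _ _) _.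
rewrite -/D; apply: (@le_trans _ _ (D * (K * t) + D)).
  by rewrite lerD2r mulrCA mulrA; exact: vb.
by have := ler_wpM2l D0 K4; lra.
Qed.

(** A simplified Newton iteration: [psi] corrects [w] by the miss distance divided by [s]. It
    contracts by 1/4, and maps the ball of radius [B] to itself because 0 is moved by at most
    [B / 2]. The solution is its fixed point. *)
Lemma shooting_surjective (B s : R) u : 0 < B -> 0 < s -> `|u - u0| <= s * B / 2 ->
  (forall w w', `|w| <= B -> `|w'| <= B ->
     `|(chart i (G w s) - chart i (G w' s)) - s *: (w - w')| <= s * `|w - w'| / 4) ->
  exists2 w, `|w| <= B & chart i (G w s) = u.
Proof.
move=> B0 s0 us lip.
pose U := [set w : 'rV[R]_n | `|w| <= B].
pose psi w := w - s^-1 *: (chart i (G w s) - u).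
have pl w w' : U w -> U w' -> `|psi w - psi w'| <= 4^-1 * `|w - w'|.
  move=> wB wB'.
  have -> : psi w - psi w' = - s^-1 *: (chart i (G w s) - chart i (G w' s) - s *: (w - w')).
    apply/rowP => a; rewrite !mxE; field; exact: lt0r_neq0.
  rewrite normrZ normrN gtr0_norm ?invr_gt0// mulrC ler_pdivrMr//.
  by apply: le_trans (lip w w' wB wB') _; rewrite le_eqVlt; apply/orP; left; apply/eqP; ring.
have U0 : U 0 by rewrite /U /= normr0 ltW.
have pU w : U w -> U (psi w).
  move=> wB; have := pl w 0 wB U0; rewrite subr0 => H.
  have p0 : `|psi 0| <= B / 2.
    rewrite /psi exponential_zero -/u0 sub0r normrN normrZ gtr0_norm ?invr_gt0// mulrC ler_pdivrMr// distrC.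
    by apply: le_trans us _; rewrite le_eqVlt; apply/orP; left; apply/eqP; ring.
  rewrite /U /= -[psi w](subrK (psi 0)); apply: le_trans (ler_normD _ _) _.
  have : `|w| <= B by [].
  by move: `|w| `|psi 0| `|psi w - psi 0| H p0 => x y z; lra.
pose X : completeNormedModType R := HB.pack_for (completeNormedModType R) 'rV[R]_n.
pose f : {fun (U : set X) >-> (U : set X)} := mkfun pU.
have [|||w wB wE] := @banach_fixed_point R X U f.
- exists 4^-1%:nng; split; first by rewrite /= invf_lt1// ltr1n.
  by move=> [x y] [/= Ux Uy]; exact: pl.
- have := @closed_le_norm R 'rV[R]_n 0 B; under eq_set do rewrite subr0; exact.
- by exists 0.
exists w => //; move: wE; rewrite /f /= /psi => /esym/eqP; rewrite -subr_eq0 addrAC subrr sub0r oppr_eq0.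
by rewrite scaler_eq0 invr_eq0 (gt_eqF s0) /= subr_eq0 => /eqP.
Qed.

(* [F] is the distance to [q] in normal coordinates; the fourth condition is
   the upper half of the eikonal equation for [F]. *)
Lemma normal_ball (e : R) : 0 < e -> exists (rho l C : R) (F : 'rV[R]_n -> R),
  [/\ [/\ 0 < rho, rho <= e, 0 < l, l <= e & forall u, `|u - u0| <= rho -> chart_image i u],
   [/\ F u0 = 0, forall u, 0 <= F u & forall u, `|u - u0| = rho -> l < F u],
   forall u u', `|u - u0| <= rho -> `|u' - u0| <= rho -> `|F u - F u'| <= C * `|u - u'|,
   forall u u', `|u - u0| <= rho -> `|u' - u0| <= rho ->
      F u * (F u' - F u) <= F u * gnorm h i u (u' - u) + C * `|u' - u| ^+ 2 &
   (forall w (t : R), gnorm h i u0 w = 1 -> 0 <= t <= l -> chart_dom i (G w t) /\ `|chart i (G w t) - u0| < rho) /\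
   forall u, `|u - u0| <= rho -> F u <= l ->
     (F u = 0 -> u = u0) /\
     (0 < F u -> exists w, gnorm h i u0 w = 1 /\ chart i (G w (F u)) = u)].
Proof.
move=> e0.
have [r1 [C [r10 C1 r1i mb1 _]]] := metric_bounds h iu0.
have C0 : 0 < C by apply: lt_le_trans C1.
pose B := 8 * C; have B0 : 0 < B by rewrite mulr_gt0.
have [r3 [C3 [r30 C30 ge]]] := gauss_estimate h iu0 (addr_gt0 B0 B0).
have re0 : 0 < Num.min r1 r3 by rewrite lt_min r10.
have [h0 h00 sh] := shooting B0 re0.
pose l := Num.min (Num.min h0 1) (Num.min e (Num.min e r1 / (4 * C))).
have l0 : 0 < l by rewrite !lt_min h00 ltr01 e0 divr_gt0 ?mulr_gt0// lt_min e0.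
have [lh l1 le lr] : [/\ l <= h0, l <= 1, l <= e & 4 * C * l <= Num.min e r1].
  split; last by rewrite mulrC -ler_pdivlMr ?mulr_gt0// /l !ge_min lexx !orbT.
  - by rewrite /l !ge_min lexx.
  - by rewrite /l !ge_min lexx orbT.
  - by rewrite /l !ge_min lexx !orbT.
have l00 : 0 <= l by exact: ltW.
have lI (t : R) : 0 <= t <= l -> 0 <= t <= h0 by case/andP => -> /= tl; exact: le_trans tl lh.
have lT : 0 <= l <= l by rewrite l00 lexx.
(* [rho] is [l * B / 2], the radius covered by [shooting_surjective] at time [l]. Geodesics with
   unit initial vector get at most [2 * C * l] away from the centre by time [l], hence stay inside;
   on the boundary the initial vector has metric norm at least 2, so that [F] exceeds [l] there. *)
pose rho := 4 * C * l; have rho0 : 0 < rho by rewrite !mulr_gt0.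
have [rhoe rhor] : rho <= e /\ rho <= r1 by move: lr; rewrite le_min => /andP[].
have surj u : `|u - u0| <= rho -> exists2 w, `|w| <= B & chart i (G w l) = u.
  move=> ur; apply: (shooting_surjective B0 l0) => [|w w' wB wB'].
    by apply: le_trans ur _; rewrite /rho /B le_eqVlt; apply/orP; left; apply/eqP; field.
  by have [_ /(_ w w' wB wB')[]] := sh l (lI l lT).
pose W u := if pselect (`|u - u0| <= rho) is left p then s2val (cid2 (surj u p)) else 0.
have WP u : `|u - u0| <= rho -> `|W u| <= B /\ chart i (G (W u) l) = u.
  by move=> p; rewrite /W; case: pselect => // p'; case: cid2.
have B00 : `|0 : 'rV[R]_n| <= B by rewrite normr0 ltW.
have diff (t : R) w w' : 0 <= t <= l -> `|w| <= B -> `|w'| <= B ->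
  `|chart i (G w t) - chart i (G w' t)| <= 2 * (t * `|w - w'|) /\ t * `|w - w'| <= 2 * `|chart i (G w t) - chart i (G w' t)|.
  move=> tl wB wB'; have [_ /(_ w w' wB wB')[H _]] := sh t (lI t tl).
  have t0 : 0 <= t by case/andP: tl.
  have E : `|t *: (w - w')| = t * `|w - w'| by rewrite normrZ ger0_norm.
  have H1 := normB_add H (lexx _); rewrite E in H1.
  rewrite distrC in H; have H2 := normB_add H (lexx _); rewrite E in H2.
  exact: shooting_arith H1 H2.
have W0 : W u0 = 0.
  have uu0 : `|u0 - u0| <= rho by rewrite subrr normr0 ltW.
  have [WB WE] := WP u0 uu0; have [_] := diff l (W u0) 0 lT WB B00.
  rewrite WE exponential_zero subrr normr0 mulr0 subr0 pmulr_rle0// normr_le0 => /eqP //.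
(* The length of the geodesic from the centre that reaches [u] at time [l]. Outside the ball [W] has
   the default value 0. *)
pose F u := l * gnorm h i u0 (W u).
have u00 : `|u0 - u0| <= r1 by rewrite subrr normr0 ltW.
have gB v : gnorm h i u0 v <= C * `|v| by exact: (mb1 u0 v u00).1.
have Bg v : `|v| <= C * gnorm h i u0 v by exact: (mb1 u0 v u00).2.
have F0 u : 0 <= F u by rewrite mulr_ge0// gnorm_ge0.
have Wlip u u' : `|u - u0| <= rho -> `|u' - u0| <= rho -> l * `|W u - W u'| <= 2 * `|u - u'|.
  move=> ur ur'; have [WB WE] := WP u ur; have [WB' WE'] := WP u' ur'.
  by have [_] := diff l _ _ lT WB WB'; rewrite WE WE'.
exists rho, l, (2 * C + 32 * C3), F; split.
- by split=> // u ur; apply: r1i; exact: le_trans ur rhor.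
- split=> //; first by rewrite /F W0 gnorm0 mulr0.
  move=> u ur; have ur' : `|u - u0| <= rho by rewrite ur.
  have [WB WE] := WP u ur'; have [+ _] := diff l _ _ lT WB B00.
  rewrite exponential_zero subr0 WE -/u0 ur => H.
  rewrite /F -[X in X < _]mulr1 ltr_pM2l//.
  have H2 : 2 * C <= `|W u|.
    rewrite -(ler_pM2l l0); move: H; rewrite /rho; move: `|W u| => y; lra.
  have := le_trans H2 (Bg (W u)); rewrite mulrC ler_pM2l// => H3.
  by apply: lt_le_trans H3; rewrite ltr1n.
- move=> u u' ur ur'; rewrite /F -mulrBr normrM gtr0_norm//.
  apply: (@le_trans _ _ (2 * C * `|u - u'|)); last by apply: ler_wpM2r; rewrite ?lerDl ?mulr_ge0// ltW.
  have H : `|gnorm h i u0 (W u) - gnorm h i u0 (W u')| <= C * `|W u - W u'|.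
    rewrite ler_norml; apply/andP; split.
      rewrite lerNl opprB lerBlDr; apply: (@le_trans _ _ (gnorm h i u0 (W u' - W u) + gnorm h i u0 (W u))).
        by rewrite -{1}[W u'](subrK (W u)); exact: gnormD.
      by rewrite lerD2r distrC.
    rewrite lerBlDr; apply: (@le_trans _ _ (gnorm h i u0 (W u - W u') + gnorm h i u0 (W u'))).
      by rewrite -{1}[W u](subrK (W u')); exact: gnormD.
    by rewrite lerD2r.
  apply: (@le_trans _ _ (l * (C * `|W u - W u'|))); first by apply: ler_wpM2l.
  by rewrite mulrCA [2 * C]mulrC -mulrA; apply: ler_wpM2l; [exact: ltW|exact: Wlip].
- move=> u u' ur ur'; have [WB WE] := WP u ur; have [WB' WE'] := WP u' ur'.
  pose m := 2 * `|W u' - W u|.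
  have bd w (t : R) : `|w| <= B -> 0 <= t <= l ->
    [/\ chart_dom i (G w t), `|chart i (G w t) - u0| <= r3 & `|velocity i (G w) t| <= B + B].
    move=> wB tl; have [/(_ w wB)[a b c] _] := sh t (lI t tl); split=> //.
    by apply: le_trans b _; rewrite ge_min lexx orbT.
  have mm (t : R) : 0 <= t <= l -> `|chart i (G (W u') t) - chart i (G (W u) t)| <= m /\
      `|velocity i (G (W u')) t - velocity i (G (W u)) t| <= m.
    move=> tl; split; last by have [_ /(_ _ _ WB' WB)[]] := sh t (lI t tl).
    have [] := diff t _ _ tl WB' WB => d1 _; apply: le_trans d1 _; rewrite /m; apply: ler_wpM2l => //.
    by rewrite ler_piMl//; case/andP: tl => _ tl; exact: le_trans tl l1.
  have e00 : G (W u) 0 = G (W u') 0 by rewrite !G_start.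
  have H := @ge (G (W u)) (G (W u')) l m (G_geodesic _) (G_geodesic _) e00 l00 (fun t => bd _ t WB) (fun t => bd _ t WB') mm.
  rewrite G_start !G_velocity WE WE' in H.
  have iu : chart_image i u by apply: r1i; exact: le_trans ur rhor.
  have [dl _ _] := bd _ l WB lT.
  have dq : chart_dom i (G (W u) 0) by rewrite G_start.
  have sp := speed_gnorm (G_geodesic (W u)) dl dq.
  rewrite WE G_start -/u0 G_velocity in sp.
  have cs := gdot_le h (velocity i (G (W u)) l) (u' - u) iu; rewrite sp in cs.
  rewrite -/u0 -!(gnorm_sq h _ iu0) in H.
  have lm : l * m <= 4 * `|u' - u|.
    by have := Wlip u' u ur' ur; rewrite /m; move: `|W u' - W u| `|u' - u| => x y; lra.
  have m0 : 0 <= m by rewrite /m mulr_ge0.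
  move: H; rewrite ler_norml => /andP[H _].
  exact: eikonal_arith l00 (ltW C0) (ltW C30) m0 lm H cs.
- split.
    move=> w t w1 tl; have wC : `|w| <= C by have := Bg w; rewrite w1 mulr1.
    have wB : `|w| <= B by apply: le_trans wC _; rewrite /B; lra.
    have [/(_ w wB)[d _ _] _] := sh t (lI t tl); split=> //.
    have [+ _] := diff t w 0 tl wB B00; rewrite exponential_zero subr0 -/u0 => H.
    apply: le_lt_trans H _; rewrite /rho.
    have : t * `|w| <= l * C by case/andP: tl => t0 tl; apply: ler_pM.
    have : 0 < l * C by rewrite mulr_gt0.
    by move: (t * `|w|) => y; lra.
  move=> u ur Fl; have [WB WE] := WP u ur; split.
    move=> /eqP; rewrite /F mulf_eq0 (gt_eqF l0) /= => /eqP g0.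
    have W00 : W u = 0 by apply/eqP; rewrite -normr_le0; apply: le_trans (Bg (W u)) _; rewrite g0 mulr0.
    by rewrite -WE W00 exponential_zero.
  move=> Fp; have g0 : 0 < gnorm h i u0 (W u) by move: Fp; rewrite /F pmulr_rgt0.
  set N := gnorm h i u0 (W u) in g0.
  have N1 : N <= 1 by move: Fl; rewrite /F -/N -{2}[l]mulr1 ler_pM2l.
  (* Normalising the velocity multiplies the arrival time [l] by [N], and [l * N] is [F u]. *)
  exists (N^-1 *: W u).
  have EG t : G (N^-1 *: W u) t = G (W u) (N^-1 * t + 0).
    have ga := geodesic_affine N^-1 0 (G_geodesic (W u)).
    have d0 : chart_dom i (G (W u) (N^-1 * 0 + 0)) by rewrite mulr0 addr0 G_start.
    have dG : chart_dom i (G (N^-1 *: W u) 0) by rewrite G_start.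
    have e0' : G (N^-1 *: W u) 0 = G (W u) (N^-1 * 0 + 0) by rewrite mulr0 addr0 !G_start.
    have v0' : velocity i (G (N^-1 *: W u)) 0 = velocity i (fun t => G (W u) (N^-1 * t + 0)) 0.
      by rewrite (velocity_affine (G_geodesic _) d0) mulr0 addr0 !G_velocity.
    exact: (f_equal (fun k => k t) (geodesic_unique (G_geodesic (N^-1 *: W u)) ga dG e0' v0')).
  split; first by rewrite gnormZ gtr0_norm ?invr_gt0// mulVf// gt_eqF.
  have FN : N^-1 * F u = l by rewrite /F mulrCA mulVf ?mulr1// gt_eqF.
  by rewrite EG FN addr0.
Qed.

End NormalBall.

(** * Homotopies of paths *)

Section ContinuityRules.
Context {R : realType} {X : topologicalType}.
Implicit Types (f g : X -> R).

Lemma contD f g : continuous f -> continuous g -> continuous (fun x => f x + g x).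
Proof. by move=> cf cg x; exact: (@continuousD _ _ _ f g x (cf x) (cg x)). Qed.

Lemma contB f g : continuous f -> continuous g -> continuous (fun x => f x - g x).
Proof. by move=> cf cg x; exact: (@continuousB _ _ _ f g x (cf x) (cg x)). Qed.

Lemma contM f g : continuous f -> continuous g -> continuous (fun x => f x * g x).
Proof. by move=> cf cg x; exact: (@continuousM _ _ f g x (cf x) (cg x)). Qed.

Lemma contmin f g : continuous f -> continuous g -> continuous (fun x => Num.min (f x) (g x)).
Proof. by move=> cf cg x; exact: (@continuous_min _ _ f g x (cf x) (cg x)). Qed.

Lemma contmax f g : continuous f -> continuous g -> continuous (fun x => Num.max (f x) (g x)).
Proof. by move=> cf cg x; exact: (@continuous_max _ _ f g x (cf x) (cg x)). Qed.

Lemma contcst (Y : topologicalType) (y : Y) : continuous (fun _ : X => y).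
Proof. exact: cst_continuous. Qed.

Lemma contid : continuous (fun x : X => x).
Proof. by move=> x; exact: cvg_id. Qed.

Lemma contcomp (Y Z : topologicalType) (k : Y -> Z) (f : X -> Y) :
  continuous k -> continuous f -> continuous (fun x => k (f x)).
Proof. by move=> ck cf x; apply: (@continuous_comp _ _ _ f k); [exact: cf|exact: ck]. Qed.

Lemma contpair (Y Z : topologicalType) (f : X -> Y) (k : X -> Z) :
  continuous f -> continuous k -> continuous (fun x => (f x, k x)).
Proof. by move=> cf ck x; apply: cvg_pair; [exact: cf|exact: ck]. Qed.

Lemma glue_continuous (T : topologicalType) (phi : X -> R) (A B : X -> T) :
  continuous phi -> continuous A -> continuous B -> (forall x, phi x = 0 -> A x = B x) ->
  continuous (fun x => if phi x <= 0 then A x else B x).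
Proof.
move=> cp cA cB AB x; have [px|px|px] := ltgtP (phi x) 0.
- have near1 : \forall y \near x, A y = if phi y <= 0 then A y else B y.
    near=> y; rewrite ifT//; apply/ltW; near: y; exact: (cp x _ (lt_nbhsl px)).
  exact: near_eq_continuous near1 (cA x).
- have near1 : \forall y \near x, B y = if phi y <= 0 then A y else B y.
    near=> y; rewrite ifF//; apply/negbTE; rewrite -ltNge; near: y; exact: (cp x _ (lt_nbhsr px)).
  exact: near_eq_continuous near1 (cB x).
- move=> S; rewrite px lexx => nS.
  have nA : \forall y \near x, S (A y) by exact: cA.
  have nB : \forall y \near x, S (B y) by apply: cB; rewrite -AB.
  apply: filterS2 nA nB => y Ay By; rewrite /preimage /=; case: (_ <= _); [exact: Ay|exact: By].
Unshelve. all: by end_near. Qed.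

End ContinuityRules.

Lemma contfst (X Y : topologicalType) : continuous (fun p : X * Y => p.1).
Proof. by move=> p; exact: cvg_fst. Qed.

Lemma contsnd (X Y : topologicalType) : continuous (fun p : X * Y => p.2).
Proof. by move=> p; exact: cvg_snd. Qed.

Section Clamp01.
Context {R : realType}.

Definition clamp01 (s : R) : R := Num.max 0 (Num.min s 1).

Lemma clamp01_itv s : 0 <= clamp01 s <= 1.
Proof. by rewrite /clamp01 le_max lexx/= ge_max ler01 ge_min lexx orbT. Qed.

Lemma clamp01_id s : 0 <= s <= 1 -> clamp01 s = s.
Proof. by move=> /andP[s0 s1]; rewrite /clamp01 (min_idPl s1) (max_idPr s0). Qed.

Lemma clamp01_continuous : continuous clamp01.
Proof.
exact: (@contmax _ _ (fun=> 0) _ (@contcst _ _ _) (@contmin _ _ (fun x => x) (fun=> 1) (@contid _) (@contcst _ _ _))).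
Qed.

End Clamp01.

Ltac compc k := refine (@contcomp _ _ _ k _ _ _).

Ltac cont := repeat first [ assumption | lazymatch goal with
  | |- continuous (fun x => (@?f x, @?g x)) => refine (@contpair _ _ _ f g _ _)
  | |- continuous (fun x => @?f x - @?g x) => refine (@contB _ _ f g _ _)
  | |- continuous (fun x => @?f x + @?g x) => refine (@contD _ _ f g _ _)
  | |- continuous (fun x => @?f x * @?g x) => refine (@contM _ _ f g _ _)
  | |- continuous (fun x => Num.min (@?f x) (@?g x)) => refine (@contmin _ _ f g _ _)
  | |- continuous (fun x => Num.max (@?f x) (@?g x)) => refine (@contmax _ _ f g _ _)
  | |- continuous (fun x => clamp01 (@?f x)) => refine (@contcomp _ _ _ clamp01 f clamp01_continuous _)
  | |- continuous (fun x => x.1) => exact: contfst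
  | |- continuous (fun x => x.2) => exact: contsnd
  | |- continuous fst => exact: contfst
  | |- continuous snd => exact: contsnd
  | |- continuous (fun x => x) => exact: contid
  | |- continuous (fun x => ?c) => exact: contcst
  end ].

Section Paths.
Context {R : realType} {T : topologicalType}.
Implicit Types (f g : R -> T).

(** Paths are total and stand still before 0 and after [L]. Continuity is then continuity on the
    whole line, and paths of different durations can be concatenated and compared without subspace
    topologies. *)
Definition path_to (L : R) f := [/\ 0 <= L, continuous f, forall t : R, t <= 0 -> f t = f 0 & forall t : R, L <= t -> f t = f L].

(** Homotopy with fixed ends, where the time [L] after which all intermediate paths rest is left
    free: waiting and reparametrisation stay within one class. *)
Definition hom f g := exists H : R * R -> T, [/\ continuous H, forall t, H (0, t) = f t,
  forall t, H (1, t) = g t & exists2 L : R, 0 <= L &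
  forall s t : R, 0 <= s <= 1 -> (t <= 0 -> H (s, t) = f 0) /\ (L <= t -> H (s, t) = f L)].

Lemma path_toW (L L' : R) f : L <= L' -> path_to L f -> path_to L' f.
Proof.
move=> LL [L0 cf f0 fL]; split=> //; first exact: le_trans L0 LL.
by move=> t Lt; rewrite (fL t (le_trans LL Lt)) (fL L').
Qed.

(** The parameter is moved linearly from [t] to [theta t]. *)
Lemma hom_reparam (L L' : R) f (theta : R -> R) : path_to L f -> continuous theta -> 0 <= L' ->
  (forall t : R, t <= 0 -> theta t <= 0) -> (forall t : R, L' <= t -> L <= theta t) -> hom f (f \o theta).
Proof.
move=> [L0 cf f0 fL] ct L'0 t0 tL.
exists (fun p : R * R => f ((1 - p.1) * p.2 + p.1 * theta p.2)); split.
- compc f => //; cont; compc theta; cont.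
- by move=> t /=; rewrite subr0 mul1r mul0r addr0.
- by move=> t /=; rewrite subrr mul1r mul0r add0r.
exists (Num.max L L'); first by rewrite le_max L0.
move=> s t /andP[s0 s1] /=; split=> [tn|].
  rewrite f0//; have := t0 t tn => h.
  by rewrite -oppr_ge0 opprD addr_ge0// -mulrN mulr_ge0 ?subr_ge0// oppr_ge0.
rewrite ge_max => /andP[Lt L't]; rewrite [RHS]fL ?le_max ?lexx//.
rewrite fL//; have h := tL t L't.
have := ler_wpM2l s0 h; have s1' : 0 <= 1 - s by rewrite subr_ge0.
by have := ler_wpM2l s1' Lt; lra.
Qed.

Lemma hom_sym f g : hom f g -> hom g f.
Proof.
move=> [H [cH H0 H1 [L L0 HL]]].
have I0 : 0 <= (1 : R) <= 1 by rewrite ler01 lexx.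
exists (fun p : R * R => H (1 - p.1, p.2)); split.
- by compc H; cont.
- by move=> t; rewrite subr0.
- by move=> t; rewrite subrr.
exists L => // s t /andP[s0 s1]; have s' : 0 <= 1 - s <= 1 by rewrite subr_ge0 s1 gerBl.
have [a b] := HL 1 0 I0; have [c d] := HL 1 L I0.
by rewrite -!H1 a// (d (lexx _)); exact: HL.
Qed.

Lemma hom_trans f g k : hom f g -> hom g k -> hom f k.
Proof.
move=> [H [cH H0 H1 [L L0 HL]]] [K [cK K0 K1 [L' L0' KL]]].
have I0 : 0 <= (1 : R) <= 1 by rewrite ler01 lexx.
have J0 : 0 <= (0 : R) <= 1 by rewrite ler01 lexx.
exists (fun p : R * R => if p.1 - 2^-1 <= 0 then H (2 * p.1, p.2) else K (2 * p.1 - 1, p.2)); split.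
- apply: (@glue_continuous _ _ _ (fun p : R * R => p.1 - 2^-1)).
  + by cont.
  + by compc H; cont.
  + by compc K; cont.
  by move=> [s t] /= /subr0_eq ->; rewrite divff ?pnatr_eq0// subrr H1 K0.
- by move=> t /=; rewrite ifT ?mulr0//; lra.
- move=> t /=; rewrite ifF; last by apply/negbTE; lra.
  by have -> : 2 * 1 - 1 = 1 :> R by lra.
have [a b] := HL 1 0 I0; have [c d] := HL 1 (Num.max L L') I0.
have [e1 e2] := HL 0 (Num.max L L') J0.
exists (Num.max L L'); first by rewrite le_max L0.
move=> s t /andP[s0 s1] /=; have g0 : g 0 = f 0 by rewrite -H1 a.
have gL : g (Num.max L L') = f (Num.max L L').
  by rewrite -H1 -H0 d ?e2// le_max lexx ?orbT.
case: ifP => sh.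
  have s' : 0 <= 2 * s <= 1 by lra.
  have [p1 p2] := HL _ t s'; split=> //; rewrite ge_max => /andP[Lt _].
  by rewrite p2// -e2 ?le_max ?lexx// H0.
have s' : 0 <= 2 * s - 1 <= 1 by move: sh => /negbT; rewrite -ltNge => sh; lra.
have [p1 p2] := KL _ t s'; split; first by rewrite -g0.
rewrite ge_max => /andP[_ Lt]; have [_ E] := KL 0 (Num.max L L') J0.
by rewrite p2// -gL -E ?K0// le_max lexx orbT.
Qed.

Lemma hom_refl (L : R) f : path_to L f -> hom f f.
Proof.
move=> pf; have [L0 _ _ _] := pf.
by have := @hom_reparam L L f id pf (fun x => cvg_id) L0; apply.
Qed.

Lemma contslice (H : R * R -> T) s : continuous H -> continuous (fun t => H (s, t)).
Proof.
move=> cH; exact: (@contcomp _ _ _ H (fun t : R => (s, t)) cH (@contpair _ _ _ (fun=> s) (fun t => t) (@contcst _ _ _) (@contid _))).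
Qed.

Lemma hom_ends f g : hom f g -> exists2 L : R, 0 <= L & path_to L f /\ path_to L g /\ f 0 = g 0 /\ f L = g L.
Proof.
move=> [H [cH H0 H1 [L L0 HL]]].
have I0 : 0 <= (0 : R) <= 1 by rewrite ler01 lexx.
have I1 : 0 <= (1 : R) <= 1 by rewrite ler01 lexx.
have e0 : f 0 = g 0 by rewrite -H1; have [->] := HL 1 0 I1.
have eL : f L = g L by rewrite -H1; have [_ ->] := HL 1 L I1.
exists L => //; split; last (split; last by []); split=> //.
- have -> : f = fun t => H (0, t) by apply/funext => t.
  exact: contslice.
- by move=> t t0; have [E _] := HL 0 t I0; rewrite -H0 E.
- by move=> t tL; have [_ E] := HL 0 t I0; rewrite -H0 E.
- have -> : g = fun t => H (1, t) by apply/funext => t.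
  exact: contslice.
- by move=> t t0; have [E _] := HL 1 t I1; rewrite -e0 -H1 E.
- by move=> t tL; have [_ E] := HL 1 t I1; rewrite -eL -H1 E.
Qed.


Definition concat (L : R) f g : R -> T := fun t => if t <= L then f t else g (t - L).

Lemma path_cat (L L' : R) f g : path_to L f -> path_to L' g -> f L = g 0 -> path_to (L + L') (concat L f g).
Proof.
move=> [L0 cf f0 fL] [L0' cg g0 gL] fg; split.
- exact: addr_ge0.
- have -> : concat L f g = fun t => if t - L <= 0 then f t else g (t - L).
    by apply/funext => t; rewrite /concat subr_le0.
  apply: (@glue_continuous _ _ _ (fun t : R => t - L)) => //; [by cont|by compc g; cont|].
  by move=> t /subr0_eq ->; rewrite subrr.
- by move=> t t0; rewrite /concat L0 (le_trans t0 L0) f0.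
move=> t LLt; have Lt : L <= t by apply: le_trans LLt; rewrite lerDl.
rewrite /concat; case: (leP t L) => [tL|_].
  have tE : t = L by apply/eqP; rewrite eq_le tL.
  have L'E : L' = 0 by apply/eqP; rewrite eq_le L0' andbT; move: LLt; rewrite tE; lra.
  by rewrite L'E addr0 lexx tE.
case: (leP (L + L') L) => [LL|_].
  have L'E : L' = 0 by apply/eqP; rewrite eq_le L0' andbT -(lerD2l L) addr0.
  by rewrite gL ?L'E ?subr_ge0// addr0 fg.
by rewrite addrAC subrr add0r gL// lerBrDl.
Qed.

Lemma pause_cont (b m : R) : continuous (fun t : R => Num.min t b + Num.max 0 (t - m)).
Proof. by cont. Qed.

(** For [b <= m] the new path waits at [f b] during [[b, m]]. Pauses synchronise two paths before
    they are compared piece by piece. *)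
Lemma hom_pause (L b m : R) f : path_to L f -> 0 <= b -> 0 <= m ->
  hom f (fun t => f (Num.min t b + Num.max 0 (t - m))).
Proof.
move=> pf b0 m0; have [L0 _ _ _] := pf.
apply: (@hom_reparam L (L + m + b) f (fun t => Num.min t b + Num.max 0 (t - m)) pf (@pause_cont b m)).
- by rewrite !addr_ge0.
- by move=> t t0; rewrite (max_idPl _) ?addr0 ?ge_min ?t0//; lra.
move=> t tL; rewrite (min_idPr _); last by lra.
by rewrite (max_idPr _); lra.
Qed.

Lemma hom_cat_pause (L L' L2 : R) f g : path_to L f -> path_to L2 g -> f L = g 0 -> L <= L' ->
  hom (concat L f g) (concat L' f g).
Proof.
move=> pf pg fg LL; have [L0 _ f0 fL] := pf.
have -> : concat L' f g = fun t => concat L f g (Num.min t L + Num.max 0 (t - L')).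
  apply/funext => t; rewrite /concat; case: (leP t L') => tL'.
    rewrite (max_idPl _) ?subr_le0// addr0 ge_min lexx orbT.
    by case: (leP t L) => // /ltW Lt; rewrite fL.
  rewrite (min_idPr _) ?(le_trans LL (ltW tL'))// (max_idPr _) ?subr_ge0 ?(ltW tL')//.
  by rewrite ifF; [rewrite addrAC subrr add0r|apply/negbTE; rewrite -ltNge; lra].
exact: hom_pause (path_cat pf pg fg) L0 (le_trans L0 LL).
Qed.

(** Both first factors are prolonged by waiting to a common time [m] at which the given homotopy
    already rests; there it can be glued to the fixed second factor. *)
Lemma hom_cat (L L' L2 : R) f f' g : path_to L f -> path_to L' f' -> hom f f' -> path_to L2 g ->
  f L = g 0 -> hom (concat L f g) (concat L' f' g).
Proof.
move=> pf pf' ff' pg fg; have [L1 L10 [_ [_ [_ eL]]]] := hom_ends ff'.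
have [H [cH H0 H1 [L3 L30 HL]]] := ff'.
pose m := Num.max (Num.max L L') (Num.max L1 L3).
have [mL mL' mL1 mL3] : [/\ L <= m, L' <= m, L1 <= m & L3 <= m] by rewrite !le_max !lexx !orbT.
have [L0 _ f0 fL] := pf; have [L0' _ f0' fL'] := pf'.
have m0 : 0 <= m by exact: le_trans L0 mL.
have fm : f' m = f m.
  have J0 : 0 <= (1 : R) <= 1 by rewrite ler01 lexx.
  have J1 : 0 <= (0 : R) <= 1 by rewrite ler01 lexx.
  by rewrite -H1 -H0; have [_ ->//] := HL 1 m J0; have [_ ->] := HL 0 m J1.
have fg' : f' L' = g 0 by rewrite -(fL' m)// fm fL.
have fL3 : f L3 = f L.
  have J1 : 0 <= (0 : R) <= 1 by rewrite ler01 lexx.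
  by rewrite -(fL m)// -(H0 m); have [_ ->] := HL 0 m J1.
have Hm s : H (clamp01 s, m) = f L by have [_ ->//] := HL (clamp01 s) m (clamp01_itv s).
apply: hom_trans (hom_cat_pause pf pg fg mL) _.
apply: hom_trans (hom_sym (hom_cat_pause pf' pg fg' mL')).
exists (fun p : R * R => if p.2 - m <= 0 then H (clamp01 p.1, p.2) else g (p.2 - m)); split.
- apply: (@glue_continuous _ _ _ (fun p : R * R => p.2 - m)).
  + by cont.
  + by compc H; cont.
  + by have [_ cg _ _] := pg; compc g; cont.
  move=> [s t] /= /subr0_eq ->; rewrite subrr.
  by rewrite Hm.
- by move=> t; rewrite /= clamp01_id ?lexx ?ler01// H0 /concat subr_le0.
- by move=> t; rewrite /= clamp01_id ?lexx ?ler01// H1 /concat subr_le0.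
have [L20 cg g0 gL] := pg.
exists (m + L2); first by rewrite addr_ge0.
move=> s t _; have [_ _ _ cm] := path_cat (path_toW mL pf) pg (etrans (fL m mL) fg).
split=> [t0|tm]; rewrite /=.
  rewrite subr_le0 (le_trans t0 m0) /concat m0.
  by have [-> //] := HL (clamp01 s) t (clamp01_itv s).
rewrite -(cm t tm) subr_le0 /concat; case: (leP t m) => // tm'.
have -> : t = m by apply/eqP; rewrite eq_le tm' (le_trans _ tm)// lerDl.
by rewrite Hm fL.
Qed.

End Paths.

(** * Modification of a path inside a coordinate ball *)

Section LocalModification.
Context {R : realType} {n : nat} {M : smooth_manifold R n}.
Implicit Types (f g : R -> M).

Definition coord_ball (i : chart_index M) u0 (r : R) : set M :=
  [set p | chart_dom i p /\ `|chart i p - u0| <= r].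

Lemma convex_ball u0 (r s : R) (v w : 'rV[R]_n) : 0 <= s <= 1 -> `|v - u0| <= r -> `|w - u0| <= r ->
  `|(1 - s) *: v + s *: w - u0| <= r.
Proof.
move=> /andP[s0 s1] vr wr.
have -> : (1 - s) *: v + s *: w - u0 = (1 - s) *: (v - u0) + s *: (w - u0).
  by apply/rowP => a; rewrite !mxE; ring.
have s1' : 0 <= 1 - s by rewrite subr_ge0.
apply: le_trans (ler_normD _ _) _; rewrite !normrZ !ger0_norm//.
by have := ler_wpM2l s0 wr; have := ler_wpM2l s1' vr; lra.
Qed.

(** Straight-line homotopy in coordinates during [[a, b]]; it is constant at the times where the two
    paths agree, so it glues to the constant homotopy outside. *)
Lemma hom_local i u0 (r L L' a b : R) f g : (forall u, `|u - u0| <= r -> chart_image i u) ->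
  path_to L f -> path_to L' g -> 0 <= a <= b ->
  (forall t, t <= a -> f t = g t) -> (forall t, b <= t -> f t = g t) ->
  (forall t, a <= t <= b -> coord_ball i u0 r (f t) /\ coord_ball i u0 r (g t)) -> hom f g.
Proof.
move=> ri [L0 cf f0 fL] [L0' cg g0 gL] /andP[a0 ab] fa fb fg.
pose ct (t : R) := Num.max a (Num.min b t).
have ctI t : a <= ct t <= b by rewrite /ct le_max lexx/= ge_max ab ge_min lexx.
have ctE t : a <= t <= b -> ct t = t by move=> /andP[at_ tb]; rewrite /ct (min_idPr tb) (max_idPr at_).
pose U (p : R * R) := (1 - clamp01 p.1) *: chart i (f (ct p.2)) + clamp01 p.1 *: chart i (g (ct p.2)).
have Uball p : `|U p - u0| <= r.
  by have [[_ b1] [_ b2]] := fg _ (ctI p.2); apply: convex_ball => //; exact: clamp01_itv.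
have cc (k : R -> M) : continuous k -> (forall t, a <= t <= b -> coord_ball i u0 r (k t)) ->
    continuous (fun p : R * R => chart i (k (ct p.2))).
  move=> ck kb p; apply: (@continuous_comp _ _ _ (fun p : R * R => k (ct p.2)) (chart i) p).
    have c : continuous (fun p : R * R => k (ct p.2)) by compc k => //; rewrite /ct; cont.
    exact: (c p).
  by apply: chart_continuous_at; have [] := kb _ (ctI p.2).
pose A p := chart_inv i (U p).
have cA : continuous A.
  move=> p; apply: (@continuous_comp _ _ _ U (chart_inv i) p); last first.
    exact: chart_inv_continuous_at (ri _ (Uball p)).
  apply: cvgD; apply: cvgZ.
  - have c : continuous (fun p : R * R => 1 - clamp01 p.1) by cont.
    exact: (c p).
  - by apply: (cc f cf) => t /fg[].
  - have c : continuous (fun p : R * R => clamp01 p.1) by cont.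
    exact: (c p).
  - by apply: (cc g cg) => t /fg[].
have AE s t : a <= t <= b -> f t = g t -> A (s, t) = f t.
  move=> tab E; rewrite /A /U /= ctE// -E -scalerDl subrK scale1r chartK//.
  by have [[]] := fg t tab.
exists (fun p : R * R => if p.2 - a <= 0 then f p.2 else if p.2 - b <= 0 then A p else f p.2); split.
- apply: (@glue_continuous _ _ _ (fun p : R * R => p.2 - a)).
  + by cont.
  + by compc f; cont.
  + apply: (@glue_continuous _ _ _ (fun p : R * R => p.2 - b)) => //; [by cont|by compc f; cont|].
    by move=> [s t] /= /subr0_eq ->; rewrite AE ?ab ?lexx// fb.
  by move=> [s t] /= /subr0_eq ->; rewrite subr_le0 ab AE ?ab ?lexx// fa.
- move=> t /=; rewrite !subr_le0; case: (leP t a) => // ta; case: (leP t b) => // tb.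
  have tab : a <= t <= b by rewrite (ltW ta).
  rewrite /A /U /= clamp01_id ?lexx ?ler01// subr0 scale1r scale0r addr0 ctE// chartK//.
  by have [[]] := fg t tab.
- move=> t /=; rewrite !subr_le0; case: (leP t a) => [/fa//|ta]; case: (leP t b) => [tb|/ltW/fb//].
  have tab : a <= t <= b by rewrite (ltW ta).
  rewrite /A /U /= clamp01_id ?lexx ?ler01// subrr scale1r scale0r add0r ctE// chartK//.
  by have [_ []] := fg t tab.
exists (Num.max L b); first by rewrite le_max L0.
move=> s t _ /=; rewrite !subr_le0; split=> [t0|].
  by rewrite (le_trans t0 a0) f0.
rewrite ge_max => /andP[Lt bt]; have fE : f t = f (Num.max L b) by rewrite !fL// le_max lexx.
case: (leP t a) => // ta; case: (leP t b) => // tb.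
have tE : t = b by apply/eqP; rewrite eq_le tb.
by rewrite AE ?tb ?(ltW ta)// tE fb.
Qed.

Definition splice f g (a b b' : R) : R -> M :=
  fun t => if t <= a then f t else if t <= b' then g t else f (t - b' + b).

Lemma splice_path (L a b b' : R) f g : path_to L f -> continuous g -> 0 <= a -> a <= b -> b <= L -> a <= b' ->
  g a = f a -> g b' = f b -> path_to (L - b + b') (splice f g a b b').
Proof.
move=> [L0 cf f0 fL] cg a0 ab bL ab' ga gb; split.
- by rewrite addr_ge0 ?subr_ge0// (le_trans a0).
- have -> : splice f g a b b' = fun t => if t - a <= 0 then f t else if t - b' <= 0 then g t else f (t - b' + b).
    by apply/funext => t; rewrite /splice !subr_le0.
  apply: (@glue_continuous _ _ _ (fun t : R => t - a)) => //; first by cont.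
    apply: (@glue_continuous _ _ _ (fun t : R => t - b')) => //; [by cont|by compc f; cont|].
    by move=> t /subr0_eq ->; rewrite subrr add0r.
  by move=> t /subr0_eq ->; rewrite subr_le0 ab' ga.
- by move=> t t0; rewrite /splice (le_trans t0 a0) a0 f0.
have fin t : L - b + b' <= t -> splice f g a b b' t = f L.
  move=> Lt; rewrite /splice; case: (leP t a) => ta.
    have [bE aE] : b' = a /\ b = L by split; lra.
    have tE : t = a by lra.
    by rewrite tE -ga -bE gb aE.
  case: (leP t b') => tb; last by rewrite fL//; lra.
  have [tE bE] : t = b' /\ b = L by split; lra.
  by rewrite tE gb bE.
by move=> t tL; rewrite !fin.
Qed.

(** Pauses make the old and the new piece both end at time [m], the later of [b] and [b']. The paths
    then agree outside [[a, m]] and stay in the ball in between, as [hom_local] requires. *)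
Lemma hom_splice i u0 (r L a b b' : R) f g : (forall u, `|u - u0| <= r -> chart_image i u) ->
  path_to L f -> continuous g -> 0 <= a -> a <= b -> b <= L -> a <= b' -> g a = f a -> g b' = f b ->
  (forall t, a <= t <= b -> coord_ball i u0 r (f t)) ->
  (forall t, a <= t <= b' -> coord_ball i u0 r (g t)) -> hom f (splice f g a b b').
Proof.
move=> ri pf cg a0 ab bL ab' ga gb fB gB.
have ps := splice_path pf cg a0 ab bL ab' ga gb.
have b0 := le_trans a0 ab; have b0' := le_trans a0 ab'.
pose m := Num.max b b'; have [bm bm'] : b <= m /\ b' <= m by rewrite !le_max !lexx orbT.
have m0 : 0 <= m by exact: le_trans b0 bm.
have h1 := hom_pause pf b0 m0; have h2 := hom_pause ps b0' m0.
have [L1 _ [_ [p1 _]]] := hom_ends h1; have [L2 _ [_ [p2 _]]] := hom_ends h2.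
apply: hom_trans h1 _; apply: hom_trans (hom_sym h2).
apply: (@hom_local i u0 r L1 L2 a m _ _ ri p1 p2).
- by rewrite a0 (le_trans ab).
- move=> t ta; have tb := le_trans ta ab; have tb' := le_trans ta ab'.
  rewrite (min_idPl tb) (min_idPl tb') (max_idPl _) ?subr_le0 ?(le_trans tb)// addr0 /splice ta.
  by [].
- move=> t mt; rewrite (min_idPr (le_trans bm mt)) (min_idPr (le_trans bm' mt)) (max_idPr _) ?subr_ge0//.
  rewrite /splice; case: (leP (b' + (t - m)) a) => ta.
    have [bE tE] : b' = a /\ t = m by split; lra.
    by rewrite bE tE subrr !addr0 -ga -gb bE.
  case: (leP (b' + (t - m)) b') => tb; last by congr f; ring.
  have -> : t = m by lra.
  by rewrite subrr !addr0 gb.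
move=> t /andP[at_ tm]; rewrite (max_idPl _) ?subr_le0// !addr0; split.
  by apply: fB; rewrite le_min at_ ab ge_min lexx orbT.
rewrite /splice; case: (leP (Num.min t b') a) => ta.
  have tE : Num.min t b' = a by apply/eqP; rewrite eq_le ta le_min at_.
  by rewrite tE; apply: fB; rewrite lexx.
rewrite ge_min lexx orbT; apply: gB; rewrite (ltW ta) ge_min lexx orbT //.
Qed.

End LocalModification.

(** * Curves of speed at most 1 *)

Section RightGrowth.
Context {R : realType}.

Lemma derive_approx (m : nat) (u : R -> 'rV[R]_m) (W : 'rV[R]_m) (t : R) :
  (forall a, is_derive t 1 (fun s => u s 0 a) (W 0 a)) ->
  forall e : R, 0 < e -> exists2 d : R, 0 < d & forall s, `|s - t| < d -> `|u s - u t - (s - t) *: W| <= e * `|s - t|.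
Proof.
move=> du e e0.
have [||d d0 H] := @finI_uniform R 'I_m (fun a d => forall s, `|s - t| < d ->
  `|u s 0 a - u t 0 a - (s - t) * W 0 a| <= e * `|s - t|).
- by move=> a r r' _ rr Hr s sr; apply: Hr; exact: lt_le_trans sr rr.
- move=> a; have [df dE] := du a.
  have cv : (fun k : R => k^-1 *: (u (k *: 1 + t) 0 a - u t 0 a)) @ 0^' --> W 0 a by rewrite -dE; exact: df.
  have /cvgrPdist_le/(_ e e0) nr := cv.
  have [d d0 Hd] := (nearN (0 : R) (fun k => k != 0 -> `|W 0 a - k^-1 *: (u (k *: 1 + t) 0 a - u t 0 a)| <= e)).1 nr.
  exists d => // s sd; have [->|st] := eqVneq s t; first by rewrite !subrr mul0r subrr normr0 mulr0.
  have k0 : s - t != 0 by rewrite subr_eq0.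
  have := Hd (s - t); rewrite subr0 => /(_ sd k0).
  rewrite /GRing.scale /= mulr1 subrK => Hk.
  have -> : u s 0 a - u t 0 a - (s - t) * W 0 a = - (s - t) * (W 0 a - (s - t)^-1 * (u s 0 a - u t 0 a)).
    by field.
  by rewrite normrM normrN mulrC; apply: ler_wpM2r.
exists d => // s sd; apply/rV_normP => [|a]; first exact: (mulr_ge0 (ltW e0) (normr_ge0 _)).
by rewrite !mxE; exact: H.
Qed.

(** A Dini derivative argument. Growth is controlled only where [phi] is positive, because in the
    application the eikonal inequality carries the factor [F], and says nothing where [F]
    vanishes. *)
Lemma right_growth (phi : R -> R) (a b : R) : a <= b -> phi a = 0 ->
  (forall t, a <= t <= b -> {for t, continuous phi}) ->
  (forall t, a <= t < b -> 0 < phi t -> forall e : R, 0 < e ->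
     exists2 d : R, 0 < d & forall s, t < s < t + d -> phi s <= phi t + (1 + e) * (s - t)) ->
  phi b <= b - a.
Proof.
move=> ab pa cp gr.
(* The additive [e] gives room at times with [phi t <= 0], where continuity alone is available; the
   factor [1 + e] is the one in the growth hypothesis. *)
have key (e : R) : 0 < e -> phi b <= (1 + e) * (b - a) + e.
  move=> e0; apply: (@real_induction R (fun t => phi t <= (1 + e) * (t - a) + e) a b); last by rewrite ab lexx.
  - by rewrite pa subrr mulr0 add0r ltW.
  - move=> t tab Hs; have [t1 t2] := andP tab.
    have Pt : phi t <= (1 + e) * (t - a) + e by apply: Hs; rewrite t1 lexx.
    have [p0|p0] := ltP 0 (phi t).
      have [d d0 Hd] := gr t tab p0 e e0; exists d => // s sd; apply: le_trans (Hd s sd) _.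
      by lra.
    have tab' : a <= t <= b by rewrite t1 ltW.
    have [d d0 Hd] := (continuousN phi t).1 (cp t tab') e e0.
    exists d => // s /andP[ts sd]; have st : `|s - t| < d by rewrite gtr0_norm ?subr_gt0//; lra.
    have := Hd s st; rewrite ltr_norml => /andP[_ H].
    have e1 : 0 <= (1 + e) * (s - a) by apply: mulr_ge0; lra.
    by move: ((1 + e) * (s - a)) e1 => x; lra.
  move=> t /andP[at_ tb] Hs; rewrite leNgt; apply/negP => gt.
  have tab' : a <= t <= b by rewrite (ltW at_).
  pose g := phi t - ((1 + e) * (t - a) + e); have g0 : 0 < g by rewrite subr_gt0.
  have [d d0 Hd] := (continuousN phi t).1 (cp t tab') g g0.
  pose s := Num.max a (t - d / 2).
  have [as_ ds] : a <= s /\ t - d / 2 <= s by rewrite !le_max !lexx orbT.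
  have st : s < t by rewrite gt_max at_; lra.
  have st' : `|s - t| < d by rewrite ltr0_norm ?subr_lt0//; lra.
  have := Hd s st'; rewrite ltr_norml => /andP[H _].
  have Hs' : phi s <= (1 + e) * (s - a) + e by apply: Hs; rewrite as_.
  have e1 : (1 + e) * (s - a) <= (1 + e) * (t - a) by apply: ler_wpM2l; lra.
  by move: H; rewrite /g; lra.
rewrite leNgt; apply/negP => gt; pose g := phi b - (b - a).
have g0 : 0 < g by rewrite subr_gt0.
have ba : 0 < b - a + 2 by rewrite ltr_wpDl// subr_ge0.
have := key (g / (b - a + 2)) (divr_gt0 g0 ba).
have E : g / (b - a + 2) * (b - a + 2) = g by rewrite divfK// gt_eqF.
have := divr_gt0 g0 ba; move: (g / _) E => e E e0; rewrite mulrDl mul1r.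
by move: E; rewrite mulrDr /g; lra.
Qed.

End RightGrowth.

Section SlowCurves.
Context {R : realType} {n : nat} {M : smooth_manifold R n}.
Variable h : riemannian_metric M.

(** Upper right speed at most 1, measured with the metric frozen at [c t]. Being one-sided, the
    condition is unaffected by corners, so slow curves can be concatenated freely. *)
Definition slow_at (c : R -> M) (t : R) := forall i, chart_dom i (c t) -> forall e : R, 0 < e ->
  exists2 d : R, 0 < d & forall s, t < s < t + d ->
    gnorm h i (chart i (c t)) (chart i (c s) - chart i (c t)) <= (1 + e) * (s - t).

Lemma slow_at_germ (c c' : R -> M) (t k d : R) : 0 < d -> (forall s, t <= s < t + d -> c s = c' (s + k)) ->
  slow_at c' (t + k) -> slow_at c t.
Proof.
move=> d0 E sl i; rewrite E ?lexx ?ltrDl// => di e e0.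
have [d' d'0 H] := sl i di e e0.
exists (Num.min d d'); first by rewrite lt_min d0.
move=> s /andP[ts]; rewrite -ltrBlDl lt_min !ltrBlDl => /andP[sd sd'].
rewrite (E s) ?(ltW ts)// (_ : s - t = s + k - (t + k)); last by ring.
by apply: H; rewrite ltrD2r ts addrAC ltrD2r.
Qed.

Lemma slow_derivative (c : R -> M) i (V : 'rV[R]_n) (t : R) : {for t, continuous c} -> chart_dom i (c t) ->
  (forall a, is_derive t 1 (fun s => chart i (c s) 0 a) (V 0 a)) -> gnorm h i (chart i (c t)) V <= 1 -> slow_at c t.
Proof.
move=> cc di dV V1 j dj e e0.
have ov : overlap i j (chart i (c t)) by exists (c t).
pose Jac : 'M[R]_n := \matrix_(a, b) partial (fun y => transition i j y 0 b) a (chart i (c t)).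
pose W := V *m Jac.
have dW b : is_derive t 1 (fun s => chart j (c s) 0 b) (W 0 b).
  have := is_derive_comp_smooth (@open_overlap _ _ _ i j) (@transition_smooth _ _ M i j b) ov dV.
  have -> : \sum_(a < n) V 0 a * partial (fun u => chart j (chart_inv i u) 0 b) a (chart i (c t)) = W 0 b.
    by rewrite /W mxE; apply: eq_bigr => a _; rewrite mxE.
  apply: near_eq_is_derive; near=> s; rewrite chartK//; near: s; exact: near_chart_dom.
have W1 : gnorm h j (chart j (c t)) W <= 1.
  by move: V1; rewrite /gnorm (gdot_transition h _ _ ov) /transition chartK.
have ju := chart_image_chart dj.
have [r [C [r0 C1 _ mb _]]] := metric_bounds h ju.
have C0 : 0 < C by apply: lt_le_trans C1.
have [d d0 H] := derive_approx dW (divr_gt0 e0 C0).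
exists d => // s /andP[ts sd].
have st : `|s - t| = s - t by rewrite gtr0_norm ?subr_gt0.
have := H s; rewrite st => /(_ _) H1; have {}H1 := H1 _.
rewrite -[chart j (c s) - chart j (c t)](subrK ((s - t) *: W)).
apply: le_trans (gnormD h _ _ ju) _; rewrite gnormZ st.
have u0 : `|chart j (c t) - chart j (c t)| <= r by rewrite subrr normr0 ltW.
have [g1 _] := mb _ (chart j (c s) - chart j (c t) - (s - t) *: W) u0.
have H2 : `|chart j (c s) - chart j (c t) - (s - t) *: W| <= e / C * (s - t) by apply: H1; lra.
have s0 : 0 <= s - t by rewrite subr_ge0 ltW.
have a2 := ler_wpM2l s0 W1; rewrite mulr1 in a2.
have a1 := le_trans g1 (ler_wpM2l (ltW C0) H2).
have E : C * (e / C * (s - t)) = e * (s - t) by field; rewrite gt_eqF.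
by rewrite [leRHS]mulrDl mul1r addrC -E; exact: lerD.
Unshelve. all: by end_near. Qed.

Lemma slow_geodesic gam i (t0 t : R) : geodesic h setT gam -> chart_dom i (gam t0) ->
  gnorm h i (chart i (gam t0)) (velocity i gam t0) = 1 -> slow_at gam t.
Proof.
move=> g d0 v1; have [j dj] := chart_dom_cover (gam t).
have [d1 _] := geodesicT_ode g dj.
have cg : {for t, continuous gam} by exact: (geodesicT_continuous g).
by apply: (slow_derivative cg dj d1); rewrite (speed_gnorm g dj d0) v1.
Qed.

Definition segment i (v w : 'rV[R]_n) (sigma : R) : R -> M :=
  fun t => chart_inv i ((1 - clamp01 (t / sigma)) *: v + clamp01 (t / sigma) *: w).

Section Segments.
Variables (i : chart_index M) (u0 v w : 'rV[R]_n) (r sigma : R).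
Hypothesis ri : forall u, `|u - u0| <= r -> chart_image i u.
Hypotheses (s0 : 0 < sigma) (vr : `|v - u0| <= r) (wr : `|w - u0| <= r).

Lemma segment_ball t : coord_ball i u0 r (segment i v w sigma t).
Proof.
have b := convex_ball (clamp01_itv (t / sigma)) vr wr.
have [d E] := chart_invP (ri b).
by split; rewrite /segment ?E.
Qed.

Lemma segment_path : path_to sigma (segment i v w sigma).
Proof.
have c0 t : t <= 0 -> clamp01 (t / sigma) = 0.
  move=> t0; have t1 : t / sigma <= 0 by rewrite ler_pdivrMr// mul0r.
  by rewrite /clamp01 (max_idPl _)// ge_min t1.
have c1 t : sigma <= t -> clamp01 (t / sigma) = 1.
  by move=> t1; rewrite /clamp01 (min_idPr _) ?(max_idPr _)// ler_pdivlMr ?mul1r.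
split; first exact: ltW.
- move=> t; pose k (s : R) := clamp01 (s / sigma).
  have ck : continuous k by rewrite /k; cont.
  have ck' : continuous (fun s => 1 - k s) by cont.
  apply: (@continuous_comp _ _ _ (fun s => (1 - k s) *: v + k s *: w) (chart_inv i) t).
    apply: cvgD; apply: cvgZ; [exact: ck'|exact: cvg_cst|exact: ck|exact: cvg_cst].
  by apply: chart_inv_continuous_at; apply: ri; apply: convex_ball => //; exact: clamp01_itv.
- by move=> t t0; rewrite /segment !c0.
- by move=> t t0; rewrite /segment !c1.
Qed.

Lemma segment_start t : t <= 0 -> segment i v w sigma t = chart_inv i v.
Proof.
move=> t0; have [_ _ E _] := segment_path.
by rewrite (E t t0) /segment mul0r clamp01_id ?lexx ?ler01// subr0 scale1r scale0r addr0.
Qed.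

Lemma segment_end t : sigma <= t -> segment i v w sigma t = chart_inv i w.
Proof.
move=> t0; have [_ _ _ E] := segment_path.
by rewrite (E t t0) /segment divff ?gt_eqF// clamp01_id ?lexx ?ler01// subrr scale1r scale0r add0r.
Qed.

Lemma segment_slow t : (forall u, `|u - u0| <= r -> gnorm h i u (w - v) <= sigma) -> 0 <= t < sigma ->
  slow_at (segment i v w sigma) t.
Proof.
move=> le_sigma /andP[t0 t1].
pose u (s : R) := v + s *: (sigma^-1 *: (w - v)).
have uE (s : R) : u s = (1 - s / sigma) *: v + (s / sigma) *: w.
  by rewrite /u; apply/rowP => a; rewrite !mxE; ring.
have oi := @chart_image_open _ _ M i.
have tI : 0 <= t / sigma <= 1 by rewrite (divr_ge0 t0 (ltW s0)) /= ler_pdivrMr// mul1r ltW.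
have ub : `|u t - u0| <= r by rewrite uE; exact: convex_ball.
have cu (s : R) : {for s, continuous u}.
  apply: (@is_derive_row_continuous _ _ u (fun a => (sigma^-1 *: (w - v)) 0 a)) => a.
  have -> : (fun s => u s 0 a) = (fun s => v 0 a + s * (sigma^-1 *: (w - v)) 0 a) by apply/funext => x; rewrite /u !mxE.
  exact: is_derive_affine.
have cc : {for t, continuous (chart_inv i \o u)}.
  by apply: continuous_comp; [exact: cu|exact: chart_inv_continuous_at (ri ub)].
have [dt et] := chart_invP (ri ub).
have sl : slow_at (chart_inv i \o u) t.
  apply: (@slow_derivative _ i (sigma^-1 *: (w - v)) t cc dt).
    move=> a; apply: (@near_eq_is_derive _ _ _ (fun s : R => v 0 a + s * (sigma^-1 *: (w - v)) 0 a)); last exact: is_derive_affine.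
    near=> s; have iu : chart_image i (u s) by near: s; apply: (cu t); apply: open_nbhs_nbhs; split; [exact: oi|exact: ri ub].
    by have [_ E] := chart_invP iu; rewrite /comp E /u !mxE.
  rewrite /comp et gnormZ gtr0_norm ?invr_gt0// ler_pdivrMl// mulr1.
  exact: le_sigma.
apply: (@slow_at_germ _ (chart_inv i \o u) t 0 (sigma - t)); rewrite ?subr_gt0// ?addr0//.
move=> s /andP[ts ss]; rewrite addr0 /segment /comp uE clamp01_id//.
by rewrite (divr_ge0 (le_trans t0 ts) (ltW s0)) /= ler_pdivrMr// mul1r; lra.
Unshelve. all: by end_near. Qed.

End Segments.

End SlowCurves.

Lemma first_exit {R : realType} (T : topologicalType) (U : set T) (c : R -> T) (s b : R) : open U ->
  continuous c -> U (c s) -> (forall t, s <= t <= b -> U (c t)) \/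
  exists t, [/\ s < t, t <= b, forall t', s <= t' < t -> U (c t') & ~ U (c t)].
Proof.
move=> oU cc Us; have [ex|nex] := pselect (exists t, [/\ s < t, t <= b, forall t', s <= t' < t -> U (c t') & ~ U (c t)]).
  by right.
left; apply: real_induction => //.
  move=> t /andP[st _] H; have Ut : U (c t) by apply: H; rewrite st lexx.
  have [d d0 Hd] := (nearN t (fun y : R => U (c y))).1 (cc t _ (open_nbhs_nbhs (conj oU Ut))).
  by exists d => // y /andP[ty yt]; apply: Hd; rewrite gtr0_norm ?subr_gt0// ltrBlDl.
move=> t /andP[st tb] H; apply: contrapT => nU; apply: nex.
by exists t.
Qed.

(** * Slow curves leaving the centre of a normal ball *)

Section NormalRegion.
Context {R : realType} {n : nat} {M : smooth_manifold R n}.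
Variable h : riemannian_metric M.
Variables (i : chart_index M) (q : M) (G : 'rV[R]_n -> R -> M).
Hypothesis chart_q : chart_dom i q.
Hypothesis G_geodesic : forall v, geodesic h setT (G v).
Hypothesis G_start : forall v, G v 0 = q.
Hypothesis G_velocity : forall v, velocity i (G v) 0 = v.
Let u0 := chart i q.

(** Along a slow curve from [q] the function [F] of [normal_ball] grows at rate at most 1, by
    [right_growth] and the eikonal inequality. Whichever alternative occurs, a first piece of the
    curve can therefore be exchanged, within the ball, for a radial geodesic that takes no longer,
    or for rest at [q]. The second alternative is the crossing of the geodesic sphere of radius
    [l]. *)
Lemma normal_region (e : R) : 0 < e -> exists (rho l : R), [/\ 0 < rho <= e, 0 < l <= e,
  forall u, `|u - u0| <= rho -> chart_image i u,
  forall w (t : R), gnorm h i u0 w = 1 -> 0 <= t <= l -> coord_ball i u0 rho (G w t) &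
  forall (c : R -> M) (s b : R), s <= b -> continuous c -> (forall t, s <= t < b -> slow_at h c t) -> c s = q ->
    ((forall t, s <= t <= b -> coord_ball i u0 rho (c t)) /\
     (c b = q \/ exists w sigma, [/\ gnorm h i u0 w = 1, 0 < sigma <= Num.min l (b - s) & G w sigma = c b])) \/
    (exists tau w, [/\ s + l <= tau <= b, forall t, s <= t <= tau -> coord_ball i u0 rho (c t),
        gnorm h i u0 w = 1 & G w l = c tau])].
Proof.
move=> e0; have iu0 : chart_image i u0 := chart_image_chart chart_q.
have [r1 [C1 [r10 C11 r1i mb _]]] := metric_bounds h iu0.
have e10 : 0 < Num.min e r1 by rewrite lt_min e0.
have [rho [l [C [F [[rho0 rhoe l0 le ri] [Fu0 F0 Fb] Flip Feik [Gb Fex]]]]]] :=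
  normal_ball chart_q G_geodesic G_start G_velocity e10.
have [rhoe' rhor] : rho <= e /\ rho <= r1 by move: rhoe; rewrite le_min => /andP[].
have le' : l <= e by apply: le_trans le _; rewrite ge_min lexx.
have ballG w (t : R) : gnorm h i u0 w = 1 -> 0 <= t <= l -> coord_ball i u0 rho (G w t).
  by move=> w1 tl; have [d r] := Gb w t w1 tl; split=> //; exact: ltW.
exists rho, l; split=> //; [by rewrite rho0|by rewrite l0|].
move=> c s b sb cc sl cs.
have ocI := @chart_image_open _ _ M i.
(* On the coordinate sphere of radius [rho] one has [F > l], so a curve that leaves [U] does so at a
   point with [F = l], still inside the coordinate ball. *)
pose U : set M := [set p | [/\ chart_dom i p, `|chart i p - u0| < rho & F (chart i p) < l]].
have Flc (p : M) : chart_dom i p -> `|chart i p - u0| < rho -> {for p, continuous (fun p => F (chart i p))}.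
  move=> dp pr; apply: (@continuous_comp _ _ _ (chart i) F p (chart_continuous_at dp)).
  apply/continuousN => x x0; pose C' := Num.max C 1.
  have C'0 : 0 < C' by rewrite lt_max ltr01 orbT.
  exists (Num.min (rho - `|chart i p - u0|) (x / C')); first by rewrite lt_min subr_gt0 pr divr_gt0.
  move=> v; rewrite lt_min => /andP[v1 v2].
  have vr : `|v - u0| <= rho.
    by apply/ltW; have := normB_le (lexx `|v - chart i p|) (lexx `|chart i p - u0|); lra.
  apply: le_lt_trans (Flip v (chart i p) vr (ltW pr)) _.
  apply: (@le_lt_trans _ _ (C' * `|v - chart i p|)); first by apply: ler_wpM2r; rewrite // le_max lexx.
  by rewrite mulrC -ltr_pdivlMr.
have oU : open U.
  rewrite openE => p [dp pr Fp]; rewrite /interior.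
  have n1 : \forall y \near p, chart_dom i y by exact: open_nbhs_nbhs (conj (chart_dom_open i) dp).
  have n2 : \forall y \near p, `|chart i y - u0| < rho.
    have pr' : 0 < rho - `|chart i p - u0| by rewrite subr_gt0.
    have /cvgrPdist_lt/(_ _ pr') H := chart_continuous_at dp.
    near=> y; have : `|chart i p - chart i y| < rho - `|chart i p - u0| by near: y.
    rewrite distrC => H1; have := normB_le (lexx `|chart i y - chart i p|) (lexx `|chart i p - u0|); lra.
  have n3 : \forall y \near p, F (chart i y) < l.
    exact: (Flc p dp pr _ (lt_nbhsl Fp)).
  near=> y; split; near: y; [exact: n1|exact: n2|exact: n3].
have Us : U (c s) by rewrite cs; split; rewrite ?subrr ?normr0// -/u0 Fu0.
pose phi t := F (chart i (c t)).
have grow (b' : R) : s <= b' <= b -> (forall t, s <= t < b' -> U (c t)) -> chart_dom i (c b') ->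
    `|chart i (c b') - u0| < rho -> phi b' <= b' - s.
  move=> /andP[sb' bb] Ut db' rb'.
  have Ut' t : s <= t <= b' -> chart_dom i (c t) /\ `|chart i (c t) - u0| < rho.
    move=> /andP[st]; rewrite le_eqVlt => /orP[/eqP->//|tb'].
    have stb : s <= t < b' by rewrite st.
    by have [] := Ut t stb.
  apply: right_growth => //; first by rewrite /phi cs Fu0.
    move=> t /Ut'[dt rt]; apply: (@continuous_comp _ _ _ c (fun p => F (chart i p)) t); first exact: cc.
    exact: Flc.
  move=> t tb pt x x0; have [st tb'] := andP tb.
  have [dt rt Ft] := Ut t tb.
  have rt1 : `|chart i (c t) - u0| <= r1 by apply: le_trans (ltW rt) rhor.
  have x2 : 0 < Num.min x 1 / 2 by rewrite divr_gt0// lt_min x0 ltr01.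
  have slt : slow_at h c t by apply: sl; rewrite st (lt_le_trans tb' bb).
  have [d1 d10 H1] := slt i dt _ x2.
  have nU : \forall y \near t, U (c y) by exact: (cc t _ (open_nbhs_nbhs (conj oU (Ut t tb)))).
  have [d2 d20 H2] := (nearN t (fun y : R => U (c y))).1 nU.
  (* [K] absorbs the quadratic error of the eikonal inequality. For steps shorter than
     [x / 2 * phi t / K] the error is at most [x / 2 * phi t * (y - t)], and division by the
     positive [phi t] leaves the permitted excess. *)
  pose K := Num.max C 0 * (C1 * 2) ^+ 2 + 1.
  have K0 : 0 < K by rewrite ltr_wpDl// mulr_ge0 ?sqr_ge0// le_max lexx orbT.
  exists (Num.min (Num.min d1 d2) (x / 2 * phi t / K)).
    by rewrite !lt_min d10 d20 !divr_gt0// mulr_gt0// divr_gt0.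
  move=> y /andP[ty]; rewrite -ltrBlDl !lt_min !ltrBlDl => /andP[/andP[y1 y2]].
  rewrite -ltrBlDl ltr_pdivlMr// => y3.
  have yt : 0 < y - t by rewrite subr_gt0.
  have [dy ry Fy] : U (c y) by apply: H2; rewrite gtr0_norm// ltrBlDl.
  have := H1 y; rewrite ty y1 => /(_ isT) gy.
  have [m1 m2] : Num.min x 1 <= x /\ Num.min x 1 <= 1 by rewrite !ge_min !lexx orbT.
  set N := gnorm h i _ _ in gy.
  have gy1 : N <= (1 + x / 2) * (y - t).
    by apply: le_trans gy _; apply: ler_wpM2r; [exact: ltW|lra].
  have gy3 : N <= 2 * (y - t).
    by apply: le_trans gy _; apply: ler_wpM2r; [exact: ltW|lra].
  have gy2 : `|chart i (c y) - chart i (c t)| <= C1 * 2 * (y - t).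
    apply: le_trans (mb _ _ rt1).2 _; rewrite -mulrA; apply: ler_wpM2l gy3.
    by apply: le_trans C11.
  have := Feik _ _ (ltW rt) (ltW ry); rewrite -/(phi t) -/(phi y) -/N => fe.
  have sq : `|chart i (c y) - chart i (c t)| ^+ 2 <= (C1 * 2) ^+ 2 * (y - t) ^+ 2.
    by rewrite -exprMn !expr2; apply: ler_pM.
  have CC : C * `|chart i (c y) - chart i (c t)| ^+ 2 <= (y - t) * K * (y - t).
    apply: (@le_trans _ _ (Num.max C 0 * `|chart i (c y) - chart i (c t)| ^+ 2)).
      by apply: ler_wpM2r; rewrite ?sqr_ge0// le_max lexx.
    apply: (@le_trans _ _ (Num.max C 0 * ((C1 * 2) ^+ 2 * (y - t) ^+ 2))).
      by apply: ler_wpM2l sq; rewrite le_max lexx orbT.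
    have -> : (y - t) * K * (y - t) = Num.max C 0 * ((C1 * 2) ^+ 2 * (y - t) ^+ 2) + (y - t) ^+ 2 by rewrite /K; ring.
    by rewrite lerDl sqr_ge0.
  have CC2 : (y - t) * K * (y - t) <= x / 2 * phi t * (y - t) by apply: ler_wpM2r; exact: ltW.
  rewrite -lerBlDl -(ler_pM2l pt); apply: le_trans fe _.
  apply: (@le_trans _ _ (phi t * ((1 + x / 2) * (y - t)) + x / 2 * phi t * (y - t))).
    by apply: lerD; [apply: ler_wpM2l gy1; exact: ltW|exact: le_trans CC CC2].
  by rewrite le_eqVlt; apply/orP; left; apply/eqP; field.
have ballU (p : M) : U p -> coord_ball i u0 rho p by move=> [d r _]; split=> //; exact: ltW.
have [stay|[tau [st tb Ut nU]]] := first_exit b oU cc Us.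
  left; split; first by move=> t /stay/ballU.
  have sbb : s <= b <= b by rewrite sb lexx.
  have [db rb Fl] := stay b sbb.
  have gb : phi b <= b - s by apply: (grow b sbb _ db rb) => t /andP[st tb]; apply: stay; rewrite st ltW.
  have [z p] := Fex _ (ltW rb) (ltW Fl).
  have [Fp|] := ltP 0 (F (chart i (c b))); last first.
    move=> Fn; left; have /z E : F (chart i (c b)) = 0 by apply/eqP; rewrite eq_le Fn F0.
    by rewrite -(chartK db) E chartK.
  right; have [w [w1 wE]] := p Fp; exists w, (F (chart i (c b))); split=> //.
    by rewrite Fp le_min (ltW Fl) -/(phi b) gb.
  have FF : 0 <= F (chart i (c b)) <= l by rewrite (ltW Fp) ltW.
  by have [dw _] := ballG w _ w1 FF; rewrite -(chartK dw) wE chartK.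
right.
have Ub t : s <= t < tau -> (chart_inv i @` [set u | `|u - u0| <= rho]) (c t).
  by move=> /Ut[d r _]; exists (chart i (c t)); [exact: ltW|rewrite chartK].
have [u ur uE] := closed_left_limit (closed_chart_ball ri) st (cc tau) Ub.
have [dt et] := chart_invP (ri u ur); rewrite uE in dt et.
have rt : `|chart i (c tau) - u0| <= rho by rewrite et.
have Ft : phi tau <= l.
  rewrite leNgt; apply/negP => lF; pose g := phi tau - l; have g0 : 0 < g by rewrite subr_gt0.
  have cx : {for tau, continuous (fun t => chart i (c t))}.
    by apply: (@continuous_comp _ _ _ c (chart i) tau); [exact: cc|exact: chart_continuous_at].
  pose C' := Num.max C 1; have C'0 : 0 < C' by rewrite lt_max ltr01 orbT.
  have [d d0 Hd] := (continuousN _ tau).1 cx (g / C') (divr_gt0 g0 C'0).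
  pose t := Num.max s (tau - d / 2).
  have [st' dt'] : s <= t /\ tau - d / 2 <= t by rewrite !le_max !lexx orbT.
  have tt : t < tau by rewrite gt_max st; lra.
  have Utt : U (c t) by apply: Ut; rewrite st'.
  have td : `|t - tau| < d by rewrite ltr0_norm ?subr_lt0//; lra.
  have [d1 r2 F3] := Utt.
  have := le_trans (ler_norm _) (Flip _ _ rt (ltW r2)); rewrite distrC => H1.
  have H2 : C * `|chart i (c t) - chart i (c tau)| <= C' * `|chart i (c t) - chart i (c tau)|.
    by apply: ler_wpM2r; rewrite // le_max lexx.
  have := Hd t td; rewrite ltr_pdivlMr// mulrC => H3.
  by move: H1 H2 H3 F3; rewrite /g /phi; lra.
have rt' : `|chart i (c tau) - u0| < rho.
  rewrite lt_neqAle rt andbT; apply/eqP => /Fb; rewrite -/(phi tau) => lF.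
  by move: (le_lt_trans Ft lF); rewrite ltxx.
have FE : phi tau = l.
  by apply/eqP; rewrite eq_le Ft /= leNgt; apply/negP => Fl; apply: nU; split.
have gt : phi tau <= tau - s by apply: (grow tau _ Ut dt rt'); rewrite tb (ltW st).
have [_ p] := Fex _ rt Ft; have [|w [w1 wE]] := p; first by rewrite -/(phi tau) FE.
rewrite -/(phi tau) FE in wE.
exists tau, w; split=> //.
- by rewrite tb andbT; lra.
- move=> t /andP[s1]; rewrite le_eqVlt => /orP[/eqP->|t1]; first by split.
  by apply: ballU; apply: Ut; rewrite s1.
have ll : 0 <= l <= l by rewrite lexx ltW.
by have [dw _] := ballG w l w1 ll; rewrite -(chartK dw) wE chartK.
Unshelve. all: by end_near. Qed.

End NormalRegion.

Lemma hom_end_eq {R : realType} {T : topologicalType} (f g : R -> T) L L' : hom f g -> path_to L f -> path_to L' g -> f L = g L'.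
Proof.
move=> [H [cH H0 H1 [L2 L20 HL]]] [_ _ _ fL] [_ _ _ gL].
pose m := Num.max (Num.max L L') L2.
have [m1 m2 m3] : [/\ L <= m, L' <= m & L2 <= m] by rewrite !le_max !lexx !orbT.
have J0 : 0 <= (1 : R) <= 1 by rewrite ler01 lexx.
have J1 : 0 <= (0 : R) <= 1 by rewrite ler01 lexx.
rewrite -(fL m)// -(gL m)// -H0 -H1.
by have [_ ->//] := HL 0 m J1; have [_ ->] := HL 1 m J0.
Qed.

Lemma hom_start_eq {R : realType} {T : topologicalType} (f g : R -> T) : hom f g -> f 0 = g 0.
Proof. by case/hom_ends => L _ [_ [_ []]]. Qed.

(** * Durations of slow paths in a homotopy class *)

Section SlowPaths.
Context {R : realType} {n : nat} {M : smooth_manifold R n}.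
Variable h : riemannian_metric M.

Definition slow_path (L : R) (g : R -> M) := path_to L g /\ forall t, 0 <= t < L -> slow_at h g t.

(** The infimum of these [L] plays the role of the length of a shortest curve in the class of
    [f]. *)
Definition dur (f : R -> M) (L : R) := exists2 g, slow_path L g & hom f g.

Lemma slow_path_cat (L L' : R) f g : slow_path L f -> slow_path L' g -> f L = g 0 -> slow_path (L + L') (concat L f g).
Proof.
move=> [pf sf] [pg sg] fg; split; first exact: path_cat.
have [L0 _ _ _] := pf.
move=> t /andP[t0 tL]; have [Lt|Lt] := ltP t L.
  apply: (@slow_at_germ _ _ _ _ _ f t 0 (L - t)); rewrite ?subr_gt0// ?addr0//.
    by move=> s /andP[ts sL]; rewrite addr0 /concat ifT//; lra.
  by apply: sf; rewrite t0.
apply: (@slow_at_germ _ _ _ _ _ g t (- L) 1) => //; last by apply: sg; rewrite subr_ge0 Lt/= ltrBlDl.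
move=> s /andP[ts _]; rewrite /concat; case: (leP s L) => // sL.
have -> : s = L by apply/eqP; rewrite eq_le sL (le_trans Lt).
by rewrite subrr.
Qed.

Lemma slow_path_splice (L a b b' : R) f g : slow_path L f -> continuous g -> 0 <= a -> a <= b -> b <= L -> a <= b' ->
  g a = f a -> g b' = f b -> (forall t, a <= t < b' -> slow_at h g t) -> slow_path (L - b + b') (splice f g a b b').
Proof.
move=> [pf sf] cg a0 ab bL ab' ga gb sg; split; first exact: splice_path.
move=> t /andP[t0 tL]; have [ta|ta] := ltP t a.
  apply: (@slow_at_germ _ _ _ _ _ f t 0 (a - t)); rewrite ?subr_gt0// ?addr0//.
    by move=> s /andP[ts sL]; rewrite addr0 /splice ifT//; lra.
  by apply: sf; rewrite t0 (lt_le_trans ta)// (le_trans ab).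
have [tb|tb] := ltP t b'.
  apply: (@slow_at_germ _ _ _ _ _ g t 0 (b' - t)); rewrite ?subr_gt0// ?addr0//.
    move=> s /andP[ts sL]; rewrite addr0 /splice; case: (leP s a) => sa; last by rewrite ifT//; lra.
    by have -> : s = a by apply/eqP; rewrite eq_le sa (le_trans ta).
  by apply: sg; rewrite ta.
apply: (@slow_at_germ _ _ _ _ _ f t (b - b') 1) => //; last first.
  apply: sf; apply/andP; split; last by lra.
  by have := le_trans a0 ab; lra.
move=> s /andP[ts _]; rewrite /splice; case: (leP s a) => sa.
  have [-> bE] : s = a /\ b' = a by split; lra.
  by rewrite -ga -{1}bE gb bE addrC subrK.
case: (leP s b') => sb; last by congr f; ring.
have -> : s = b' by lra.
by rewrite gb addrC subrK.
Qed.

(** [C] bounds the metric norm by the coordinate norm on the whole ball, so a duration of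
    [C * |w - v|] suffices for a coordinate segment wherever it runs. *)
Lemma local_segment i u0 : chart_image i u0 -> exists r C : R, [/\ 0 < r, 1 <= C,
  forall u, `|u - u0| <= r -> chart_image i u &
  forall r' v w sigma, r' <= r -> `|v - u0| <= r' -> `|w - u0| <= r' -> 0 < sigma -> C * `|w - v| <= sigma ->
   [/\ slow_path sigma (segment i v w sigma), segment i v w sigma 0 = chart_inv i v,
    segment i v w sigma sigma = chart_inv i w & forall t, coord_ball i u0 r' (segment i v w sigma t)]].
Proof.
move=> iu; have [r [C [r0 C1 ri mb _]]] := metric_bounds h iu.
exists r, C; split=> // r' v w s r'r vr wr s0 Cs.
have ri' u : `|u - u0| <= r' -> chart_image i u by move=> ur; apply: ri; exact: le_trans ur r'r.
split.
- split; first exact: segment_path ri' s0 vr wr.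
  move=> t t0; apply: (segment_slow ri' s0 vr wr _ t0) => u ur.
  by apply: le_trans (mb u _ (le_trans ur r'r)).1 _.
- exact: (segment_start ri' s0 vr wr).
- exact: (segment_end ri' s0 vr wr).
- by move=> t; exact: (segment_ball _ ri' vr wr).
Qed.

Lemma near_coord_ball (i : chart_index M) p (r : R) : chart_dom i p -> 0 < r -> \forall y \near p, coord_ball i (chart i p) r y.
Proof.
move=> dp r0; have n1 : \forall y \near p, chart_dom i y by exact: open_nbhs_nbhs (conj (chart_dom_open i) dp).
have /cvgrPdist_le/(_ _ r0) n2 := chart_continuous_at dp.
by near=> y; split; [near: y; exact: n1|rewrite distrC; near: y; exact: n2].
Unshelve. all: by end_near. Qed.

(** Real induction on the time at which [f] is stopped: inside a coordinate ball the next stretch of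
    [f] is homotopic to a coordinate segment, which is slow if given enough time. *)
Lemma path_dur f (L : R) : path_to L f -> exists L', dur f L'.
Proof.
move=> [L0 cf f0 fL].
pose stop t s := f (Num.min s t).
have pstop t : 0 <= t -> path_to t (stop t).
  move=> t0; split=> //; first by rewrite /stop; compc f; cont.
    by move=> s s0; rewrite /stop (min_idPl (le_trans s0 t0)) (min_idPl t0) f0.
  by move=> s s0; rewrite /stop (min_idPr s0) minxx.
have step s t i u0 (r C : R) : 0 <= s -> s <= t -> 0 < r -> 1 <= C -> (forall u, `|u - u0| <= r -> chart_image i u) ->
   (forall v w sigma, `|v - u0| <= r -> `|w - u0| <= r -> 0 < sigma -> C * `|w - v| <= sigma ->
   [/\ slow_path sigma (segment i v w sigma), segment i v w sigma 0 = chart_inv i v,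
    segment i v w sigma sigma = chart_inv i w & forall t, coord_ball i u0 r (segment i v w sigma t)]) ->
   (forall y, s <= y <= t -> coord_ball i u0 r (f y)) -> (exists L', dur (stop s) L') -> exists L', dur (stop t) L'.
  move=> s0 st r0 C1 ri seg fb [L' [g sg hg]].
  have [ds bs] : coord_ball i u0 r (f s) by apply: fb; rewrite lexx.
  have [dt bt] : coord_ball i u0 r (f t) by apply: fb; rewrite st lexx.
  pose sigma := C * `|chart i (f t) - chart i (f s)| + 1.
  have sg0 : 0 < sigma by rewrite ltr_wpDl// mulr_ge0// (le_trans ler01).
  have sgC : C * `|chart i (f t) - chart i (f s)| <= sigma by rewrite /sigma lerDl.
  have [[pse sse] se0 se1 seb] := seg _ _ sigma bs bt sg0 sgC.
  rewrite chartK// in se0; rewrite chartK// in se1.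
  set se := segment i _ _ sigma in pse sse se0 se1 seb.
  have [_ cse se00 se11] := pse.
  have t0 := le_trans s0 st.
  pose k (y : R) := se (y - s).
  have ck : continuous k by rewrite /k; compc se => //; cont.
  have stt : stop t t = f t by rewrite /stop minxx.
  have sts : stop t s = f s by rewrite /stop (min_idPl st).
  have sss : stop s s = f s by rewrite /stop minxx.
  have H1 : hom (stop t) (splice (stop t) k s t (s + sigma)).
    apply: (hom_splice ri (pstop t t0) ck s0 st (lexx t)).
    - by rewrite lerDl ltW.
    - by rewrite /k subrr se0 sts.
    - by rewrite /k addrAC subrr add0r se1 stt.
    - by move=> y /andP[sy yt]; rewrite /stop (min_idPl yt); apply: fb; rewrite sy.
    - by move=> y _; exact: seb.
  have E : splice (stop t) k s t (s + sigma) = concat s (stop s) se.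
    apply/funext => y; rewrite /splice /concat /stop; case: (leP y s) => ys.
      by rewrite (min_idPl (le_trans ys st)).
    case: (leP y (s + sigma)) => // ys'.
    by rewrite (min_idPr _) ?se11 ?se1//; lra.
  have gL : stop s s = g L' by have [pg _] := sg; exact: hom_end_eq hg (pstop s s0) pg.
  exists (L' + sigma), (concat L' g se).
    by apply: slow_path_cat => //; rewrite se0 -sss gL.
  apply: hom_trans H1 _; rewrite E; have [pg _] := sg; apply: (hom_cat (pstop s s0) pg hg pse).
  by rewrite sss se0.
have E : stop L = f by apply/funext => s; rewrite /stop; case: (leP s L) => // /ltW Ls; rewrite fL.
rewrite -E; apply: (@real_induction R (fun t => exists L', dur (stop t) L') 0 L); last by rewrite L0 lexx.
- exists 0, (cst (f 0)); first by split=> [|t /andP[t0]]; [split=> //; exact: cst_continuous|rewrite ltNge t0].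
  have -> : stop 0 = cst (f 0).
    by apply/funext => s; rewrite /stop /cst; case: (leP s 0) => // /f0.
  by apply: (@hom_refl _ _ 0); split=> //; exact: cst_continuous.
- move=> t /andP[t0 tL] Hs.
  have [i di] := chart_dom_cover (f t).
  have [r [C [r0 C1 ri seg]]] := local_segment (chart_image_chart di).
  have nf : \forall y \near t, coord_ball i (chart i (f t)) r (f y) by exact: (cf t _ (near_coord_ball di r0)).
  have [d d0 Hd] := (nearN t (fun y : R => coord_ball i (chart i (f t)) r (f y))).1 nf.
  exists d => // s /andP[ts sd]; apply: (step t s i _ r C t0 (ltW ts) r0 C1 ri).
  + by move=> v w sg; exact: (seg r v w sg (lexx r)).
  + by move=> y /andP[ty ys]; apply: Hd; rewrite ger0_norm ?subr_ge0//; lra.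
  by apply: Hs; rewrite t0 lexx.
move=> t /andP[t0 tL] Hs.
have [i di] := chart_dom_cover (f t).
have [r [C [r0 C1 ri seg]]] := local_segment (chart_image_chart di).
have nf : \forall y \near t, coord_ball i (chart i (f t)) r (f y) by exact: (cf t _ (near_coord_ball di r0)).
have [d d0 Hd] := (nearN t (fun y : R => coord_ball i (chart i (f t)) r (f y))).1 nf.
pose s := Num.max 0 (t - d / 2).
have [s0 sd] : 0 <= s /\ t - d / 2 <= s by rewrite !le_max !lexx orbT.
have st : s < t by rewrite gt_max t0; lra.
apply: (step s t i _ r C s0 (ltW st) r0 C1 ri).
+ by move=> v w sg; exact: (seg r v w sg (lexx r)).
+ by move=> y /andP[ty ys]; apply: Hd; rewrite ler0_norm ?subr_le0//; lra.
by apply: Hs; rewrite s0.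
Qed.

End SlowPaths.

Lemma parallelogram_lt2 {R : realType} (N b : R) : 0 <= N -> 0 < b ->
  N ^+ 2 + b ^+ 2 = 2 * 1 ^+ 2 + 2 * 1 ^+ 2 -> N < 2.
Proof.
move=> N0 b0 E; rewrite -(@ltr_pXn2r _ 2)// ?nnegrE//.
have := exprn_gt0 2 b0; lra.
Qed.

Lemma corner_remainder {R : realType} (a b c d : R) : a * (2 * b) = c -> a * (b * d + b * d) = d * c.
Proof. by move=> <-; ring. Qed.

Lemma corner_increment {R : realType} (m : nat) (u v w a b : 'rV[R]_m) (s d : R) :
  w - v = d *: (a + b) + (w - u - (s + d - s) *: b - (v - u - (s - d - s) *: a)).
Proof. by apply/rowP => k; rewrite !mxE; ring. Qed.

Lemma corner_saving {R : realType} (N eps : R) : N = 2 - 8 * eps -> 0 < eps -> eps <= 4^-1 ->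
  (1 + eps) * (N + eps) < 2.
Proof. by move=> -> e0 e1; nra. Qed.

(** * Cutting corners *)

Section Corner.
Context {R : realType} {n : nat} {M : smooth_manifold R n}.
Variable h : riemannian_metric M.

(* By the parallelogram law two distinct unit vectors have a sum of norm less
   than 2, so the coordinate segment from [gam1 (s - delta)] to
   [gam2 (s + delta)] is shorter than [2 delta]. *)
Lemma corner_cut i gam1 gam2 (s d : R) : geodesic h setT gam1 -> geodesic h setT gam2 -> gam1 s = gam2 s ->
  chart_dom i (gam1 s) -> gnorm h i (chart i (gam1 s)) (velocity i gam1 s) = 1 ->
  gnorm h i (chart i (gam1 s)) (velocity i gam2 s) = 1 -> velocity i gam1 s <> velocity i gam2 s -> 0 < d ->
  exists2 kappa : R, 0 < kappa & forall L g, slow_path h L g -> d <= s -> s + d <= L ->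
    (forall t, s - d <= t <= s -> g t = gam1 t) -> (forall t, s <= t <= s + d -> g t = gam2 t) ->
    dur h g (L - kappa).
Proof.
move=> g1 g2 e12 d1 n1 n2 vv d0; set u0 := chart i (gam1 s) in n1 n2.
set v1 := velocity i gam1 s in n1 vv; set v2 := velocity i gam2 s in n2 vv.
have iu := chart_image_chart d1; rewrite -/u0 in iu.
have d2 : chart_dom i (gam2 s) by rewrite -e12.
have [r [C [r0 C1 ri mb mb2]]] := metric_bounds h iu.
have C0 : 0 < C by apply: lt_le_trans C1.
have u00 : `|u0 - u0| <= r by rewrite subrr normr0 ltW.
pose N := gnorm h i u0 (v1 + v2); have N0 : 0 <= N by exact: gnorm_ge0.
have N2 : N < 2.
  have := gnorm_parallelogram h v1 v2 iu; rewrite n1 n2 -/N.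
  have v12 : v1 - v2 != 0 by rewrite subr_eq0; exact/eqP.
  exact: parallelogram_lt2 N0 (gnorm_gt0 h iu v12).
clear vv.
(* One [eps] pays for the linear approximation of the geodesics, another for the variation of the
   metric over the ball; with [N = 2 - 8 * eps], the product [(1 + eps) * (N + eps)] is still less
   than 2. *)
pose eps := (2 - N) / 8; have eps0 : 0 < eps by move: N2; rewrite /eps; clear -h; lra.
have eps1 : eps <= 4^-1 by move: N0; rewrite /eps; clear -h; lra.
have epsE : N = 2 - 8 * eps by rewrite /eps; field.
clearbody eps.
pose r' := Num.min r (eps / C).
have r'0 : 0 < r' by rewrite lt_min r0 divr_gt0.
have [r'r r'e] : r' <= r /\ r' <= eps / C by rewrite !ge_min !lexx orbT.
clearbody r'.
have ri' u : `|u - u0| <= r' -> chart_image i u by move=> ur; apply: ri; exact: le_trans ur r'r.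
(* Two linearisation errors of [e1 * delta], converted to the metric norm by the factor [C], add up
   to [eps * delta]. *)
pose e1 := eps / (2 * C); have e10 : 0 < e1 by rewrite divr_gt0// mulr_gt0.
have e1C : C * (2 * e1) = eps by rewrite /e1; field; rewrite gt_eqF.
have e11 : e1 <= 1.
  by rewrite /e1 ler_pdivrMr ?mulr_gt0// mul1r; apply: le_trans eps1 _; move: C1; clear -h; lra.
clearbody e1.
have [x1 _] := geodesicT_ode g1 d1; have [x2 _] := geodesicT_ode g2 d2.
have [da da0 Ha] := derive_approx x1 e10; have [db db0 Hb] := derive_approx x2 e10.
rewrite -/u0 -/v1 in Ha; rewrite -e12 -/u0 -/v2 in Hb.
have c1 : {for s, continuous gam1} by exact: (geodesicT_continuous g1).
have c2 : {for s, continuous gam2} by exact: (geodesicT_continuous g2).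
have [dc dc0 Hc] := (nearN s _).1 (near_chart_dom c1 d1).
have [dd dd0 Hd] := (nearN s _).1 (near_chart_dom c2 d2).
pose delta := Num.min (Num.min d (r' / (C + 1))) (Num.min (Num.min (da / 2) (db / 2)) (Num.min (dc / 2) (dd / 2))).
have C10 : 0 < C + 1 by rewrite addr_gt0.
have de0 : 0 < delta by rewrite !lt_min d0 !divr_gt0.
have [ded der [dea deb] [dec dede]] : [/\ delta <= d, (C + 1) * delta <= r', delta <= da / 2 /\ delta <= db / 2 &
    delta <= dc / 2 /\ delta <= dd / 2].
  have : delta <= delta by [].
  rewrite {2}/delta !le_min => /and3P[/andP[a1 a2] /andP[a3 a4] /andP[a5 a6]]; split=> //.
  by rewrite mulrC -ler_pdivlMr.
clearbody delta.
have vC v : gnorm h i u0 v = 1 -> `|v| <= C by move=> v1'; have [_] := mb u0 v u00; rewrite v1' mulr1.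
have near1 gam v (dx dy : R) : `|v| <= C -> delta <= dx / 2 -> 0 < dx -> delta <= dy / 2 -> 0 < dy ->
    (forall t, `|t - s| < dx -> `|chart i (gam t) - u0 - (t - s) *: v| <= e1 * `|t - s|) ->
    (forall t, `|t - s| < dy -> chart_dom i (gam t)) ->
    forall t, `|t - s| <= delta -> coord_ball i u0 r' (gam t) /\ `|chart i (gam t) - u0 - (t - s) *: v| <= e1 * `|t - s|.
  move=> vb dex dx0 dey dy0 H1 H2 t td.
  have half x : 0 < x -> delta <= x / 2 -> `|t - s| < x.
    by move=> x0 dex'; apply: le_lt_trans td _; apply: le_lt_trans dex' _; move: x0; clear -h; lra.
  have A := H1 t (half _ dx0 dex); have B := H2 t (half _ dy0 dey).
  split=> //; split=> //; have := normB_add A (lexx _); rewrite normrZ => A2.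
  apply: le_trans A2 _; apply: le_trans der; apply: le_trans (ler_wpM2l (ltW C10) td).
  have := ler_wpM2l (normr_ge0 (t - s)) vb; have := ler_wpM2r (normr_ge0 (t - s)) e11.
  rewrite mul1r => q2 q3; rewrite [leRHS]mulrDl mul1r addrC [C * _]mulrC; exact: lerD q3 q2.
have B1 := near1 gam1 v1 da dc (vC _ n1) dea da0 dec dc0 Ha Hc.
have B2 := near1 gam2 v2 db dd (vC _ n2) deb db0 dede dd0 Hb Hd.
pose v := chart i (gam1 (s - delta)); pose w := chart i (gam2 (s + delta)).
have sd1 : `|s - delta - s| = delta by rewrite addrAC subrr add0r normrN gtr0_norm.
have sd2 : `|s + delta - s| = delta by rewrite addrAC subrr add0r gtr0_norm.
have sd1' : `|s - delta - s| <= delta by rewrite sd1.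
have sd2' : `|s + delta - s| <= delta by rewrite sd2.
have [[dv vr] va] := B1 (s - delta) sd1'.
have [[dw wr] wa] := B2 (s + delta) sd2'.
rewrite sd1 -/v in va vr; rewrite sd2 -/w in wa wr.
have wv : gnorm h i u0 (w - v) <= delta * (N + eps).
  pose rem := w - u0 - (s + delta - s) *: v2 - (v - u0 - (s - delta - s) *: v1).
  have remb : `|rem| <= e1 * delta + e1 * delta := le_trans (ler_normB _ _) (lerD wa va).
  have -> : w - v = delta *: (v1 + v2) + rem := corner_increment u0 v w v1 v2 s delta.
  apply: le_trans (gnormD h _ _ iu) _; rewrite gnormZ gtr0_norm// -/N mulrDr lerD2l.
  apply: le_trans (mb u0 rem u00).1 _; apply: le_trans (ler_wpM2l (ltW C0) remb) _.
  by rewrite (corner_remainder _ e1C).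
pose sigma := delta * ((1 + eps) * (N + eps)).
have sg0 : 0 < sigma by rewrite !mulr_gt0//; move: N0 eps0; clear -h; lra.
have sgle u : `|u - u0| <= r' -> gnorm h i u (w - v) <= sigma.
  move=> ur; apply: le_trans (mb2 u u0 _ (le_trans ur r'r) u00) _.
  rewrite /sigma mulrCA; apply: ler_pM; rewrite ?gnorm_ge0// ?addr_ge0 ?mulr_ge0// ?(ltW C0)//.
  rewrite lerD2l mulrC -ler_pdivlMr//; exact: le_trans ur r'e.
have kap : sigma < 2 * delta.
  rewrite /sigma mulrC ltr_pM2r//.
  exact: corner_saving epsE eps0 eps1.
clearbody sigma.
(* The saving depends on the two geodesics only and is fixed before the competitor [g]; this allows
   a competitor with a surplus smaller than the saving to be chosen afterwards. *)
exists (2 * delta - sigma); first by rewrite subr_gt0.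
move=> L g sg ds sL E1 E2.
pose k t := segment i v w sigma (t - (s - delta)).
have [_ cse _ _] := segment_path ri' sg0 vr wr.
have ck : continuous k by rewrite /k; compc (segment i v w sigma) => //; cont.
have a0 : 0 <= s - delta by rewrite subr_ge0 (le_trans ded).
have ab : s - delta <= s + delta by move: de0; clear -h; lra.
have bL : s + delta <= L by apply: le_trans sL; rewrite lerD2l.
have ab' : s - delta <= s - delta + sigma by rewrite lerDl ltW.
have ka : k (s - delta) = g (s - delta).
  by rewrite /k subrr (segment_start ri' sg0 vr wr)// /v chartK// E1// lerD2l lerN2 ded gerBl ltW.
have kb : k (s - delta + sigma) = g (s + delta).
  by rewrite /k addrAC subrr add0r (segment_end ri' sg0 vr wr)// /w chartK// E2// lerD2l ded lerDl ltW.
exists (splice g k (s - delta) (s + delta) (s - delta + sigma)).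
  have -> : L - (2 * delta - sigma) = L - (s + delta) + (s - delta + sigma) by ring.
  apply: (slow_path_splice sg ck a0 ab bL ab' ka kb) => t /andP[t1 t2].
  apply: (@slow_at_germ _ _ _ h _ (segment i v w sigma) t (- (s - delta)) 1) => //.
  by apply: (segment_slow ri' sg0 vr wr sgle); rewrite subr_ge0 t1 ltrBlDl.
have [pg _] := sg; apply: (hom_splice ri' pg ck a0 ab bL ab' ka kb).
  move=> t /andP[t1 t2]; have [ts|st] := leP t s.
    rewrite E1; last by rewrite ts andbT (le_trans _ t1)// lerD2l lerN2.
    have td : `|t - s| <= delta by rewrite ler0_norm ?subr_le0// opprB; move: t1; clear -h; lra.
    by have [] := B1 t td.
  rewrite E2; last by rewrite (ltW st) (le_trans t2)// lerD2l.
  have td : `|t - s| <= delta by rewrite gtr0_norm ?subr_gt0// lerBlDl.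
  by have [] := B2 t td.
by move=> t _; exact: (segment_ball _ ri' vr wr).
Qed.

End Corner.

(** Locally uniform thresholds on a compact set have a common one: a near covering along the filter
    of positive numbers tending to 0. *)
Lemma compact_uniform {R : realType} {X : topologicalType} (K : set X) (P : R -> X -> Prop) : compact K ->
  (forall x, K x -> exists2 d : R, 0 < d & \forall y \near x, forall eta, 0 < eta <= d -> P eta y) ->
  exists2 d : R, 0 < d & forall x, K x -> P d x.
Proof.
move=> /compact_near_coveringP cK H.
have N : \forall eta \near 0^'+, K `<=` P eta.
  apply: cK => x Kx; have [d d0 nA] := H x Kx.
  exists ([set y | forall eta, 0 < eta <= d -> P eta y], [set eta | 0 < eta <= d]); first split=> //=.
    near=> eta; apply/andP; split; near: eta; [exact: nbhs_right_gt|exact: nbhs_right_le].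
  by move=> [y eta] /= [Ay etad]; exact: Ay.
have [d [d0 Pd]] : exists d : R, 0 < d /\ K `<=` P d.
  have N2 : \forall eta \near 0^'+, 0 < eta /\ K `<=` P eta.
    near=> eta; split; near: eta; [exact: nbhs_right_gt|exact: N].
  by have [d Hd] := filter_ex N2; exists d.
by exists d.
Unshelve. all: by end_near. Qed.

(** * Minimizing rays in homotopy classes *)

Section HopfRinow.
Context {R : realType} {n : nat} {M : smooth_manifold R n}.
Variable h : riemannian_metric M.

Lemma exponential_family i q : complete_metric h -> chart_dom i q -> exists G : 'rV[R]_n -> R -> M,
  [/\ forall v, geodesic h setT (G v), forall v, G v 0 = q & forall v, velocity i (G v) 0 = v].
Proof.
move=> hc dq; pose G v := projT1 (cid (geodesic_exists v hc dq)).
have GP v : [/\ geodesic h setT (G v), G v 0 = q & velocity i (G v) 0 = v] by rewrite /G; case: cid.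
by exists G; split=> v; have [] := GP v.
Qed.

Lemma gnorm_continuous i u : chart_image i u -> continuous (gnorm h i u).
Proof.
move=> iu; have [r [C [r0 C1 _ mb _]]] := metric_bounds h iu.
have u0 : `|u - u| <= r by rewrite subrr normr0 ltW.
have C0 : 0 < C by apply: lt_le_trans C1.
have tri v w : gnorm h i u v <= C * `|v - w| + gnorm h i u w.
  rewrite -{1}[v](subrK w); apply: le_trans (gnormD h _ _ iu) _; rewrite lerD2r; exact: (mb u _ u0).1.
move=> v; apply/continuousN => e e0; exists (e / C); first exact: divr_gt0.
move=> w; rewrite ltr_pdivlMr// mulrC => wv.
have := tri v w; have := tri w v; rewrite distrC in wv; rewrite (distrC w v) => a b.
by rewrite ltr_norml; apply/andP; split; lra.
Qed.

Lemma unit_sphere_compact i u : chart_image i u -> compact [set w | gnorm h i u w = 1].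
Proof.
move=> iu; have [r [C [r0 C1 _ mb _]]] := metric_bounds h iu.
have u0 : `|u - u| <= r by rewrite subrr normr0 ltW.
apply: bounded_closed_compact.
  exists C; split; first exact: num_real.
  move=> x Cx w /= w1; have := (mb u w u0).2; rewrite w1 mulr1 => /le_trans; apply; exact: ltW.
rewrite (_ : [set w | _] = gnorm h i u @^-1` [set 1]) //.
by apply: preimage_closed; [move=> w _; exact: gnorm_continuous|exact: closed_eq].
Qed.

(** Approximate form of the statement that [gam] on [[0, s]] starts a shortest curve in the class of
    [f]: a competitor begins with this arc and exceeds the infimum [ell] by at most [eta]. [P]
    records what else is known of the competitor. *)
Definition follows f (ell : R) (gam : R -> M) (s eta : R) (P : (R -> M) -> Prop) :=
  exists g L, [/\ slow_path h L g, hom f g, L <= ell + eta, forall t, 0 <= t <= s -> g t = gam t & P g].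

(** For each surplus [normal_region] allows the competitor to leave [gam s] along a radial geodesic
    of length [l], but its direction depends on the surplus. If every direction failed at some
    surplus, compactness of the unit sphere would give one surplus at which all of them fail. *)
Lemma extend_minimal f (ell s : R) gam i G : (forall L, dur h f L -> ell <= L) -> 0 <= s < ell ->
  (forall eta : R, 0 < eta -> follows f ell gam s eta (fun=> True)) -> chart_dom i (gam s) ->
  (forall v, geodesic h setT (G v)) -> (forall v, G v 0 = gam s) -> (forall v, velocity i (G v) 0 = v) ->
  exists w l, [/\ gnorm h i (chart i (gam s)) w = 1, 0 < l, s + l <= ell &
    forall eta : R, 0 < eta -> follows f ell gam s eta (fun g => forall t, s <= t <= s + l -> g t = G w (t - s))].
Proof.
move=> mn /andP[s0 sl] Q dq Gg Gs Gv.
set q := gam s; set u0 := chart i q; have iu := chart_image_chart dq.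
have [rs [C [rs0 C1 _ seg]]] := local_segment h iu.
have e0 : 0 < Num.min ((ell - s) / 2) rs by rewrite lt_min rs0 divr_gt0// subr_gt0.
have [rho [l [/andP[rho0 rhoe] /andP[l0 le] ri ballG NR]]] := normal_region dq Gg Gs Gv e0.
have [lell rhors] : l <= (ell - s) / 2 /\ rho <= rs.
  by move: le rhoe; rewrite !le_min => /andP[-> _] /andP[_ ->].
have sll : s + l < ell by lra.
pose Ext eta w := follows f ell gam s eta (fun g => forall t, s <= t <= s + l -> g t = G w (t - s)).
have GC w : continuous (G w) by exact: geodesicT_continuous (Gg w).
have Gslow w t : gnorm h i u0 w = 1 -> slow_at h (G w) t.
  move=> w1; have d0 : chart_dom i (G w 0) by rewrite Gs.
  have E : gnorm h i (chart i (G w 0)) (velocity i (G w) 0) = 1 by rewrite Gs Gv.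
  exact: (@slow_geodesic R n M h (G w) i 0 t (Gg w) d0 E).
have shiftc w : continuous (fun t => G w (t - s)) by compc (G w) => //; cont.
have shifts w t : gnorm h i u0 w = 1 -> slow_at h (fun t => G w (t - s)) t.
  by move=> w1; apply: (@slow_at_germ _ _ _ h _ (G w) t (- s) 1) => //; exact: Gslow.
have B eta : 0 < eta -> exists2 w, gnorm h i u0 w = 1 & Ext eta w.
  move=> eta0; have [g [L [sg hg Le gE _]]] := Q eta eta0.
  have gs : g s = q by apply: gE; rewrite s0 lexx.
  have Lell : ell <= L by apply: mn; exists g.
  have [pg slg] := sg; have [L0 cg _ _] := pg.
  have sL : s <= L by apply: le_trans Lell; exact: ltW.
  have slg' t : s <= t < L -> slow_at h g t by move=> /andP[st tL]; apply: slg; rewrite (le_trans s0).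
  have [[bg gq]|[tau [w [/andP[st tL] bg w1 Gw]]]] := NR g s L sL cg slg' gs.
    (* A competitor that never reaches the geodesic sphere could be ended inside the ball by time
       [s + l], which is less than [ell]. *)
    exfalso; case: gq => [gq|[w [sg' [w1 /andP[sg0 sgl] Gw]]]].
      have := @hom_splice _ _ _ i u0 rho L s L s g (cst q) ri pg (@cst_continuous _ _ q) s0 sL (lexx L) (lexx s).
      rewrite gs gq => /(_ erefl erefl bg) hs.
      have sp := @slow_path_splice _ _ _ h L s L s g (cst q) sg (@cst_continuous _ _ q) s0 sL (lexx L) (lexx s).
      rewrite gs gq subrr add0r in sp.
      have : dur h f s.
        exists (splice g (cst q) s L s).
          by apply: sp => // t /andP[t1 /(le_lt_trans t1)]; rewrite ltxx.
        apply: hom_trans hg (hs _) => t /andP[t1 t2]; have -> : t = s by lra.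
        by split=> //=; rewrite subrr normr0 ltW.
      by move=> /mn; lra.
    move: sgl; rewrite le_min => /andP[sgl _].
    have ss' : s <= s + sg' by lra.
    have e1 : G w (s - s) = g s by rewrite subrr Gs gs.
    have e2 : G w (s + sg' - s) = g L by rewrite addrAC subrr add0r.
    have : dur h f (s + sg').
      exists (splice g (fun t => G w (t - s)) s L (s + sg')).
        have := @slow_path_splice _ _ _ h L s L (s + sg') g _ sg (shiftc w) s0 sL (lexx L) ss' e1 e2 (fun t _ => shifts w t w1).
        by rewrite subrr add0r.
      apply: hom_trans hg _; apply: (hom_splice ri pg (shiftc w) s0 sL (lexx L) ss' e1 e2 bg) => t /andP[t1 t2].
      by apply: ballG => //; lra.
    by move=> /mn; lra.
  exists w => //; have ss' : s <= s + l by lra.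
  have stau : s <= tau by lra.
  have e1 : G w (s - s) = g s by rewrite subrr Gs gs.
  have e2 : G w (s + l - s) = g tau by rewrite addrAC subrr add0r.
  exists (splice g (fun t => G w (t - s)) s tau (s + l)), (L - tau + (s + l)); split.
  - exact: (@slow_path_splice _ _ _ h L s tau (s + l) g _ sg (shiftc w) s0 stau tL ss' e1 e2 (fun t _ => shifts w t w1)).
  - apply: hom_trans hg _; apply: (hom_splice ri pg (shiftc w) s0 stau tL ss' e1 e2 bg) => t /andP[t1 t2].
    by apply: ballG => //; lra.
  - by lra.
  - by move=> t /andP[t0 ts]; rewrite /splice ts gE// t0.
  - move=> t /andP[st' tl]; rewrite /splice; case: (leP t s) => ts; last by rewrite tl.
    by have -> : t = s by [lra]; rewrite gs subrr Gs.
apply: contrapT => nex.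
have [|d d0 Hd] := @compact_uniform R _ [set w | gnorm h i u0 w = 1]
    (fun eta w => gnorm h i u0 w = 1 -> ~ Ext eta w) (unit_sphere_compact iu); last first.
  by have [w w1 Ew] := B d d0; exact: (Hd w w1 w1 Ew).
move=> w w1.
have [eta eta0 nE] : exists2 eta : R, 0 < eta & ~ Ext eta w.
  apply: contrapT => nE; apply: nex; exists w, l; split=> //; first exact: ltW.
  by move=> eta eta0; apply: contrapT => nE'; apply: nE; exists eta.
(* Failure of [w] at surplus [eta] forces failure of nearby [w'] at surplus at most [eta / 2]:
   otherwise the competitor along [w'] could be rerouted along [w] and then over a coordinate
   segment to [G w' l], at an additional cost of [eta / 2]. *)
pose sg := eta / 2; have sg0 : 0 < sg by rewrite divr_gt0.
have l00 : 0 <= l <= l by rewrite lexx ltW.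
have [dwl rwl] := ballG w l w1 l00.
have cw : {for w, continuous (fun w' => chart i (G w' l))}.
  have fc := flow_continuous Gg Gs dq Gv (v0 := w) (ltW l0).
  have fc2 : {for w, continuous (fun w' => G w' (Num.max 0 l))}.
    apply: (@continuous_comp _ _ _ (fun w' => (w', l)) (fun p : 'rV[R]_n * R => G p.1 (Num.max 0 p.2))); last exact: fc.
    exact: (@contpair _ _ _ (fun w1 => w1) (fun=> l) (@contid _) (@contcst _ _ _) w).
  rewrite (max_idPr (ltW l0)) in fc2.
  by apply: (@continuous_comp _ _ _ (fun w' => G w' l) (chart i) w fc2); exact: chart_continuous_at.
have C0 : 0 < C by apply: lt_le_trans C1.
have [d d0 Hd] := (continuousN _ w).1 cw (sg / C) (divr_gt0 sg0 C0).
exists sg => //; near=> w' => eta' /andP[eta'0 eta's] w'1 [g [L [slg hg Le gE gG]]]; apply: nE.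
have wd : `|w' - w| < d by near: w'; exact: nbhs_lt.
have [dwl' rwl'] := ballG w' l w'1 l00.
have Csg : C * `|chart i (G w' l) - chart i (G w l)| <= sg.
  by have := Hd w' wd; rewrite ltr_pdivlMr// mulrC => /ltW.
have [[pse sse] se0 se1 seb] := seg rho _ _ sg rhors rwl rwl' sg0 Csg.
rewrite chartK// in se0; rewrite chartK// in se1.
set se := segment i _ _ sg in pse sse se0 se1 seb.
have [_ cse se00 se11] := pse.
pose k (t : R) := if t - (s + l) <= 0 then G w (t - s) else se (t - (s + l)).
have ck : continuous k.
  apply: (@glue_continuous _ _ _ (fun t : R => t - (s + l)) (fun t => G w (t - s)) (fun t => se (t - (s + l)))).
  - by cont.
  - exact: shiftc.
  - by compc se => //; cont.
  by move=> t /subr0_eq ->; rewrite subrr se0 addrAC subrr add0r.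
have kl t : t <= s + l -> k t = G w (t - s) by move=> tl; rewrite /k subr_le0 tl.
have ku t : s + l <= t -> k t = se (t - (s + l)).
  move=> lt; rewrite /k subr_le0; case: (leP t (s + l)) => // tl.
  have -> : t = s + l by apply/eqP; rewrite eq_le tl.
  by rewrite subrr se0 addrAC subrr add0r.
have gs : g s = q by apply: gE; rewrite s0 lexx.
have ssl : s <= s + l by rewrite lerDl ltW.
have ssl' : s <= s + l + sg by rewrite -addrA lerDl addr_ge0// ltW.
have Lell : ell <= L by apply: mn; exists g.
have slL : s + l <= L by apply: le_trans Lell; exact: ltW.
have e1 : k s = g s by rewrite kl// subrr Gs gs.
have e2 : k (s + l + sg) = g (s + l).
  rewrite ku ?lerDl ?ltW// addrAC subrr add0r se1 gG; first by rewrite addrAC subrr add0r.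
  by rewrite ssl lexx.
have ksl t : s <= t < s + l + sg -> slow_at h k t.
  move=> /andP[st tl]; have [tsl|tsl] := ltP t (s + l).
    apply: (@slow_at_germ _ _ _ h _ (fun t => G w (t - s)) t 0 (s + l - t)); rewrite ?subr_gt0//.
      by move=> y /andP[_ yl]; rewrite [t + _]addrC subrK in yl; rewrite addr0 (kl _ (ltW yl)).
    exact: shifts.
  apply: (@slow_at_germ _ _ _ h _ se t (- (s + l)) 1) => //.
    by move=> y /andP[ty _]; rewrite ku// (le_trans tsl).
  by apply: sse; rewrite subr_ge0 tsl ltrBlDl.
have [pg _] := slg.
exists (splice g k s (s + l) (s + l + sg)), (L - (s + l) + (s + l + sg)); split.
- exact: slow_path_splice slg ck s0 ssl slL ssl' e1 e2 ksl.
- apply: hom_trans hg _; apply: (hom_splice ri pg ck s0 ssl slL ssl' e1 e2).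
    move=> t /andP[t1 t2]; rewrite gG ?t1//; apply: ballG => //.
    by rewrite subr_ge0 t1 lerBlDl.
  move=> t /andP[t1 t2]; have [tl|tl] := leP t (s + l); last by rewrite ku ?ltW//; exact: seb.
  by rewrite kl//; apply: ballG => //; rewrite subr_ge0 t1 lerBlDl.
- have -> : L - (s + l) + (s + l + sg) = L + sg by ring.
  by apply: le_trans (lerD Le (lexx sg)) _; rewrite -addrA lerD2l; move: eta's; rewrite /sg; clear -h; lra.
- by move=> t /andP[t0 ts]; rewrite /splice ts gE// t0.
move=> t /andP[st' tl]; rewrite /splice; case: (leP t s) => ts.
  by have -> : t = s by [apply/eqP; rewrite eq_le ts]; rewrite gs subrr Gs.
by rewrite (le_trans tl) ?lerDl ?ltW// kl.
Unshelve. all: by end_near. Qed.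

End HopfRinow.

Lemma half_absurd {R : realType} (a l : R) : 0 < l -> a + l <= a + l / 2 -> False.
Proof. by lra. Qed.

Lemma budget_absurd {R : realType} (a l k : R) : 0 < k -> l <= a + k / 2 -> a <= l - k -> False.
Proof. by lra. Qed.

Lemma budget_bound {R : realType} (L a s m ell eta : R) : 0 < eta -> L <= ell + eta / 2 -> s - m / 2 <= a ->
  m <= eta / 4 -> L - a + (s + eta / 4) <= ell + eta.
Proof. by lra. Qed.

(** * Continuation of a minimizing ray up to the infimum *)

Section HopfRinowTheorem.
Context {R : realType} {n : nat} {M : smooth_manifold R n}.
Variable h : riemannian_metric M.
Hypothesis complete_h : complete_metric h.

(** A competitor that follows [gam] up to a slightly earlier time [a] gets an excursion inserted
    there: along [gam] to time [s], then back to [gam a] over a coordinate segment. The excursion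
    lies in a small ball, so the class is kept, and it costs [s - a] plus [eta / 4]. *)
Lemma follows_limit f (ell s : R) gam : (forall L, dur h f L -> ell <= L) -> 0 < s <= ell -> continuous gam ->
  (forall t, slow_at h gam t) ->
  (forall s', 0 <= s' < s -> forall eta : R, 0 < eta -> follows h f ell gam s' eta (fun=> True)) ->
  forall eta : R, 0 < eta -> follows h f ell gam s eta (fun=> True).
Proof.
move=> mn /andP[s0 sl] cg sg Q eta eta0.
have [i dq] := chart_dom_cover (gam s).
have [r [C [r0 C1 ri seg]]] := local_segment h (chart_image_chart dq).
have C0 : 0 < C by apply: lt_le_trans C1.
pose sigma := eta / 4; have sg0 : 0 < sigma by rewrite divr_gt0.
pose r' := Num.min r (sigma / C); have r'0 : 0 < r' by rewrite lt_min r0 divr_gt0.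
have [r'r r'C] : r' <= r /\ r' <= sigma / C by rewrite !ge_min !lexx orbT.
have nb : \forall t \near s, coord_ball i (chart i (gam s)) r' (gam t) by exact: (cg s _ (near_coord_ball dq r'0)).
have [d d0 Hd] := (nearN s (fun t : R => coord_ball i (chart i (gam s)) r' (gam t))).1 nb.
pose a := Num.max 0 (s - Num.min d sigma / 2).
have dm0 : 0 < Num.min d sigma by rewrite lt_min d0.
have [dm1 dm2] : Num.min d sigma <= d /\ Num.min d sigma <= sigma by rewrite !ge_min !lexx orbT.
have [a0 ads] : 0 <= a /\ s - Num.min d sigma / 2 <= a by rewrite !le_max !lexx orbT.
have as_ : a < s by rewrite gt_max s0; lra.
have aI : 0 <= a < s by rewrite a0.
have e20 : 0 < eta / 2 by rewrite divr_gt0.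
have [g [L [slg hg Le gE _]]] := Q a aI (eta / 2) e20.
have inb t : a <= t <= s -> coord_ball i (chart i (gam s)) r' (gam t).
  by move=> /andP[at_ ts]; apply: Hd; rewrite ler0_norm ?subr_le0// opprB; lra.
have aa : a <= a <= s by rewrite lexx ltW.
have ss : a <= s <= s by rewrite lexx ltW.
have [da ra] := inb a aa; have [_ rs] := inb s ss.
have Csg : C * `|chart i (gam a) - chart i (gam s)| <= sigma.
  by rewrite mulrC -ler_pdivlMr//; exact: le_trans ra r'C.
have [[pse sse] se0 se1 seb] := seg r' _ _ sigma r'r rs ra sg0 Csg.
rewrite chartK// in se0; rewrite chartK// in se1.
set se := segment i _ _ sigma in pse sse se0 se1 seb.
have [_ cse _ _] := pse.
pose k (t : R) := if t - s <= 0 then gam t else se (t - s).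
have ck : continuous k.
  apply: (@glue_continuous _ _ _ (fun t : R => t - s) gam (fun t => se (t - s))) => //.
  - by cont.
  - by compc se => //; cont.
  by move=> t /subr0_eq ->; rewrite subrr se0.
have kl t : t <= s -> k t = gam t by move=> tl; rewrite /k subr_le0 tl.
have ku t : s <= t -> k t = se (t - s).
  move=> lt; rewrite /k subr_le0; case: (leP t s) => // tl.
  have -> : t = s by apply/eqP; rewrite eq_le tl.
  by rewrite subrr se0.
have Lell : ell <= L by apply: mn; exists g.
have aL : a <= L by apply: le_trans Lell; apply: le_trans sl; exact: ltW.
have as' : a <= s + sigma by apply: le_trans (ltW as_) _; rewrite lerDl ltW.
have ga : g a = gam a by apply: gE; rewrite a0 lexx.
have e1 : k a = g a by rewrite kl ?ltW.
have e2 : k (s + sigma) = g a by rewrite ku ?lerDl ?ltW// addrAC subrr add0r se1.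
have ksl t : a <= t < s + sigma -> slow_at h k t.
  move=> /andP[st tl]; have [tsl|tsl] := ltP t s.
    apply: (@slow_at_germ _ _ _ h _ gam t 0 (s - t)); rewrite ?subr_gt0// ?addr0//.
    by move=> y /andP[_ yl]; rewrite [t + _]addrC subrK in yl; rewrite addr0 (kl _ (ltW yl)).
  apply: (@slow_at_germ _ _ _ h _ se t (- s) 1) => //.
    by move=> y /andP[ty _]; rewrite ku// (le_trans tsl).
  by apply: sse; rewrite subr_ge0 tsl ltrBlDl.
have ri' u : `|u - chart i (gam s)| <= r' -> chart_image i u by move=> ur; apply: ri; exact: le_trans ur r'r.
have [pg _] := slg.
exists (splice g k a a (s + sigma)), (L - a + (s + sigma)); split=> //.
- exact: slow_path_splice slg ck a0 (lexx a) aL as' e1 e2 ksl.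
- apply: hom_trans hg _; apply: (hom_splice ri' pg ck a0 (lexx a) aL as' e1 e2).
    by move=> t /andP[t1 t2]; have -> : t = a; [apply/eqP; rewrite eq_le t2|rewrite ga].
  move=> t /andP[t1 t2]; have [tl|tl] := leP t s; last by rewrite ku ?ltW//; exact: seb.
  by rewrite kl//; apply: inb; rewrite t1.
- exact: budget_bound eta0 Le ads dm2.
move=> t /andP[t0 ts]; rewrite /splice; case: (leP t a) => ta; first by rewrite gE// t0.
by rewrite (le_trans ts) ?lerDl ?ltW// kl.
Qed.

Section Rays.
Variables (x : M) (i0 : chart_index M) (G : 'rV[R]_n -> R -> M).
Hypothesis chart_x : chart_dom i0 x.
Hypothesis G_geodesic : forall v, geodesic h setT (G v).
Hypothesis G_start : forall v, G v 0 = x.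
Hypothesis G_velocity : forall v, velocity i0 (G v) 0 = v.
Let unit_vector u := gnorm h i0 (chart i0 x) u = 1.

Definition ray u (L t : R) := G u (Num.max 0 (Num.min t L)).

Lemma ray_slow u t : unit_vector u -> slow_at h (G u) t.
Proof.
move=> u1; have d0 : chart_dom i0 (G u 0) by rewrite G_start.
have E : gnorm h i0 (chart i0 (G u 0)) (velocity i0 (G u) 0) = 1 by rewrite G_start G_velocity.
exact: (@slow_geodesic R n M h (G u) i0 0 t (G_geodesic u) d0 E).
Qed.

Lemma ray_unit u i t : unit_vector u -> chart_dom i (G u t) -> gnorm h i (chart i (G u t)) (velocity i (G u) t) = 1.
Proof.
move=> u1 di; have d0 : chart_dom i0 (G u 0) by rewrite G_start.
by rewrite (speed_gnorm (G_geodesic u) di d0) G_start G_velocity.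
Qed.

(* A minimizing continuation of a ray has no corner, so it follows the ray. *)
Lemma follows_extend f (ell s : R) u : (forall L, dur h f L -> ell <= L) -> 0 < s < ell -> unit_vector u ->
  (forall eta : R, 0 < eta -> follows h f ell (G u) s eta (fun=> True)) ->
  exists2 l : R, 0 < l & forall eta : R, 0 < eta -> follows h f ell (G u) (s + l) eta (fun=> True).
Proof.
move=> mn /andP[s0 sl] u1 Q; have [i dq] := chart_dom_cover (G u s).
have [Gq [Gg Gs Gv]] := exponential_family complete_h dq.
have sI : 0 <= s < ell by rewrite ltW.
have [w [l [w1 l0 sle H]]] := extend_minimal mn sI Q dq Gg Gs Gv.
pose gam2 (t : R) := Gq w (1 * t + - s).
have g2 : geodesic h setT gam2 by exact: geodesic_affine.
have g2s : gam2 s = G u s by rewrite /gam2 mul1r subrr Gs.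
have d2 : chart_dom i (Gq w (1 * s + - s)) by rewrite mul1r subrr Gs.
have v2 : velocity i gam2 s = w by rewrite (velocity_affine (Gg w) d2) scale1r mul1r subrr Gv.
have vE : velocity i (G u) s = velocity i gam2 s.
  apply: contrapT => vne.
  have ml0 : 0 < Num.min s l by rewrite lt_min s0.
  have n2 : gnorm h i (chart i (G u s)) (velocity i gam2 s) = 1 by rewrite v2.
  have [kap kap0 K] := corner_cut (G_geodesic u) g2 (esym g2s) dq (ray_unit u1 dq) n2 vne ml0.
  (* A surplus smaller than the saving, so that the cut competitor would be shorter than [ell]. *)
  have kap20 : 0 < kap / 2 by rewrite divr_gt0.
  have [g [L [slg hg Le gE gG]]] := H _ kap20.
  have Lell : ell <= L by apply: mn; exists g.
  have [m1 m2] : Num.min s l <= s /\ Num.min s l <= l by rewrite !ge_min !lexx orbT.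
  have [|||g' sg' hg'] := K L g slg m1.
  - by apply: le_trans Lell; apply: le_trans sle; rewrite lerD2l.
  - by move=> t /andP[t1 t2]; apply: gE; rewrite t2 andbT; apply: le_trans t1; rewrite subr_ge0.
  - move=> t /andP[t1 t2]; rewrite gG ?t1/= ?(le_trans t2) ?lerD2l//.
    by rewrite /gam2 mul1r.
  have := mn (L - kap); have : dur h f (L - kap) := ex_intro2 _ _ g' sg' (hom_trans hg hg').
  by move=> A /(_ A); exact: budget_absurd kap0 Le.
have gE : gam2 = G u.
  have d2' : chart_dom i (gam2 s) by rewrite g2s.
  exact: geodesic_unique g2 (G_geodesic u) d2' g2s (esym vE).
exists l => // eta eta0; have [g [L [slg hg Le g1 g2']]] := H eta eta0.
exists g, L; split=> // t /andP[t0 tl]; have [ts|ts] := leP t s; first by apply: g1; rewrite t0.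
by rewrite g2' ?(ltW ts)// -gE /gam2 mul1r.
Qed.

Lemma unit_vector_exists : (0 < n)%N -> exists u, unit_vector u.
Proof.
move=> n0; pose e : 'rV[R]_n := delta_mx 0 (Ordinal n0).
have e0 : e != 0.
  by apply/eqP => /rowP/(_ (Ordinal n0))/eqP; rewrite !mxE !eqxx /= oner_eq0.
have g0 := gnorm_gt0 h (chart_image_chart chart_x) e0.
exists ((gnorm h i0 (chart i0 x) e)^-1 *: e).
by rewrite /unit_vector gnormZ gtr0_norm ?invr_gt0// mulVf// gt_eqF.
Qed.

(** After time [ell] a competitor has less than [l] left and cannot reach the geodesic sphere of
    radius [l] about [G u ell], so it ends in an arbitrarily small ball. Hence the end point of [f]
    is [G u ell], and the last stretch, a loop in a ball, can be contracted. *)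
Lemma follows_end f (L0 ell : R) u : path_to L0 f -> (forall L, dur h f L -> ell <= L) -> 0 <= ell ->
  (forall eta : R, 0 < eta -> follows h f ell (G u) ell eta (fun=> True)) -> hom f (ray u ell).
Proof.
move=> pf mn ell0 Q; have [i dq] := chart_dom_cover (G u ell).
have [Gq [Gg Gs Gv]] := exponential_family complete_h dq.
have key (e : R) : 0 < e -> exists rho g L, [/\ 0 < rho <= e, forall u', `|u' - chart i (G u ell)| <= rho -> chart_image i u',
   [/\ path_to L g, hom f g & ell <= L], forall t, 0 <= t <= ell -> g t = G u t &
   forall t, ell <= t <= L -> coord_ball i (chart i (G u ell)) rho (g t)].
  move=> e0; have [rho [l [rho0 /andP[l0 _] ri _ NR]]] := normal_region dq Gg Gs Gv e0.
  have l20 : 0 < l / 2 by rewrite divr_gt0.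
  have [g [L [[pg slg] hg Le gE _]]] := Q _ l20.
  have Lell : ell <= L by apply: mn; exists g.
  have [L00 cg _ _] := pg.
  exists rho, g, L; split=> //.
  have slg' t : ell <= t < L -> slow_at h g t by move=> /andP[st tL]; apply: slg; rewrite (le_trans ell0).
  have gs : g ell = G u ell by apply: gE; rewrite ell0 lexx.
  have [[]//|[tau [w [/andP[a b] _ _ _]]]] := NR g ell L Lell cg slg' gs.
  exfalso; exact: half_absurd l0 (le_trans (le_trans a b) Le).
have zE : f L0 = G u ell.
  have [rho [g [L [_ _ [pg hg Lell] _ bg]]]] := key 1 ltr01.
  have LL : ell <= L <= L by rewrite Lell lexx.
  have [dz _] := bg L LL; have fz := hom_end_eq hg pf pg.
  rewrite fz -(chartK dz) -(chartK dq); congr chart_inv; apply/eqP; rewrite -subr_eq0 -normr_le0.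
  apply/ler_addgt0Pl => e e0; rewrite addr0.
  have [rho' [g' [L' [/andP[_ rhoe] _ [pg' hg' Lell'] _ bg']]]] := key e e0.
  have LL' : ell <= L' <= L' by rewrite Lell' lexx.
  have [_ dz'] := bg' L' LL'; rewrite -(hom_end_eq hg' pf pg') fz in dz'.
  exact: le_trans dz' rhoe.
have [rho [g [L [/andP[rho0 _] ri [pg hg Lell] gE bg]]]] := key 1 ltr01.
have gL : g L = G u ell by rewrite -(hom_end_eq hg pf pg).
have gs : g ell = G u ell by apply: gE; rewrite ell0 lexx.
pose k : R -> M := cst (G u ell).
have ck : continuous k by exact: cst_continuous.
apply: hom_trans hg _.
have -> : ray u ell = splice g k ell L ell.
  apply/funext => t; rewrite /ray /splice; have [tl|tl] := leP t ell; last first.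
    have [_ _ _ gc] := pg; have Lt : L <= t - ell + L by rewrite lerDr subr_ge0 ltW.
    by rewrite (max_idPr ell0) (gc _ Lt) gL.
  have [t0|t0] := leP 0 t; first by rewrite gE// t0.
  by have [_ _ gc _] := pg; rewrite (gc t (ltW t0)) gE// lexx.
apply: (hom_splice ri pg ck ell0 Lell (lexx L) (lexx ell)) => //.
move=> t _; split=> //=; rewrite /k /cst subrr normr0; exact: ltW.
Qed.

Theorem hopf_rinow f (L0 : R) : (0 < n)%N -> path_to L0 f -> f 0 = x ->
  exists u (ell : R), [/\ unit_vector u, 0 <= ell, hom f (ray u ell) & forall L, dur h f L -> ell <= L].
Proof.
move=> n0 pf fx.
pose D := [set L | dur h f L].
have D0 : D !=set0 by have [L dL] := path_dur h pf; exists L.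
have lbD : lbound D 0 by move=> L [g [[]]].
have hlb : has_lbound D by exists 0.
pose ell := inf D.
have mn L : dur h f L -> ell <= L by move=> dL; exact: ge_inf.
have ell0 : 0 <= ell by exact: lb_le_inf.
have Q0 eta : 0 < eta -> exists g L, [/\ slow_path h L g, hom f g & L <= ell + eta].
  move=> eta0; have [L [g sg hg] Le] := inf_adherent eta0 (conj D0 hlb).
  by exists g, L; split=> //; exact: ltW.
have g0 g : hom f g -> g 0 = x by move=> hg; rewrite -(hom_start_eq hg).
have foll0 gam : gam 0 = x -> forall eta : R, 0 < eta -> follows h f ell gam 0 eta (fun=> True).
  move=> gx eta eta0; have [g [L [sg hg Le]]] := Q0 eta eta0; exists g, L; split=> // t t0.
  have -> : t = 0 by apply/eqP; rewrite eq_le andbC.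
  by rewrite gx g0.
suff [u u1 Qu] : exists2 u, unit_vector u & forall eta : R, 0 < eta -> follows h f ell (G u) ell eta (fun=> True).
  by exists u, ell; split=> //; exact: follows_end pf mn ell0 Qu.
have [ellp|] := ltP 0 ell; last first.
  (* In a class with infimum 0 no direction is distinguished; any unit vector serves. *)
  move=> elln; have [u u1] := unit_vector_exists n0; exists u => //.
  have -> : ell = 0 by apply/eqP; rewrite eq_le elln.
  have := foll0 (G u) (G_start u); have -> : ell = 0 by apply/eqP; rewrite eq_le elln.
  by [].
have I0 : 0 <= (0 : R) < ell by rewrite lexx.
(* At time 0 there is no incoming direction to be matched: the direction is chosen here once and for
   all, and every later continuation must agree with it. *)
have [u [l [u1 l0 le H]]] := extend_minimal mn I0 (foll0 (cst x) erefl) chart_x G_geodesic G_start G_velocity.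
exists u => //.
apply: (@real_induction R (fun s => forall eta : R, 0 < eta -> follows h f ell (G u) s eta (fun=> True)) 0 ell); last by rewrite ell0 lexx.
- exact: foll0.
- move=> t /andP[t0 tl] Hs.
  have mono s s' : s' <= s -> (forall eta : R, 0 < eta -> follows h f ell (G u) s eta (fun=> True)) ->
      forall eta : R, 0 < eta -> follows h f ell (G u) s' eta (fun=> True).
    move=> ss Qs eta eta0; have [g [L [sg hg Le gE _]]] := Qs eta eta0; exists g, L; split=> // y /andP[y0 ys].
    by apply: gE; rewrite y0 (le_trans ys).
  have [tp|tn] := ltP 0 t.
    have tI : 0 < t < ell by rewrite tp.
    have Qt : forall eta : R, 0 < eta -> follows h f ell (G u) t eta (fun=> True) by apply: Hs; rewrite t0 lexx.
    have [l' l'0 Hl'] := follows_extend mn tI u1 Qt.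
    by exists l' => // s /andP[_ sl]; exact: mono (ltW sl) Hl'.
  have tE : t = 0 by apply/eqP; rewrite eq_le tn.
  exists l => // s /andP[_ sl]; rewrite tE in sl.
  apply: mono (ltW sl) _ => eta eta0; have [g [L [sg hg Le _ gE]]] := H eta eta0.
  by exists g, L; split=> // y yl; rewrite gE// subr0.
move=> t /andP[t0 tl] Hs.
have tI : 0 < t <= ell by rewrite t0.
have cG : continuous (G u) by exact: geodesicT_continuous (G_geodesic u).
have sG y : slow_at h (G u) y by exact: ray_slow.
exact: (follows_limit mn tI cG sG Hs).
Qed.

End Rays.

End HopfRinowTheorem.

(** Compactness in near-covering form, along the filter [F] on lists generated by the families of
    all lists containing a given one. A neighbourhood of [p] is served by any list that contains
    [p]. *)
Lemma finite_representatives {X : topologicalType} (K : set X) (Q : X -> X -> Prop) : compact K ->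
  (forall p, K p -> \forall q \near p, K q -> Q q p) ->
  exists l : seq X, forall q, K q -> exists2 p, p \in l & Q q p.
Proof.
move=> /compact_near_coveringP cK H.
pose F : set_system (seq X) := fun A => exists s0 : seq X, forall s : seq X, {subset s0 <= s} -> A s.
have FF : Filter F.
  split.
  - by exists [::].
  - move=> A B [s1 H1] [s2 H2]; exists (s1 ++ s2) => s sub; split.
      by apply: H1 => x xs; apply: sub; rewrite mem_cat xs.
    by apply: H2 => x xs; apply: sub; rewrite mem_cat xs orbT.
  by move=> A B AB [s1 H1]; exists s1 => s sub; apply: AB; exact: H1.
have [s0 H0] : F (fun s => K `<=` (fun q => K q -> exists2 p, p \in s & Q q p)).
  apply: (cK (seq X) F (fun s q => K q -> exists2 p, p \in s & Q q p) FF) => p Kp.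
  exists ([set q | K q -> Q q p], [set s : seq X | p \in s]).
    by split; [exact: H|exists [:: p] => s sub; apply: sub; rewrite inE].
  by move=> [q s] /= [Hq ps] Kq; exists p => //; exact: Hq.
by exists s0 => q Kq; exact: (H0 s0 _ q Kq Kq).
Qed.

(** * Minimal rays through a common point *)

Section RayClasses.
Context {R : realType} {n : nat} {M : smooth_manifold R n}.
Variable h : riemannian_metric M.
Variables (x : M) (i0 : chart_index M) (G : 'rV[R]_n -> R -> M).
Hypothesis chart_x : chart_dom i0 x.
Hypothesis G_geodesic : forall v, geodesic h setT (G v).
Hypothesis G_start : forall v, G v 0 = x.
Hypothesis G_velocity : forall v, velocity i0 (G v) 0 = v.
Let unit_vector u := gnorm h i0 (chart i0 x) u = 1.

Definition flow (p : 'rV[R]_n * R) := G p.1 (Num.max 0 p.2).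

Lemma flow_cont : continuous flow.
Proof.
move=> [v t]; have [t0|t0] := leP 0 t.
  exact: (flow_continuous G_geodesic G_start chart_x G_velocity t0).
apply: (@near_eq_continuous _ _ (fun=> x)); last exact: cst_continuous.
have nt : \forall p \near (v, t), p.2 < 0.
  exact: (@contsnd _ _ (v, t) _ (lt_nbhsl t0)).
by near=> p; rewrite /flow (max_idPl _) ?G_start//; apply: ltW; near: p.
Unshelve. all: by end_near. Qed.

Lemma ray_path u (L : R) : 0 <= L -> path_to L (ray G u L).
Proof.
move=> L0; split=> //.
- rewrite /ray; compc (G u); last by cont.
  exact: geodesicT_continuous (G_geodesic u).
- by move=> t t0; rewrite /ray (min_idPl (le_trans t0 L0)) (min_idPl L0) (max_idPl t0) maxxx.
by move=> t tL; rewrite /ray (min_idPr tL) minxx.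
Qed.

(** Initial vector and length move along the segment from [p] to [q]. The ends of the intermediate
    rays wander in a ball around the common end [z]; during [[m, m + 1]] the map [D] brings them
    back to [z] along coordinate segments. *)
Lemma rays_hom i u0 (r : R) (p q : 'rV[R]_n * R) : (forall u, `|u - u0| <= r -> chart_image i u) ->
  0 <= p.2 -> 0 <= q.2 -> flow p = flow q ->
  (forall s, 0 <= s <= 1 -> coord_ball i u0 r (flow ((1 - s) *: p + s *: q))) ->
  hom (ray G p.1 p.2) (ray G q.1 q.2).
Proof.
move=> ri p0 q0 pq B.
pose P s := (1 - clamp01 s) *: p + clamp01 s *: q.
have cP : continuous P.
  move=> s; have c1 : continuous (fun s : R => 1 - clamp01 s) by cont.
  have c2 : continuous (fun s : R => clamp01 s) by cont.
  apply: cvgD; apply: cvgZ; [exact: c1|exact: cvg_cst|exact: c2|exact: cvg_cst].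
have BP s : coord_ball i u0 r (flow (P s)) by apply: B; exact: clamp01_itv.
have P0 : P 0 = p by rewrite /P clamp01_id ?lexx ?ler01// subr0 scale1r scale0r addr0.
have P1 : P 1 = q by rewrite /P clamp01_id ?lexx ?ler01// subrr scale1r scale0r add0r.
pose m := Num.max p.2 q.2; have [pm qm] : p.2 <= m /\ q.2 <= m by rewrite !le_max !lexx orbT.
have m0 : 0 <= m by apply: le_trans pm.
have Pm s : (P s).2 <= m.
  have /andP[c0 c1] := clamp01_itv s; rewrite /P /=; have c1' : 0 <= 1 - clamp01 s by rewrite subr_ge0.
  have := lerD (ler_wpM2l c1' pm) (ler_wpM2l c0 qm); rewrite -mulrDl subrK mul1r; exact.
pose z := flow p; have zE : flow q = z by rewrite -pq.
have dz : coord_ball i u0 r z by rewrite /z -P0.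
pose A (y : R * R) := flow ((P y.1).1, Num.min y.2 (P y.1).2).
pose D (y : R * R) := chart_inv i ((1 - clamp01 (y.2 - m)) *: chart i (flow (P y.1)) + clamp01 (y.2 - m) *: chart i z).
have cA : continuous A.
  have cPfst : continuous (fun y : R * R => P y.1) by compc P => //; cont.
  have cp1 : continuous (fun y : R * R => (P y.1).1) by apply: (@contcomp _ _ _ fst _ (@contfst _ _) cPfst).
  have cp2 : continuous (fun y : R * R => (P y.1).2) by apply: (@contcomp _ _ _ snd _ (@contsnd _ _) cPfst).
  by rewrite /A; compc flow; [exact: flow_cont|cont].
have cD : continuous D.
  move=> y; apply: (@continuous_comp _ _ _ (fun y : R * R => (1 - clamp01 (y.2 - m)) *: chart i (flow (P y.1)) + clamp01 (y.2 - m) *: chart i z) (chart_inv i) y).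
    have c1 : continuous (fun y : R * R => 1 - clamp01 (y.2 - m)) by cont.
    have c2 : continuous (fun y : R * R => clamp01 (y.2 - m)) by cont.
    apply: cvgD; apply: cvgZ; [exact: c1| |exact: c2|exact: cvg_cst].
    apply: (@continuous_comp _ _ _ (fun y : R * R => flow (P y.1)) (chart i) y).
      have cf : continuous (fun y : R * R => flow (P y.1)).
        by compc flow; [exact: flow_cont|compc P => //; cont].
      exact: (cf y).
    by apply: chart_continuous_at; have [] := BP y.1.
  apply: chart_inv_continuous_at; apply: ri; apply: convex_ball; first exact: clamp01_itv.
    by have [] := BP y.1.
  by have [] := dz.
have AE y : m <= y.2 -> A y = flow (P y.1).
  by move=> my; rewrite /A (min_idPr (le_trans (Pm _) my)) -surjective_pairing.
have DE y : y.2 <= m \/ flow (P y.1) = z -> D y = flow (P y.1).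
  have [d _] := BP y.1; case=> H; rewrite /D.
    have -> : clamp01 (y.2 - m) = 0 by rewrite /clamp01 (max_idPl _)// ge_min subr_le0 H.
    by rewrite subr0 scale1r scale0r addr0 chartK.
  by rewrite H -scalerDl subrK scale1r chartK//; rewrite -H.
have A0 t : A (0, t) = ray G p.1 p.2 t by rewrite -P0.
have A1 t : A (1, t) = ray G q.1 q.2 t by rewrite -P1.
exists (fun y : R * R => if y.2 - m <= 0 then A y else D y); split.
- apply: (@glue_continuous _ _ _ (fun y : R * R => y.2 - m)) => //; first by cont.
  by move=> y /subr0_eq E; rewrite AE ?E// DE//; left; rewrite E.
- move=> t /=; rewrite subr_le0; case: (leP t m) => tm; first exact: A0.
  rewrite (DE (0, t)) /= P0; last by right.
  by rewrite /ray (min_idPr (le_trans pm (ltW tm))).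
- move=> t /=; rewrite subr_le0; case: (leP t m) => tm; first exact: A1.
  rewrite (DE (1, t)) /= P1; last by right.
  by rewrite /ray (min_idPr (le_trans qm (ltW tm))).
have m1 : 0 <= m + 1 by rewrite addr_ge0.
exists (m + 1) => // s t _; split=> [t0|tm]; rewrite /= subr_le0.
  rewrite (le_trans t0 m0) /A /flow /= (max_idPl _) ?ge_min ?t0// G_start.
  by rewrite /ray (min_idPl p0) maxxx G_start.
have mt : m < t by apply: lt_le_trans tm; rewrite ltrDl.
rewrite leNgt mt /= /D /=.
have -> : clamp01 (t - m) = 1.
  by rewrite /clamp01 (min_idPr _) ?(max_idPr _)// lerBrDl.
rewrite subrr scale0r add0r scale1r chartK; last by have [] := dz.
by rewrite /ray (min_idPr (le_trans pm _))// lerDl.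
Qed.

(** The pairs of a unit vector and a time at most [T] whose geodesic arrives at [z] form a compact
    set [K], and by [rays_hom] the homotopy class of the arc is locally constant on [K]. *)
Lemma finite_ray_classes (z : M) (T : R) : exists (k : nat) (rep : 'I_k -> R -> M), forall u (t : R), unit_vector u ->
  0 <= t <= T -> G u t = z -> exists j, hom (ray G u t) (rep j).
Proof.
have iu := chart_image_chart chart_x.
pose K := [set p : 'rV[R]_n * R | unit_vector p.1 /\ 0 <= p.2 <= T] `&` [set p | flow p = z].
have cK : compact K.
  have c1 : compact ([set w | gnorm h i0 (chart i0 x) w = 1] `*` `[0, T]).
    by apply: compact_setX; [exact: unit_sphere_compact|exact: segment_compact].
  apply: (subclosed_compact _ c1); last first.
    by move=> p [[p1 p2] _]; split=> //=; rewrite in_itv.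
  rewrite (_ : K = (([set w | gnorm h i0 (chart i0 x) w = 1] `*` `[0, T]) `&` [set p | flow p = z])).
    apply: closedI; first by apply: compact_closed => //; exact: norm_hausdorff.
    rewrite (_ : [set p | _] = flow @^-1` [set z])//; apply: preimage_closed; first by move=> p _; exact: flow_cont.
    by apply: compact_closed; [exact: carrier_hausdorff|exact: compact_set1].
  by rewrite eqEsubset; split=> p [[p1 p2] p3]; split=> //; split=> //=; move: p2; rewrite /= in_itv.
have [i dz] := chart_dom_cover z.
have [r r0 ri] := open_ball_sub (@chart_image_open _ _ M i) (chart_image_chart dz).
have loc (p : 'rV[R]_n * R) : exists d : R, 0 < d /\ (K p -> forall q, K q -> `|q - p| < d -> hom (ray G q.1 q.2) (ray G p.1 p.2)).
  have [Kp|nK] := pselect (K p); last by exists 1.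
  have [_ pz] := Kp.
  have nb : \forall q \near p, coord_ball i (chart i z) r (flow q).
    by apply: flow_cont; rewrite pz; exact: near_coord_ball.
  have [d d0 Hd] := (nearN p _).1 nb.
  exists d; split=> // _ q Kq qd; apply: hom_sym.
  have [[_ /andP[p0 _]] _] := Kp; have [[_ /andP[q0 _]] qz] := Kq.
  apply: (rays_hom ri p0 q0); first by rewrite pz qz.
  move=> s /andP[s0 s1]; apply: Hd.
  have -> : (1 - s) *: p + s *: q - p = s *: (q - p).
    by rewrite scalerBl scale1r scalerBr [p - s *: p]addrC addrAC addrK addrC.
  rewrite normrZ ger0_norm//; apply: le_lt_trans qd.
  by rewrite -[leRHS]mul1r; apply: ler_wpM2r.
pose d p := projT1 (cid (loc p)).
have dP p : 0 < d p /\ (K p -> forall q, K q -> `|q - p| < d p -> hom (ray G q.1 q.2) (ray G p.1 p.2)).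
  by rewrite /d; case: cid.
have [l Hl] : exists l : seq ('rV[R]_n * R), forall q, K q -> exists2 p, p \in l & hom (ray G q.1 q.2) (ray G p.1 p.2).
  apply: (finite_representatives cK) => p Kp; have [d0 H] := dP p.
  by apply: filterS (nbhs_lt p d0) => q qd Kq; exact: H.
exists (size l), (fun j => let p := nth (0 : 'rV[R]_n * R) l j in ray G p.1 p.2) => u t u1 tT zt.
have Kut : K (u, t).
  by split=> //; rewrite /flow /= (max_idPr _) ?zt//; case/andP: tT.
have [p pl Hp] := Hl _ Kut.
have il : (index p l < size l)%N by rewrite index_mem.
by exists (Ordinal il) => /=; rewrite nth_index.
Qed.

End RayClasses.

Lemma perturb_bound {R : realType} (T L0 L a : R) : T < L0 -> a <= (L0 - T) / 2 -> L0 <= L + a -> T < L.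
Proof. by lra. Qed.

Lemma scaled_lt {R : realType} (x y a eps : R) : 0 < eps -> (x - a) / eps < (y - a) / eps + 1 -> x <= y + eps.
Proof. by move=> e0; rewrite -ltrBlDl -mulrBl ltr_pdivrMr// mul1r; lra. Qed.

(* Pigeonhole: finitely many Lipschitz curves do not cover a square. *)
Lemma curves_not_dense {R : realType} (n k : nat) (u0 : 'rV[R]_n) (rho a b K : R) (cls : 'rV[R]_n -> 'I_k)
    (len : 'rV[R]_n -> R) : (2 <= n)%N -> 0 < rho -> 0 < b -> 0 < K ->
  (forall v, `|v - u0| <= rho -> a <= len v <= a + b) ->
  exists (eps : R) v w, [/\ 0 < eps, `|v - u0| <= rho, `|w - u0| <= rho & [/\ cls v = cls w, len v <= len w <= len v + eps,
    K * eps <= rho & K * eps < `|w - v|]].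
Proof.
move=> n2 rho0 b0 K0 lenI.
(* The [N * N] grid points fall into [k] classes times [N * A] cells of width [eps] for [len], and
   [N = k * A + 1] makes the points more numerous. [eps] is such that [K * eps] is half the grid
   step, and then [b / eps < N * A]. *)
pose A := Num.bound (2 * K * b / rho).
have A0 : 2 * K * b / rho < A%:R by apply: archi_boundP; rewrite divr_ge0 ?mulr_ge0 ?ltW.
pose N := (k * A).+1.
have N0 : 0 < N%:R :> R by rewrite ltr0n.
pose eps := rho / (2 * N%:R * K); have eps0 : 0 < eps by rewrite divr_gt0 ?mulr_gt0.
have Ke : K * eps = rho / N%:R / 2 by rewrite /eps; field; rewrite !gt_eqF.
have rN : 0 < rho / N%:R by rewrite divr_gt0.
(* Here [2 <= n] enters: with a single direction the grid would have [N] points only, too few for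
   the pigeonhole. *)
pose i0 := Ordinal (ltn_trans (ltnSn 0) n2); pose i1 := Ordinal n2.
pose pt (p : 'I_N * 'I_N) : 'rV[R]_n := u0 + (rho / N%:R) *: ((p.1 : nat)%:R *: delta_mx 0 i0 + (p.2 : nat)%:R *: delta_mx 0 i1).
have ptE p j : (pt p - u0) 0 j = rho / N%:R * ((p.1 : nat)%:R * (j == i0)%:R + (p.2 : nat)%:R * (j == i1)%:R).
  by rewrite /pt addrAC subrr add0r !mxE !eqxx.
have aN (c : 'I_N) : `|rho / N%:R * (c : nat)%:R| <= rho.
  rewrite normrM (gtr0_norm rN) (ger0_norm (ler0n _ _)) mulrAC ler_pdivrMr// ler_pM2l// ler_nat; exact/ltnW/ltn_ord.
have ptb p : `|pt p - u0| <= rho.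
  apply/rV_normP => [|j]; first exact: ltW.
  rewrite ptE; have [->|ji0] := eqVneq j i0; first by rewrite mulr1 /= mulr0 addr0; exact: aN.
  rewrite mulr0 add0r; have [_|ji1] := eqVneq j i1; first by rewrite mulr1; exact: aN.
  by rewrite !mulr0 normr0 ltW.
have cell (p : 'I_N * 'I_N) : (Num.truncn ((len (pt p) - a) / eps) < N * A)%N.
  have /andP[l1 l2] := lenI _ (ptb p).
  have x0 : 0 <= (len (pt p) - a) / eps by apply: divr_ge0; [rewrite subr_ge0|exact: ltW].
  have /andP[t1 _] := truncn_itv x0; rewrite -(ltr_nat R); apply: le_lt_trans t1 _.
  apply: (@le_lt_trans _ _ (b / eps)); first by rewrite ler_pM2r ?invr_gt0// lerBlDl.
  have -> : b / eps = N%:R * (2 * K * b / rho) by rewrite /eps; field; rewrite !gt_eqF.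
  by rewrite natrM ltr_pM2l.
pose phi p := (cls (pt p), Ordinal (cell p)).
have ninj : ~ injective phi.
  move=> /leq_card; rewrite !card_prod !card_ord leqNgt => /negP; apply.
  by rewrite mulnCA [(k * A)%N in X in (X < _)%N]mulnC ltn_pmul2l// ltnS mulnC.
have [p [q [pq E]]] : exists p q, p <> q /\ phi p = phi q.
  apply: contrapT => H; apply: ninj => p q E; apply: contrapT => pq; apply: H.
  by exists p, q.
wlog lpq : p q pq E / len (pt p) <= len (pt q).
  move=> H; have [/(H p q pq E)//|/ltW l2] := leP (len (pt p)) (len (pt q)).
  by apply: (H q p) => // qp; apply: pq.
have [cE tE] : cls (pt p) = cls (pt q) /\ Num.truncn ((len (pt p) - a) / eps) = Num.truncn ((len (pt q) - a) / eps).
  by split; [exact: (congr1 fst E)|exact: (congr1 (fun z => nat_of_ord z.2) E)].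
exists eps, (pt p), (pt q); split=> //; split=> //.
- rewrite lpq /=.
  have /andP[lp _] := lenI _ (ptb p); have /andP[lq _] := lenI _ (ptb q).
  have xp : 0 <= (len (pt p) - a) / eps by apply: divr_ge0; [rewrite subr_ge0|exact: ltW].
  have xq : 0 <= (len (pt q) - a) / eps by apply: divr_ge0; [rewrite subr_ge0|exact: ltW].
  have /andP[t1 _] := truncn_itv xp; have /andP[_ t2] := truncn_itv xq.
  rewrite -tE in t2.
  have t3 : (len (pt q) - a) / eps < (len (pt p) - a) / eps + 1.
    by apply: lt_le_trans t2 _; rewrite -natr1 lerD2r.
  exact: scaled_lt eps0 t3.
- rewrite Ke ler_pdivrMr// ler_pdivrMr//; have : 1 <= N%:R :> R by rewrite ler1n.
  by nra.
rewrite Ke; have dif j : (pt q - pt p) 0 j = (pt q - u0) 0 j - (pt p - u0) 0 j by rewrite !mxE; ring.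
have far (c c' : 'I_N) : c <> c' -> rho / N%:R / 2 < `|rho / N%:R * (c : nat)%:R - rho / N%:R * (c' : nat)%:R|.
  move=> cc; rewrite -mulrBr normrM (gtr0_norm rN) ltr_pM2l//.
  have ge1 (m m' : nat) : (m < m')%N -> 2^-1 < `|m%:R - m'%:R : R|.
    move=> mm; rewrite distrC ger0_norm ?subr_ge0 ?ler_nat 1?ltnW//.
    have : (m.+1)%:R <= m'%:R :> R by rewrite ler_nat.
    by rewrite -natr1; lra.
  have := cc; case: (ltngtP c c') => [/ge1//|/ge1|/val_inj //]; by rewrite distrC.
have [e1|n1] := pselect (p.1 = q.1).
  have n2' : q.2 <> p.2 by move=> e2; apply: pq; case: (p) (q) e1 e2 => a1 a2 [b1 b2] /= -> ->.
  apply: lt_le_trans (far _ _ n2') _; apply: le_trans (coord_norm _ i1).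
  by rewrite dif !ptE eqxx (_ : (i1 == i0) = false)// !mulr0 !add0r !mulr1.
have n1' : q.1 <> p.1 by move=> e; exact: n1.
apply: lt_le_trans (far _ _ n1') _; apply: le_trans (coord_norm _ i0).
by rewrite dif !ptE eqxx (_ : (i0 == i1) = false)// !mulr0 !addr0 !mulr1.
Qed.

(** * Minimal rays are not longer than the bound [T] *)

Section LongRays.
Context {R : realType} {n : nat} {M : smooth_manifold R n}.
Variable h : riemannian_metric M.
Hypothesis complete_h : complete_metric h.
Variables (x : M) (i0 : chart_index M) (G : 'rV[R]_n -> R -> M).
Hypothesis chart_x : chart_dom i0 x.
Hypothesis G_geodesic : forall v, geodesic h setT (G v).
Hypothesis G_start : forall v, G v 0 = x.
Hypothesis G_velocity : forall v, velocity i0 (G v) 0 = v.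
Let unit_vector u := gnorm h i0 (chart i0 x) u = 1.

Definition minimal_ray u (L : R) := [/\ unit_vector u, 0 <= L & forall L', dur h (ray G u L) L' -> L <= L'].

Lemma ray_slow_path u (L : R) : unit_vector u -> 0 <= L -> slow_path h L (ray G u L).
Proof.
move=> u1 L0; split; first exact: (ray_path G_geodesic).
move=> t /andP[t0 tL]; apply: (@slow_at_germ _ _ _ h _ (G u) t 0 (L - t)); rewrite ?subr_gt0//.
  move=> s /andP[ts sL]; rewrite addr0 /ray (min_idPl _) ?(max_idPr _) ?(le_trans t0)//.
  by move: sL; rewrite addrC subrK => /ltW.
exact: (ray_slow chart_x G_geodesic G_start G_velocity).
Qed.

Definition ray_tail u (t L s : R) := G u (t + Num.max 0 (Num.min s (L - t))).

Lemma ray_tailE u (t L s : R) : 0 <= s <= L - t -> ray_tail u t L s = G u (s + t).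
Proof. by move=> /andP[s0 sL]; rewrite /ray_tail (min_idPl sL) (max_idPr s0) addrC. Qed.

Lemma ray_tail_slow_path u (t L : R) : unit_vector u -> t <= L -> slow_path h (L - t) (ray_tail u t L).
Proof.
move=> u1 tL; have Lt : 0 <= L - t by rewrite subr_ge0.
split.
  split=> //.
  - rewrite /ray_tail; compc (G u); last by cont.
    exact: geodesicT_continuous (G_geodesic u).
  - by move=> s s0; rewrite /ray_tail (min_idPl (le_trans s0 Lt)) (min_idPl Lt) (max_idPl s0) maxxx.
  by move=> s sL; rewrite /ray_tail (min_idPr sL) minxx.
move=> s /andP[s0 sL]; apply: (@slow_at_germ _ _ _ h _ (G u) s t (L - t - s)); rewrite ?subr_gt0//.
  move=> y /andP[sy yL]; rewrite ray_tailE// (le_trans s0 sy) /= ltW//.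
  by move: yL; rewrite [s + _]addrC subrK.
exact: (ray_slow chart_x G_geodesic G_start G_velocity).
Qed.

Lemma ray_tail0 u (t L : R) : t <= L -> ray_tail u t L 0 = G u t.
Proof. by move=> tL; rewrite /ray_tail (min_idPl _) ?subr_ge0// maxxx addr0. Qed.

Lemma ray_end u (t : R) : 0 <= t -> ray G u t t = G u t.
Proof. by move=> t0; rewrite /ray minxx (max_idPr t0). Qed.

Lemma ray_split u (t L : R) : 0 <= t <= L -> ray G u L = concat t (ray G u t) (ray_tail u t L).
Proof.
move=> /andP[t0 tL]; apply/funext => s; rewrite /ray /concat /ray_tail; case: (leP s t) => st.
  by rewrite (min_idPl (le_trans st tL)).
congr (G u _); have m1 : t <= Num.min s L by rewrite le_min (ltW st).
have -> : Num.min (s - t) (L - t) = Num.min s L - t.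
  by rewrite /Num.min ltrD2r; case: ifP.
rewrite (max_idPr (le_trans t0 m1)) (max_idPr _) ?subr_ge0//; ring.
Qed.

(** The exchange of arcs: along the other ray to the meeting point, then along the rest of the first
    one. *)
Let detour u u' (t t' L : R) : unit_vector u -> unit_vector u' -> 0 <= t <= L -> 0 <= t' ->
  hom (ray G u t) (ray G u' t') -> slow_path h (t' + (L - t)) (concat t' (ray G u' t') (ray_tail u t L)) /\
  hom (ray G u L) (concat t' (ray G u' t') (ray_tail u t L)).
Proof.
move=> u1 u1' tL t'0 hh; have [t0 tL'] := andP tL.
have pt := ray_path G_geodesic u t0; have pt' := ray_path G_geodesic u' t'0.
have e := hom_end_eq hh pt pt'; rewrite !ray_end// in e.
split.
  apply: slow_path_cat; [exact: ray_slow_path|exact: ray_tail_slow_path|].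
  by rewrite ray_end// ray_tail0.
rewrite (ray_split u tL); have [ptl _] := ray_tail_slow_path u1 tL'.
by apply: (hom_cat pt pt' hh ptl); rewrite ray_end// ray_tail0.
Qed.

(** Neither detour may be shorter than the ray it replaces, which forces [t = t']; then the detour
    has the minimal duration itself and tolerates no corner. The meeting point is strictly inside,
    which leaves an interval on either side for the cut. *)
Lemma minimal_rays_meet u u' (t t' L L' : R) : minimal_ray u L -> minimal_ray u' L' -> 0 < t < L -> 0 < t' < L' ->
  hom (ray G u t) (ray G u' t') -> u = u'.
Proof.
move=> [u1 L0 mn] [u1' L0' mn'] /andP[t0 tL] /andP[t0' tL'] hh.
have tI : 0 <= t <= L by rewrite !ltW.
have tI' : 0 <= t' <= L' by rewrite !ltW.
have [s1 h1] := detour u1 u1' tI (ltW t0') hh.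
have [s2 h2] := detour u1' u1 tI' (ltW t0) (hom_sym hh).
have tt : t = t'.
  have a1 : L <= t' + (L - t) by apply: mn; eexists; [exact: s1|exact: h1].
  have a2 : L' <= t + (L' - t') by apply: mn'; eexists; [exact: s2|exact: h2].
  by apply/eqP; rewrite eq_le; lra.
subst t'.
have e : G u t = G u' t.
  by have := hom_end_eq hh (ray_path G_geodesic u (ltW t0)) (ray_path G_geodesic u' (ltW t0)); rewrite !ray_end// ltW.
have [i di] := chart_dom_cover (G u' t).
have di' : chart_dom i (G u t) by rewrite e.
have vE : velocity i (G u') t = velocity i (G u) t.
  apply: contrapT => vne.
  have d0 : 0 < Num.min t (L - t) by rewrite lt_min t0 subr_gt0.
  have [d1 d2] : Num.min t (L - t) <= t /\ Num.min t (L - t) <= L - t by rewrite !ge_min !lexx orbT.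
  have n1 := ray_unit chart_x G_geodesic G_start G_velocity u1' di.
  have n2 : gnorm h i (chart i (G u' t)) (velocity i (G u) t) = 1.
    by rewrite -e; exact: (ray_unit chart_x G_geodesic G_start G_velocity u1 di').
  have [kap kap0 K] := corner_cut (G_geodesic u') (G_geodesic u) (esym e) di n1 n2 vne d0.
  have tdL : t + Num.min t (L - t) <= t + (L - t) by rewrite lerD2l.
  have [||g sg hg] := K _ _ s1 d1 tdL.
  - move=> s /andP[sa sb]; rewrite /concat sb /ray (min_idPl sb) (max_idPr _)//.
    by apply: le_trans sa; rewrite subr_ge0.
  - move=> s /andP[sa sb]; rewrite /concat; case: (leP s t) => st.
      have -> : s = t by apply/eqP; rewrite eq_le st.
      by rewrite ray_end ?(ltW t0)// e.
    rewrite ray_tailE ?subrK// subr_ge0 sa /= lerBlDl (le_trans sb)//.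
  have := mn (t + (L - t) - kap); have D : dur h (ray G u L) (t + (L - t) - kap).
    exact: ex_intro2 _ _ g sg (hom_trans h1 hg).
  by move=> /(_ D); rewrite [t + _]addrC subrK lerBrDr gerDl leNgt kap0.
have gE := geodesic_unique (G_geodesic u) (G_geodesic u') di' e (esym vE).
by rewrite -(G_velocity u) -(G_velocity u') gE.
Qed.

(** A coordinate segment of duration [C * rho] from the end of the ray to [v] defines the class in
    which [hopf_rinow] supplies the new ray. Its length is at most [L0 + C * rho] by construction,
    and at least [L0 - C * rho] because going back along the segment returns to the class of the old
    ray. The bound on [C * rho] keeps it longer than [T]. *)
Lemma perturbed_rays u0 (L0 T : R) i : (0 < n)%N -> minimal_ray u0 L0 -> T < L0 -> chart_dom i (G u0 L0) ->
  exists r C : R, [/\ 0 < r, 1 <= C & forall rho v, 0 < rho <= r -> C * rho <= (L0 - T) / 2 ->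
    `|v - chart i (G u0 L0)| <= rho -> exists u L, [/\ minimal_ray u L, L0 - C * rho <= L <= L0 + C * rho, T < L &
      chart_dom i (G u L) /\ chart i (G u L) = v]].
Proof.
move=> n0 [u01 L00 mn0] TL di; set p := G u0 L0.
have [r [C [r0 C1 ri seg]]] := local_segment h (chart_image_chart di).
have C0 : 0 < C by apply: lt_le_trans C1.
exists r, C; split=> // rho v /andP[rho0 rhor] CT vr.
pose sigma := C * rho; have sg0 : 0 < sigma by rewrite mulr_gt0.
have pr : `|chart i p - chart i p| <= rho by rewrite subrr normr0 ltW.
have Csg : C * `|v - chart i p| <= sigma by rewrite /sigma ler_pM2l.
have Csg' : C * `|chart i p - v| <= sigma by rewrite distrC.
have [sf sf0 sf1 sfb] := seg rho _ _ sigma rhor pr vr sg0 Csg.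
have [sb sb0 sb1 sbb] := seg rho _ _ sigma rhor vr pr sg0 Csg'.
rewrite chartK// in sf0; rewrite chartK// in sb1.
set segf := segment i (chart i p) v sigma in sf sf0 sf1 sfb.
set segb := segment i v (chart i p) sigma in sb sb0 sb1 sbb.
have [[psf _] [psb _]] := (sf, sb); have [_ csf _ fsf] := psf; have [_ csb _ fsb] := psb.
have r0s := ray_slow_path u01 L00; have [r0p _] := r0s.
have e0 : ray G u0 L0 L0 = segf 0 by rewrite ray_end.
pose fv := concat L0 (ray G u0 L0) segf.
have sfv : slow_path h (L0 + sigma) fv by exact: slow_path_cat.
have [pfv _] := sfv.
have fv0 : fv 0 = x by rewrite /fv /concat L00 /ray (min_idPl L00) maxxx G_start.
have [u [L [u1 Lpos hL mnL]]] := hopf_rinow complete_h chart_x G_geodesic G_start G_velocity n0 pfv fv0.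
have mL : minimal_ray u L.
  by split=> // L' [g sg hg]; apply: mnL; exists g => //; exact: hom_trans hL hg.
have L1 : L <= L0 + sigma by apply: mnL; exists fv => //; exact: (hom_refl pfv).
have fvL : fv (L0 + sigma) = chart_inv i v.
  rewrite /fv /concat ifF; first by rewrite addrAC subrr add0r.
  by apply/negbTE; rewrite -ltNge ltrDl.
have pL := ray_path G_geodesic u Lpos.
have eL : G u L = chart_inv i v by rewrite -(ray_end u Lpos) -(hom_end_eq hL pfv pL).
have [dv ev] := chart_invP (ri v (le_trans vr rhor)).
exists u, L.
have L2 : L0 <= L + sigma.
  apply: mn0; have e1 : fv (L0 + sigma) = segb 0 by rewrite fvL sb0.
  exists (concat L (ray G u L) segb).
    by apply: slow_path_cat => //; [exact: ray_slow_path|rewrite ray_end// eL sb0].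
  apply: hom_trans (hom_cat pfv pL hL psb e1).
  (* The excursion to [v] and back, which lies in the ball and is contracted by [hom_splice] with an
     empty replaced interval. *)
  pose k (s : R) := if s - (L0 + sigma) <= 0 then segf (s - L0) else segb (s - (L0 + sigma)).
  have ck : continuous k.
    apply: (@glue_continuous _ _ _ (fun s : R => s - (L0 + sigma)) (fun s => segf (s - L0)) (fun s => segb (s - (L0 + sigma)))).
    - by cont.
    - by compc segf => //; cont.
    - by compc segb => //; cont.
    by move=> s /subr0_eq ->; rewrite subrr sb0 addrAC subrr add0r sf1.
  pose b' := L0 + sigma + sigma; have Lb' : L0 <= b' by rewrite /b' -addrA lerDl addr_ge0// ltW.
  have k0 : k L0 = ray G u0 L0 L0.
    by rewrite /k subr_le0 lerDl (ltW sg0) subrr e0.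
  have k1 : k b' = ray G u0 L0 L0.
    rewrite /k subr_le0 leNgt /b' ltrDl sg0 /= addrAC subrr add0r sb1 e0 sf0 //.
  have -> : concat (L0 + sigma) fv segb = splice (ray G u0 L0) k L0 L0 b'.
    apply/funext => s; rewrite /concat /splice /fv /concat; case: (leP s L0) => sL.
      by rewrite (le_trans sL) ?lerDl ?ltW//.
    case: (leP s (L0 + sigma)) => ss.
      by rewrite (le_trans ss) ?lerDl ?ltW// /k subr_le0 ss.
    case: (leP s b') => sb'; first by rewrite /k subr_le0 leNgt ss.
    rewrite fsb ?sb1; last by rewrite lerBrDl ltW.
    have [_ _ _ ->] := r0p; first by rewrite e0 sf0.
    by rewrite lerDr subr_ge0 ltW.
  have ri' u' : `|u' - chart i p| <= rho -> chart_image i u' by move=> ur; apply: ri; exact: le_trans ur rhor.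
  apply: (hom_splice ri' r0p ck L00 (lexx L0) (lexx L0) Lb' k0 k1).
    move=> s /andP[s1 s2]; have -> : s = L0 by apply/eqP; rewrite eq_le s2.
    by rewrite e0; exact: sfb.
  by move=> s _; rewrite /k; case: ifP => _; [exact: sfb|exact: sbb].
split=> //; last by rewrite eL.
  by rewrite L1 andbT lerBlDr.
exact: perturb_bound TL CT L2.
Qed.

Lemma ray_lipschitz i p : chart_dom i p -> exists r T K : R, [/\ 0 < r, 0 < T, 0 < K &
  forall u (L L' : R), unit_vector u -> L <= L' <= L + T -> chart_dom i (G u L) -> `|chart i (G u L) - chart i p| <= r ->
    `|chart i (G u L') - chart i (G u L)| <= K * (L' - L)].
Proof.
move=> dp; have iu := chart_image_chart dp.
have [r1 [C [r10 C1 ri mb _]]] := metric_bounds h iu.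
have C0 : 0 < C by apply: lt_le_trans C1.
have [r [T [K [r0 T0 K0 _ [_ [fb _]]]]]] := flow_box h iu C0.
exists (Num.min r r1), T, K; split=> //; first by rewrite lt_min r0.
move=> u L L' u1 LL dL; rewrite le_min => /andP[b1 b2].
have vb : `|velocity i (G u) L| <= C.
  by have := (mb _ (velocity i (G u) L) b2).2; rewrite (ray_unit chart_x G_geodesic G_start G_velocity u1 dL) mulr1.
have [_ +] := fb (G u) L (G_geodesic u) dL b1 vb L' LL.
by rewrite /state sub_row_mx => /norm_row_mx_le[].
Qed.

(** Each point [v] of a ball around the end of a too long ray is labelled by the length of a minimal
    ray ending at [v] and by the class of its arc to [y]. The pigeonhole gives [v] and [w] with
    equal class, lengths within [eps] and distance more than [K * eps]. Equal classes mean equal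
    directions, and then the ends of the two rays are at most [K * eps] apart. *)
Lemma no_long_ray (y : M) (T : R) : (2 <= n)%N ->
  (forall u, unit_vector u -> exists t : R, 0 < t <= T /\ G u t = y) ->
  forall u L, minimal_ray u L -> L <= T.
Proof.
move=> n2 hT u0 L0 mn0; rewrite leNgt; apply/negP => TL.
have n0 : (0 < n)%N by exact: ltn_trans n2.
have [i di] := chart_dom_cover (G u0 L0).
have [r [C [r0 C1 PR]]] := perturbed_rays n0 mn0 TL di.
have [r2 [Tb [K [r20 Tb0 K0 lip]]]] := ray_lipschitz di.
have [k [rep cls]] := finite_ray_classes chart_x G_geodesic G_start G_velocity y T.
have C0 : 0 < C by apply: lt_le_trans C1.
(* The four bounds: validity of the perturbation, validity of the Lipschitz estimate, rays still
   longer than [T], and [eps <= Tb] by way of [K * eps <= rho]. *)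
pose rho := Num.min (Num.min r r2) (Num.min ((L0 - T) / 2 / C) (K * Tb)).
have rho0 : 0 < rho by rewrite !lt_min r0 r20 !divr_gt0 ?mulr_gt0 ?subr_gt0.
have [rr rr2 rC rT] : [/\ rho <= r, rho <= r2, C * rho <= (L0 - T) / 2 & rho <= K * Tb].
  have : rho <= rho by [].
  by rewrite {2}/rho !le_min => /andP[/andP[a1 a2] /andP[a3 a4]]; split=> //; rewrite mulrC -ler_pdivlMr.
have rI : 0 < rho <= r by rewrite rho0.
pose u0' := chart i (G u0 L0).
have PR' v : exists uLj : 'rV[R]_n * R * 'I_k, `|v - u0'| <= rho -> [/\ minimal_ray uLj.1.1 uLj.1.2,
    L0 - C * rho <= uLj.1.2 <= L0 - C * rho + (2 * (C * rho)), T < uLj.1.2,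
    chart_dom i (G uLj.1.1 uLj.1.2) /\ chart i (G uLj.1.1 uLj.1.2) = v &
    exists t : R, 0 < t <= T /\ hom (ray G uLj.1.1 t) (rep uLj.2)].
  have [vr|nv] := pselect (`|v - u0'| <= rho).
    have [u [L [mL LI TL' E]]] := PR rho v rI rC vr.
    have [u1 _ _] := mL; have [t [tT ty]] := hT u u1.
    have tT' : 0 <= t <= T by case/andP: tT => /ltW ->.
    have [j hj] := cls u t u1 tT' ty.
    exists (u, L, j) => _; split=> //; last by exists t.
    by rewrite mulr_natl mulr2n addrA subrK.
  (* A value outside the ball is required because the labelling is total; the class of the original
     ray provides an index in ['I_k]. *)
  have [_ [_ [u1 _ _]]] := (tt, (tt, mn0)).
  have [t [tT ty]] := hT u0 u1.
  have tT' : 0 <= t <= T by case/andP: tT => /ltW ->.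
  by have [j _] := cls u0 t u1 tT' ty; exists (u0, L0, j).
pose f v := projT1 (cid (PR' v)).
have fP v : `|v - u0'| <= rho -> [/\ minimal_ray (f v).1.1 (f v).1.2,
    L0 - C * rho <= (f v).1.2 <= L0 - C * rho + (2 * (C * rho)), T < (f v).1.2,
    chart_dom i (G (f v).1.1 (f v).1.2) /\ chart i (G (f v).1.1 (f v).1.2) = v &
    exists t : R, 0 < t <= T /\ hom (ray G (f v).1.1 t) (rep (f v).2)].
  by rewrite /f; case: cid.
have b0 : 0 < 2 * (C * rho) by rewrite !mulr_gt0.
have lI v : `|v - u0'| <= rho -> L0 - C * rho <= (f v).1.2 <= L0 - C * rho + (2 * (C * rho)).
  by case/fP.
have [eps [v [w [eps0 vr wr [cE lE Ke vw]]]]] := @curves_not_dense R n k u0' rho _ _ K (fun v => (f v).2) (fun v => (f v).1.2) n2 rho0 b0 K0 lI.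
have [mv _ Tv [dv ev] [t [/andP[t0 tT] ht]]] := fP v vr.
have [mw _ Tw [dw ew] [t' [/andP[t0' tT'] ht']]] := fP w wr.
rewrite cE in ht.
have uE : (f v).1.1 = (f w).1.1.
  apply: (minimal_rays_meet mv mw _ _ (hom_trans ht (hom_sym ht'))).
    by rewrite t0 (le_lt_trans tT).
  by rewrite t0' (le_lt_trans tT').
have [u1 _ _] := mv.
have epsT : eps <= Tb by rewrite -(ler_pM2l K0); exact: le_trans Ke rT.
have [le1 le2] := andP lE.
have LT : (f v).1.2 <= (f w).1.2 <= (f v).1.2 + Tb by rewrite le1 (le_trans le2)// lerD2l.
have vr2 : `|chart i (G (f v).1.1 (f v).1.2) - u0'| <= r2 by rewrite ev; exact: le_trans vr rr2.
have := lip _ _ _ u1 LT dv vr2; rewrite {1}uE ew ev => H.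
have : `|w - v| <= K * eps by apply: le_trans H _; rewrite ler_pM2l// lerBlDl.
by rewrite leNgt vw.
Qed.

End LongRays.

(** * Loops *)

Section Cancellation.
Context {R : realType} {T : topologicalType}.
Implicit Types (a b c : R -> T).

Lemma cat_right (L d : R) a b : 0 < d -> concat L a b (L + d) = b d.
Proof. by move=> d0; rewrite /concat leNgt ltrDl d0 /= addrAC subrr add0r. Qed.

Lemma hom_catr (L : R) c a b : path_to L c -> hom a b -> c L = a 0 -> hom (concat L c a) (concat L c b).
Proof.
move=> pc hab ca; have [L0 cc c0 cL] := pc.
have [H [cH H0 H1 [L2 L20 HL]]] := hab.
exists (fun y : R * R => if y.2 - L <= 0 then c y.2 else H (clamp01 y.1, y.2 - L)); split.
- apply: (@glue_continuous _ _ _ (fun y : R * R => y.2 - L)).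
  + by cont.
  + by compc c => //; cont.
  + by compc H => //; cont.
  move=> [s t] /= /subr0_eq ->; rewrite subrr ca.
  by have [->] := HL (clamp01 s) 0 (clamp01_itv s).
- by move=> t /=; rewrite clamp01_id ?lexx ?ler01// H0 /concat subr_le0.
- by move=> t /=; rewrite clamp01_id ?lexx ?ler01// H1 /concat subr_le0.
have LL : 0 <= L + L2 by exact: addr_ge0.
exists (L + L2) => // s t _; rewrite /= subr_le0 /concat L0; split=> [t0|tL].
  by rewrite (le_trans t0 L0) c0.
have [hz hl] := HL (clamp01 s) (t - L) (clamp01_itv s).
have tL2 : L2 <= t - L by rewrite lerBrDl.
rewrite hl// gerDl; case: (leP L2 0) => L2n.
  have -> : L2 = 0 by apply/eqP; rewrite eq_le L2n.
  by rewrite addr0 -ca; case: ifP => // tl; rewrite cL// (le_trans _ tL)// lerDl.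
by rewrite addrAC subrr add0r ifF//; apply/negbTE; rewrite -ltNge (lt_le_trans _ tL)// ltrDl.
Qed.

(** The reverse of [c] followed by [c] is the path [c] at [|t - L|]. At stage [s] it turns round at
    [c (s * L)] instead of [c 0], so that at stage 1 it rests at [c L]. *)
Lemma hom_cancel_inverse (L La : R) c a : path_to L c -> path_to La a -> c L = a 0 ->
  hom (concat L (fun t => c (L - t)) (concat L c a)) a.
Proof.
move=> [L0 cc c0 cL] pa ca; have [La0 ca' a0 aL] := pa.
pose K (y : R * R) := if y.2 - (L + L) <= 0 then c (Num.max `|y.2 - L| (clamp01 y.1 * L)) else a (y.2 - (L + L)).
have LL : 0 <= L + L by exact: addr_ge0.
apply: (@hom_trans _ _ _ (fun t => a (t - (L + L)))); last first.
  apply: hom_sym; apply: (@hom_reparam _ _ La (La + (L + L)) a (fun t => t - (L + L)) pa).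
  - by cont.
  - exact: addr_ge0.
  - by move=> t t0; rewrite subr_le0 (le_trans t0).
  by move=> t tL; rewrite lerBrDr.
have Kc : continuous K.
  have cabs : continuous (fun y : R * R => `|y.2 - L|).
    apply: (@contcomp _ _ _ (fun z : R => `|z|) (fun y : R * R => y.2 - L)); last by cont.
    by move=> z; exact: norm_continuous.
  apply: (@glue_continuous _ _ _ (fun y : R * R => y.2 - (L + L))).
  - by cont.
  - by compc c => //; cont.
  - by compc a => //; cont.
  move=> [s t] /= /subr0_eq ->; rewrite subrr addrK ger0_norm//.
  have /andP[s0 s1] := clamp01_itv s.
  by rewrite (max_idPl _) ?ca// ler_piMl.
have big s t : t <= L + L -> t <= 0 \/ s = 1 -> c (Num.max `|t - L| (clamp01 s * L)) = c L.
  move=> tL ts; apply: cL; rewrite le_max; case: ts => [t0|->]; last by rewrite clamp01_id ?lexx ?ler01// mul1r lexx orbT.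
  by rewrite ler0_norm ?subr_le0 ?(le_trans t0)// opprB lerBrDr gerDl t0.
exists K; split=> //.
- move=> t; rewrite /K /= clamp01_id ?lexx ?ler01// mul0r (max_idPl _)// subr_le0 /concat lerBlDr.
  case: (leP t (L + L)) => tLL; case: (leP t L) => tL.
  + by rewrite ler0_norm ?subr_le0// opprB.
  + by rewrite ger0_norm// subr_ge0 ltW.
  + by move: (lt_le_trans tLL tL); rewrite gtrDl ltNge L0.
  by congr a; ring.
- move=> t; rewrite /K /= subr_le0; case: (leP t (L + L)) => tL //.
  by rewrite big//; [rewrite ca (a0 (t - _)) ?subr_le0|right].
exists (L + L + La + 1); first by rewrite !addr_ge0.
move=> s t _; rewrite /K /= /concat L0 subr0 !subr_le0; split=> [t0|tL].
  have tLL := le_trans t0 LL.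
  by rewrite tLL big//; left.
have t1 : L + L < t by lra.
have t2 : L < L + L + La + 1 by lra.
have t3 : L < L + L + La + 1 - L by lra.
rewrite !leNgt t1 t2 t3 /= !(aL (_ - _))//; lra.
Qed.

Lemma hom_cancel (L La Lb : R) c a b : path_to L c -> path_to La a -> path_to Lb b -> c L = a 0 -> c L = b 0 ->
  hom (concat L c a) (concat L c b) -> hom a b.
Proof.
move=> pc pa pb ca cb hab; have [L0 cc c0 cL] := pc.
apply: hom_trans (hom_sym (hom_cancel_inverse pc pa ca)) _.
apply: hom_trans (hom_cancel_inverse pc pb cb).
apply: hom_catr hab _.
  split=> //.
  - by compc c => //; cont.
  - by move=> t t0; rewrite subr0 cL// lerBrDr gerDl.
  by move=> t tL; rewrite subrr c0// subr_le0.
by rewrite subrr /concat L0.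
Qed.

End Cancellation.

Section Loops.
Context {R : realType} {T : topologicalType}.
Implicit Types (f g : R -> T) (p : T).

Lemma within_comp {X Y Z : topologicalType} (A : set Y) (f : Y -> Z) (k : X -> Y) :
  {within A, continuous f} -> continuous k -> (forall x, A (k x)) -> continuous (fun x => f (k x)).
Proof.
move=> /subspace_continuousP cf ck Ak x S nS.
have H : \forall y \near k x, A y -> S (f y) by exact: (cf (k x) (Ak x) S nS).
have H2 : \forall y \near x, A (k y) -> S (f (k y)) by exact: (ck x _ H).
by apply: filterS H2 => y; apply; exact: Ak.
Qed.

(** Only the values of a loop on [[0, 1]] count; this normal form of it is a path in the sense of
    [path_to]. *)
Definition hat f : R -> T := fun t => f (clamp01 t).

Lemma hat_id f t : 0 <= t <= 1 -> hat f t = f t.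
Proof. by move=> t1; rewrite /hat clamp01_id. Qed.

Lemma loop_hat p f : loop p f -> [/\ path_to 1 (hat f), hat f 0 = p & hat f 1 = p].
Proof.
move=> [cf f0 f1]; have h0 : hat f 0 = p by rewrite hat_id ?lexx ?ler01.
have h1 : hat f 1 = p by rewrite hat_id ?lexx ?ler01.
split=> //; split=> //.
- apply: (within_comp cf); first exact: clamp01_continuous.
  by move=> t; rewrite /= in_itv /=; exact: clamp01_itv.
- move=> t t0; rewrite h0 /hat (_ : clamp01 t = 0)// /clamp01 (max_idPl _)// ge_min t0 //.
by move=> t t1; rewrite h1 /hat (_ : clamp01 t = 1)// /clamp01 (min_idPr t1) (max_idPr _).
Qed.

(** The difficulty is the passage from [hom], whose intermediate paths may rest only after a time
    [m] larger than 1, to homotopies on the unit square: the time scale has to change during the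
    deformation and be restored at the end. *)
Lemma loop_homotopicP p f g : loop p f -> loop p g -> loop_homotopic p f g <-> hom (hat f) (hat g).
Proof.
move=> lf lg; have [pf f0 f1] := loop_hat lf; have [pg g0 g1] := loop_hat lg.
have I01 (s : R) : (s \in `[0, 1]) = (0 <= s <= 1) by rewrite in_itv.
have z01 : (0 : R) \in `[0, 1] by rewrite I01 lexx ler01.
have o01 : (1 : R) \in `[0, 1] by rewrite I01 lexx ler01.
have c01 (s : R) : clamp01 s \in `[0, 1] by rewrite I01 clamp01_itv.
split=> [[H [cH H0 H1 Hp]]|[H [cH H0 H1 [L L0 HL]]]].
  exists (fun y => H (clamp01 y.1, clamp01 y.2)); split.
  - apply: (within_comp cH); first by cont.
    by move=> y; split=> /=; exact: c01.
  - by move=> t; rewrite /= clamp01_id ?lexx ?ler01// H0.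
  - by move=> t; rewrite /= clamp01_id ?lexx ?ler01// H1.
  exists 1 => // s t _; have [Hp0 Hp1] := Hp (clamp01 s) (c01 s); rewrite f0 f1 /=; split=> [t0|t1].
    by rewrite (_ : clamp01 t = 0)// /clamp01 (max_idPl _)// ge_min t0.
  by rewrite (_ : clamp01 t = 1)// /clamp01 (min_idPr t1) (max_idPr _).
pose m := Num.max L 1; have [mL m1] : L <= m /\ 1 <= m by rewrite !le_max !lexx orbT.
(* In the first third the time scale grows from 1 to [m] while the loop [f] stays fixed, in the
   middle third the given homotopy runs, in the last third the scale returns to 1. *)
pose lam (s : R) := 1 + (m - 1) * Num.min 1 (Num.min (3 * s) (3 * (1 - s))).
have clam : continuous lam by rewrite /lam; cont.
have [_ _ _ fL] := pf; have [_ _ _ gL] := pg.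
exists (fun y => H (clamp01 (3 * y.1 - 1), lam y.1 * y.2)); split.
- apply: continuous_subspaceT; compc H => //; cont.
  by compc lam => //; cont.
- move=> t; rewrite I01 => t1; rewrite /= /lam mulr0 subr0 mulr1 (_ : clamp01 (0 - 1) = 0).
    rewrite (_ : Num.min 1 (Num.min 0 3) = 0); last by rewrite (min_idPl (ler0n _ 3)) (min_idPr ler01).
    by rewrite mulr0 addr0 mul1r H0 hat_id.
  by rewrite /clamp01 (max_idPl _)// ge_min sub0r oppr_le0 ler01.
- move=> t; rewrite I01 => t1; rewrite /= /lam mulr1 subrr mulr0 (_ : clamp01 (3 - 1) = 1).
    rewrite (_ : Num.min 1 (Num.min 3 0) = 0); last by rewrite (min_idPr (ler0n _ 3)) (min_idPr ler01).
    by rewrite mulr0 addr0 mul1r H1 hat_id.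
  by rewrite /clamp01 (min_idPr _) ?(max_idPr _)//; lra.
move=> s; rewrite I01 => /andP[s0 s1] /=; rewrite mulr0 mulr1.
have e0 := (HL (clamp01 (3 * s - 1)) 0 (clamp01_itv _)).1 (lexx _).
split; first by rewrite e0 f0.
have lam1 : 1 <= lam s.
  by rewrite /lam lerDl mulr_ge0 ?subr_ge0// !le_min ler01 !mulr_ge0// subr_ge0.
have [sa|sa] := leP (3 * s) 1.
  have -> : clamp01 (3 * s - 1) = 0 by rewrite /clamp01 (max_idPl _)// ge_min subr_le0 sa.
  by rewrite H0 fL.
have [sb|sb] := leP (3 * (1 - s)) 1.
  have -> : clamp01 (3 * s - 1) = 1 by rewrite /clamp01 (min_idPr _) ?(max_idPr _)//; lra.
  by rewrite H1 gL.
have mE : Num.min 1 (Num.min (3 * s) (3 * (1 - s))) = 1 by apply/min_idPl; rewrite le_min (ltW sa) (ltW sb).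
have J0 : 0 <= (0 : R) <= 1 by rewrite lexx ler01.
have E := (HL (clamp01 (3 * s - 1)) m (clamp01_itv _)).2 mL.
have E0 := (HL 0 m J0).2 mL.
have lamE : lam s = m by rewrite /lam mE mulr1 [1 + _]addrC subrK.
by rewrite lamE E -E0 H0 fL.
Qed.

End Loops.

(** * Compactness of the manifold and the count of loop classes *)

Section MainTheorem.
Context {R : realType} {n : nat} {M : smooth_manifold R n}.
Variable h : riemannian_metric M.

(** Points of a common coordinate ball are joined by a coordinate segment, so both the set of
    reachable points and its complement are open. *)
Lemma path_connected (x : M) : connected [set: M] ->
  forall z, exists (f : R -> M) (L : R), [/\ path_to L f, f 0 = x & f L = z].
Proof.
move=> cM; pose S := [set z : M | exists (f : R -> M) (L : R), [/\ path_to L f, f 0 = x & f L = z]].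
suff ST : S = setT by move=> z; have : S z by rewrite ST.
have loc (z : M) : \forall w \near z, S z <-> S w.
  have [i dz] := chart_dom_cover z.
  have [r r0 ri] := open_ball_sub (@chart_image_open _ _ M i) (chart_image_chart dz).
  have ext (y w : M) : coord_ball i (chart i z) r y -> coord_ball i (chart i z) r w -> S y -> S w.
    move=> [dy by_] [dw bw] [f [L [pf fx fy]]].
    have ps := segment_path ri ltr01 by_ bw.
    have e0 := segment_start ri ltr01 by_ bw (lexx 0); have e1 := segment_end ri ltr01 by_ bw (lexx 1).
    rewrite chartK// in e0; rewrite chartK// in e1.
    have fL : f L = segment i (chart i y) (chart i w) 1 0 by rewrite e0.
    exists (concat L f (segment i (chart i y) (chart i w) 1)), (L + 1); split.
    - exact: path_cat.
    - by have [L0 _ _ _] := pf; rewrite /concat L0.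
    by rewrite cat_right.
  apply: filterS (near_coord_ball dz r0) => w bw.
  have bz : coord_ball i (chart i z) r z by split=> //; rewrite subrr normr0 ltW.
  by split; exact: ext.
apply: cM.
- by exists x, (cst x), 0; split=> //; split=> //; exact: cst_continuous.
- exists S; last by rewrite setTI.
  rewrite openE => z Sz; rewrite /interior; apply: filterS (loc z) => w; exact: (fun e => e.1 Sz).
exists S; last by rewrite setTI.
rewrite -[S]setCK; apply: open_closedC; rewrite openE => z nSz; rewrite /interior.
by apply: filterS (loc z) => w e Sw; apply: nSz; exact: e.2.
Qed.

Theorem compact_finite_fundamental_group (x y : M) : (2 <= n)%N -> connected [set: M] ->
  complete_metric h ->
  (exists T : R, 0 < T /\
     forall (J : set R) (alpha : R -> M),
       maximal_geodesic h J alpha -> unit_speed h J alpha -> J 0 -> alpha 0 = x ->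
       exists t, [/\ J t, 0 < t, t <= T & alpha t = y]) ->
  compact [set: M] /\ forall p : M, finite_set (fundamental_group R p).
Proof.
move=> n2 cM hc [T [T0 hT]].
have n0 : (0 < n)%N by exact: ltn_trans n2.
have [i0 dx] := chart_dom_cover x.
have [G [Gg Gs Gv]] := exponential_family hc dx.
pose unit_vector u := gnorm h i0 (chart i0 x) u = 1.
have hT' u : unit_vector u -> exists t : R, 0 < t <= T /\ G u t = y.
  move=> u1; have mg : maximal_geodesic h setT (G u).
    split; first exact: Gg.
    by move=> J' gam' _ JJ _; rewrite eqEsubset; split.
  have us : unit_speed h setT (G u).
    by move=> t i _ di /=; have := ray_unit dx Gg Gs Gv u1 di; rewrite /gnorm gdotE.
  have [t [_ t0 tT ty]] := hT setT (G u) mg us I (Gs u).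
  by exists t; rewrite t0.
(* Every path from [x] is homotopic to a ray of length at most [T]; both conclusions are drawn from
   this alone and the compactness of the set of such rays. *)
have short f L : path_to L f -> f 0 = x -> exists u (t : R), [/\ unit_vector u, 0 <= t <= T & hom f (ray G u t)].
  move=> pf fx; have [u [t [u1 t0 hf mn]]] := hopf_rinow hc dx Gg Gs Gv n0 pf fx.
  exists u, t; split=> //; rewrite t0; apply: (no_long_ray hc dx Gg Gs Gv n2 hT' (u := u)).
  by split=> // L' [g sg hg]; apply: mn; exists g => //; exact: hom_trans hf hg.
have reach := path_connected x cM.
split.
  have -> : [set: M] = flow G @` ([set w | unit_vector w] `*` `[0, T]).
    rewrite eqEsubset; split=> // z _; have [f [L [pf fx fz]]] := reach z.
    have [u [t [u1 tT hf]]] := short f L pf fx; have /andP[t0 _] := tT.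
    exists (u, t); first by split=> //=; rewrite in_itv.
    by rewrite /flow /= (max_idPr t0) -(ray_end G u t0) -fz; symmetry; exact: hom_end_eq hf pf (ray_path Gg u t0).
  apply: continuous_compact; last first.
    apply: compact_setX; last exact: segment_compact.
    exact: unit_sphere_compact (chart_image_chart dx).
  by apply: continuous_subspaceT; exact: (flow_cont dx Gg Gs Gv).
move=> p; have [c [L [pc cx cp]]] := reach p.
have [k [rep cls]] := finite_ray_classes dx Gg Gs Gv p T.
(* A class of loops is recovered from the index of the ray class of [c] followed by a member, since
   [c] can be cancelled on the left by [hom_cancel]. So the fundamental group lies in the range of
   [cl]. *)
pose cl (j : 'I_k) : set (R -> M) := [set g | loop p g /\ hom (concat L c (hat g)) (rep j)].
apply: (@sub_finite_set _ _ (range cl)); last by apply: finite_image; exact: finite_finset.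
move=> C [f lf ->]; have [pf f0 f1] := loop_hat lf.
have cf : c L = hat f 0 by rewrite f0.
have pcf := path_cat pc pf cf; have [L0 _ _ _] := pc.
have cf0 : concat L c (hat f) 0 = x by rewrite /concat L0.
have [u [t [u1 tT hf]]] := short _ _ pcf cf0; have /andP[t0 _] := tT.
have cfL : concat L c (hat f) (L + 1) = p.
  by rewrite cat_right.
have ut : G u t = p.
  by rewrite -(ray_end G u t0) -cfL; symmetry; exact: hom_end_eq hf pcf (ray_path Gg u t0).
have [j hj] := cls u t u1 tT ut.
have hfj := hom_trans hf hj.
exists j => //; rewrite eqEsubset; split=> g [lg hg]; split=> //; have [pg g0 g1] := loop_hat lg;
  have cg : c L = hat g 0 by rewrite g0.
  apply/(loop_homotopicP lf lg); apply: (hom_cancel pc pf pg cf cg).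
  exact: hom_trans hfj (hom_sym hg).
apply: hom_trans hfj; apply: hom_sym; apply: hom_catr => //.
by apply/(loop_homotopicP lf lg).
Qed.

End MainTheorem.

Unset Implicit Arguments.
Set Strict Implicit.
Set Printing Implicit Defensive.

Theorem mainTheorem3 (R : realType) (n : nat) (hn : (2 <= n)%N)
  (M : smooth_manifold R n) (hM : connected [set: M])
  (h : riemannian_metric M) (x y : M)
  (hZ : Z_manifold h x y)
  (hT : exists T : R, 0 < T /\
     forall (J : set R) (alpha : R -> M),
       maximal_geodesic h J alpha -> unit_speed h J alpha ->
       J 0 -> alpha 0 = x ->
       exists t, [/\ J t, 0 < t, t <= T & alpha t = y]) :
  compact [set: M] /\ forall p : M, finite_set (fundamental_group R p).
Proof.
case: hZ => complete_h _.
exact: compact_finite_fundamental_group hn hM complete_h hT.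
Qed.
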